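(* Let $(\mathcal G,w)$ be the weighted branching graph associated with an inductive system $\mathbb G=(G_N,\theta_N)_{N\ge0}$ of compact quantum groups with $G_0=(\mathbb C,\mathrm{id})$. A $w$-central probability measure $P$ on $\Omega$ is $\mathfrak S(\Omega)$-ergodic if and only if the corresponding quantized character $\chi\in\mathrm{Ch}(\mathbb G)$ is factorial, namely, it is extremal (in $\mathrm{Ch}(\mathbb G)$). Therefore, $P$ is $\mathfrak S(\Omega)$-ergodic if and only if $P$ is extremal in the convex set $\mathrm{Cent}(\mathbb G)$ of $w$-central probability measures.
   Context: **Compact quantum groups.** A compact quantum group (CQG) $G=(A,\delta)$ is a unital $C^*$-algebra $A$ with a unital $*$-homomorphism $\delta:A\to A\otimes A$ (minimal tensor product) such that $(\mathrm{id}\otimes\delta)\delta=(\delta\otimes\mathrm{id})\delta$ and $\delta(A)(A\otimes1)$, $\delta(A)(1\otimes A)$ are dense in $A\otimes A$. A finite-dimensional representation on $V$ is an invertible $U\in B(V)\otimes A$ with $(\mathrm{id}\otimes\delta)(U)=U_{12}U_{13}$; unitary if $V$ is a Hilbert space and $U$ is unitary. $\mathrm{Mor}(U,V)=\{T:(T\otimes1)U=V(T\otimes1)\}$, $\mathrm{End}(U)=\mathrm{Mor}(U,U)$; irreducible means $\mathrm{End}(U)=\mathbb C1$. $\widehat G$ is the set of unitary equivalence classes of irreducible unitary representations, with fixed representatives $U_\pi\in B(\mathcal H_\pi)\otimes A$. $U^c=(j\otimes\mathrm{id})(U^{-1})$, $j:B(\mathcal H)\to B(\mathcal H^* )$ the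 transpose map. For each finite-dimensional unitary $U$ there is a unique positive invertible $F_U\in\mathrm{Mor}(U,U^{cc})$ with $\mathrm{Tr}(F_U\,\cdot)=\mathrm{Tr}(F_U^{-1}\,\cdot)$ on $\mathrm{End}(U)$; $F_\pi:=F_{U_\pi}$, $\dim_q(\pi):=\mathrm{Tr}(F_\pi)$. $\mathcal A\subset A$ is the dense Hopf $*$-algebra spanned by matrix coefficients, and $A$ is assumed to be the universal $C^*$-algebra of $\mathcal A$. $\mathcal U(G)=\mathcal A^*$ is a $*$-algebra with $f_1*f_2=(f_1\otimes f_2)\delta$, $f^*(a)=\overline{f(S(a^* ))}$; $f\mapsto((\mathrm{id}\otimes f)(U_\pi))_\pi$ is a $*$-isomorphism onto $\prod_\pi B(\mathcal H_\pi)$, used as an identification. $W^*(G)$: norm-bounded families; $\mathbb C[G]$: algebraic direct sum; $C^*(G)$: norm closure of $\mathbb C[G]$. Scaling group: $(\mathrm{id}\otimes\tau^G_t)(U)=(F_U^{it}\otimes1)U(F_U^{-it}\otimes1)$; $\widehat\tau^G_t(f)=f\circ\tau^G_t$ (acting as $\mathrm{Ad}(F_\pi^{it})$ on $B(\mathcal H_\pi)$). **Inductive systems and quantized characters.** $\mathbb G=(G_N,\theta_N)_{N\ge0}$, $G_N=(A_N,\delta_N)$, $G_0=(\mathbb C,\mathrm{id})$, each $\widehat G_N$ countable, $\theta_N:A_{N+1}\to A_N$ a surjective $*$-homomorphism with $\delta_N\theta_N=(\theta_N\otimes\theta_N)\delta_{N+1}$. $\Theta_N(f)=f\circ\theta_N$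 gives injective unital $*$-homomorphisms $W^*(G_N)\to W^*(G_{N+1})$; $\mathfrak A(\mathbb G)$ is the $C^*$-subalgebra of the $C^*$-inductive limit $\varinjlim(W^*(G_N),\Theta_N)$ generated by all $C^*(G_N)$, with flow $\widehat\tau^{\mathbb G}$ induced by the $\widehat\tau^{G_N}$. A state $\chi$ is $\widehat\tau^{\mathbb G}$-KMS at inverse temperature $\beta$ if $\chi(x\widehat\tau^{\mathbb G}_{i\beta}(y))=\chi(yx)$ for $x,y$ in a norm-dense $\widehat\tau^{\mathbb G}$-invariant $*$-subalgebra of entire analytic elements. $\mathrm{Ch}(\mathbb G)$ (quantized characters) is the convex set of $\widehat\tau^{\mathbb G}$-KMS states $\chi$ on $\mathfrak A(\mathbb G)$ at inverse temperature $-1$ with $\|\chi|_{C^*(G_N)}\|=1$ for all $N\ge1$. A state is factorial if the von Neumann algebra generated by its GNS representation is a factor. **Weighted branching graph of $\mathbb G$.** Vertices $V=\bigsqcup_NV_N$, $V_N=\widehat G_N$, $V_0=\{*\}$. For $\pi\in\widehat G_N$ the restriction is $U_{\pi|}=(\mathrm{id}\otimes\theta_{N-1})(U_\pi)$; $m_\pi(\rho)$ is the multiplicity of $\rho\in\widehat G_{N-1}$ in it, and $\rho\prec\pi$ means $m_\pi(\rho)\ge1$. Edges $E_N=\{[\rho,l,\pi]:\rho\prec\pi,\ 1\le l\le m_\pi(\rho)\}$ with source $s=\rho$, range $r=\pi$. There is a unique positive invertible $W_\pi\in\mathrm{End}(U_{\pi|})$ with $F_\pi=W_\pi F_{U_{\pi|}}=F_{U_{\pi|}}W_\pi$;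 representatives and intertwiners $S_{\rho,l,\pi}\in\mathrm{Mor}(U_\rho,U_{\pi|})$ are chosen with $S_{\rho,l,\pi}^*S_{\rho',l',\pi}=\delta_{\rho,\rho'}\delta_{l,l'}1$, $\sum_{\rho,l}S_{\rho,l,\pi}S_{\rho,l,\pi}^*=1$ and $W_\pi=\sum_{\rho,l}w(\rho,l,\pi)S_{\rho,l,\pi}S_{\rho,l,\pi}^*$, $w(\rho,l,\pi)$ nondecreasing in $l$. The weight function is $w([\rho,l,\pi])=w(\rho,l,\pi)>0$. **Central measures, ergodicity.** For a finite path $t$, $w(t)$ is the product of the weights of its edges; $\Omega( *,v)$ is the set of paths from $*$ to $v$; $w\text{-}\dim(v)=\sum_{t\in\Omega( *,v)}w(t)$. $\Omega$ is the space of infinite paths from $*$ with the $\sigma$-algebra generated by cylinder sets $C_t=\{\omega:\omega_n=t_n,\ n\le N\}$; $X_N(\omega)=r(\omega_N)$. $P$ is $w$-central if $P(C_t)/w(t)=P(X_N=v)/w\text{-}\dim(v)$ for all $N\ge1$, $v\in V_N$, $t\in\Omega( *,v)$. For $v\in V_N$ each permutation $\gamma$ of $\Omega( *,v)$ acts on $\Omega$ by replacing the initial segment $(\omega_1,\dots,\omega_N)$ by $\gamma(\omega_1,\dots,\omega_N)$ if $r(\omega_N)=v$ and fixing $\omega$ otherwise; $\mathfrak S_N(\Omega)$ is the group generated by these over all $v\in V_N$, and $\mathfrak S(\Omega)=\bigcup_N\mathfrak S_N(\Omega)$. Every $w$-central $P$ is quasi-invariant under $\mathfrak S(\Omega)$;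 $P$ is $\mathfrak S(\Omega)$-ergodic if every $\mathfrak S(\Omega)$-invariant measurable set has $P$-measure $0$ or $1$. **Correspondence.** $P$ and $\chi\in\mathrm{Ch}(\mathbb G)$ correspond (bijectively) when $\chi|_{C^*(G_N)}=\sum_{\pi\in\widehat G_N}P(X_N=\pi)\chi_\pi$ for all $N\ge1$, where $\chi_\pi(x)=\mathrm{Tr}(F_\pi x_\pi)/\dim_q(\pi)$. *)

(* Defs.v *)
From HB Require Import structures.
From mathcomp Require Import all_boot all_order all_algebra.
From mathcomp Require Import finmap complex.
From mathcomp Require Import all_classical all_reals all_analysis.
Set Implicit Arguments.
Unset Strict Implicit.
Unset Printing Implicit Defensive.
Import Order.TTheory GRing.Theory Num.Theory.
Local Open Scope classical_set_scope.
Local Open Scope ring_scope.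

Definition cabs (R : realType) (z : R[i]) : R := complex.Re `|z|.

(* The norm is a separate real-valued field: MathComp's hierarchy does not
   allow a joint instance of a (possibly non-commutative) ring and of a normed
   module whose norm takes values in the scalars. *)
HB.mixin Record isCStarAlgebra (R : realType) A of GRing.Algebra R[i] A := {
  star : A -> A ;
  cnorm : A -> R ;
  cstar_oner_neq0 : 1 <> 0 :> A ;
  starK : forall x, star (star x) = x ;
  starD : forall x y, star (x + y) = star x + star y ;
  starZ : forall (c : R[i]) x, star (c *: x) = Num.conj c *: star x ;
  starM : forall x y, star (x * y) = star y * star x ;
  cnorm0_eq0 : forall x, cnorm x = 0 -> x = 0 ;
  ler_cnormD : forall x y, cnorm (x + y) <= cnorm x + cnorm y ;
  cnormZ : forall (c : R[i]) x, cnorm (c *: x) = cabs c * cnorm x ;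
  ler_cnormM : forall x y, cnorm (x * y) <= cnorm x * cnorm y ;
  cnorm_starM : forall x, cnorm (star x * x) = cnorm x ^+ 2 ;
  cstar_complete : forall u : nat -> A,
    (forall e : R, 0 < e -> exists N, forall m n, (N <= m)%N -> (N <= n)%N ->
       cnorm (u m - u n) < e) ->
    exists l, forall e : R, 0 < e -> exists N, forall n, (N <= n)%N ->
       cnorm (u n - l) < e
}.

#[short(type="cstarAlgType")]
HB.structure Definition CStarAlgebra (R : realType) :=
  {A of isCStarAlgebra R A & GRing.Algebra R[i] A}.

HB.mixin Record isHilbert (R : realType) H of GRing.Lmodule R[i] H := {
  inner : H -> H -> R[i] ;
  innerDl : forall x y z, inner (x + y) z = inner x z + inner y z ;
  innerZl : forall (c : R[i]) x z, inner (c *: x) z = c * inner x z ;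
  innerC : forall x y, inner y x = Num.conj (inner x y) ;
  inner_ge0 : forall x, 0 <= inner x x ;
  inner_eq0 : forall x, inner x x = 0 -> x = 0 ;
  hilbert_complete : forall u : nat -> H,
    (forall e : R, 0 < e -> exists N, forall m n, (N <= m)%N -> (N <= n)%N ->
       Num.sqrt (complex.Re (inner (u m - u n) (u m - u n))) < e) ->
    exists l, forall e : R, 0 < e -> exists N, forall n, (N <= n)%N ->
       Num.sqrt (complex.Re (inner (u n - l) (u n - l))) < e
}.

#[short(type="hilbertType")]
HB.structure Definition Hilbert (R : realType) :=
  {H of isHilbert R H & GRing.Lmodule R[i] H}.

Section CStarNotions.
Variable R : realType.

Definition hnorm (H : hilbertType R) (v : H) : R :=
  Num.sqrt (complex.Re (inner v v)).

Definition is_linear (V W : lmodType R[i]) (f : V -> W) : Prop :=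
  forall (c : R[i]) x y, f (c *: x + y) = c *: f x + f y.

Definition linspan (V : lmodType R[i]) (S : set V) : set V :=
  [set x | exists s : seq (R[i] * V),
     (forall p, p \in s -> S p.2) /\ x = \sum_(p <- s) p.1 *: p.2].

Definition cclosure (A : cstarAlgType R) (S : set A) : set A :=
  [set x | forall e : R, 0 < e -> exists y, S y /\ cnorm (x - y) < e].

Definition cdense (A : cstarAlgType R) (S : set A) : Prop :=
  cclosure S = [set: A].

Record star_subalgebra (A : cstarAlgType R) (D : set A) : Prop := {
  star_subalg0 : D 0 ;
  star_subalgD : forall (c : R[i]) x y, D x -> D y -> D (c *: x + y) ;
  star_subalgM : forall x y, D x -> D y -> D (x * y) ;
  star_subalg_star : forall x, D x -> D (star x)
}.

Definition cstar_gen (A : cstarAlgType R) (S : set A) : set A :=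
  [set x | forall D : set A, star_subalgebra D -> cclosure D `<=` D ->
     S `<=` D -> D x].

(* Unital *-homomorphisms; between C*-algebras they are contractive. *)
Record is_starhom (A B : cstarAlgType R) (f : A -> B) : Prop := {
  starhom_linear : is_linear f ;
  starhom1 : f 1 = 1 ;
  starhomM : forall x y, f (x * y) = f x * f y ;
  starhom_star : forall x, f (star x) = star (f x)
}.

Definition bounded_op (H : hilbertType R) (T : H -> H) : Prop :=
  is_linear T /\ exists K : R, forall v, hnorm (T v) <= K * hnorm v.

Record is_starrep (A : cstarAlgType R) (H : hilbertType R)
    (pi : A -> H -> H) : Prop := {
  starrep_bounded : forall a, bounded_op (pi a) ;
  starrep_linear : forall (c : R[i]) a b v,
    pi (c *: a + b) v = c *: pi a v + pi b v ;
  starrep1 : forall v, pi 1 v = v ;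
  starrepM : forall a b v, pi (a * b) v = pi a (pi b v) ;
  starrep_star : forall a u v, inner (pi (star a) u) v = inner u (pi a v)
}.

(* A sequence of pairs stands for the corresponding sum of elementary tensors,
   in the algebraic tensor product of two C*-algebras or Hilbert spaces. *)

Definition tens_normsq (H K : hilbertType R) (y : seq (H * K)) : R :=
  complex.Re (\sum_(p <- y) \sum_(q <- y) inner p.1 q.1 * inner p.2 q.2).

Definition tens_app (A B : cstarAlgType R) (H K : hilbertType R)
    (pi : A -> H -> H) (sg : B -> K -> K) (x : seq (A * B))
    (y : seq (H * K)) : seq (H * K) :=
  [seq (pi a.1 p.1, sg a.2 p.2) | a <- x, p <- y].

(* The square of the spatial norm: the supremum over all pairs of
   representations of the squared operator norm of [(pi (x) sg) x]. *)
Definition spatial_normsq (A B : cstarAlgType R) (x : seq (A * B)) : R :=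
  sup [set r : R | exists (H K : hilbertType R)
         (pi : A -> H -> H) (sg : B -> K -> K) (y : seq (H * K)),
       [/\ is_starrep pi, is_starrep sg, tens_normsq y <= 1
         & r = tens_normsq (tens_app pi sg x y)]].

Record is_min_tensor (A B T : cstarAlgType R) (ten : A -> B -> T) : Prop := {
  ten_linear_l : forall b, is_linear (fun a => ten a b) ;
  ten_linear_r : forall a, is_linear (ten a) ;
  ten11 : ten 1 1 = 1 ;
  tenM : forall a a' b b', ten (a * a') (b * b') = ten a b * ten a' b' ;
  ten_star : forall a b, ten (star a) (star b) = star (ten a b) ;
  ten_dense : cdense (linspan [set t | exists a b, t = ten a b]) ;
  ten_norm : forall x : seq (A * B),
    cnorm (\sum_(p <- x) ten p.1 p.2) ^+ 2 = spatial_normsq x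
}.

End CStarNotions.

(* [cqg_ten2] is the minimal tensor product [A (x) A], and [cqg_ten3] is
   [A (x) A (x) A], seen both as [(A (x) A) (x) A] and as [A (x) (A (x) A)]. *)
Record cqg (R : realType) := Cqg {
  cqg_alg :> cstarAlgType R ;
  cqg_ten2 : cstarAlgType R ;
  cqg_ten3 : cstarAlgType R ;
  ten : cqg_alg -> cqg_alg -> cqg_ten2 ;
  tenl : cqg_ten2 -> cqg_alg -> cqg_ten3 ;
  tenr : cqg_alg -> cqg_ten2 -> cqg_ten3 ;
  ten_min : is_min_tensor ten ;
  tenl_min : is_min_tensor tenl ;
  tenr_min : is_min_tensor tenr ;
  tenlrA : forall a b c, tenl (ten a b) c = tenr a (ten b c) ;
  comul : cqg_alg -> cqg_ten2 ;
  comul_hom : is_starhom comul ;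
  comulA : exists id_comul comul_id : cqg_ten2 -> cqg_ten3,
    [/\ is_starhom id_comul, is_starhom comul_id,
        forall a b, id_comul (ten a b) = tenr a (comul b),
        forall a b, comul_id (ten a b) = tenl (comul a) b
      & forall a, id_comul (comul a) = comul_id (comul a)] ;
  comul_dense_l :
    cdense (linspan [set t | exists a b, t = comul a * ten b 1]) ;
  comul_dense_r :
    cdense (linspan [set t | exists a b, t = comul a * ten 1 b])
}.

Section Representations.
Variable R : realType.

Definition adjmx m n (T : 'M[R[i]]_(m, n)) : 'M[R[i]]_(n, m) :=
  map_mx Num.conj T^T.

Definition posdefmx n (T : 'M[R[i]]_n) : Prop :=
  adjmx T = T /\
  forall v : 'cV[R[i]]_n, v != 0 -> 0 < (adjmx v *m T *m v) 0 0.

Variable G : cqg R.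

(* [T (x) 1] in [M_(m,n)(C) (x) A = M_(m,n)(A)]. *)
Definition scalmx m n (T : 'M[R[i]]_(m, n)) : 'M[G]_(m, n) :=
  map_mx (fun c : R[i] => c%:A) T.

Definition is_inverse n (U V : 'M[G]_n) : Prop :=
  U *m V = 1%:M /\ V *m U = 1%:M.

(* Finite-dimensional representations, in coordinates: for [U = (u_ij)] the
   identity [(id (x) delta)(U) = U_12 U_13] reads
   [delta(u_ij) = \sum_k u_ik (x) u_kj]. *)
Definition is_rep n (U : 'M[G]_n) : Prop :=
  (exists V, is_inverse U V) /\
  forall i j, comul (U i j) = \sum_k ten (U i k) (U k j).

Definition is_unitary_rep n (U : 'M[G]_n) : Prop :=
  is_rep U /\ is_inverse U (map_mx star U^T).

Definition Mor n m (U : 'M[G]_n) (V : 'M[G]_m) : set 'M[R[i]]_(m, n) :=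
  [set T | scalmx T *m U = V *m scalmx T].

Definition irreducible_rep n (U : 'M[G]_n) : Prop :=
  (0 < n)%N /\ forall T, Mor U U T -> exists c : R[i], T = c%:M.

Definition unitarily_equivalent n m (U : 'M[G]_n) (V : 'M[G]_m) : Prop :=
  exists T, [/\ Mor U V T, adjmx T *m T = 1%:M & T *m adjmx T = 1%:M].

(* [Uc] is the contragredient [(j (x) id)(U^-1)] of [U]. *)
Definition is_contragredient n (U Uc : 'M[G]_n) : Prop :=
  exists2 V, is_inverse U V & Uc = V^T.

Definition is_Fmatrix n (U : 'M[G]_n) (F : 'M[R[i]]_n) : Prop :=
  [/\ posdefmx F,
      exists Uc Ucc,
        [/\ is_contragredient U Uc, is_contragredient Uc Ucc & Mor U Ucc F]
    & forall T, Mor U U T -> \tr (F *m T) = \tr (invmx F *m T)].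

Definition coef_algebra : set G :=
  linspan [set a | exists n (U : 'M[G]_n) i j, is_rep U /\ a = U i j].

(* The C*-norm of [A] is the largest one on the coefficient Hopf *-algebra. *)
Definition cqg_universal : Prop :=
  forall (B : cstarAlgType R) (phi : G -> B),
    (forall (c : R[i]) x y, coef_algebra x -> coef_algebra y ->
       phi (c *: x + y) = c *: phi x + phi y) ->
    phi 1 = 1 ->
    (forall x y, coef_algebra x -> coef_algebra y ->
       phi (x * y) = phi x * phi y) ->
    (forall x, coef_algebra x -> phi (star x) = star (phi x)) ->
    forall x, coef_algebra x -> cnorm (phi x) <= cnorm x.

(* The dual of [G], with a representative of each equivalence class. *)
Record dual := Dual {
  irr :> countType ;
  irr_dim : irr -> nat ;
  irr_rep : forall p : irr, 'M[G]_(irr_dim p) ;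
  irr_unitary : forall p, is_unitary_rep (irr_rep p) ;
  irr_irreducible : forall p, irreducible_rep (irr_rep p) ;
  irr_inj : forall p q,
    unitarily_equivalent (irr_rep p) (irr_rep q) -> p = q ;
  irr_complete : forall n (U : 'M[G]_n), is_unitary_rep U ->
    irreducible_rep U -> exists p, unitarily_equivalent U (irr_rep p)
}.

(* [U(G)], identified with the product of the [B(H_p)]. *)
Definition matfamily (I : dual) := forall p : I, 'M[R[i]]_(irr_dim p).

(* [x] is the family of the [(id (x) f)(U_p)] where [f] is a linear functional
   on the coefficient algebra. *)
Definition represents (I : dual) (f : G -> R[i]) (x : matfamily I) : Prop :=
  (forall (c : R[i]) a b, coef_algebra a -> coef_algebra b ->
     f (c *: a + b) = c * f a + f b) /\
  (forall p i j, x p i j = f (irr_rep p i j)).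

Definition cvnorm n (v : 'cV[R[i]]_n) : R :=
  Num.sqrt (\sum_i cabs (v i 0) ^+ 2).

Definition opnorm n (T : 'M[R[i]]_n) : R :=
  sup [set r | exists2 v : 'cV[R[i]]_n, cvnorm v <= 1 & r = cvnorm (T *m v)].

(* [W*(G)], with its norm [fam_norm]. *)
Definition in_Wstar (I : dual) (x : matfamily I) : Prop :=
  exists K : R, forall p, opnorm (x p) <= K.

Definition fam_norm (I : dual) (x : matfamily I) : R :=
  sup [set r | exists p, r = opnorm (x p)].

(* [C*(G)], the norm closure of [C[G]]. *)
Definition in_Cstar (I : dual) (x : matfamily I) : Prop :=
  forall e : R, 0 < e -> exists y : matfamily I,
    finite_set [set p | y p != 0] /\
    forall p, opnorm (x p - y p) <= e.

(* [F^(it)] for positive definite [F], by functional calculus. *)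
Definition imag_pow n (F : 'M[R[i]]_n) (t : R) : 'M[R[i]]_n :=
  invmx (spectralmx F)
  *m diag_mx (map_mx (fun z : R[i] =>
       let s := t * ln (complex.Re z) in Complex (cos s) (sin s))
       (spectral_diag F))
  *m spectralmx F.

End Representations.

Record indsys (R : realType) := Indsys {
  isys :> nat -> cqg R ;
  isys_universal : forall N, cqg_universal (isys N) ;
  isys_dual : forall N, dual (isys N) ;
  isys0 : forall a : isys 0%N, exists c : R[i], a = c%:A ;
  theta : forall N, isys N.+1 -> isys N ;
  theta_hom : forall N, is_starhom (@theta N) ;
  theta_surj : forall N (a : isys N), exists b, theta b = a ;
  theta_comul : forall N, exists theta2 : cqg_ten2 (isys N.+1) ->
                                          cqg_ten2 (isys N),
    [/\ is_starhom theta2,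
        forall a b, theta2 (ten a b) = ten (theta a) (theta b)
      & forall a, comul (theta a) = theta2 (comul a)]
}.

Section Restriction.
Variables (R : realType) (GG : indsys R).

Definition res_rep N (p : isys_dual GG N.+1) : 'M[GG N]_(irr_dim p) :=
  map_mx (@theta R GG N) (irr_rep p).

(* [y = Theta_N(x)], that is [f_y = f_x \o theta_N]. *)
Definition is_Theta N (x : matfamily (isys_dual GG N))
    (y : matfamily (isys_dual GG N.+1)) : Prop :=
  exists f : GG N -> R[i],
    represents f x /\ represents (fun a => f (theta a)) y.

End Restriction.

(* The matrices [F], the multiplicities, the intertwiners [S_(rho,l,pi)] and
   the weights [w(rho,l,pi)].  By [br_orth], [br_neq] and [br_sum] the
   isometries [br_S q p l] decompose the restriction of [p] as the direct sum
   of [br_mult q p] copies of each [q], which is what makes [br_mult q p] the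
   multiplicity of [q]; the index [l] starts at 0. *)
Record branching (R : realType) (GG : indsys R) := Branching {
  br_F : forall N (p : isys_dual GG N), 'M[R[i]]_(irr_dim p) ;
  br_FP : forall N (p : isys_dual GG N), is_Fmatrix (irr_rep p) (br_F p) ;
  br_Fres : forall N (p : isys_dual GG N.+1), 'M[R[i]]_(irr_dim p) ;
  br_FresP : forall N (p : isys_dual GG N.+1),
    is_Fmatrix (res_rep p) (br_Fres p) ;
  br_mult : forall N, isys_dual GG N -> isys_dual GG N.+1 -> nat ;
  br_S : forall N (q : isys_dual GG N) (p : isys_dual GG N.+1),
    'I_(br_mult q p) -> 'M[R[i]]_(irr_dim p, irr_dim q) ;
  br_weight : forall N (q : isys_dual GG N) (p : isys_dual GG N.+1),
    'I_(br_mult q p) -> R ;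
  br_mor : forall N (q : isys_dual GG N) (p : isys_dual GG N.+1)
    (l : 'I_(br_mult q p)), Mor (irr_rep q) (res_rep p) (br_S l) ;
  br_orth : forall N (q : isys_dual GG N) (p : isys_dual GG N.+1)
    (l l' : 'I_(br_mult q p)),
    adjmx (br_S l) *m br_S l' = (l == l')%:R%:M ;
  br_neq : forall N (q q' : isys_dual GG N) (p : isys_dual GG N.+1)
    (l : 'I_(br_mult q p)) (l' : 'I_(br_mult q' p)),
    q <> q' -> adjmx (br_S l) *m br_S l' = 0 ;
  br_sum : forall N (p : isys_dual GG N.+1),
    \sum_(q \in [set: isys_dual GG N]) \sum_(l < br_mult q p)
      br_S l *m adjmx (br_S l) = 1%:M ;
  br_W : forall N (p : isys_dual GG N.+1), 'M[R[i]]_(irr_dim p) ;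
  br_W_end : forall N (p : isys_dual GG N.+1),
    Mor (res_rep p) (res_rep p) (br_W p) ;
  br_W_pos : forall N (p : isys_dual GG N.+1), posdefmx (br_W p) ;
  br_W_F : forall N (p : isys_dual GG N.+1),
    br_F p = br_W p *m br_Fres p /\ br_F p = br_Fres p *m br_W p ;
  br_W_sum : forall N (p : isys_dual GG N.+1),
    br_W p = \sum_(q \in [set: isys_dual GG N]) \sum_(l < br_mult q p)
      (br_weight l)%:C%C *: (br_S l *m adjmx (br_S l)) ;
  br_weight_gt0 : forall N (q : isys_dual GG N) (p : isys_dual GG N.+1)
    (l : 'I_(br_mult q p)), 0 < br_weight l ;
  br_weight_mono : forall N (q : isys_dual GG N) (p : isys_dual GG N.+1)
    (l l' : 'I_(br_mult q p)), (l <= l')%N -> br_weight l <= br_weight l'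
}.

Record wgraph (R : realType) := Wgraph {
  vertex : choiceType ;
  edge : choiceType ;
  level : vertex -> nat ;
  src : edge -> vertex ;
  tgt : edge -> vertex ;
  weight : edge -> R
}.

Section Paths.
Variables (R : realType) (B : wgraph R).

Fixpoint walk (x : vertex B) (t : seq (edge B)) (v : vertex B) : Prop :=
  if t is e :: t' then src e = x /\ walk (tgt e) t' v else x = v.

(* [Omega( *, v)]; in the branching graph of an inductive system, [*] is the
   only vertex of level 0. *)
Definition fin_paths (v : vertex B) : set (seq (edge B)) :=
  [set t | exists2 x, level x = 0%N & walk x t v].

Definition path_weight (t : seq (edge B)) : R := \prod_(e <- t) weight e.

Definition wdim (v : vertex B) : R :=
  \sum_(t \in fin_paths v) path_weight t.

(* The edge written omega_n in 1-based notation is [omega n.-1]. *)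
Definition is_inf_path (omega : nat -> edge B) : Prop :=
  level (src (omega 0%N)) = 0%N /\
  forall n, tgt (omega n) = src (omega n.+1).

Definition inf_path := {omega : nat -> edge B | is_inf_path omega}.

Definition initial (N : nat) (omega : nat -> edge B) : seq (edge B) :=
  mkseq omega N.

(* [X_N = v], for [N >= 1]. *)
Definition passes (N : nat) (v : vertex B) (omega : nat -> edge B) : Prop :=
  tgt (omega N.-1) = v.

Definition cylinder (t : seq (edge B)) : set inf_path :=
  [set omega | initial (size t) (sval omega) = t].

Definition cylinders : set (set inf_path) :=
  [set C | exists v t, fin_paths v t /\ C = cylinder t].

Definition X_eq (N : nat) (v : vertex B) : set inf_path :=
  [set omega | passes N v (sval omega)].

(* [gamma] acts on the paths through [v] at level [N]. *)
Definition act_perm (N : nat) (v : vertex B)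
    (gamma : seq (edge B) -> seq (edge B)) (omega : nat -> edge B) :
    nat -> edge B :=
  if `[< passes N v omega >] then
    fun n => if (n < N)%N then nth (omega n) (gamma (initial N omega)) n
             else omega n
  else omega.

Inductive frakS_level (N : nat) : (inf_path -> inf_path) -> Prop :=
| FrakS_gen (v : vertex B) (gamma : seq (edge B) -> seq (edge B)) g :
    level v = N -> set_bij (fin_paths v) (fin_paths v) gamma ->
    (forall omega, sval (g omega) = act_perm N v gamma (sval omega)) ->
    frakS_level N g
| FrakS_id : frakS_level N id
| FrakS_comp g h : frakS_level N g -> frakS_level N h ->
    frakS_level N (g \o h)
| FrakS_inv g h : frakS_level N g -> cancel g h -> cancel h g ->
    frakS_level N h.

Definition frakS (g : inf_path -> inf_path) : Prop :=
  exists2 N, (1 <= N)%N & frakS_level N g.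

End Paths.

(* The path space, with a base point because measurable types are pointed. *)
Definition pathspace (R : realType) (B : wgraph R) (omega0 : inf_path B) :=
  inf_path B.

HB.instance Definition _ (R : realType) (B : wgraph R) (o : inf_path B) :=
  gen_eqMixin (pathspace o).
HB.instance Definition _ (R : realType) (B : wgraph R) (o : inf_path B) :=
  gen_choiceMixin (pathspace o).
HB.instance Definition _ (R : realType) (B : wgraph R) (o : inf_path B) :=
  isPointed.Build (pathspace o) o.

Section Measures.
Variables (R : realType) (B : wgraph R) (o : inf_path B).

Definition Omega := g_sigma_algebraType (@cylinders R B : set (set (pathspace o))).

Definition central (P : probability Omega R) : Prop :=
  forall N (v : vertex B) t, (1 <= N)%N -> level v = N -> fin_paths v t ->
    fine (P (cylinder t)) / path_weight t = fine (P (X_eq N v)) / wdim v.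

Definition ergodic (P : probability Omega R) : Prop :=
  forall A : set Omega, measurable A ->
    (forall g, frakS g -> g @^-1` A = A) ->
    P A = 0%E \/ P A = 1%E.

Definition extremal_central (P : probability Omega R) : Prop :=
  central P /\
  forall (P1 P2 : probability Omega R) (s : R),
    central P1 -> central P2 -> 0 < s < 1 ->
    (forall A, measurable A ->
       P A = (s%:E * P1 A + (1 - s)%:E * P2 A)%E) ->
    forall A, measurable A -> P1 A = P A /\ P2 A = P A.

End Measures.

(* Vertices are pairs [(N, pi)] with [pi] in the dual of [G_N], and edges
   are tuples [(N, rho, pi, l)] with [l < m_pi(rho)]. *)
Definition branching_graph (R : realType) (GG : indsys R) (D : branching GG) :
    wgraph R :=
  @Wgraph R
    {N : nat & isys_dual GG N}
    {N : nat & {qp : isys_dual GG N * isys_dual GG N.+1 &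
                'I_(br_mult D qp.1 qp.2)}}
    (fun v => tag v)
    (fun e => Tagged (fun N => isys_dual GG N : Type) (tag (tagged e)).1)
    (fun e => Tagged (fun N => isys_dual GG N : Type) (tag (tagged e)).2)
    (fun e => br_weight (tagged (tagged e))).

(* [lim_W] is the C*-inductive limit of the [W*(G_N)], with the canonical maps
   [lim_Psi N]; [lim_A] is its C*-subalgebra A(GG), with the inclusion
   [lim_inc], and [lim_flow] is the flow on it. *)
Record limit_algebra (R : realType) (GG : indsys R) (D : branching GG) :=
    LimitAlgebra {
  lim_W : cstarAlgType R ;
  lim_Psi : forall N, matfamily (isys_dual GG N) -> lim_W ;
  lim_Psi_linear : forall N (c : R[i]) (x y : matfamily (isys_dual GG N)),
    in_Wstar x -> in_Wstar y ->
    lim_Psi (fun p => c *: x p + y p) = c *: lim_Psi x + lim_Psi y ;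
  lim_Psi1 : forall N, @lim_Psi N (fun p => 1%:M) = 1 ;
  lim_PsiM : forall N (x y : matfamily (isys_dual GG N)),
    in_Wstar x -> in_Wstar y ->
    lim_Psi (fun p => x p *m y p) = lim_Psi x * lim_Psi y ;
  lim_Psi_star : forall N (x : matfamily (isys_dual GG N)), in_Wstar x ->
    lim_Psi (fun p => adjmx (x p)) = star (lim_Psi x) ;
  lim_Psi_norm : forall N (x : matfamily (isys_dual GG N)), in_Wstar x ->
    cnorm (lim_Psi x) = fam_norm x ;
  lim_Psi_Theta : forall N (x : matfamily (isys_dual GG N))
    (y : matfamily (isys_dual GG N.+1)), in_Wstar x -> is_Theta x y ->
    lim_Psi y = lim_Psi x ;
  lim_Psi_dense : cdense [set z | exists N (x : matfamily (isys_dual GG N)),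
    in_Wstar x /\ z = lim_Psi x] ;
  lim_A : cstarAlgType R ;
  lim_inc : lim_A -> lim_W ;
  lim_inc_hom : is_starhom lim_inc ;
  lim_inc_norm : forall a, cnorm (lim_inc a) = cnorm a ;
  lim_inc_range : [set z | exists a, z = lim_inc a] =
    cstar_gen [set z | exists N (x : matfamily (isys_dual GG N)),
      in_Cstar x /\ z = lim_Psi x] ;
  lim_flow : R -> lim_A -> lim_A ;
  lim_flow_hom : forall t, is_starhom (lim_flow t) ;
  lim_flowE : forall t a N (x : matfamily (isys_dual GG N)), in_Cstar x ->
    lim_inc a = lim_Psi x ->
    lim_inc (lim_flow t a) = lim_Psi (fun p =>
      imag_pow (br_F D p) t *m x p *m imag_pow (br_F D p) (- t))
}.

Section States.
Variables (R : realType) (A : cstarAlgType R).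

Definition is_state (chi : A -> R[i]) : Prop :=
  [/\ forall (c : R[i]) x y, chi (c *: x + y) = c * chi x + chi y,
      forall x, 0 <= chi (star x * x)
    & chi 1 = 1].

Definition is_entire (f : R[i] -> A) : Prop :=
  forall z, exists d : A, forall e : R, 0 < e ->
    exists2 r : R, 0 < r & forall h : R[i], h != 0 -> cabs h < r ->
      cnorm (h^-1 *: (f (z + h) - f z) - d) < e.

Definition entire_extension (tau : R -> A -> A) (y : A) (f : R[i] -> A) :=
  is_entire f /\ forall t : R, f t%:C%C = tau t y.

Definition is_KMS (tau : R -> A -> A) (beta : R) (chi : A -> R[i]) : Prop :=
  exists D : set A,
    [/\ star_subalgebra D, cdense D,
        forall t y, D y -> D (tau t y),
        forall y, D y -> exists f, entire_extension tau y f
      & forall x y f, D x -> D y -> entire_extension tau y f ->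
          chi (x * f (Complex 0 beta)) = chi (y * x)].

Record gns (chi : A -> R[i]) := Gns {
  gns_space : hilbertType R ;
  gns_rep : A -> gns_space -> gns_space ;
  gns_vec : gns_space ;
  gns_repP : is_starrep gns_rep ;
  gns_state : forall a, chi a = inner (gns_rep a gns_vec) gns_vec ;
  gns_cyclic : forall (v : gns_space) (e : R), 0 < e ->
    exists a, hnorm (v - gns_rep a gns_vec) < e
}.

Definition commutant (H : hilbertType R) (S : set (H -> H)) : set (H -> H) :=
  [set T | bounded_op T /\ forall T', S T' -> forall v, T (T' v) = T' (T v)].

Definition is_factor (H : hilbertType R) (M : set (H -> H)) : Prop :=
  forall T, M T -> commutant M T -> exists c : R[i], forall v, T v = c *: v.

(* The von Neumann algebra generated by [gns_rep] is its bicommutant. *)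
Definition factorial_state (chi : A -> R[i]) : Prop :=
  exists g : gns chi,
    is_factor (commutant (commutant [set T | exists a, T = @gns_rep chi g a])).

End States.

Section QuantizedCharacters.
Variables (R : realType) (GG : indsys R) (D : branching GG).
Variable L : limit_algebra D.

(* [a] is the element [x] of [C*(G_N)]. *)
Definition is_Cstar_elt N (x : matfamily (isys_dual GG N)) (a : lim_A L) : Prop :=
  in_Cstar x /\ lim_inc a = lim_Psi L x.

Definition quantized_character (chi : lim_A L -> R[i]) : Prop :=
  [/\ is_state chi,
      is_KMS (@lim_flow _ _ _ L) (-1) chi
    & forall N, (1 <= N)%N ->
        sup [set r | exists (x : matfamily (isys_dual GG N)) (a : lim_A L),
               [/\ is_Cstar_elt x a, cnorm a <= 1 & r = cabs (chi a)]] = 1].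

Definition extremal_character (chi : lim_A L -> R[i]) : Prop :=
  quantized_character chi /\
  forall (chi1 chi2 : lim_A L -> R[i]) (s : R),
    quantized_character chi1 -> quantized_character chi2 -> 0 < s < 1 ->
    (forall a, chi a = s%:C%C * chi1 a + (1 - s)%:C%C * chi2 a) ->
    chi1 = chi /\ chi2 = chi.

Definition irr_character N (p : isys_dual GG N)
    (x : matfamily (isys_dual GG N)) : R[i] :=
  \tr (br_F D p *m x p) / \tr (br_F D p).

(* Unconditional convergence of a series indexed by a countable set. *)
Definition has_sum (I : choiceType) (f : I -> R[i]) (s : R[i]) : Prop :=
  forall e : R, 0 < e -> exists J0 : {fset I}, forall J : {fset I},
    (J0 `<=` J)%fset -> cabs (s - \sum_(i <- J) f i) < e.

Definition corresponds (o : inf_path (branching_graph D))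
    (P : probability (Omega o) R) (chi : lim_A L -> R[i]) : Prop :=
  forall N (x : matfamily (isys_dual GG N)) (a : lim_A L), (1 <= N)%N ->
    is_Cstar_elt x a ->
    has_sum (fun p : isys_dual GG N =>
        (fine (P (@X_eq R (branching_graph D) N
           (Tagged (fun N => isys_dual GG N : Type) p))))%:C%C
        * irr_character p x)
      (chi a).

End QuantizedCharacters.

(* Main.v *)
(* The character chi is determined by its values on the elements supported at a
   single vertex p of the branching graph, where it equals P(X_N = p) times the
   F-weighted trace, because eigenvectors Y of Ad F satisfy
   chi(Y x) = lambda chi(x Y).  Every bounded functional with this twist that is
   dominated by chi gives a function on the vertices whose quotient by w-dim is
   harmonic; if P is ergodic, Doob's maximal inequality for the quotient by
   P(X_N = .) shows that it is a multiple of chi.  Applied to <T pi(.) xi, xi>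
   with T in the centre of the von Neumann algebra of chi, and to the components
   of a convex decomposition of chi, this shows that ergodicity implies
   factoriality and extremality; that a component satisfies the twist follows
   from the KMS condition after projecting onto one frequency of the flow.
   Conversely, an invariant set S yields a central operator, the strong limit of
   pi(a_N) with a_N = sum_p P(S | X_N = p) 1_p, and, after normalization, the
   quantized character of P(. | S); both are trivial only if P(S) is 0 or 1. *)

From HB Require Import structures.
Require Import Defs.
From mathcomp Require Import all_boot all_order all_algebra.
From mathcomp Require Import finmap complex.
From mathcomp Require Import all_classical all_reals all_analysis.
From mathcomp Require Import ring lra.
Set Implicit Arguments.
Unset Strict Implicit.
Unset Printing Implicit Defensive.
Import Order.TTheory GRing.Theory Num.Theory.
Import numFieldNormedType.Exports.
Local Open Scope classical_set_scope.
Local Open Scope ring_scope.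

(* Decision procedure for linear identities in additive groups, extended to
   non-commutative rings by expanding products into monomials. *)
Inductive zexp := ZAtom of nat | ZZero | ZAdd of zexp & zexp | ZOpp of zexp.

Section ZmodNormalization.
Variable V : zmodType.

Fixpoint zeval (env : seq V) (e : zexp) : V :=
  match e with
  | ZAtom n => env`_n
  | ZZero => 0
  | ZAdd a b => zeval env a + zeval env b
  | ZOpp a => - zeval env a
  end.

Fixpoint zcoef (e : zexp) (i : nat) : int :=
  match e with
  | ZAtom n => (n == i)%:R
  | ZZero => 0
  | ZAdd a b => zcoef a i + zcoef b i
  | ZOpp a => - zcoef a i
  end.

Lemma zevalE env e :
  zeval env e = \sum_(i < size env) env`_i *~ zcoef e i.
Proof.
elim: e => [n||a IHa b IHb|a IHa] /=.
- have [nl|nl] := ltnP n (size env).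
    rewrite (bigD1 (Ordinal nl)) //= eqxx mulr1z big1 ?addr0 // => i.
    by rewrite -val_eqE /= eq_sym => /negbTE ->; rewrite mulr0z.
  rewrite nth_default // big1 // => i _; have := ltn_ord i.
  by case: eqP => [ni|_] lt; [move: nl; rewrite ni leqNgt lt | rewrite mulr0z].
- by rewrite big1 // => i _; rewrite mulr0z.
- by rewrite IHa IHb -big_split /=; apply: eq_bigr => i _; rewrite mulrzDr.
- by rewrite IHa -sumrN; apply: eq_bigr => i _; rewrite mulrNz.
Qed.

Lemma zeval_eq env a b :
  all (fun i => zcoef a i == zcoef b i) (iota 0 (size env)) ->
  zeval env a = zeval env b.
Proof.
move=> /allP h; rewrite !zevalE; apply: eq_bigr => i _.
by rewrite (eqP (h i _)) // mem_iota /= ltn_ord.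
Qed.

End ZmodNormalization.

Ltac zinsert x l :=
  match l with
  | nil => constr:(x :: l)
  | ?y :: _ => let _ := match goal with _ => unify x y end in l
  | ?y :: ?l' => let l1 := zinsert x l' in constr:(y :: l1)
  end.
Ltac zatoms e l :=
  lazymatch e with
  | (?a + ?b)%R => let l1 := zatoms a l in zatoms b l1
  | (- ?a)%R => zatoms a l
  | (0)%R => l
  | _ => let l' := zinsert e l in l'
  end.
Ltac zindex x l :=
  match l with
  | ?y :: _ => let _ := match goal with _ => unify x y end in constr:(0%N)
  | _ :: ?l' => let n := zindex x l' in constr:(n.+1)
  end.
Ltac zreify e l :=
  lazymatch e with
  | (?a + ?b)%R => let x := zreify a l in let y := zreify b l in constr:(ZAdd x y)
  | (- ?a)%R => let x := zreify a l in constr:(ZOpp x)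
  | (0)%R => constr:(ZZero)
  | _ => let n := zindex e l in constr:(ZAtom n)
  end.
Ltac abel :=
  lazymatch goal with
  | |- @eq ?T ?x ?y =>
    let l0 := zatoms x (@nil T) in let l := zatoms y l0 in
    let a := zreify x l in let b := zreify y l in
    exact: (@zeval_eq _ l a b isT)
  end.
Ltac ncring :=
  rewrite ?(mulrDl, mulrDr, mulNr, mulrN, mul1r, mulr1, mul0r, mulr0, mulrA, opprK);
  abel.

(** * Complex numbers and positive semidefinite forms *)

Section ComplexModulus.
Variable R : realType.
Implicit Types (z w : R[i]) (x : R).

Lemma normcE z : `|z| = (cabs z)%:C%C.
Proof. by rewrite /cabs normc_def. Qed.

Lemma conj_rc x : Num.conj (x%:C%C : R[i]) = x%:C%C.
Proof. exact: conjc_real. Qed.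

Lemma conj_i : Num.conj ('i%C : R[i]) = - 'i%C.
Proof. by apply/eqP; rewrite eq_complex /= oppr0 !eqxx. Qed.

Lemma Re_rc x : complex.Re (x%:C%C : R[i]) = x.
Proof. by []. Qed.

Lemma ReD z w : complex.Re (z + w) = complex.Re z + complex.Re w.
Proof. by case: z; case: w. Qed.

Lemma ReN z : complex.Re (- z) = - complex.Re z.
Proof. by case: z. Qed.

Lemma ReB z w : complex.Re (z - w) = complex.Re z - complex.Re w.
Proof. by rewrite ReD ReN. Qed.

Lemma ImD z w : complex.Im (z + w) = complex.Im z + complex.Im w.
Proof. by case: z; case: w. Qed.

Lemma ImN z : complex.Im (- z) = - complex.Im z.
Proof. by case: z. Qed.

Lemma Re_rcM x z : complex.Re (x%:C%C * z) = x * complex.Re z.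
Proof. by case: z => a b /=; rewrite mul0r subr0. Qed.

Lemma Re_sum (I : Type) (r : seq I) (P : pred I) (F : I -> R[i]) :
  complex.Re (\sum_(i <- r | P i) F i) = \sum_(i <- r | P i) complex.Re (F i).
Proof. by elim/big_rec2: _ => // i y1 y2 _ <-; rewrite ReD. Qed.

Lemma cRe_conj z : complex.Re (Num.conj z) = complex.Re z.
Proof. by case: z. Qed.

Lemma cIm_conj z : complex.Im (Num.conj z) = - complex.Im z.
Proof. by case: z. Qed.

Lemma rcD x y : ((x + y)%:C)%C = x%:C%C + y%:C%C :> R[i].
Proof. exact: rmorphD. Qed.

Lemma rcM x y : ((x * y)%:C)%C = x%:C%C * y%:C%C :> R[i].
Proof. exact: rmorphM. Qed.

Lemma rcN x : ((- x)%:C)%C = - x%:C%C :> R[i].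
Proof. exact: rmorphN. Qed.

Lemma rcB x y : ((x - y)%:C)%C = x%:C%C - y%:C%C :> R[i].
Proof. exact: rmorphB. Qed.

Lemma rc_sum (I : Type) (r : seq I) (P : pred I) (F : I -> R) :
  ((\sum_(i <- r | P i) F i)%:C)%C = \sum_(i <- r | P i) (F i)%:C%C :> R[i].
Proof. exact: rmorph_sum. Qed.

Lemma ge0_rcRe z : 0 <= z -> z = (complex.Re z)%:C%C.
Proof. by case: z => a b; rewrite lecE /= => /andP[/eqP -> _]. Qed.

Lemma Re_ge0 z : 0 <= z -> 0 <= complex.Re z.
Proof. by rewrite lecE /= => /andP[]. Qed.

Lemma cabs_ge0 z : 0 <= cabs z.
Proof. by rewrite -lecR -normcE normr_ge0. Qed.

Lemma cabs0 : cabs (0 : R[i]) = 0.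
Proof. by apply: complexI; rewrite -normcE normr0. Qed.

Lemma cabs1 : cabs (1 : R[i]) = 1.
Proof. by apply: complexI; rewrite -normcE normr1. Qed.

Lemma cabsM z w : cabs (z * w) = cabs z * cabs w.
Proof. by apply: complexI; rewrite -normcE normrM !normcE rcM. Qed.

Lemma cabsD z w : cabs (z + w) <= cabs z + cabs w.
Proof. by rewrite -lecR rcD -!normcE ler_normD. Qed.

Lemma cabsN z : cabs (- z) = cabs z.
Proof. by apply: complexI; rewrite -!normcE normrN. Qed.

Lemma cabsB z w : cabs (z - w) = cabs (w - z).
Proof. by rewrite -cabsN opprB. Qed.

Lemma cabs_conj z : cabs (Num.conj z) = cabs z.
Proof. by apply: complexI; rewrite -!normcE norm_conjC. Qed.

Lemma cabs_rc x : cabs (x%:C%C) = `|x|.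
Proof.
by rewrite /cabs normc_def /= expr0n addr0 sqrtr_sqr.
Qed.

Lemma cabs_i : cabs ('i%C : R[i]) = 1.
Proof. by rewrite /cabs normc_def /= expr0n expr1n add0r sqrtr1. Qed.

Lemma cabs_eq0 z : cabs z = 0 -> z = 0.
Proof. by move=> h; apply/eqP; rewrite -normr_eq0 normcE h. Qed.

Lemma cabs_gt0 z : z != 0 -> 0 < cabs z.
Proof.
by move=> h; rewrite lt_neqAle cabs_ge0 andbT eq_sym; apply: contraNneq h => /cabs_eq0->.
Qed.

Lemma cabsV z : cabs z^-1 = (cabs z)^-1.
Proof.
have [->|z0] := eqVneq z 0; first by rewrite invr0 cabs0 invr0.
by apply: complexI; rewrite -normcE normfV normcE fmorphV.
Qed.

Lemma cabs_sqr z : (cabs z ^+ 2)%:C%C = z * Num.conj z.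
Proof. by rewrite rmorphXn /= -normcE normCK. Qed.

Lemma cabs_sqrE z : cabs z ^+ 2 = complex.Re z ^+ 2 + complex.Im z ^+ 2.
Proof. by apply: complexI; rewrite add_Re2_Im2 rmorphXn /= -normcE. Qed.

Lemma ler_Re_cabs z : `|complex.Re z| <= cabs z.
Proof.
rewrite -(ler_pXn2r (ltn0Sn 1)) ?nnegrE ?cabs_ge0 // cabs_sqrE real_normK ?num_real //.
by rewrite lerDl sqr_ge0.
Qed.

Lemma ler_Im_cabs z : `|complex.Im z| <= cabs z.
Proof.
rewrite -(ler_pXn2r (ltn0Sn 1)) ?nnegrE ?cabs_ge0 // cabs_sqrE [X in X <= _]real_normK ?num_real //.
by rewrite lerDr sqr_ge0.
Qed.

Lemma Re_le_cabs z : complex.Re z <= cabs z.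
Proof. exact: le_trans (ler_norm _) (ler_Re_cabs _). Qed.

Lemma cabs_le_ReIm z : cabs z <= `|complex.Re z| + `|complex.Im z|.
Proof.
rewrite -(ler_pXn2r (ltn0Sn 1)) ?nnegrE ?cabs_ge0 ?addr_ge0 // cabs_sqrE.
rewrite sqrrD !real_normK ?num_real // [X in _ <= X]addrAC lerDl mulrn_wge0 //.
Qed.

Lemma ge0_cabs z : 0 <= z -> cabs z = complex.Re z.
Proof. by move=> h; rewrite /cabs ger0_norm. Qed.

Lemma eq_cabs_eps z w :
  (forall e : R, 0 < e -> cabs (z - w) <= e) -> z = w.
Proof.
move=> h; apply/eqP; rewrite -subr_eq0; apply/negPn/negP => /cabs_gt0 h0.
have := h (cabs (z - w) / 2); rewrite divr_gt0 // => /(_ isT).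
by rewrite leNgt ltr_pdivrMr // ltr_pMr // ltr1n.
Qed.

End ComplexModulus.

Section PSDForms.
Variables (R : realType) (V : lmodType R[i]).

Record psd_form (s : V -> V -> R[i]) : Prop := PsdForm {
  psdDl : forall x y z, s (x + y) z = s x z + s y z ;
  psdZl : forall (c : R[i]) x z, s (c *: x) z = c * s x z ;
  psdC : forall x y, s y x = Num.conj (s x y) ;
  psd_ge0 : forall x, 0 <= s x x
}.

Variables (s : V -> V -> R[i]) (hs : psd_form s).

Definition sqn x : R := complex.Re (s x x).
Definition snorm x : R := Num.sqrt (sqn x).

Lemma psdDr x y z : s z (x + y) = s z x + s z y.
Proof. by rewrite psdC // psdDl // rmorphD /= -!(psdC hs). Qed.

Lemma psdZr (c : R[i]) x z : s z (c *: x) = Num.conj c * s z x.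
Proof. by rewrite psdC // psdZl // rmorphM /= -!(psdC hs). Qed.

Lemma psd0l z : s 0 z = 0.
Proof. by rewrite -(scale0r 0) psdZl // mul0r. Qed.

Lemma psd0r z : s z 0 = 0.
Proof. by rewrite psdC // psd0l rmorph0. Qed.

Lemma psdNl x z : s (- x) z = - s x z.
Proof. by rewrite -scaleN1r psdZl // mulN1r. Qed.

Lemma psdNr x z : s z (- x) = - s z x.
Proof. by rewrite psdC // psdNl rmorphN /= -(psdC hs). Qed.

Lemma psdBl x y z : s (x - y) z = s x z - s y z.
Proof. by rewrite psdDl // psdNl. Qed.

Lemma psdBr x y z : s z (x - y) = s z x - s z y.
Proof. by rewrite psdDr psdNr. Qed.

Lemma sqn_ge0 x : 0 <= sqn x.
Proof. exact: Re_ge0 (psd_ge0 hs x). Qed.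

Lemma psd_sqn x : s x x = (sqn x)%:C%C.
Proof. exact/ge0_rcRe/psd_ge0. Qed.

Lemma snorm_ge0 x : 0 <= snorm x.
Proof. exact: sqrtr_ge0. Qed.

Lemma snorm_sqr x : snorm x ^+ 2 = sqn x.
Proof. by rewrite sqr_sqrtr // sqn_ge0. Qed.

Lemma snorm0 : snorm 0 = 0.
Proof. by rewrite /snorm /sqn psd0l sqrtr0. Qed.

Lemma sqnZ (c : R[i]) x : sqn (c *: x) = cabs c ^+ 2 * sqn x.
Proof.
apply: complexI; rewrite -psd_sqn psdZl // psdZr rcM -psd_sqn cabs_sqr; ring.
Qed.

Lemma snormZ (c : R[i]) x : snorm (c *: x) = cabs c * snorm x.
Proof.
rewrite /snorm sqnZ sqrtrM ?sqr_ge0 // sqrtr_sqr ger0_norm //; exact: cabs_ge0.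
Qed.

Lemma snormN x : snorm (- x) = snorm x.
Proof. by rewrite -scaleN1r snormZ cabsN cabs1 mul1r. Qed.

Lemma snormB x y : snorm (x - y) = snorm (y - x).
Proof. by rewrite -snormN opprB. Qed.

(* Expand [0 <= s (b x - a y) (b x - a y)] with [a = s x y], [b = s y y]. *)
Lemma psd_CS_sqr x y : cabs (s x y) ^+ 2 <= sqn x * sqn y.
Proof.
have key (t : R) : 0 <= sqn x - 2 * t * cabs (s x y) ^+ 2
    + t ^+ 2 * cabs (s x y) ^+ 2 * sqn y.
  have h := psd_ge0 hs (x - (t%:C%C * s x y) *: y).
  rewrite -ler0c; apply: le_trans h _.
  rewrite psdBl !psdBr psdZl // psdZr psdZl // psdZr (psdC hs x y) !psd_sqn.
  rewrite !rmorphM /= conj_rc rcD !rcB.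
  have -> : ((2 * t * cabs (s x y) ^+ 2)%:C)%C =
     2 * t%:C%C * (s x y * Num.conj (s x y)).
    by rewrite rcM cabs_sqr rcM; congr (_ * _ * _); rewrite rmorph_nat.
  have -> : ((t ^+ 2 * cabs (s x y) ^+ 2 * sqn y)%:C)%C =
     t%:C%C ^+ 2 * (s x y * Num.conj (s x y)) * (sqn y)%:C%C.
    by rewrite rcM [X in X * _]rcM cabs_sqr rmorphXn.
  by rewrite le_eqVlt; apply/orP; left; apply/eqP; ring.
have [y0|y0] := eqVneq (sqn y) 0.
  rewrite y0 mulr0; have := key ((sqn x + 1) / (cabs (s x y) ^+ 2)).
  rewrite y0 mulr0 addr0.
  have [->//|n0] := eqVneq (cabs (s x y) ^+ 2) 0.
  rewrite -mulrA divfK // => h.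
  have := sqn_ge0 x; lra.
have yp : 0 < sqn y by rewrite lt_neqAle eq_sym y0 sqn_ge0.
have := key (sqn y)^-1.
have -> : sqn x - 2 * (sqn y)^-1 * cabs (s x y) ^+ 2
   + (sqn y)^-1 ^+ 2 * cabs (s x y) ^+ 2 * sqn y
   = (sqn x * sqn y - cabs (s x y) ^+ 2) / sqn y by field.
by rewrite pmulr_lge0 ?invr_gt0 // subr_ge0.
Qed.

Lemma psd_CS x y : cabs (s x y) <= snorm x * snorm y.
Proof.
rewrite -(ler_pXn2r (ltn0Sn 1)) ?nnegrE ?cabs_ge0 ?mulr_ge0 ?snorm_ge0 //.
by rewrite exprMn !snorm_sqr psd_CS_sqr.
Qed.

Lemma snormD x y : snorm (x + y) <= snorm x + snorm y.
Proof.
rewrite -(ler_pXn2r (ltn0Sn 1)) ?nnegrE ?snorm_ge0 ?addr_ge0 ?snorm_ge0 //.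
rewrite sqrrD !snorm_sqr /sqn psdDl // !psdDr !ReD -/(sqn x) -/(sqn y).
have h1 := le_trans (Re_le_cabs _) (psd_CS x y).
have h2 := le_trans (Re_le_cabs _) (psd_CS y x).
rewrite (mulrC (snorm y)) in h2; rewrite -mulr_natl; lra.
Qed.

Lemma snorm_trans y x z : snorm (x - z) <= snorm (x - y) + snorm (y - z).
Proof. by rewrite -[x - z](subrKA y) snormD. Qed.

Lemma sqnB x y : sqn (x - y) = sqn x - 2 * complex.Re (s x y) + sqn y.
Proof.
rewrite /sqn psdBl !psdBr !ReB (psdC hs x y) cRe_conj; ring.
Qed.

Lemma snorm_sum (I : Type) (r : seq I) (P : pred I) (F : I -> V) :
  snorm (\sum_(i <- r | P i) F i) <= \sum_(i <- r | P i) snorm (F i).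
Proof.
elim/big_rec2: _ => [|i y1 y2 _ h]; first by rewrite snorm0.
by rewrite (le_trans (snormD _ _)) // lerD2l.
Qed.

Lemma psd_suml (I : Type) (r : seq I) (P : pred I) (F : I -> V) y :
  s (\sum_(i <- r | P i) F i) y = \sum_(i <- r | P i) s (F i) y.
Proof. by elim/big_rec2: _ => [|i a b _ <-]; rewrite ?psd0l ?psdDl. Qed.

Lemma psd_sumr (I : Type) (r : seq I) (P : pred I) (F : I -> V) y :
  s y (\sum_(i <- r | P i) F i) = \sum_(i <- r | P i) s y (F i).
Proof. by elim/big_rec2: _ => [|i a b _ <-]; rewrite ?psd0r ?psdDr. Qed.

End PSDForms.

Lemma nondecr_bounded_cauchy (R : realType) (u : nat -> R) (M : R) :
  (forall n, u n <= u n.+1) -> (forall n, u n <= M) ->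
  forall e : R, 0 < e -> exists N, forall m n, (N <= m)%N -> (N <= n)%N ->
    `|u m - u n| < e.
Proof.
move=> um uM e e0.
have mono m n : (m <= n)%N -> u m <= u n.
  by move=> /subnK <-; elim: (n - m)%N => // k h; apply: le_trans h _; rewrite addSn um.
have hs : has_sup (range u).
  by split; [exists (u 0%N); exists 0%N | exists M => _ [n _ <-]].
have [_ [N _ <-] hN] := sup_adherent e0 hs.
have hub n : u n <= sup (range u) by apply: sup_upper_bound => //; exists n.
exists N => m n /mono Nm /mono Nn.
have := hub m; have := hub n; rewrite ltr_norml; lra.
Qed.

(** * Positivity and states in C*-algebras *)

Section CStarBasics.
Variables (R : realType) (A : cstarAlgType R).
Implicit Types (x y z : A) (c : R[i]) (t : R).

Lemma star0 : star (0 : A) = 0.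
Proof. by rewrite -(scale0r 0) starZ rmorph0 !scale0r. Qed.

Lemma starN x : star (- x) = - star x.
Proof. by rewrite -scaleN1r starZ rmorphN rmorph1 scaleN1r. Qed.

Lemma starB x y : star (x - y) = star x - star y.
Proof. by rewrite starD starN. Qed.

Lemma star1 : star (1 : A) = 1.
Proof. by rewrite -[star 1]mulr1 -[X in _ * X]starK -starM mulr1 starK. Qed.

Lemma starZr t x : star (t%:C%C *: x) = t%:C%C *: star x.
Proof. by rewrite starZ conj_rc. Qed.

Lemma star_sum (I : Type) (r : seq I) (P : pred I) (F : I -> A) :
  star (\sum_(i <- r | P i) F i) = \sum_(i <- r | P i) star (F i).
Proof. by elim/big_rec2: _ => [|i a b _ <-]; rewrite ?star0 ?starD. Qed.

Lemma cnormZr t x : cnorm (t%:C%C *: x) = `|t| * cnorm x.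
Proof. by rewrite cnormZ cabs_rc. Qed.

Lemma mulrn_rc x n : x *+ n = (n%:R : R)%:C%C *: x.
Proof. by rewrite rmorph_nat scaler_nat. Qed.

Lemma double_rc x : x + x = (2 : R)%:C%C *: x.
Proof. by rewrite -mulrn_rc mulr2n. Qed.

Lemma cnorm0 : cnorm (0 : A) = 0.
Proof. by rewrite -(scale0r 0) cnormZ cabs0 mul0r. Qed.

Lemma cnormN x : cnorm (- x) = cnorm x.
Proof. by rewrite -scaleN1r cnormZ cabsN cabs1 mul1r. Qed.

Lemma cnormB x y : cnorm (x - y) = cnorm (y - x).
Proof. by rewrite -cnormN opprB. Qed.

Lemma cnorm_ge0 x : 0 <= cnorm x.
Proof.
by have := ler_cnormD x (- x); rewrite subrr cnorm0 cnormN; lra.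
Qed.

Lemma cnorm_trans y x z : cnorm (x - z) <= cnorm (x - y) + cnorm (y - z).
Proof. by rewrite -[x - z](subrKA y) ler_cnormD. Qed.

Lemma cnorm_le_trans y x : cnorm x <= cnorm (x - y) + cnorm y.
Proof. by rewrite -{1}(subrK y x) ler_cnormD. Qed.

Lemma cnorm_star x : cnorm (star x) = cnorm x.
Proof.
have key y : cnorm y <= cnorm (star y).
  have [/eqP y0|y0] := eqVneq (cnorm y) 0; first by rewrite (eqP y0) cnorm_ge0.
  have yp : 0 < cnorm y by rewrite lt_neqAle eq_sym y0 cnorm_ge0.
  have := ler_cnormM (star y) y; rewrite cnorm_starM expr2.
  by rewrite ler_pM2r.
by apply/eqP; rewrite eq_le key -{2}(starK x) key.
Qed.

Lemma cnorm1 : cnorm (1 : A) = 1.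
Proof.
have h : cnorm (1 : A) ^+ 2 = cnorm (1 : A) by rewrite -cnorm_starM star1 mulr1.
have n0 : cnorm (1 : A) != 0.
  by apply/eqP => /cnorm0_eq0; exact: cstar_oner_neq0.
by apply: (mulfI n0); rewrite -expr2 h mulr1.
Qed.

Lemma cnorm_sa_sqr x : star x = x -> cnorm (x * x) = cnorm x ^+ 2.
Proof. by move=> h; rewrite -cnorm_starM h. Qed.

Lemma star_mul_eq0 x : star x * x = 0 -> x = 0.
Proof.
move=> h; apply: cnorm0_eq0; apply/eqP.
by rewrite -sqrf_eq0 -cnorm_starM h cnorm0.
Qed.

Lemma sa_sqr_eq0 x : star x = x -> x * x = 0 -> x = 0.
Proof. by move=> h h2; apply: star_mul_eq0; rewrite h. Qed.

Lemma eq_cnorm_eps x y : (forall e : R, 0 < e -> cnorm (x - y) <= e) -> x = y.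
Proof.
move=> h; apply/eqP; rewrite -subr_eq0; apply/eqP; apply: cnorm0_eq0.
apply/eqP; rewrite eq_le cnorm_ge0 andbT; apply/ler_addgt0Pl => e e0.
by rewrite addr0 h.
Qed.

Definition ccvg (u : nat -> A) (l : A) : Prop :=
  forall e : R, 0 < e -> exists N, forall n, (N <= n)%N -> cnorm (u n - l) < e.

Lemma ccvg_cst l : ccvg (fun=> l) l.
Proof. by move=> e e0; exists 0%N => n _; rewrite subrr cnorm0. Qed.

Lemma ccvg_le u l t : ccvg u l -> (forall n, cnorm (u n) <= t) -> cnorm l <= t.
Proof.
move=> ul ut; apply/ler_addgt0Pl => e e0; have [N hN] := ul e e0.
by rewrite (le_trans (cnorm_le_trans (u N) l)) // cnormB lerD // ltW // hN.
Qed.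

Lemma ccvgD u v l m : ccvg u l -> ccvg v m -> ccvg (fun n => u n + v n) (l + m).
Proof.
move=> ul vm e e0; have e2 : 0 < e / 2 by rewrite divr_gt0.
have [N hN] := ul _ e2; have [M hM] := vm _ e2.
exists (maxn N M) => n; rewrite geq_max => /andP[/hN h1 /hM h2].
rewrite opprD addrACA (le_lt_trans (ler_cnormD _ _)) //; lra.
Qed.

Lemma ccvgM u v l m : ccvg u l -> ccvg v m -> ccvg (fun n => u n * v n) (l * m).
Proof.
move=> ul vm e e0.
pose K := 1 + cnorm l + cnorm m.
have l0 := cnorm_ge0 l; have m0 := cnorm_ge0 m.
have K0 : 0 < K by rewrite /K; lra.
have e2 : 0 < Num.min 1 (e / 2 / K) by rewrite lt_min ltr01 !divr_gt0.
have [N hN] := ul _ e2; have [M hM] := vm _ e2.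
exists (maxn N M) => n; rewrite geq_max => /andP[/hN h1 /hM h2].
have -> : u n * v n - l * m = (u n - l) * v n + l * (v n - m).
  by rewrite mulrBl mulrBr addrA subrK.
rewrite (le_lt_trans (ler_cnormD _ _)) //.
have := ler_cnormM (u n - l) (v n); have := ler_cnormM l (v n - m).
have hv := cnorm_le_trans m (v n).
move: h1 h2; rewrite !lt_min => /andP[a1 a2] /andP[b1 b2].
have hK : cnorm (v n) <= K by rewrite /K; lra.
have c1 : cnorm (u n - l) * cnorm (v n) <= cnorm (u n - l) * K.
  by rewrite ler_wpM2l ?cnorm_ge0.
have c2 : cnorm l * cnorm (v n - m) <= K * cnorm (v n - m).
  by rewrite ler_wpM2r ?cnorm_ge0 // /K; lra.
rewrite ltr_pdivlMr // in a2; rewrite ltr_pdivlMr // mulrC in b2; lra.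
Qed.

Lemma ccvgZ c u l : ccvg u l -> ccvg (fun n => c *: u n) (c *: l).
Proof.
move=> ul e e0; have c0 := cabs_ge0 c.
have e1 : 0 < e / (cabs c + 1) by rewrite divr_gt0 //; lra.
have [N hN] := ul _ e1; exists N => n /hN.
rewrite -scalerBr cnormZ ltr_pdivlMr; last lra.
have := cnorm_ge0 (u n - l); nra.
Qed.

Lemma ccvg_star u l : ccvg u l -> ccvg (fun n => star (u n)) (star l).
Proof.
by move=> ul e /ul[N hN]; exists N => n /hN; rewrite -starB cnorm_star.
Qed.

Lemma ccvg_unique u l m : ccvg u l -> ccvg u m -> l = m.
Proof.
move=> ul um; apply: eq_cnorm_eps => e e0.
have e2 : 0 < e / 2 by rewrite divr_gt0.
have [N hN] := ul _ e2; have [M hM] := um _ e2.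
have := hN _ (leq_maxl N M); have := hM _ (leq_maxr N M).
have := cnorm_trans (u (maxn N M)) l m; rewrite (cnormB l (u _)); lra.
Qed.

Lemma ccvgS u l : ccvg u l -> ccvg (fun n => u n.+1) l.
Proof. by move=> ul e /ul[N hN]; exists N => n h; apply: hN; apply: leqW. Qed.

(* [1 - c] is squared by [1 - e] where [e] is the limit of
   [e_(n+1) = (c + e_n ^ 2) / 2], dominated by the scalar iteration from [c = 1]. *)
Lemma cstar_sqrt1B (c : A) : star c = c -> cnorm c <= 1 ->
  exists e, [/\ star e = e, cnorm e <= 1, (1 - e) * (1 - e) = 1 - c
    & forall z, c * z = z * c -> e * z = z * e].
Proof.
move=> sc c1.
pose e := fix e n : A := if n is n'.+1 then (2^-1 : R)%:C%C *: (c + e n' * e n') else 0.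
pose r := fix r n : R := if n is n'.+1 then 2^-1 * (1 + r n' * r n') else 0.
have r01 n : 0 <= r n <= 1.
  by elim: n => [|n /andP[h1 h2]] /=; [rewrite lexx ler01 | nra].
have eS n : e n.+1 = (2^-1 : R)%:C%C *: (c + e n * e n) by [].
have rS n : r n.+1 = 2^-1 * (1 + r n * r n) by [].
have half0 : `|2^-1| = 2^-1 :> R by rewrite ger0_norm // invr_ge0.
have er n : cnorm (e n) <= r n.
  elim: n => [|n h] /=; first by rewrite cnorm0.
  rewrite cnormZr half0; have := ler_cnormM (e n) (e n).
  have := ler_cnormD c (e n * e n); have := cnorm_ge0 (e n); nra.
have der n : cnorm (e n.+1 - e n) <= r n.+1 - r n.
  elim: n => [|n h]; first by rewrite subr0 [r 0%N]/= subr0; exact: (er 1%N).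
  have -> : e n.+2 - e n.+1 = (2^-1 : R)%:C%C *:
       (e n.+1 * (e n.+1 - e n) + (e n.+1 - e n) * e n).
    rewrite (eS n.+1) [X in _ - X]eS -scalerBr; congr (_ *: _).
    by rewrite opprD addrACA subrr add0r mulrBr mulrBl addrA subrK.
  rewrite cnormZr half0.
  have h1 := ler_cnormD (e n.+1 * (e n.+1 - e n)) ((e n.+1 - e n) * e n).
  have h2 := ler_cnormM (e n.+1) (e n.+1 - e n).
  have h3 := ler_cnormM (e n.+1 - e n) (e n).
  have h4 := er n; have h5 := er n.+1.
  have -> : r n.+2 - r n.+1 = 2^-1 * (r n.+1 * (r n.+1 - r n) + (r n.+1 - r n) * r n).
    by rewrite (rS n.+1) [X in _ - X]rS; ring.
  rewrite ler_pM2l ?invr_gt0 //.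
  apply: (le_trans h1); apply: lerD.
    by apply: (le_trans h2); apply: ler_pM => //; exact: cnorm_ge0.
  by apply: (le_trans h3); apply: ler_pM => //; exact: cnorm_ge0.
have derk n k : cnorm (e (k + n)%N - e n) <= r (k + n)%N - r n.
  elim: k => [|k h]; first by rewrite !subrr cnorm0.
  have := cnorm_trans (e (k + n)%N) (e (k + n).+1) (e n).
  have := der (k + n)%N; rewrite addSn; lra.
have rmono n : r n <= r n.+1.
  by have := der n; have := cnorm_ge0 (e n.+1 - e n); lra.
have rc := nondecr_bounded_cauchy rmono (fun n => proj2 (andP (r01 n))).
have [|l ul] := @cstar_complete R A e.
  move=> d d0; have [N hN] := rc _ d0; exists N => m n Nm Nn.
  wlog mn : m n Nm Nn / (n <= m)%N.
    by move=> W; case/orP: (leq_total n m) => h; [exact: W | rewrite cnormB; exact: W].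
  rewrite -(subnK mn); apply: (le_lt_trans (derk _ _)); rewrite (subnK mn).
  by apply: le_lt_trans (hN m n Nm Nn); rewrite ler_norm.
have hl : ccvg e l := ul.
exists l; split.
- apply: ccvg_unique (ccvg_star hl) _.
  have -> // : (fun n => star (e n)) = e.
  apply/funext; elim => [|n h] /=; first exact: star0.
  by rewrite starZr starD starM h sc.
- by apply: ccvg_le hl _ => n; apply: le_trans (er n) _; have /andP[] := r01 n.
- have := ccvg_unique (ccvgS hl)
     (ccvgZ (2^-1 : R)%:C%C (ccvgD (ccvg_cst c) (ccvgM hl hl))).
  move=> h; have {}h : l + l = c + l * l.
    rewrite {1 2}h -scalerDl -rcD.
    by rewrite (_ : 2^-1 + 2^-1 = 1 :> R) ?scale1r //; field.
  have -> : c = l + l - l * l by rewrite h; abel.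
  ncring.
- move=> z cz.
  apply: ccvg_unique (ccvgM hl (ccvg_cst z)) _.
  have -> : (fun n => e n * z) = (fun n => z * e n).
    apply/funext; elim => [|n h] /=; first by rewrite mul0r mulr0.
    by rewrite -scalerAl -scalerAr mulrDl mulrDr cz -mulrA h !mulrA h.
  exact: ccvgM (ccvg_cst z) hl.
Qed.

End CStarBasics.

Section CStarPositivity.
Variables (R : realType) (A : cstarAlgType R).
Implicit Types (x y z h : A) (t : R).

Definition cpos h : Prop :=
  star h = h /\ exists2 t, 0 <= t & cnorm (t%:C%C *: 1 - h) <= t.

Lemma cpos_sa h : cpos h -> star h = h. Proof. by case. Qed.

Lemma cposD x y : cpos x -> cpos y -> cpos (x + y).
Proof.
move=> [sx [t t0 tx]] [sy [r r0 ry]]; split; first by rewrite starD sx sy.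
exists (t + r); first exact: addr_ge0.
by rewrite rcD scalerDl opprD addrACA (le_trans (ler_cnormD _ _)) // lerD.
Qed.

Lemma cposZ t x : 0 <= t -> cpos x -> cpos (t%:C%C *: x).
Proof.
move=> t0 [sx [r r0 rx]]; split; first by rewrite starZr sx.
exists (t * r); first exact: mulr_ge0.
by rewrite rcM -scalerA -scalerBr cnormZr ger0_norm // ler_wpM2l.
Qed.

Lemma cpos0 : cpos 0.
Proof. by split; [rewrite star0 | exists 0 => //; rewrite scale0r subrr cnorm0]. Qed.

Lemma cpos_subr t h : star h = h -> cnorm h <= t -> cpos (t%:C%C *: 1 - h).
Proof.
move=> sh ht; have t0 : 0 <= t := le_trans (cnorm_ge0 _) ht.
by split; [rewrite starB starZr star1 sh | exists t; rewrite // subKr].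
Qed.

Lemma cpos_sqrt h : cpos h -> exists r,
  [/\ cpos r, r * r = h & forall z, h * z = z * h -> r * z = z * r].
Proof.
move=> [sh [t t0 th]].
have [t_eq0|tn0] := eqVneq t 0.
  have h0 : h = 0.
    apply: cnorm0_eq0; move: th; rewrite t_eq0 scale0r sub0r cnormN.
    by move=> th; apply/eqP; rewrite eq_le th cnorm_ge0.
  by exists 0; rewrite h0 mul0r; split=> //; exact: cpos0.
have tp : 0 < t by rewrite lt_neqAle eq_sym tn0.
pose c := (t^-1)%:C%C *: (t%:C%C *: 1 - h).
have cE : c = 1 - (t^-1)%:C%C *: h.
  by rewrite /c scalerBr scalerA -rcM mulVf // scale1r.
have [||e [se e1 ee ce]] := @cstar_sqrt1B R A c.
- by rewrite starZr starB starZr star1 sh.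
- by rewrite cnormZr ger0_norm ?invr_ge0 // ler_pdivrMl // mulr1.
pose s := Num.sqrt t.
have s2 : s * s = t by rewrite -expr2 sqr_sqrtr.
exists (s%:C%C *: (1 - e)); split.
- apply: cposZ; first exact: sqrtr_ge0.
  by have := cpos_subr se e1; rewrite scale1r.
- rewrite -scalerAl -scalerAr scalerA ee cE -rcM s2 subKr scalerA -rcM.
  by rewrite mulfV // scale1r.
- move=> z hz; have : e * z = z * e.
    by apply: ce; rewrite cE mulrBl mulrBr mul1r mulr1 -scalerAl -scalerAr hz.
  by move=> ez; rewrite -scalerAl -scalerAr mulrBl mulrBr mul1r mulr1 ez.
Qed.

Lemma cnorm_saD_sqr x y : star x = x -> star y = y -> x * y = y * x ->
  cnorm x ^+ 2 <= cnorm (x * x + y * y) /\ cnorm y ^+ 2 <= cnorm (x * x + y * y).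
Proof.
move=> sx sy xy; pose z := x + 'i%C *: y.
have sz : star z = x - 'i%C *: y by rewrite starD starZ conj_i sx sy scaleNr.
have zz : star z * z = x * x + y * y.
  rewrite sz /z mulrDr !mulrBl -!scalerAr -!scalerAl xy scalerA.
  have -> : ('i%C * 'i%C : R[i]) = -1 by rewrite -expr2 sqr_i.
  by rewrite scaleN1r; abel.
have hz : cnorm z ^+ 2 = cnorm (x * x + y * y) by rewrite -cnorm_starM zz.
have half (w : A) : cnorm (w + w) = 2 * cnorm w.
  by rewrite double_rc cnormZr ger0_norm.
have h1 : cnorm x <= cnorm z.
  have : x + x = z + star z by rewrite sz /z; abel.
  move=> /(congr1 (@cnorm R A)); rewrite half => h.
  by have := ler_cnormD z (star z); rewrite -h cnorm_star; lra.
have h2 : cnorm y <= cnorm z.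
  have : 'i%C *: y + 'i%C *: y = z - star z by rewrite sz /z; abel.
  move=> /(congr1 (@cnorm R A)); rewrite half cnormZ cabs_i mul1r => h.
  by have := ler_cnormD z (- star z); rewrite -h cnormN cnorm_star; lra.
by rewrite -hz; split; apply: lerXn2r; rewrite ?nnegrE ?cnorm_ge0.
Qed.

Lemma cpos_sqr x : star x = x -> cpos (x * x).
Proof.
move=> sx; have [x0|x0] := eqVneq (cnorm x) 0.
  by rewrite (cnorm0_eq0 _ x0) mul0r; exact: cpos0.
have xp : 0 < cnorm x by rewrite lt_neqAle eq_sym x0 cnorm_ge0.
pose y := ((cnorm x)^-1)%:C%C *: x.
have sy : star y = y by rewrite starZr sx.
have y1 : cnorm (y * y) <= 1.
  by rewrite cnorm_sa_sqr // /y cnormZr ger0_norm ?invr_ge0 ?cnorm_ge0 // mulVf // expr1n.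
have syy : star (y * y) = y * y by rewrite starM sy.
have [e [se _ ee ce]] := cstar_sqrt1B syy y1.
have sd : star (1 - e) = 1 - e by rewrite starB star1 se.
have dy : y * (1 - e) = (1 - e) * y.
  by rewrite mulrBl mulrBr mul1r mulr1 ce // mulrA.
have [_] := cnorm_saD_sqr sy sd dy.
rewrite ee (_ : y * y + _ = 1) ?cnorm1; last by abel.
rewrite -(cnorm_sa_sqr sd) ee => h.
have : cpos (y * y) by split=> //; exists 1; rewrite ?scale1r.
move=> /(cposZ (sqr_ge0 (cnorm x))).
rewrite /y -scalerAl -scalerAr !scalerA -!rcM expr2 mulfK // mulfV //.
by rewrite scale1r.
Qed.

Lemma cpos_le_norm x t : cpos x -> cpos (t%:C%C *: 1 - x) -> cnorm x <= `|t|.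
Proof.
move=> px pt; have [p [pp ppx cp]] := cpos_sqrt px; have [q [pq qqx cq]] := cpos_sqrt pt.
have sp := cpos_sa pp; have sq := cpos_sa pq.
have xp : x * p = p * x by rewrite -ppx mulrA.
have pq' : p * q = q * p.
  apply/esym/cq; rewrite mulrBl mulrBr xp -scalerAl -scalerAr.
  by rewrite mul1r mulr1.
have [+ _] := cnorm_saD_sqr sp sq pq'.
by rewrite ppx qqx addrC subrK -(cnorm_sa_sqr sp) ppx cnormZr cnorm1 mulr1.
Qed.

Lemma cpos_antisym x : cpos x -> cpos (- x) -> x = 0.
Proof.
move=> px pN; apply: cnorm0_eq0; apply/eqP; rewrite eq_le cnorm_ge0 andbT.
by rewrite -(normr0 R) cpos_le_norm // scale0r sub0r.
Qed.

Lemma cpos_norm_mono x y : cpos x -> cpos (y - x) -> cnorm x <= cnorm y.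
Proof.
move=> px pyx; rewrite -(ger0_norm (cnorm_ge0 y)); apply: cpos_le_norm => //.
have py : star y = y.
  by rewrite -(subrK x y) starD (cpos_sa px) (cpos_sa pyx).
rewrite (_ : _ - x = ((cnorm y)%:C%C *: 1 - y) + (y - x)); last by abel.
by apply: cposD => //; exact: cpos_subr.
Qed.

Lemma cpos_conj_sa p d : cpos p -> star d = d -> p * d = d * p -> cpos (d * p * d).
Proof.
move=> pp sd pd; have [r [pr rr cr]] := cpos_sqrt pp.
have rd : r * d = d * r by exact: cr.
have := @cpos_sqr (d * r); rewrite starM sd (cpos_sa pr) rd => /(_ erefl).
by rewrite -{2}rd -[d * r * _]mulrA [r * (r * d)]mulrA rr mulrA.
Qed.

Lemma cpos_mul p q : cpos p -> cpos q -> p * q = q * p -> cpos (p * q).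
Proof.
move=> pp pq pqc; have [r [pr rr cr]] := cpos_sqrt pp.
have rq : r * q = q * r by exact: cr.
have := cpos_conj_sa pq (cpos_sa pr) (esym rq).
by rewrite rq -mulrA rr pqc.
Qed.

Lemma cpos_sqrt_uniq p q : cpos p -> cpos q -> p * q = q * p ->
  p * p = q * q -> p = q.
Proof.
move=> pp pq pqc e; pose d := p - q.
have sd : star d = d by rewrite starB (cpos_sa pp) (cpos_sa pq).
have pd : p * d = d * p by rewrite mulrBl mulrBr pqc.
have qd : q * d = d * q by rewrite mulrBl mulrBr pqc.
have P1 := cpos_conj_sa pp sd pd; have P2 := cpos_conj_sa pq sd qd.
have e2 : p * d + q * d = 0.
  rewrite /d !mulrBr e pqc; abel.
have s0 : d * p * d + d * q * d = 0 by rewrite -!mulrA -mulrDr e2 mulr0.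
have z1 : d * p * d = 0.
  by apply: cpos_antisym P1 _; rewrite -(_ : d * q * d = - _) //; apply/eqP; rewrite -addr_eq0 addrC s0.
have z2 : d * q * d = 0 by rewrite z1 add0r in s0.
have d3 : d * d * d = 0.
  have -> : d * d * d = d * p * d - d * q * d by rewrite -mulrBl -mulrBr.
  by rewrite z1 z2 subrr.
have d0 : d = 0.
  apply: sa_sqr_eq0 => //; apply: sa_sqr_eq0; first by rewrite starM sd.
  by rewrite mulrA d3 mul0r.
by apply/eqP; rewrite -subr_eq0 -/d d0.
Qed.

(* With [h = - c* c] and [g = c c*]: the identity
   [c* (1 - g)^k c = - h (1 + h)^k] bounds the right-hand side, whereas
   [h (1 + h)^k >= k h^2]. *)
Lemma star_mul_neg_eq0 c : cpos (- (star c * c)) -> c = 0.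
Proof.
wlog c1 : c / cnorm c <= 1.
  move=> W ph; pose t := cnorm c + 1.
  have tp : 0 < t by have := cnorm_ge0 c; rewrite /t; lra.
  have : (t^-1)%:C%C *: c = 0.
    apply: W.
      rewrite cnormZr (ger0_norm (ltW _)) ?invr_gt0 // ler_pdivrMl // mulr1 /t; lra.
    have -> : - (star (t^-1%:C%C *: c) * (t^-1%:C%C *: c)) =
       ((t^-1 * t^-1)%:C)%C *: - (star c * c).
      by rewrite starZr -scalerAl -scalerAr scalerA -rcM scalerN.
    by apply: cposZ => //; rewrite mulr_ge0 // invr_ge0 ltW.
  move=> /eqP; rewrite scaler_eq0 => /orP[/eqP h|/eqP //].
  by have := congr1 (@complex.Re R) h; rewrite /= => /eqP; rewrite invr_eq0 gt_eqF.
move=> ph; pose h := - (star c * c); pose g := c * star c.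
have pg : cpos g.
  pose x := c + star c; pose y := 'i%C *: (c - star c).
  have sx : star x = x by rewrite starD starK addrC.
  have sy : star y = y by rewrite starZ conj_i starB starK scaleNr -scalerN opprB.
  have gE : g + g = x * x + y * y + (h + h).
    have -> : y * y = - ((c - star c) * (c - star c)).
      rewrite -scalerAl -scalerAr scalerA -expr2 sqr_i scaleN1r //.
    rewrite /g /h /x; ncring.
  have : cpos (g + g).
    by rewrite gE; apply: cposD; [apply: cposD; exact: cpos_sqr | exact: cposD].
  move=> /(@cposZ 2^-1 _ (ltac:(by rewrite invr_ge0))).
  by rewrite double_rc scalerA -rcM mulVf ?scale1r.
have g1 : cnorm g <= 1.
  rewrite (le_trans (ler_cnormM _ _)) // cnorm_star -expr2.
  by rewrite expr_le1 // cnorm_ge0.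
have bg : cnorm (1 - g) <= 1.
  rewrite -(normr1 R); apply: cpos_le_norm.
    by have := cpos_subr (cpos_sa pg) g1; rewrite scale1r.
  by rewrite scale1r subKr.
have bgk k : cnorm ((1 - g) ^+ k) <= 1.
  elim: k => [|k IH]; first by rewrite expr0 cnorm1.
  rewrite exprS (le_trans (ler_cnormM _ _)) //.
  by rewrite mulr_ile1 // cnorm_ge0.
have idk k : (1 - g) ^+ k * c = c * (1 + h) ^+ k.
  elim: k => [|k IH]; first by rewrite !expr0 mul1r mulr1.
  rewrite exprS -mulrA IH exprS !mulrA; congr (_ * _).
  by rewrite /g /h; ncring.
have bk k : cnorm (h * (1 + h) ^+ k) <= 1.
  have -> : h * (1 + h) ^+ k = - (star c * ((1 - g) ^+ k * c)).
    by rewrite idk mulrA /h mulNr.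
  rewrite cnormN (le_trans (ler_cnormM _ _)) // cnorm_star mulr_ile1 ?cnorm_ge0 //.
  by rewrite (le_trans (ler_cnormM _ _)) // mulr_ile1 ?cnorm_ge0.
have p1 : cpos 1 by split; [exact: star1 | exists 1 => //; rewrite scale1r subrr cnorm0].
have commh k : GRing.comm h ((1 + h) ^+ k).
  by apply: commrX; apply: commrD => //; exact: commr1.
have pQ k : cpos ((1 + h) ^+ k - 1 - h *+ k).
  elim: k => [|k IH]; first by rewrite expr0 subrr mulr0n subr0; exact: cpos0.
  have -> : (1 + h) ^+ k.+1 - 1 - h *+ k.+1 =
     (1 + h) * ((1 + h) ^+ k - 1 - h *+ k) + (h * h) *+ k.
    rewrite exprS mulrSr !mulrBr !mulrDl !mul1r !mulr1 mulrnAr; abel.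
  apply: cposD.
    apply: cpos_mul => //; first exact: cposD.
    have ch : GRing.comm h ((1 + h) ^+ k - 1 - h *+ k).
      by apply: commrB; [apply: commrB => //; exact: commr1 | exact: commrMn].
    by apply/commr_sym/commrD; [exact: commr1 | exact/commr_sym].
  by elim: (k) => [|m IHm]; [exact: cpos0 | rewrite mulrS; apply: cposD => //; exact: cpos_sqr (cpos_sa ph)].
have pk k : cpos (h * (1 + h) ^+ k - (h * h) *+ k).
  have -> : h * (1 + h) ^+ k - (h * h) *+ k = h * ((1 + h) ^+ k - 1 - h *+ k) + h.
    by rewrite !mulrBr mulr1 mulrnAr; abel.
  apply: cposD => //; apply: cpos_mul => //.
  by apply: commrB; [apply: commrB => //; exact: commr1 | exact: commrMn].
have kh k : k%:R * cnorm (h * h) <= 1.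
  have -> : k%:R * cnorm (h * h) = cnorm ((h * h) *+ k).
    by rewrite mulrn_rc cnormZr ger0_norm.
  apply: le_trans (bk k); apply: cpos_norm_mono (pk k).
  elim: (k) => [|m IHm]; first exact: cpos0.
  by rewrite mulrS; apply: cposD => //; exact: cpos_sqr (cpos_sa ph).
have h0 : h = 0.
  apply: sa_sqr_eq0; first exact: cpos_sa.
  apply: cnorm0_eq0; apply/eqP/negPn/negP => n0.
  have np : 0 < cnorm (h * h) by rewrite lt_neqAle eq_sym n0 cnorm_ge0.
  have [k hk] : exists k : nat, (cnorm (h * h))^-1 < k%:R.
    by exists (Num.bound (cnorm (h * h))^-1); rewrite archi_boundP // invr_ge0 ltW.
  by have := kh k; rewrite leNgt -ltr_pdivrMr // div1r hk.
by apply: star_mul_eq0; apply/eqP; rewrite -oppr_eq0 -/h h0.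
Qed.

(* Kaplansky: if [n] is the negative part of [a = b* b], then [c = b n]
   satisfies [c* c = - n ^ 3 <= 0], hence [c = 0]. *)
Lemma cpos_starM b : cpos (star b * b).
Proof.
pose a := star b * b.
have sa : star a = a by rewrite starM starK.
have [r [pr rr cr]] := cpos_sqrt (cpos_sqr sa).
have sr := cpos_sa pr.
have ar : a * r = r * a by apply/esym/cr; rewrite mulrA.
pose n := r - a; pose m := r + a.
have sn : star n = n by rewrite starB sr sa.
have sm : star m = m by rewrite starD sr sa.
have an : a * n = n * a by rewrite mulrBl mulrBr ar.
have am : a * m = m * a by rewrite mulrDl mulrDr ar.
have rn : r * n = n * r by rewrite mulrBl mulrBr ar.
have rm : r * m = m * r by rewrite mulrDl mulrDr ar.
have nm : n * m = 0.
  rewrite /n /m mulrBl !mulrDr rr ar; abel.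
have mn : m * n = 0 by rewrite mulrBr -rm -am -mulrBl.
have nmE : n + m = r + r by rewrite /n /m; abel.
have aaE : a + a = m - n by rewrite /n /m; abel.
have n0a : n = 0 -> star b * b = r.
  by move=> n0; apply/esym/eqP; rewrite -subr_eq0 -/a -/n n0.
clearbody n m.
have [N [pN NN cN]] := cpos_sqrt (cpos_sqr sn).
have [M [pM MM cM]] := cpos_sqrt (cpos_sqr sm).
have Nn : N * n = n * N by apply: cN; rewrite mulrA.
have mN : M * n = n * M.
  by apply: cM; rewrite -mulrA mn mulr0 mulrA nm mul0r.
have Nm : N * m = m * N.
  by apply: cN; rewrite -mulrA nm mulr0 mulrA mn mul0r.
have MN : M * N = N * M.
  by apply: cM; rewrite -mulrA -Nm mulrA -Nm mulrA.
have sNM : star (N * M) = N * M by rewrite starM (cpos_sa pN) (cpos_sa pM) MN.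
have nM0 : n * M = 0.
  apply: sa_sqr_eq0; first by rewrite starM sn (cpos_sa pM) mN.
  by rewrite -{2}mN mulrA -[n * M * M]mulrA MM !mulrA nm !mul0r.
have NM0 : N * M = 0.
  apply: sa_sqr_eq0 => //.
  by rewrite mulrA -(mulrA N M N) MN !mulrA NN -(mulrA n n M) nM0 mulr0 mul0r.
have hS : N + M = n + m.
  apply: cpos_sqrt_uniq.
  - exact: cposD.
  - by rewrite nmE; exact: cposD.
  - by rewrite !mulrDl !mulrDr Nn Nm mN (cM m) ?mulrA //; abel.
  - rewrite !mulrDl !mulrDr MN NM0 nm mn NN MM; abel.
have nN : n * N = n * n.
  by have := congr1 (fun z => n * z) hS; rewrite !mulrDr nm nM0 !addr0.
have nE : n = N.
  apply/eqP; rewrite -subr_eq0; apply/eqP; apply: sa_sqr_eq0.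
    by rewrite starB sn (cpos_sa pN).
  by rewrite !mulrDl !mulrDr !mulNr !mulrN Nn nN NN; abel.
have pn : cpos n by rewrite nE.
have pnnn := cpos_conj_sa pn sn erefl.
have cc : star (b * n) * (b * n) = n * a * n by rewrite starM sn !mulrA.
have n2 : n * a * n + n * a * n = - (n * n * n).
  rewrite -mulrDl -mulrDr aaE.
  by rewrite mulrBr nm sub0r mulNr.
have bn0 : b * n = 0.
  apply: star_mul_neg_eq0.
  have -> : - (star (b * n) * (b * n)) = (2^-1 : R)%:C%C *: (n * n * n).
    rewrite cc; apply/eqP; rewrite eqr_oppLR -scalerN -n2.
    by rewrite double_rc scalerA -rcM mulVf // scale1r.
  by apply: cposZ => //; rewrite invr_ge0.
have n3 : n * n * n = 0.
  by apply/eqP; rewrite -oppr_eq0 -n2 -cc bn0 mulr0 addr0.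
have n0 : n = 0.
  apply: sa_sqr_eq0 => //; apply: sa_sqr_eq0; first by rewrite starM sn.
  by rewrite mulrA n3 mul0r.
by rewrite n0a.
Qed.

End CStarPositivity.

Section SublinearFunctionals.
Variables (R : realType) (V : lmodType R[i]).

Record sublinear (q : V -> R) : Prop := Sublinear {
  sublinD : forall x y, q (x + y) <= q x + q y ;
  sublinZ : forall (t : R) x, 0 < t -> q (t%:C%C *: x) = t * q x
}.

Lemma sublin0 q : sublinear q -> q 0 = 0.
Proof. by move=> sq; have := sublinZ sq 0 (ltr0n R 2); rewrite scaler0; lra. Qed.

Lemma sublin_opp q x : sublinear q -> - q (- x) <= q x.
Proof. by move=> sq; have := sublinD sq x (- x); rewrite subrr sublin0 //; lra. Qed.

Lemma sublinear_inf (I : Type) (i0 : I) (F : I -> V -> R) (L : V -> R) :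
  (forall i x, L x <= F i x) ->
  (forall i j x y, exists k, F k (x + y) <= F i x + F j y) ->
  (forall i (t : R) x, 0 < t -> exists k, F k (t%:C%C *: x) <= t * F i x) ->
  let q := fun x => inf (range (F ^~ x)) in
  sublinear q /\ forall i x, q x <= F i x.
Proof.
move=> FL FD FZ q.
have hinf x : has_inf (range (F ^~ x)).
  by split; [exists (F i0 x); exists i0 | exists (L x) => _ [i _ <-]].
have qF i x : q x <= F i x by apply: ge_inf; [case: (hinf x) | exists i].
have adh x (e : R) : 0 < e -> exists i, F i x < q x + e.
  by move=> e0; have [_ [i _ <-] h] := inf_adherent e0 (hinf x); exists i.
have qZ (t : R) x : 0 < t -> q (t%:C%C *: x) <= t * q x.
  move=> t0; apply/ler_addgt0Pl => e e0.
  have [i hi] := adh x (e / t) (divr_gt0 e0 t0).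
  have [k hk] := FZ i _ x t0; apply: le_trans (qF k _) _; apply: le_trans hk _.
  by rewrite -[e](divfK (lt0r_neq0 t0)) (mulrC _ t) -mulrDr ler_pM2l // addrC ltW.
split=> //; split.
  move=> x y; apply/ler_addgt0Pl => e e0.
  have e2 : 0 < e / 2 by rewrite divr_gt0.
  have [i hi] := adh x _ e2; have [j hj] := adh y _ e2; have [k hk] := FD i j x y.
  have := qF k (x + y); lra.
move=> t x t0; apply/eqP; rewrite eq_le qZ //=.
have ti : 0 < t^-1 by rewrite invr_gt0.
have := qZ _ (t%:C%C *: x) ti; rewrite scalerA -rcM mulVf ?gt_eqF // scale1r.
by rewrite ler_pdivlMl.
Qed.

Lemma sublinear_shift q y : sublinear q ->
  exists q', [/\ sublinear q', forall x, q' x <= q x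
    & forall x, q' x <= q (x + y) - q y].
Proof.
move=> sq.
pose F (t : {t : R | 0 <= t}) x := q (x + (sval t)%:C%C *: y) - sval t * q y.
have qZ (t : R) x : 0 <= t -> q (t%:C%C *: x) = t * q x.
  rewrite le_eqVlt => /orP[/eqP <-|t0]; last exact: sublinZ.
  by rewrite scale0r sublin0 // mul0r.
have [|||sq' q'F] := @sublinear_inf _ (exist _ 0 (lexx 0)) F (fun x => - q (- x)).
- move=> [t t0] x; rewrite /F /= -qZ //.
  have := sublinD sq (x + t%:C%C *: y) (- x).
  by rewrite (_ : x + _ - x = t%:C%C *: y); [lra | abel].
- move=> [t t0] [r r0] x z; exists (exist _ (t + r) (addr_ge0 t0 r0)).
  rewrite /F /= rcD scalerDl addrACA.
  have := sublinD sq (x + t%:C%C *: y) (z + r%:C%C *: y); lra.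
- move=> [t t0] r x r0; exists (exist _ (r * t) (mulr_ge0 (ltW r0) t0)).
  by rewrite /F /= rcM -scalerA -scalerDr sublinZ // mulrBr mulrA.
exists (fun x => inf (range (F ^~ x))); split=> // x.
  by have := q'F (exist _ 0 (lexx 0)) x; rewrite /F /= scale0r addr0 mul0r subr0.
by have := q'F (exist _ 1 ler01) x; rewrite /F /= scale1r mul1r.
Qed.

(* A minimal sublinear functional is additive by [sublinear_shift]. *)
Lemma sublinear_ge_linear (p : V -> R) (h : V) : sublinear p ->
  exists f : V -> R, [/\ forall x y, f (x + y) = f x + f y,
    forall (t : R) x, f (t%:C%C *: x) = t * f x, forall x, f x <= p x & f h = p h].
Proof.
move=> sp; have [p1 [sp1 p1p p1h]] := sublinear_shift h sp.
pose T := {q : V -> R | sublinear q /\ forall x, q x <= p1 x}.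
pose rel (q1 q2 : T) := `[< forall x, sval q2 x <= sval q1 x >].
have [||||f fmin] := @Zorn T rel.
- by move=> q; apply/asboolP.
- move=> q1 q2 q3 /asboolP h12 /asboolP h23; apply/asboolP => x.
  exact: le_trans (h23 x) (h12 x).
- move=> [q1 H1] [q2 H2] /asboolP /= h12 /asboolP /= h21.
  have e : q1 = q2 by apply/funext => x; apply/eqP; rewrite eq_le h12 h21.
  by case: _ / e H2 {h12 h21} => H2; rewrite (Prop_irrelevance H1 H2).
- move=> C Ctot.
  have [[c0 Cc0]|C0] := pselect (exists q, C q); last first.
    by exists (exist _ p1 (conj sp1 (fun x => lexx _))) => s Cs; case: C0; exists s.
  pose I := {q : T | C q}.
  pose F (i : I) x := sval (sval i) x.
  have [|||sq qF] := @sublinear_inf I (exist _ c0 Cc0) F (fun x => - p1 (- x)).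
  + move=> [[q [sq qp]] Cq] x; rewrite /F /=.
    by apply: le_trans (sublin_opp x sq); rewrite lerN2.
  + move=> [q1 C1] [q2 C2] x y; rewrite /F /=.
    case: (Ctot _ _ C1 C2) => /asboolP h12.
      exists (exist _ q2 C2); case: q1 q2 C1 C2 h12 => q1 [s1 l1] [q2 [s2 l2]] C1 C2 h12 /=.
      by apply: le_trans (sublinD s2 x y) _; rewrite lerD2r; exact: h12.
    exists (exist _ q1 C1); case: q1 q2 C1 C2 h12 => q1 [s1 l1] [q2 [s2 l2]] C1 C2 h12 /=.
    by apply: le_trans (sublinD s1 x y) _; rewrite lerD2l; exact: h12.
  + by move=> [[q [sq qp]] Cq] t x t0; exists (exist _ (exist _ q (conj sq qp)) Cq); rewrite /F /= sublinZ.
  have qp x : inf (range (F ^~ x)) <= p1 x.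
    by apply: le_trans (qF (exist _ c0 Cc0) x) _; rewrite /F /=; case: (c0) => q [].
  pose t0 : T := exist _ (fun x => inf (range (F ^~ x))) (conj sq qp).
  exists t0 => s Cs; apply/asboolP => x; exact: (qF (exist _ s Cs) x).
case: f fmin => f [sf fp] fmin.
have fD x y : f (x + y) = f x + f y.
  apply/eqP; rewrite eq_le sublinD //=.
  have [f' [sf' f'f f'y]] := sublinear_shift y sf.
  have f'p z : f' z <= p1 z by apply: le_trans (f'f z) (fp z).
  have /(congr1 sval) /= e := fmin (exist _ f' (conj sf' f'p)) (asboolT f'f).
  by have := f'y x; rewrite e lerBrDr.
have f0 : f 0 = 0 := sublin0 sf.
have fN x : f (- x) = - f x.
  by have := fD x (- x); rewrite subrr f0; lra.
exists f; split=> //.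
- move=> t x; have [t0|t0|->] := ltgtP t 0.
  + rewrite -[t]opprK rcN scaleNr fN sublinZ ?oppr_gt0 //; ring.
  + exact: sublinZ.
  + by rewrite scale0r f0 mul0r.
- by move=> x; exact: le_trans (fp x) (p1p x).
- apply/eqP; rewrite eq_le (le_trans (fp h) (p1p h)) /=.
  have := le_trans (fp (- h)) (p1h (- h)).
  by rewrite fN addNr sublin0 // sub0r lerN2.
Qed.

End SublinearFunctionals.

Section States.
Variables (R : realType) (A : cstarAlgType R).

Section StateBounds.
Variables (chi : A -> R[i]) (hchi : is_state chi).
Implicit Types (a b x y : A).

Lemma state_lin (c : R[i]) x y : chi (c *: x + y) = c * chi x + chi y.
Proof. by case: hchi. Qed.

Lemma stateD x y : chi (x + y) = chi x + chi y.
Proof. by rewrite -[x in LHS]scale1r state_lin mul1r. Qed.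

Lemma state0 : chi 0 = 0.
Proof. by apply: (addrI (chi 0)); rewrite -stateD !addr0. Qed.

Lemma stateZ (c : R[i]) x : chi (c *: x) = c * chi x.
Proof. by rewrite -[c *: x]addr0 state_lin state0 addr0. Qed.

Lemma stateN x : chi (- x) = - chi x.
Proof. by rewrite -scaleN1r stateZ mulN1r. Qed.

Lemma stateB x y : chi (x - y) = chi x - chi y.
Proof. by rewrite stateD stateN. Qed.

Lemma state_sum (I : Type) (r : seq I) (P : pred I) (F : I -> A) :
  chi (\sum_(i <- r | P i) F i) = \sum_(i <- r | P i) chi (F i).
Proof. by elim/big_rec2: _ => [|i a b _ <-]; rewrite ?state0 ?stateD. Qed.

Lemma state1 : chi 1 = 1. Proof. by case: hchi. Qed.

Lemma state_ge0 x : 0 <= chi (star x * x).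
Proof. by case: hchi => _ h _; exact: h. Qed.

Definition sform x y := chi (star y * x).

Lemma sformP : psd_form sform.
Proof.
have sD x y z : sform (x + y) z = sform x z + sform y z.
  by rewrite /sform mulrDr stateD.
have sDr x y z : sform z (x + y) = sform z x + sform z y.
  by rewrite /sform starD mulrDl stateD.
have sZ (c : R[i]) x z : sform (c *: x) z = c * sform x z.
  by rewrite /sform -scalerAr stateZ.
have sZr (c : R[i]) x z : sform z (c *: x) = Num.conj c * sform z x.
  by rewrite /sform starZ -scalerAl stateZ.
have sIm x : complex.Im (sform x x) = 0.
  by have := state_ge0 x; rewrite lecE => /andP[/eqP -> _].
split=> // [x y|]; last exact: state_ge0.
have h1 := sIm (x + y); have h2 := sIm (x + 'i%C *: y).
move: h1 h2; rewrite !sD !sDr !sZ !sZr conj_i !ImD (sIm x) (sIm y).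
have -> : complex.Im ('i%C * (- 'i%C * sform y y)) = 0.
  by rewrite mulrA mulrN -expr2 sqr_i opprK mul1r sIm.
case: (sform x y) (sform y x) => [a b] [c d] /=.
move=> h1 h2; apply/eqP; rewrite eq_complex /=; apply/andP; split; apply/eqP; lra.
Qed.

Lemma state_conj a : chi (star a) = Num.conj (chi a).
Proof. by have := psdC sformP a 1; rewrite /sform star1 mul1r mulr1. Qed.

Lemma state_snormM a b : snorm sform (a * b) <= cnorm a * snorm sform b.
Proof.
rewrite -(ler_pXn2r (ltn0Sn 1)) ?nnegrE ?mulr_ge0 ?snorm_ge0 ?cnorm_ge0 //.
rewrite exprMn !(snorm_sqr sformP).
have h : cnorm (star a * a) <= cnorm a ^+ 2 by rewrite cnorm_starM.
have sa : star (star a * a) = star a * a by rewrite starM starK.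
have [r [pr rr _]] := cpos_sqrt (cpos_subr sa h).
have := Re_ge0 (state_ge0 (r * b)).
rewrite starM (cpos_sa pr) -mulrA [r * (r * b)]mulrA rr mulrBl -scalerAl mul1r.
rewrite mulrBr -scalerAr stateB stateZ ReB Re_rcM.
by rewrite /sqn /sform starM -!mulrA subr_ge0.
Qed.

Lemma state_snorm1 : snorm sform 1 = 1.
Proof. by rewrite /snorm /sqn /sform star1 mulr1 state1 sqrtr1. Qed.

Lemma state_snorm_le a : snorm sform a <= cnorm a.
Proof. by have := state_snormM a 1; rewrite mulr1 state_snorm1 mulr1. Qed.

Lemma state_cabs_le a : cabs (chi a) <= cnorm a.
Proof.
have := psd_CS sformP a 1; rewrite state_snorm1 mulr1 /sform star1 mul1r => h.
exact: le_trans h (state_snorm_le a).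
Qed.

End StateBounds.

Lemma state_separates (a : A) : exists2 chi : A -> R[i], is_state chi &
  chi (star a * a) = (cnorm a ^+ 2)%:C%C.
Proof.
pose re (x : A) := (2^-1 : R)%:C%C *: (x + star x).
have reD x y : re (x + y) = re x + re y.
  by rewrite /re starD -scalerDr; congr (_ *: _); abel.
have reZ (t : R) x : re (t%:C%C *: x) = t%:C%C *: re x.
  by rewrite /re starZr -scalerDr !scalerA mulrC.
have re_sa x : star x = x -> re x = x.
  by move=> sx; rewrite /re sx double_rc scalerA -rcM mulVf // scale1r.
pose F (k : {k : A | cpos k}) x := cnorm (re x + sval k).
have [|||sp pF] := @sublinear_inf R A _ (exist _ 0 (@cpos0 R A)) F (fun=> 0).
- by move=> k x; exact: cnorm_ge0.
- move=> [k pk] [l pl] x y; exists (exist _ (k + l) (cposD pk pl)).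
  by rewrite /F /= reD addrACA ler_cnormD.
- move=> [k pk] t x t0; exists (exist _ (t%:C%C *: k) (cposZ (ltW t0) pk)).
  by rewrite /F /= reZ -scalerDr cnormZr ger0_norm // ltW.
set p := (fun x => inf _) in sp pF.
have p_ge0 x : 0 <= p x.
  apply: lb_le_inf; first by exists (F (exist _ 0 (@cpos0 R A)) x); exists (exist _ 0 (@cpos0 R A)).
  by move=> _ [k _ <-]; exact: cnorm_ge0.
pose b := if a == 0 then 1 else a.
have b0 : b != 0.
  rewrite /b; case: ifP => [_|/negbT //].
  by apply/eqP => /(@cstar_oner_neq0 R A).
pose h := star b * b; have ph : cpos h := cpos_starM b.
have nh : 0 < cnorm h.
  rewrite cnorm_starM exprn_gt0 // lt_neqAle cnorm_ge0 andbT eq_sym.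
  by apply: contraNneq b0 => /cnorm0_eq0->.
have p_pos x : cpos x -> p x = cnorm x.
  move=> px; apply/eqP; rewrite eq_le; apply/andP; split.
    by apply: le_trans (pF (exist _ 0 (@cpos0 R A)) x) _; rewrite /F /= re_sa ?addr0 ?(cpos_sa px).
  apply: lb_le_inf; first by exists (F (exist _ 0 (@cpos0 R A)) x); exists (exist _ 0 (@cpos0 R A)).
  move=> _ [[k pk] _ <-]; rewrite /F /= re_sa ?(cpos_sa px) //.
  by apply: cpos_norm_mono => //; rewrite addrC addKr.
have p_neg x : cpos x -> p (- x) <= 0.
  move=> px; apply: le_trans (pF (exist _ x px) (- x)) _.
  by rewrite /F /= re_sa ?addNr ?cnorm0 // starN (cpos_sa px).
have p_skew x : star x = - x -> p x <= 0.
  move=> sx; apply: le_trans (pF (exist _ 0 (@cpos0 R A)) x) _.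
  by rewrite /F /= /re sx subrr scaler0 addr0 cnorm0.
have [f [fD fZ fp fh]] := sublinear_ge_linear h sp.
have f0 : f 0 = 0 by rewrite -(scale0r 0) fZ mul0r.
have fN x : f (- x) = - f x by apply: (addrI (f x)); rewrite -fD !subrr f0.
have f_skew x : star x = - x -> f x = 0.
  move=> sx; have h1 := le_trans (fp x) (p_skew x sx).
  have := le_trans (fp (- x)) (p_skew _ _); rewrite starN sx => /(_ erefl).
  by rewrite fN; lra.
have f_pos x : cpos x -> 0 <= f x.
  by move=> px; have := le_trans (fp (- x)) (p_neg x px); rewrite fN; lra.
pose chi x : R[i] := Complex (f x) (- f ('i%C *: x)).
have chi_sa x : star x = x -> chi x = (f x)%:C%C.
  move=> sx; rewrite /chi (f_skew ('i%C *: x)) ?oppr0 //.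
  by rewrite starZ conj_i sx scaleNr.
have chi_pos x : 0 <= chi (star x * x).
  by rewrite chi_sa ?starM ?starK // ler0c; apply: f_pos; exact: cpos_starM.
have chi_lin (c : R[i]) x y : chi (c *: x + y) = c * chi x + chi y.
  case: c => u v.
  have cE z : (Complex u v) *: z = u%:C%C *: z + v%:C%C *: ('i%C *: z) :> A.
    rewrite scalerA -scalerDl; congr (_ *: _).
    by apply/eqP; rewrite eq_complex /=; apply/andP; split; apply/eqP; ring.
  have iiE z : 'i%C *: ('i%C *: z) = - z :> A.
    by rewrite scalerA -expr2 sqr_i scaleN1r.
  have icE z : 'i%C *: ((Complex u v) *: z) = u%:C%C *: ('i%C *: z) + v%:C%C *: (- z) :> A.
    rewrite cE scalerDr; congr (_ + _); first by rewrite !scalerA mulrC.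
    by rewrite scalerA mulrC -scalerA iiE.
  rewrite /chi scalerDr icE cE !fD !fZ fN.
  by apply/eqP; rewrite eq_complex /=; apply/andP; split; apply/eqP; ring.
have p1 : cpos (1 : A).
  by have := @cpos_starM R A 1; rewrite star1 mulr1.
have f1 : f 1 = 1.
  apply/eqP; rewrite eq_le; apply/andP; split.
    by apply: le_trans (fp 1) _; rewrite p_pos // cnorm1.
  have := f_pos _ (cpos_subr (cpos_sa ph) (lexx (cnorm h))).
  rewrite fD fZ fN fh p_pos // subr_ge0 -[X in X <= _]mulr1.
  by rewrite ler_pM2l.
exists chi; first by split=> //; rewrite chi_sa ?f1 // star1.
rewrite chi_sa ?starM ?starK //; congr (_%:C)%C.
have [a0|a0] := eqVneq a 0; first by rewrite a0 mulr0 f0 cnorm0 expr0n.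
have bE : b = a by rewrite /b (negbTE a0).
by rewrite -bE -/h fh p_pos // cnorm_starM.
Qed.

End States.

(** * Hilbert completion and the GNS construction *)

Section ComplexLimits.
Variable R : realType.
Implicit Types (z w : nat -> R[i]) (l c : R[i]).

Definition clim z l : Prop :=
  forall e : R, 0 < e -> exists N, forall n, (N <= n)%N -> cabs (z n - l) < e.

Lemma clim_cst l : clim (fun=> l) l.
Proof. by move=> e e0; exists 0%N => n _; rewrite subrr cabs0. Qed.

Lemma climD z w l (m : R[i]) : clim z l -> clim w m -> clim (fun n => z n + w n) (l + m).
Proof.
move=> hz hw e e0; have e2 : 0 < e / 2 by rewrite divr_gt0.
have [N hN] := hz _ e2; have [M hM] := hw _ e2.
exists (maxn N M) => n; rewrite geq_max => /andP[/hN h1 /hM h2].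
rewrite opprD addrACA (le_lt_trans (cabsD _ _)) //; lra.
Qed.

Lemma climZ c z l : clim z l -> clim (fun n => c * z n) (c * l).
Proof.
move=> ul e e0; have c0 := cabs_ge0 c.
have e1 : 0 < e / (cabs c + 1) by rewrite divr_gt0 //; lra.
have [N hN] := ul _ e1; exists N => n /hN.
rewrite -mulrBr cabsM ltr_pdivlMr; last lra.
have := cabs_ge0 (z n - l); nra.
Qed.

Lemma climN z l : clim z l -> clim (fun n => - z n) (- l).
Proof. by move=> h e /h[N hN]; exists N => n /hN; rewrite -opprD cabsN. Qed.

Lemma climB z w l (m : R[i]) : clim z l -> clim w m -> clim (fun n => z n - w n) (l - m).
Proof. by move=> hz hw; apply: climD => //; exact: climN. Qed.

Lemma clim_conj z l : clim z l -> clim (fun n => Num.conj (z n)) (Num.conj l).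
Proof. by move=> h e /h[N hN]; exists N => n /hN; rewrite -rmorphB cabs_conj. Qed.

Lemma clim_unique z l m : clim z l -> clim z m -> l = m.
Proof.
move=> ul um; apply: eq_cabs_eps => e e0.
have e2 : 0 < e / 2 by rewrite divr_gt0.
have [N hN] := ul _ e2; have [M hM] := um _ e2.
have := hN _ (leq_maxl N M); have := hM _ (leq_maxr N M).
have := cabsD (l - z (maxn N M)) (z (maxn N M) - m); rewrite subrKA (cabsB l (z _)); lra.
Qed.

Lemma clim_Re_ge z l (t : R) : clim z l -> (forall n, t <= complex.Re (z n)) ->
  t <= complex.Re l.
Proof.
move=> hz ht; apply/ler_addgt0Pl => e /hz[N /(_ _ (leqnn N)) hN].
have := ler_Re_cabs (z N - l); rewrite ReB ler_norml => /andP[_ h].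
have := ht N; lra.
Qed.

Lemma clim_real z l : clim z l -> (forall n, complex.Im (z n) = 0) ->
  complex.Im l = 0.
Proof.
move=> hz hI; have h : l = Num.conj l.
  apply: clim_unique (hz) _; have -> : z = fun n => Num.conj (z n).
    apply/funext => n; apply/eqP; rewrite eq_complex.
    by rewrite cRe_conj cIm_conj hI oppr0 !eqxx.
  exact: clim_conj hz.
by have := congr1 (@complex.Im R) h; rewrite cIm_conj; lra.
Qed.

Lemma clim_complete z :
  (forall e : R, 0 < e -> exists N, forall m n, (N <= m)%N -> (N <= n)%N ->
     cabs (z m - z n) < e) -> exists l, clim z l.
Proof.
have rcomp (u : nat -> R) :
  (forall e : R, 0 < e -> exists N, forall m n, (N <= m)%N -> (N <= n)%N ->
     `|u m - u n| < e) ->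
  exists l : R, forall e : R, 0 < e -> exists N, forall n, (N <= n)%N -> `|u n - l| < e.
  move=> uc.
  have /cvg_ex[l /cvgrPdist_lt ul] : cvgn u.
    apply/cauchy_cvgP/cauchy_exP => e /uc[N hN].
    by exists (u N); exists N => // n /= Nn; rewrite /ball /= hN.
  exists l => e e0; have [N _ hN] := ul e e0.
  by exists N => n Nn; rewrite distrC; exact: hN.
move=> zc.
have [a ha] : exists l : R, forall e : R, 0 < e -> exists N, forall n, (N <= n)%N ->
   `|complex.Re (z n) - l| < e.
  apply: rcomp => e /zc[N hN]; exists N => m n Nm Nn; rewrite -ReB.
  exact: le_lt_trans (ler_Re_cabs _) (hN _ _ Nm Nn).
have [b hb] : exists l : R, forall e : R, 0 < e -> exists N, forall n, (N <= n)%N ->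
   `|complex.Im (z n) - l| < e.
  apply: rcomp => e /zc[N hN]; exists N => m n Nm Nn; rewrite -ImN -ImD.
  exact: le_lt_trans (ler_Im_cabs _) (hN _ _ Nm Nn).
exists (Complex a b) => e e0; have e2 : 0 < e / 2 by rewrite divr_gt0.
have [N hN] := ha _ e2; have [M hM] := hb _ e2.
exists (maxn N M) => n; rewrite geq_max => /andP[/hN h1 /hM h2].
apply: le_lt_trans (cabs_le_ReIm _) _.
by rewrite ReB ImD ImN /=; lra.
Qed.

End ComplexLimits.

Section Completion.
Variables (R : realType) (V : lmodType R[i]) (s : V -> V -> R[i]).
Hypothesis hs : psd_form s.
Let snm := snorm s.

Definition scauchy (x : nat -> V) : Prop :=
  forall e : R, 0 < e -> exists N, forall m n, (N <= m)%N -> (N <= n)%N ->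
    snorm s (x m - x n) < e.

Definition is_weak_lim (u : V -> R[i]) (x : nat -> V) : Prop :=
  scauchy x /\ forall y, clim (fun n => s (x n) y) (u y).

Lemma scauchyD x y : scauchy x -> scauchy y -> scauchy (fun n => x n + y n).
Proof.
move=> hx hy e e0; have e2 : 0 < e / 2 by rewrite divr_gt0.
have [N hN] := hx _ e2; have [M hM] := hy _ e2.
exists (maxn N M) => m n; rewrite !geq_max => /andP[a1 a2] /andP[b1 b2].
rewrite opprD addrACA (le_lt_trans (snormD hs _ _)) //.
have := hN _ _ a1 b1; have := hM _ _ a2 b2; lra.
Qed.

Lemma scauchyZ (c : R[i]) x : scauchy x -> scauchy (fun n => c *: x n).
Proof.
move=> hx e e0; have c0 := cabs_ge0 c.
have e1 : 0 < e / (cabs c + 1) by rewrite divr_gt0 //; lra.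
have [N hN] := hx _ e1; exists N => m n Nm Nn.
have := hN _ _ Nm Nn; rewrite -scalerBr snormZ // ltr_pdivlMr; last lra.
have := snorm_ge0 s (x m - x n); nra.
Qed.

Lemma scauchy_cst x : scauchy (fun=> x).
Proof. by move=> e e0; exists 0%N => m n _ _; rewrite subrr snorm0. Qed.

Lemma scauchy_bounded x : scauchy x ->
  exists2 K : R, 0 < K & exists N, forall n, (N <= n)%N -> snorm s (x n) <= K.
Proof.
move=> /(_ 1 ltr01)[N hN]; exists (1 + snorm s (x N)).
  by rewrite ltr_wpDr ?snorm_ge0.
exists N => n Nn; rewrite -{1}(subrK (x N) (x n)) (le_trans (snormD hs _ _)) //.
by rewrite lerD2r ltW // hN.
Qed.

Lemma scauchy_form x y : scauchy x -> scauchy y ->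
  exists l, clim (fun n => s (x n) (y n)) l.
Proof.
move=> hx hy; apply: clim_complete => e e0.
have [K K0 [N1 hK]] := scauchy_bounded hx; have [L L0 [N2 hL]] := scauchy_bounded hy.
have [N3 h3] := hx (e / 2 / L) (divr_gt0 (divr_gt0 e0 (ltr0n _ 2)) L0).
have [N4 h4] := hy (e / 2 / K) (divr_gt0 (divr_gt0 e0 (ltr0n _ 2)) K0).
exists (maxn (maxn N1 N2) (maxn N3 N4)) => m n.
rewrite !geq_max => /andP[/andP[a1 a2] /andP[a3 a4]] /andP[/andP[b1 b2] /andP[b3 b4]].
have -> : s (x m) (y m) - s (x n) (y n) = s (x m - x n) (y m) + s (x n) (y m - y n).
  by rewrite psdBl // psdBr //; ring.
rewrite (le_lt_trans (cabsD _ _)) //.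
have := psd_CS hs (x m - x n) (y m); have := psd_CS hs (x n) (y m - y n).
have := h3 _ _ a3 b3; have := h4 _ _ a4 b4.
rewrite !ltr_pdivlMr //.
have := hL _ a2; have := hK _ b1.
have := snorm_ge0 s (x m - x n); have := snorm_ge0 s (y m - y n).
have := snorm_ge0 s (x n); have := snorm_ge0 s (y m).
set A1 := snorm s (x m - x n); set A2 := snorm s (y m - y n).
set A3 := snorm s (x n); set A4 := snorm s (y m) => p4 p3 p2 p1 q3 q4 r2 r1 t2 t1.
have : A1 * A4 <= A1 * L by rewrite ler_wpM2l.
have : A3 * A2 <= A2 * K by rewrite mulrC ler_wpM2l.
lra.
Qed.

Lemma scauchy_weak_null x : scauchy x -> (forall y, clim (fun n => s (x n) y) 0) ->
  forall e : R, 0 < e -> exists N, forall n, (N <= n)%N -> sqn s (x n) < e.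
Proof.
move=> hx h0 e e0; have [K K0 [N1 hK]] := scauchy_bounded hx.
have [N2 h2] := hx (e / 2 / K) (divr_gt0 (divr_gt0 e0 (ltr0n _ 2)) K0).
have [N3 h3] := h0 (x N2) _ (divr_gt0 e0 (ltr0n _ 2)).
exists (maxn N1 (maxn N2 N3)) => n; rewrite !geq_max => /and3P[a1 a2 a3].
rewrite /sqn -{2}(subrK (x N2) (x n)) psdDr // ReD.
have := h3 _ a3; rewrite subr0 => b3.
have c3 := Re_le_cabs (s (x n) (x N2)).
have c2 := le_trans (Re_le_cabs _) (psd_CS hs (x n) (x n - x N2)).
have := h2 _ _ a2 (leqnn _); rewrite ltr_pdivlMr // => b2.
have d2 : snorm s (x n) * snorm s (x n - x N2) <= snorm s (x n - x N2) * K.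
  by rewrite mulrC ler_wpM2l ?snorm_ge0 // hK.
lra.
Qed.

Record completion_of : Type := Completion {
  compl_fun : V -> R[i] ;
  compl_funP : exists x, is_weak_lim compl_fun x
}.

Definition completion (_ : psd_form s) : Type := completion_of.
Local Notation H := (completion hs).
Implicit Types (u v w : H) (x y : nat -> V).

Lemma compl_eq u v : (forall a, compl_fun u a = compl_fun v a) -> u = v.
Proof.
case: u v => [f hf] [g hg] /= /funext e; case: _ / e hg => hg.
by rewrite (Prop_irrelevance hf hg).
Qed.

Lemma weak_limD (f g : V -> R[i]) x y : is_weak_lim f x -> is_weak_lim g y ->
  is_weak_lim (fun a => f a + g a) (fun n => x n + y n).
Proof.
move=> [cx fx] [cy gy]; split; first exact: scauchyD.
move=> a; have -> : (fun n => s (x n + y n) a) = (fun n => s (x n) a + s (y n) a).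
  by apply/funext => n; rewrite psdDl.
exact: climD.
Qed.

Lemma weak_limZ (c : R[i]) (f : V -> R[i]) x : is_weak_lim f x ->
  is_weak_lim (fun a => c * f a) (fun n => c *: x n).
Proof.
move=> [cx fx]; split; first exact: scauchyZ.
move=> a; have -> : (fun n => s (c *: x n) a) = (fun n => c * s (x n) a).
  by apply/funext => n; rewrite psdZl.
exact: climZ.
Qed.

Lemma weak_lim_cst a : is_weak_lim (s a) (fun=> a).
Proof. by split; [exact: scauchy_cst | move=> b; exact: clim_cst]. Qed.

Definition compl_emb (a : V) : H := Completion (ex_intro _ _ (weak_lim_cst a)).

Definition compl_add u v : H.
Proof.
exists (fun a => compl_fun u a + compl_fun v a).
abstract (by case: u v => [f [x hx]] [g [y hy]];
  exists (fun n => x n + y n); exact: weak_limD).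
Defined.

Definition compl_scale (c : R[i]) u : H.
Proof.
exists (fun a => c * compl_fun u a).
abstract (by case: u => [f [x hx]]; exists (fun n => c *: x n); exact: weak_limZ).
Defined.

HB.instance Definition _ := gen_eqMixin H.
HB.instance Definition _ := gen_choiceMixin H.

Fact compl_addA : associative compl_add.
Proof. by move=> u v w; apply: compl_eq => a /=; rewrite addrA. Qed.
Fact compl_addC : commutative compl_add.
Proof. by move=> u v; apply: compl_eq => a /=; rewrite addrC. Qed.
Fact compl_add0 : left_id (compl_emb 0) compl_add.
Proof. by move=> u; apply: compl_eq => a /=; rewrite psd0l // add0r. Qed.
Fact compl_addN : left_inverse (compl_emb 0) (compl_scale (-1)) compl_add.
Proof. by move=> u; apply: compl_eq => a /=; rewrite psd0l // mulN1r addNr. Qed.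

HB.instance Definition _ :=
  GRing.isZmodule.Build H compl_addA compl_addC compl_add0 compl_addN.

Fact compl_scaleA (a b : R[i]) u :
  compl_scale a (compl_scale b u) = compl_scale (a * b) u.
Proof. by apply: compl_eq => c /=; rewrite mulrA. Qed.
Fact compl_scale1 : left_id 1 compl_scale.
Proof. by move=> u; apply: compl_eq => a /=; rewrite mul1r. Qed.
Fact compl_scaleDr : right_distributive compl_scale +%R.
Proof. by move=> c u v; apply: compl_eq => a /=; rewrite mulrDr. Qed.
Fact compl_scaleDl u : {morph compl_scale^~ u : a b / a + b}.
Proof. by move=> a b; apply: compl_eq => c /=; rewrite mulrDl. Qed.

HB.instance Definition _ := GRing.Zmodule_isLmodule.Build R[i] H
  compl_scaleA compl_scale1 compl_scaleDr compl_scaleDl.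

Definition compl_seq u : nat -> V := sval (cid (compl_funP u)).

Lemma compl_seqP u : is_weak_lim (compl_fun u) (compl_seq u).
Proof. exact: (svalP (cid (compl_funP u))). Qed.

Definition compl_inner u v : R[i] :=
  sval (cid (scauchy_form (compl_seqP u).1 (compl_seqP v).1)).

Lemma compl_innerE u v x y : is_weak_lim (compl_fun u) x ->
  is_weak_lim (compl_fun v) y -> clim (fun n => s (x n) (y n)) (compl_inner u v).
Proof.
move=> [cx ux] [cy vy].
have hl := svalP (cid (scauchy_form (compl_seqP u).1 (compl_seqP v).1)).
have [cu wu] := compl_seqP u; have [cv wv] := compl_seqP v.
have null (w : V -> R[i]) (z z' : nat -> V) : is_weak_lim w z -> is_weak_lim w z' ->
   forall e : R, 0 < e -> exists N, forall n, (N <= n)%N -> snorm s (z n - z' n) < e.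
  move=> [cz hz] [cz' hz'] e e0.
  have cd : scauchy (fun n => z n - z' n).
    apply: scauchyD => //; have -> : (fun n => - z' n) = fun n => -1 *: z' n.
      by apply/funext => n; rewrite scaleN1r.
    exact: scauchyZ.
  have [|N hN] := @scauchy_weak_null _ cd _ (e ^+ 2) (exprn_gt0 2 e0).
    move=> a; have -> : (fun n => s (z n - z' n) a) = fun n => s (z n) a - s (z' n) a.
      by apply/funext => n; rewrite psdBl.
    by rewrite -(subrr (w a)); exact: climB.
  exists N => n /hN; rewrite -(snorm_sqr hs) ltr_pXn2r ?nnegrE ?snorm_ge0 //.
  exact: ltW.
have nx := null _ _ _ (conj cx ux) (conj cu wu).
have ny := null _ _ _ (conj cy vy) (conj cv wv).
have [K K0 [N1 hK]] := scauchy_bounded cx; have [L L0 [N2 hL]] := scauchy_bounded cv.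
have -> : (fun n => s (x n) (y n)) = fun n => s (compl_seq u n) (compl_seq v n)
   + (s (x n) (y n - compl_seq v n) + s (x n - compl_seq u n) (compl_seq v n)).
  by apply/funext => n; rewrite (psdBl hs) (psdBr hs); ring.
rewrite -[compl_inner u v]addr0; apply: climD; first exact: hl.
move=> e e0.
have [N3 h3] := nx (e / 2 / L) (divr_gt0 (divr_gt0 e0 (ltr0n _ 2)) L0).
have [N4 h4] := ny (e / 2 / K) (divr_gt0 (divr_gt0 e0 (ltr0n _ 2)) K0).
exists (maxn (maxn N1 N2) (maxn N3 N4)) => n.
rewrite !geq_max => /andP[/andP[a1 a2] /andP[a3 a4]]; rewrite subr0.
rewrite (le_lt_trans (cabsD _ _)) //.
have := psd_CS hs (x n) (y n - compl_seq v n).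
have := psd_CS hs (x n - compl_seq u n) (compl_seq v n).
have := h3 _ a3; have := h4 _ a4; rewrite !ltr_pdivlMr //.
have := hL _ a2; have := hK _ a1.
have := snorm_ge0 s (x n - compl_seq u n); have := snorm_ge0 s (y n - compl_seq v n).
set A1 := snorm s (x n - _); set A2 := snorm s (y n - _).
set A3 := snorm s (x n); set A4 := snorm s (compl_seq v n) => p2 p1 q3 q4 r2 r1 t1 t2.
have : A1 * A4 <= A1 * L by rewrite ler_wpM2l.
have : A3 * A2 <= A2 * K by rewrite mulrC ler_wpM2l.
lra.
Qed.

Lemma compl_inner_emb a b : compl_inner (compl_emb a) (compl_emb b) = s a b.
Proof.
apply: clim_unique (@clim_cst R (s a b)).
exact: (@compl_innerE (compl_emb a) (compl_emb b) _ _ (weak_lim_cst a) (weak_lim_cst b)).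
Qed.

Lemma compl_innerDl u v w :
  compl_inner (u + v) w = compl_inner u w + compl_inner v w.
Proof.
have hu := compl_seqP u; have hv := compl_seqP v; have hw := compl_seqP w.
apply: clim_unique (climD (compl_innerE hu hw) (compl_innerE hv hw)).
have := @compl_innerE (u + v) w _ _ (weak_limD hu hv) hw.
by congr clim; apply/funext => n; rewrite psdDl.
Qed.

Lemma compl_innerZl (c : R[i]) u w :
  compl_inner (c *: u) w = c * compl_inner u w.
Proof.
have hu := compl_seqP u; have hw := compl_seqP w.
apply: clim_unique (climZ c (compl_innerE hu hw)).
have := @compl_innerE (c *: u) w _ _ (weak_limZ c hu) hw.
by congr clim; apply/funext => n; rewrite psdZl.
Qed.

Lemma compl_innerC u v : compl_inner v u = Num.conj (compl_inner u v).
Proof.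
have hu := compl_seqP u; have hv := compl_seqP v.
apply: clim_unique (compl_innerE hv hu) _.
have := clim_conj (compl_innerE hu hv).
by congr clim; apply/funext => n; rewrite -psdC.
Qed.

Lemma compl_inner_ge0 u : 0 <= compl_inner u u.
Proof.
have hu := compl_seqP u; have h := compl_innerE hu hu.
rewrite lecE; apply/andP; split.
  apply/eqP; apply: clim_real h _ => n.
  by have := psd_ge0 hs (compl_seq u n); rewrite lecE => /andP[/eqP -> _].
by apply: clim_Re_ge h _ => n; exact: (sqn_ge0 hs).
Qed.

Lemma compl_inner_emb_r u a : compl_inner u (compl_emb a) = compl_fun u a.
Proof.
have hu := compl_seqP u; apply: clim_unique (hu.2 a).
exact: (@compl_innerE u (compl_emb a) _ _ hu (weak_lim_cst a)).
Qed.

Lemma compl_psd : psd_form compl_inner.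
Proof.
split; [exact: compl_innerDl | exact: compl_innerZl | exact: compl_innerC
  | exact: compl_inner_ge0].
Qed.

Lemma compl_inner_eq0 u : compl_inner u u = 0 -> u = 0.
Proof.
move=> h; apply: compl_eq => a; rewrite [RHS](psd0l hs) -compl_inner_emb_r.
apply: eq_cabs_eps => e e0; rewrite subr0.
apply: le_trans (psd_CS compl_psd _ _) _.
by rewrite {1}/snorm /sqn h sqrtr0 mul0r ltW.
Qed.

Lemma compl_dense u (e : R) : 0 < e ->
  exists a, snorm compl_inner (u - compl_emb a) < e.
Proof.
move=> e0; have hu := compl_seqP u.
have [N hN] := hu.1 _ (divr_gt0 e0 (ltr0n _ 2)).
exists (compl_seq u N).
have hd := @compl_innerE (u - compl_emb (compl_seq u N)) (u - compl_emb (compl_seq u N))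
   _ _ (weak_limD hu (weak_limZ (-1) (weak_lim_cst (compl_seq u N))))
   (weak_limD hu (weak_limZ (-1) (weak_lim_cst (compl_seq u N)))).
rewrite -(ltr_pXn2r (ltn0Sn 1)) ?nnegrE ?snorm_ge0 ?(ltW e0) // snorm_sqr; last exact: compl_psd.
apply: (@le_lt_trans _ _ ((e / 2) ^+ 2)); last first.
  rewrite ltr_pXn2r ?nnegrE ?(ltW e0) ?divr_ge0 ?(ltW e0) //; lra.
rewrite /sqn; have [N' hN'] : exists N' : nat, True by exists N.
rewrite -lerN2 -ReN.
have hd' : clim (fun n => - s (compl_seq u (N + n)%N + -1 *: compl_seq u N)
    (compl_seq u (N + n)%N + -1 *: compl_seq u N))
   (- compl_inner (u - compl_emb (compl_seq u N)) (u - compl_emb (compl_seq u N))).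
  apply: climN => e' /hd[M hM]; exists M => n Mn; apply: hM.
  by rewrite (leq_trans Mn) // leq_addl.
apply: clim_Re_ge hd' _ => n; rewrite ReN lerN2 scaleN1r -/(sqn s _) -(snorm_sqr hs).
rewrite ler_pXn2r ?nnegrE ?snorm_ge0 ?divr_ge0 ?(ltW e0) // ltW // hN //.
exact: leq_addr.
Qed.

Lemma compl_complete (f : nat -> H) :
  (forall e : R, 0 < e -> exists N, forall m n, (N <= m)%N -> (N <= n)%N ->
     snorm compl_inner (f m - f n) < e) ->
  exists l, forall e : R, 0 < e -> exists N, forall n, (N <= n)%N ->
     snorm compl_inner (f n - l) < e.
Proof.
move=> fc.
have k0 (k : nat) : 0 < k.+1%:R^-1 :> R by rewrite invr_gt0.
pose x k := sval (cid (compl_dense (f k) (k0 k))).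
pose dist u v := snorm compl_inner (u - v).
have dtri v u w : dist u w <= dist u v + dist v w := snorm_trans compl_psd v u w.
have dC u v : dist u v = dist v u := snormB compl_psd u v.
have hx k : dist (f k) (compl_emb (x k)) < k.+1%:R^-1.
  exact: (svalP (cid (compl_dense (f k) (k0 k)))).
have small (e : R) : 0 < e -> exists N, forall n, (N <= n)%N -> n.+1%:R^-1 < e.
  move=> e0; exists (Num.bound e^-1) => n Nn.
  rewrite invf_plt ?posrE // (lt_le_trans (archi_boundP _)) ?invr_ge0 ?(ltW e0) //.
  by rewrite ler_nat leqW.
have embB a b : compl_emb (a - b) = compl_emb a - compl_emb b.
  by apply: compl_eq => c /=; rewrite psdBl // mulN1r.
have embn a : snorm compl_inner (compl_emb a) = snorm s a.
  by rewrite /snorm /sqn compl_inner_emb.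
have cx : scauchy x.
  move=> e e0; have e3 : 0 < e / 3 by rewrite divr_gt0.
  have [N hN] := small _ e3; have [M hM] := fc _ e3.
  exists (maxn N M) => m n; rewrite !geq_max => /andP[a1 a2] /andP[b1 b2].
  rewrite -embn embB.
  apply: (@le_lt_trans _ _ (m.+1%:R^-1 + (e / 3 + n.+1%:R^-1))).
    apply: le_trans (dtri (f m) _ _) (lerD _ _); first by rewrite dC ltW.
    by apply: le_trans (dtri (f n) _ _) (lerD (ltW (hM _ _ a2 b2)) (ltW (hx n))).
  by move: (hN _ a1) (hN _ b1); move: (m.+1%:R^-1) (n.+1%:R^-1) => p q; lra.
have /choice[g gP] a : exists l, clim (fun n => s (x n) a) l.
  exact: scauchy_form cx (scauchy_cst a).
pose l : H := Completion (ex_intro _ x (conj cx gP)).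
have xl (e : R) : 0 < e -> exists N, forall n, (N <= n)%N ->
   snorm compl_inner (compl_emb (x n) - l) < e.
  move=> e0; have [N hN] := cx _ (divr_gt0 e0 (ltr0n _ 2)).
  exists N => n Nn.
  have wl : is_weak_lim (compl_fun (compl_emb (x n) - l)) (fun m => x n + -1 *: x m).
    by apply: weak_limD (weak_lim_cst _) (weak_limZ _ (conj cx gP)).
  have hd := compl_innerE wl wl.
  rewrite -(ltr_pXn2r (ltn0Sn 1)) ?nnegrE ?snorm_ge0 ?(ltW e0) // (snorm_sqr compl_psd).
  apply: (@le_lt_trans _ _ ((e / 2) ^+ 2)); last first.
    rewrite ltr_pXn2r ?nnegrE ?(ltW e0) ?divr_ge0 ?(ltW e0) //; lra.
  rewrite /sqn -lerN2 -ReN.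
  have hd' : clim (fun m => - s (x n + -1 *: x (N + m)%N) (x n + -1 *: x (N + m)%N))
     (- compl_inner (compl_emb (x n) - l) (compl_emb (x n) - l)).
    apply: climN => e' /hd[M hM]; exists M => m Mm; apply: hM.
    by rewrite (leq_trans Mm) // leq_addl.
  apply: clim_Re_ge hd' _ => m; rewrite ReN lerN2 scaleN1r -/(sqn s _) -(snorm_sqr hs).
  rewrite ler_pXn2r ?nnegrE ?snorm_ge0 ?divr_ge0 ?(ltW e0) // ltW // hN //.
  exact: leq_addr.
exists l => e e0; have e2 : 0 < e / 2 by rewrite divr_gt0.
have [N hN] := small _ e2; have [M hM] := xl _ e2.
exists (maxn N M) => n; rewrite geq_max => /andP[/hN h1 /hM h2].
apply: le_lt_trans (dtri (compl_emb (x n)) (f n) l) _.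
by rewrite [ltRHS]splitr ltrD // (lt_trans (hx n)).
Qed.

HB.instance Definition _ := isHilbert.Build R H compl_innerDl compl_innerZl
  compl_innerC compl_inner_ge0 compl_inner_eq0 compl_complete.

End Completion.

Section GNSConstruction.
Variables (R : realType) (A : cstarAlgType R) (chi : A -> R[i]).
Hypothesis hchi : is_state chi.
Let s := sform chi.
Let hs : psd_form s := sformP hchi.
Local Notation H := (completion hs).

Lemma gns_weak_lim (a : A) (f : A -> R[i]) x : is_weak_lim s f x ->
  is_weak_lim s (fun b => f (star a * b)) (fun n => a * x n).
Proof.
move=> [cx fx]; split.
  move=> e e0; have e1 : 0 < e / (cnorm a + 1).
    by rewrite divr_gt0 // ltr_wpDl ?cnorm_ge0.
  have [N hN] := cx _ e1; exists N => m n Nm Nn; rewrite -mulrBr.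
  apply: le_lt_trans (state_snormM hchi _ _) _.
  have := hN _ _ Nm Nn; rewrite ltr_pdivlMr ?ltr_wpDl ?cnorm_ge0 //.
  have := snorm_ge0 s (x m - x n); rewrite -/s; lra.
move=> b; have -> : (fun n => s (a * x n) b) = fun n => s (x n) (star a * b).
  by apply/funext => n; rewrite /s /sform starM starK mulrA.
exact: fx.
Qed.

Definition gns_op (a : A) (u : H) : H.
Proof.
exists (fun b => compl_fun u (star a * b)).
abstract (by case: u => [f [x hx]]; exists (fun n => a * x n); exact: gns_weak_lim).
Defined.

Lemma gns_op_emb a b : gns_op a (compl_emb hs b) = compl_emb hs (a * b).
Proof. by apply: compl_eq => c; rewrite /= /s /sform starM starK mulrA. Qed.

Lemma gns_op_bounded a : bounded_op (gns_op a).
Proof.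
split; first by move=> c u v; apply: compl_eq => b.
exists (cnorm a) => u; have hu := compl_seqP u.
have ha := @compl_innerE _ _ _ hs (gns_op a u) (gns_op a u) _ _ (gns_weak_lim a hu) (gns_weak_lim a hu).
have h1 := compl_innerE hu hu.
rewrite -(ler_pXn2r (ltn0Sn 1)) ?nnegrE ?mulr_ge0 ?snorm_ge0 ?cnorm_ge0 // exprMn.
rewrite !(snorm_sqr (compl_psd hs)) -subr_ge0 -Re_rcM -ReB.
apply: clim_Re_ge (climB (climZ (cnorm a ^+ 2)%:C%C h1) ha) _ => n.
rewrite ReB Re_rcM subr_ge0 -!/(sqn _ _) -!(snorm_sqr hs) -exprMn.
rewrite ler_pXn2r ?nnegrE ?mulr_ge0 ?snorm_ge0 ?cnorm_ge0 //.
exact: state_snormM.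
Qed.

Lemma gns_op_rep : is_starrep gns_op.
Proof.
split.
- exact: gns_op_bounded.
- move=> c a b u; apply: compl_eq => d.
  have [cx ux] := compl_seqP u.
  rewrite /= starD starZ mulrDl -scalerAl.
  apply: clim_unique (ux _) _.
  have -> : (fun n => s (compl_seq u n) (Num.conj c *: (star a * d) + star b * d)) =
     fun n => c * s (compl_seq u n) (star a * d) + s (compl_seq u n) (star b * d).
    by apply/funext => n; rewrite (psdDr hs) (psdZr hs) conjCK.
  by apply: climD; [exact: climZ | exact: ux].
- by move=> u; apply: compl_eq => d; rewrite /= star1 mul1r.
- by move=> a b u; apply: compl_eq => d; rewrite /= starM mulrA.
- move=> a u v.
  have hu := compl_seqP u; have hv := compl_seqP v.
  have h1 := @compl_innerE _ _ _ hs (gns_op (star a) u) v _ _ (gns_weak_lim (star a) hu) hv.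
  have h2 := @compl_innerE _ _ _ hs u (gns_op a v) _ _ hu (gns_weak_lim a hv).
  apply: clim_unique h1 _; move: h2; congr clim.
  by apply/funext => n; rewrite /s /sform starM mulrA.
Qed.

Lemma gns_exists : inhabited (gns chi).
Proof.
split; apply: (@Gns R A chi H gns_op (compl_emb hs 1)).
- exact: gns_op_rep.
- move=> a; rewrite gns_op_emb mulr1.
  by have := compl_inner_emb hs a 1; rewrite /inner /= => ->; rewrite /s /sform star1 mul1r.
- move=> v e e0; have [a ha] := compl_dense v e0; exists a.
  by rewrite gns_op_emb mulr1.
Qed.

End GNSConstruction.

(** * Faithfulness of the minimal tensor product *)

Section HilbertForm.
Variables (R : realType) (H : hilbertType R).

Lemma hinnerP : psd_form (@inner R H).
Proof.
by split; [exact: innerDl | exact: innerZl | exact: innerC | exact: inner_ge0].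
Qed.

Lemma hnormE (v : H) : hnorm v = snorm (@inner R H) v. Proof. by []. Qed.

Lemma hilbert_eq (u v : H) : (forall w, inner u w = inner v w) -> u = v.
Proof.
move=> h; apply/eqP; rewrite -subr_eq0; apply/eqP; apply: inner_eq0.
by rewrite (psdBl hinnerP) h subrr.
Qed.

End HilbertForm.

Section StarRep.
Variables (R : realType) (A : cstarAlgType R) (H : hilbertType R).
Variables (rep : A -> H -> H) (hrep : is_starrep rep).

Lemma starrepD a b v : rep (a + b) v = rep a v + rep b v.
Proof. by have := starrep_linear hrep 1 a b v; rewrite !scale1r. Qed.

Lemma starrep0 v : rep 0 v = 0.
Proof. by apply: (addrI (rep 0 v)); rewrite -starrepD !addr0. Qed.

Lemma starrepZ (c : R[i]) a v : rep (c *: a) v = c *: rep a v.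
Proof. by rewrite -[c *: a]addr0 (starrep_linear hrep) starrep0 addr0. Qed.

Lemma starrepN a v : rep (- a) v = - rep a v.
Proof. by rewrite -scaleN1r starrepZ scaleN1r. Qed.

Lemma starrepB a b v : rep (a - b) v = rep a v - rep b v.
Proof. by rewrite starrepD starrepN. Qed.

Lemma starrep_sum (I : Type) (r : seq I) (P : pred I) (F : I -> A) v :
  rep (\sum_(i <- r | P i) F i) v = \sum_(i <- r | P i) rep (F i) v.
Proof. by elim/big_rec2: _ => [|i x y _ <-]; rewrite ?starrep0 ?starrepD. Qed.

Lemma starrep_op_lin a (c : R[i]) u v : rep a (c *: u + v) = c *: rep a u + rep a v.
Proof. exact: (starrep_bounded hrep a).1. Qed.

Lemma starrep_opD a u v : rep a (u + v) = rep a u + rep a v.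
Proof. by have := starrep_op_lin a 1 u v; rewrite !scale1r. Qed.

Lemma starrep_op0 a : rep a 0 = 0.
Proof. by apply: (addrI (rep a 0)); rewrite -starrep_opD !addr0. Qed.

Lemma starrep_opZ (c : R[i]) a u : rep a (c *: u) = c *: rep a u.
Proof. by rewrite -[c *: u]addr0 starrep_op_lin starrep_op0 addr0. Qed.

Lemma starrep_opB a u v : rep a (u - v) = rep a u - rep a v.
Proof. by rewrite starrep_opD -scaleN1r starrep_opZ scaleN1r. Qed.

Lemma starrep_adj a u v : inner (rep a u) v = inner u (rep (star a) v).
Proof. by rewrite -{1}(starK a) (starrep_star hrep). Qed.

Lemma starrep_defect a : exists d, forall u v, inner (rep a u) (rep a v) =
  (cnorm a ^+ 2)%:C%C * inner u v - inner (rep d u) (rep d v).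
Proof.
have h : cnorm (star a * a) <= cnorm a ^+ 2 by rewrite cnorm_starM.
have sa : star (star a * a) = star a * a by rewrite starM starK.
have [d [pd dd _]] := cpos_sqrt (cpos_subr sa h).
exists d => u v; rewrite !starrep_adj (cpos_sa pd) -!(starrepM hrep) dd.
rewrite starrepB starrepZ (starrep1 hrep) (psdBr (hinnerP H)) (psdZr (hinnerP H)).
by rewrite conj_rc subKr.
Qed.

Lemma starrep_norm a u : hnorm (rep a u) <= cnorm a * hnorm u.
Proof.
rewrite !hnormE -(ler_pXn2r (ltn0Sn 1)) ?nnegrE ?mulr_ge0 ?snorm_ge0 ?cnorm_ge0 //.
rewrite exprMn !(snorm_sqr (hinnerP H)) /sqn.
have [d ->] := starrep_defect a; rewrite ReB Re_rcM lerBlDr lerDl.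
exact: (sqn_ge0 (hinnerP H)).
Qed.

End StarRep.

Section TensorForm.
Variables (R : realType) (H K : hilbertType R).
Implicit Types (y z : seq (H * K)).
Let hH := hinnerP H.
Let hK := hinnerP K.

Definition tens_form y z : R[i] :=
  \sum_(p <- y) \sum_(q <- z) inner p.1 q.1 * inner p.2 q.2.

Lemma tens_form_catl y y' z : tens_form (y ++ y') z = tens_form y z + tens_form y' z.
Proof. by rewrite /tens_form big_cat. Qed.

Lemma tens_form_catr y z z' : tens_form y (z ++ z') = tens_form y z + tens_form y z'.
Proof.
by rewrite /tens_form -big_split /=; apply: eq_bigr => p _; rewrite big_cat.
Qed.

Lemma tens_formC y z : tens_form z y = Num.conj (tens_form y z).
Proof.
rewrite /tens_form rmorph_sum exchange_big /=; apply: eq_bigr => p _.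
by rewrite rmorph_sum; apply: eq_bigr => q _; rewrite rmorphM /= -!innerC.
Qed.

Definition tens_scale (c : R[i]) y := [seq (c *: p.1, p.2) | p <- y].

Lemma tens_form_scalel (c : R[i]) y z : tens_form (tens_scale c y) z = c * tens_form y z.
Proof.
rewrite /tens_form big_map mulr_sumr; apply: eq_bigr => p _.
by rewrite mulr_sumr; apply: eq_bigr => q _; rewrite innerZl mulrA.
Qed.

Lemma tens_form_scaler (c : R[i]) y z :
  tens_form y (tens_scale c z) = Num.conj c * tens_form y z.
Proof. by rewrite tens_formC tens_form_scalel rmorphM /= -tens_formC. Qed.

Lemma tens_form_cons0 k y : tens_form ((0, k) :: y) ((0, k) :: y) = tens_form y y.
Proof.
rewrite /tens_form big_cons /= big1 ?add0r => [|q _]; last by rewrite (psd0l hH) mul0r.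
by apply: eq_bigr => p _; rewrite big_cons /= (psd0r hH) mul0r add0r.
Qed.

(* Split off the component of the first factors along the first one. *)
Lemma tens_form_ge0 y : 0 <= tens_form y y.
Proof.
have [n] := ubnP (size y); elim: n y => // n IH [|[h k] y] /= ysz.
  by rewrite /tens_form big_nil.
pose al (x : H) := inner x h / inner h h.
pose pr (x : H) := x - al x *: h.
have [h0|h0] := eqVneq (inner h h) 0.
  by rewrite (inner_eq0 _ h0) tens_form_cons0; exact: IH.
have alh : al h = 1 by rewrite /al divff.
have prh : pr h = 0 by rewrite /pr alh scale1r subrr.
have po x : inner (pr x) h = 0.
  by rewrite /pr (psdBl hH) innerZl /al divfK // subrr.
have xE (x : H) : x = pr x + al x *: h by rewrite subrK.
clearbody pr.
have dec (x z : H) : inner x z = al x * Num.conj (al z) * inner h h + inner (pr x) (pr z).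
  rewrite {1}(xE x) {1}(xE z).
  rewrite innerDl !(psdDr hH) !innerZl !(psdZr hH) po mulr0 addr0.
  rewrite (innerC (pr z) h) po rmorph0 mulr0 add0r addrC; congr (_ + _); ring.
pose Y := (h, k) :: y.
have -> : tens_form Y Y = inner h h *
     inner (\sum_(p <- Y) al p.1 *: p.2) (\sum_(p <- Y) al p.1 *: p.2)
   + tens_form [seq (pr p.1, p.2) | p <- y] [seq (pr p.1, p.2) | p <- y].
  have -> : tens_form [seq (pr p.1, p.2) | p <- y] [seq (pr p.1, p.2) | p <- y] =
     tens_form [seq (pr p.1, p.2) | p <- Y] [seq (pr p.1, p.2) | p <- Y].
    by rewrite /Y /= prh tens_form_cons0.
  rewrite (psd_suml hK) mulr_sumr /tens_form big_map -big_split /=.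
  apply: eq_bigr => p _.
  rewrite (_ : _ :: _ = [seq (pr p.1, p.2) | p <- Y]) // (psd_sumr hK) mulr_sumr big_map -big_split /=; apply: eq_bigr => q _.
  rewrite dec innerZl (psdZr hK) mulrDl; congr (_ + _); ring.
apply: addr_ge0; last by apply: IH; rewrite size_map.
by apply: mulr_ge0; exact: inner_ge0.
Qed.

Lemma tens_normsqE y : tens_normsq y = complex.Re (tens_form y y). Proof. by []. Qed.

Lemma tens_normsq_ge0 y : 0 <= tens_normsq y.
Proof. exact: Re_ge0 (tens_form_ge0 y). Qed.

Lemma tens_normsq_cat y z :
  tens_normsq (y ++ z) <= 2 * tens_normsq y + 2 * tens_normsq z.
Proof.
have h := tens_normsq_ge0 (y ++ tens_scale (-1) z).
suff : tens_normsq (y ++ z) + tens_normsq (y ++ tens_scale (-1) z) =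
  2 * tens_normsq y + 2 * tens_normsq z by lra.
rewrite !tens_normsqE !tens_form_catl !tens_form_catr !tens_form_scalel !tens_form_scaler.
rewrite rmorphN rmorph1 !mulN1r opprK !ReD !ReN; ring.
Qed.

Lemma tens_normsq_scale (c : R[i]) y :
  tens_normsq (tens_scale c y) = cabs c ^+ 2 * tens_normsq y.
Proof.
by rewrite !tens_normsqE tens_form_scalel tens_form_scaler mulrA -cabs_sqr Re_rcM.
Qed.

Lemma tens_form_null y z : tens_normsq y <= 0 -> tens_form y z = 0.
Proof.
move=> y0; apply: cabs_eq0; set S := tens_form y z.
have M0 := tens_normsq_ge0 z.
have key (t : R) : 0 <= - (2 * t * cabs S ^+ 2) + t ^+ 2 * cabs S ^+ 2 * tens_normsq z.
  have := tens_normsq_ge0 (y ++ tens_scale (- t%:C%C * S) z).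
  rewrite tens_normsqE !tens_form_catl !tens_form_catr !tens_form_scalel !tens_form_scaler.
  rewrite (tens_formC y z) -/S.
  rewrite rmorphM rmorphN /= conj_rc.
  have -> : tens_form y y + - t%:C%C * Num.conj S * S +
     (- t%:C%C * S * Num.conj S + - t%:C%C * S * (- t%:C%C * Num.conj S * tens_form z z)) =
     tens_form y y - (2 * t)%:C%C * (cabs S ^+ 2)%:C%C
     + (t ^+ 2)%:C%C * (cabs S ^+ 2)%:C%C * tens_form z z.
    by rewrite cabs_sqr rcM rmorph_nat rmorphXn /=; ring.
  rewrite -!rcM ReD ReB Re_rc Re_rcM -!tens_normsqE; lra.
apply/eqP; rewrite -sqrf_eq0 eq_le sqr_ge0 andbT.
have := key ((tens_normsq z + 1)^-1).
have p1 : 0 < tens_normsq z + 1 by lra.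
set M1 := tens_normsq z + 1 in p1 *.
have -> : - (2 * M1^-1 * cabs S ^+ 2) + M1^-1 ^+ 2 * cabs S ^+ 2 * tens_normsq z
   = - (cabs S ^+ 2) * (M1 + 1) / M1 ^+ 2.
  by rewrite /M1; field; rewrite gt_eqF.
rewrite pmulr_lge0 ?invr_gt0 ?exprn_gt0 // pmulr_lge0; lra.
Qed.

End TensorForm.

Section TensorFaithful.
Variables (R : realType) (A B T : cstarAlgType R) (ten : A -> B -> T).
Hypothesis hten : is_min_tensor ten.

Lemma tens_app_bound (x : seq (A * B)) : exists2 M : R, 0 <= M &
  forall (H K : hilbertType R) (pi : A -> H -> H) (sg : B -> K -> K) y,
    is_starrep pi -> is_starrep sg ->
    tens_normsq (tens_app pi sg x y) <= M * tens_normsq y.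
Proof.
elim: x => [|[a b] x [M M0 IH]].
  exists 0 => // H K pi sg y hpi hsg.
  by rewrite mul0r /tens_app /= tens_normsqE /tens_form big_nil.
exists (2 * (cnorm a ^+ 2 * cnorm b ^+ 2) + 2 * M).
  by rewrite addr_ge0 // mulr_ge0 // mulr_ge0 ?sqr_ge0.
move=> H K pi sg y hpi hsg.
have -> : tens_app pi sg ((a, b) :: x) y =
  [seq (pi a p.1, sg b p.2) | p <- y] ++ tens_app pi sg x y by [].
apply: le_trans (tens_normsq_cat _ _) _.
have h1 (z : seq (H * K)) : tens_normsq [seq (pi a p.1, p.2) | p <- z] <= cnorm a ^+ 2 * tens_normsq z.
  have [d hd] := starrep_defect hpi a.
  suff -> : tens_normsq [seq (pi a p.1, p.2) | p <- z] =
     cnorm a ^+ 2 * tens_normsq z - tens_normsq [seq (pi d p.1, p.2) | p <- z].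
    by rewrite lerBlDr lerDl tens_normsq_ge0.
  rewrite !tens_normsqE -Re_rcM -ReB /tens_form !big_map mulr_sumr -sumrB.
  congr complex.Re; apply: eq_bigr => p _; rewrite !big_map mulr_sumr -sumrB.
  by apply: eq_bigr => q _; rewrite hd mulrBl mulrA.
have h2 (z : seq (H * K)) : tens_normsq [seq (p.1, sg b p.2) | p <- z] <= cnorm b ^+ 2 * tens_normsq z.
  have [d hd] := starrep_defect hsg b.
  suff -> : tens_normsq [seq (p.1, sg b p.2) | p <- z] =
     cnorm b ^+ 2 * tens_normsq z - tens_normsq [seq (p.1, sg d p.2) | p <- z].
    by rewrite lerBlDr lerDl tens_normsq_ge0.
  rewrite !tens_normsqE -Re_rcM -ReB /tens_form !big_map mulr_sumr -sumrB.
  congr complex.Re; apply: eq_bigr => p _; rewrite !big_map mulr_sumr -sumrB.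
  by apply: eq_bigr => q _; rewrite hd mulrBr; congr (_ - _); rewrite mulrCA.
have -> : [seq (pi a p.1, sg b p.2) | p <- y] =
   [seq (pi a p.1, p.2) | p <- [seq (p.1, sg b p.2) | p <- y]] by rewrite -map_comp.
have g1 := h1 [seq (p.1, sg b p.2) | p <- y].
have g2 := ler_wpM2l (sqr_ge0 (cnorm a)) (h2 y).
have := IH _ _ _ _ y hpi hsg; lra.
Qed.

Lemma ten_vec_eq0 (x : seq (A * B)) : \sum_(p <- x) ten p.1 p.2 = 0 ->
  forall (H K : hilbertType R) (pi : A -> H -> H) (sg : B -> K -> K) u u' v v',
    is_starrep pi -> is_starrep sg ->
    \sum_(p <- x) inner (pi p.1 u) u' * inner (sg p.2 v) v' = 0.
Proof.
move=> x0 H K pi sg u u' v v' hpi hsg.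
have s0 : spatial_normsq x = 0.
  by rewrite -(ten_norm hten) x0 cnorm0 expr0n.
have [M M0 hM] := tens_app_bound x.
have key y : tens_normsq y <= 1 -> tens_normsq (tens_app pi sg x y) <= 0.
  move=> y1; rewrite -s0; apply: sup_upper_bound; last by exists H, K, pi, sg, y.
  split; first by eexists; exists H, K, pi, sg, y; split.
  exists M => _ [H' [K' [pi' [sg' [y' [h1 h2 h3 ->]]]]]].
  apply: le_trans (hM _ _ _ _ _ h1 h2) _.
  by rewrite -[leRHS]mulr1 ler_wpM2l.
have key' y : tens_normsq (tens_app pi sg x y) <= 0.
  pose c := (tens_normsq y + 1)^-1; have y0 := tens_normsq_ge0 y.
  have c0 : 0 < c by rewrite invr_gt0; lra.
  have := key (tens_scale c%:C%C y).
  rewrite tens_normsq_scale cabs_rc (gtr0_norm c0).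
  have -> : tens_app pi sg x (tens_scale c%:C%C y) = tens_scale c%:C%C (tens_app pi sg x y).
    rewrite /tens_app /tens_scale map_allpairs /= allpairs_mapr.
    by apply: eq_allpairs => a p; rewrite (starrep_opZ hpi).
  rewrite tens_normsq_scale cabs_rc (gtr0_norm c0) pmulr_rle0 ?exprn_gt0 //; apply.
  have cN : c * (tens_normsq y + 1) = 1 by rewrite mulVf // gt_eqF //; lra.
  nra.
have := tens_form_null [:: (u', v')] (key' [:: (u, v)]).
rewrite /tens_form /tens_app big_allpairs_dep /=.
by under eq_bigr => p _ do rewrite !big_seq1 /=.
Qed.

End TensorFaithful.

Section VectorFunctionals.
Variables (R : realType) (A : cstarAlgType R).

Definition vec_functional (f : A -> R[i]) : Prop :=
  exists (H : hilbertType R) (pi : A -> H -> H) u u',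
    is_starrep pi /\ f = fun a => inner (pi a u) u'.

Lemma vec_functional_separates a : (forall f, vec_functional f -> f a = 0) -> a = 0.
Proof.
move=> h; have [chi hchi ca] := state_separates a.
have [g] := gns_exists hchi.
have := h (fun b => inner (gns_rep b (gns_vec g)) (gns_rep a (gns_vec g))).
move=> /(_ (ex_intro _ _ (ex_intro _ _ (ex_intro _ _ (ex_intro _ _
  (conj (gns_repP g) erefl)))))).
rewrite -(starrep_star (gns_repP g)) -(starrepM (gns_repP g)) -(gns_state g) ca.
move=> /(congr1 (@complex.Re R)) /= /eqP; rewrite sqrf_eq0 => /eqP.
exact: cnorm0_eq0.
Qed.

End VectorFunctionals.

Lemma ten_slice_eq0 (R : realType) (A B T : cstarAlgType R) (ten : A -> B -> T)
    (x : seq (A * B)) (f : A -> R[i]) : is_min_tensor ten -> vec_functional f ->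
  \sum_(p <- x) ten p.1 p.2 = 0 -> \sum_(p <- x) f p.1 *: p.2 = 0.
Proof.
move=> hten [H [pi [u [u' [hpi ->]]]]] x0; apply: vec_functional_separates => g.
move=> [K [sg [v [v' [hsg ->]]]]].
rewrite (starrep_sum hsg) (psd_suml (hinnerP K)).
rewrite -[RHS](ten_vec_eq0 hten x0 u u' v v' hpi hsg).
by apply: eq_bigr => p _; rewrite (starrepZ hsg) innerZl.
Qed.

(** * Linear independence of matrix coefficients *)

Section PositiveDefinite.
Variable R : realType.
Local Notation C := (R[i]).

Lemma adjmxK m n (T : 'M[C]_(m, n)) : adjmx (adjmx T) = T.
Proof. by apply/matrixP => i j; rewrite !mxE conjCK. Qed.

Lemma adjmxM m n p (S : 'M[C]_(m, n)) (T : 'M[C]_(n, p)) :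
  adjmx (S *m T) = adjmx T *m adjmx S.
Proof. by rewrite /adjmx trmx_mul map_mxM. Qed.

Lemma adjmxD m n (S T : 'M[C]_(m, n)) : adjmx (S + T) = adjmx S + adjmx T.
Proof. by apply/matrixP => i j; rewrite !mxE rmorphD. Qed.

Lemma adjmxN m n (T : 'M[C]_(m, n)) : adjmx (- T) = - adjmx T.
Proof. by apply/matrixP => i j; rewrite !mxE rmorphN. Qed.

Lemma adjmxZ m n c (T : 'M[C]_(m, n)) : adjmx (c *: T) = Num.conj c *: adjmx T.
Proof. by apply/matrixP => i j; rewrite !mxE rmorphM. Qed.

Lemma adjmx1 n : adjmx 1%:M = 1%:M :> 'M[C]_n.
Proof. by apply/matrixP => i j; rewrite !mxE rmorph_nat eq_sym. Qed.

Lemma adjmx_sum (I : Type) (r : seq I) (P : pred I) m n (F : I -> 'M[C]_(m, n)) :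
  adjmx (\sum_(i <- r | P i) F i) = \sum_(i <- r | P i) adjmx (F i).
Proof.
elim/big_rec2: _ => [|i a b _ <-]; last by rewrite adjmxD.
by apply/matrixP => i j; rewrite !mxE rmorph0.
Qed.

Lemma adjmxM_ge0 m (v : 'cV[C]_m) : 0 <= (adjmx v *m v) 0 0.
Proof.
rewrite mxE sumr_ge0 // => i _; rewrite !mxE mulrC -cabs_sqr ler0c sqr_ge0 //.
Qed.

Lemma adjmxM_eq0 m n (T : 'M[C]_(m, n)) : adjmx T *m T = 0 -> T = 0.
Proof.
move=> h; apply/matrixP => i j; rewrite mxE.
have := congr1 (fun M : 'M[C]_n => M j j) h; rewrite !mxE => /eqP.
have -> : \sum_k adjmx T j k * T k j = (\sum_k cabs (T k j) ^+ 2)%:C%C.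
  by rewrite rc_sum; apply: eq_bigr => k _; rewrite !mxE cabs_sqr mulrC.
rewrite -[X in _ == X]/((0 : R)%:C%C) (inj_eq (@complexI R)) psumr_eq0 => [/allP/(_ i)|k _]; last exact: sqr_ge0.
by rewrite mem_index_enum /= sqrf_eq0 => /(_ isT)/eqP/cabs_eq0.
Qed.

Definition spmx n (F : 'M[C]_n) : 'M[C]_n := spectralmx F.

(* The eigenvalues of the positive definite matrix [F], in the basis used by
   [imag_pow]. *)
Definition eigval n (F : 'M[C]_n) (j : 'I_n) : R := complex.Re (spectral_diag F 0 j).

Variables (n : nat) (F : 'M[C]_n).
Hypothesis hF : posdefmx F.
Local Notation O := (spmx F).

Lemma spectral_adjl : adjmx O *m O = 1%:M.
Proof.
have h := spectral_unitarymx F.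
by rewrite /adjmx -(invmx_unitary h) mulVmx // unitarymx_unit.
Qed.

Lemma spectral_adjr : O *m adjmx O = 1%:M.
Proof. exact/unitarymxP/spectral_unitarymx. Qed.

Lemma posdef_normal : F \is normalmx.
Proof. by case: hF => h _; apply/normalmxP; rewrite -/(adjmx F) h. Qed.

Lemma posdef_spectralE :
  F = adjmx O *m diag_mx (\row_j (eigval F j)%:C%C) *m O /\
  forall j, 0 < eigval F j.
Proof.
have hO : invmx O = adjmx O := invmx_unitary (spectral_unitarymx F).
have e : F = adjmx O *m diag_mx (spectral_diag F) *m O.
  by rewrite -hO; exact/orthomx_spectralP/posdef_normal.
have dE : O *m F *m adjmx O = diag_mx (spectral_diag F).
  have := congr1 (fun M => O *m M *m adjmx O) e.
  by move=> ->; rewrite !mulmxA spectral_adjr mul1mx -mulmxA spectral_adjr mulmx1.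
have d0 j : 0 < spectral_diag F 0 j.
  pose v : 'cV[C]_n := adjmx O *m delta_mx j 0.
  have -> : spectral_diag F 0 j = (adjmx v *m F *m v) 0 0.
    have -> : adjmx v *m F *m v = adjmx (delta_mx j 0) *m diag_mx (spectral_diag F) *m delta_mx j 0.
      by rewrite -dE adjmxM adjmxK !mulmxA.
    rewrite mxE (bigD1 j) //= big1 => [|k kj]; last by rewrite !mxE (negbTE kj) mulr0.
    rewrite mul_mx_diag !mxE !eqxx rmorph1 mul1r mulr1 addr0 //.
  case: hF => _; apply; apply/eqP => v0.
  have : O *m v = 0 by rewrite v0 mulmx0.
  rewrite mulmxA spectral_adjr mul1mx => /matrixP/(_ j 0) /eqP.
  by rewrite !mxE !eqxx oner_eq0.
split; last by move=> j; have := d0 j; rewrite ltcE => /andP[].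
rewrite {1}e; congr (_ *m diag_mx _ *m _); apply/rowP => j; rewrite mxE.
exact/ge0_rcRe/ltW.
Qed.

End PositiveDefinite.

Section ScalarMatrices.
Variables (R : realType) (G : cqg R).
Local Notation C := (R[i]).

Definition starmx m n (U : 'M[G]_(m, n)) : 'M[G]_(n, m) := map_mx star U^T.

Lemma starmxM m n p (U : 'M[G]_(m, n)) (V : 'M[G]_(n, p)) :
  starmx (U *m V) = starmx V *m starmx U.
Proof.
apply/matrixP => i j; rewrite !mxE star_sum; apply: eq_bigr => k _.
by rewrite !mxE starM.
Qed.

Lemma starmxD m n (U V : 'M[G]_(m, n)) : starmx (U + V) = starmx U + starmx V.
Proof. by apply/matrixP => i j; rewrite !mxE starD. Qed.

Lemma starmxN m n (U : 'M[G]_(m, n)) : starmx (- U) = - starmx U.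
Proof. by apply/matrixP => i j; rewrite !mxE starN. Qed.

Lemma starmx1 n : starmx 1%:M = 1%:M :> 'M[G]_n.
Proof.
apply/matrixP => i j; rewrite !mxE eq_sym.
by case: (i == j); rewrite ?star1 ?star0.
Qed.

Lemma star_scal (c : C) : star (c%:A : G) = (Num.conj c)%:A.
Proof. by rewrite starZ star1. Qed.

Lemma starmx_scal m n (T : 'M[C]_(m, n)) : starmx (scalmx G T) = scalmx G (adjmx T).
Proof. by apply/matrixP => i j; rewrite !mxE star_scal. Qed.

Lemma scalmxM m n p (S : 'M[C]_(m, n)) (T : 'M[C]_(n, p)) :
  scalmx G (S *m T) = scalmx G S *m scalmx G T.
Proof.
apply/matrixP => i j; rewrite !mxE scaler_suml; apply: eq_bigr => k _.
by rewrite !mxE -scalerAl mul1r scalerA.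
Qed.

Lemma scalmx1 n : scalmx G 1%:M = 1%:M :> 'M[G]_n.
Proof.
by apply/matrixP => i j; rewrite !mxE; case: (i == j); rewrite ?scale1r ?scale0r.
Qed.

Lemma scalmx0 m n : scalmx G 0 = 0 :> 'M[G]_(m, n).
Proof. by apply/matrixP => i j; rewrite !mxE scale0r. Qed.

Lemma scalmxD m n (S T : 'M[C]_(m, n)) : scalmx G (S + T) = scalmx G S + scalmx G T.
Proof. by apply/matrixP => i j; rewrite !mxE scalerDl. Qed.

Lemma scalmxN m n (T : 'M[C]_(m, n)) : scalmx G (- T) = - scalmx G T.
Proof. by apply/matrixP => i j; rewrite !mxE scaleNr. Qed.

Lemma scalmx_suml m n p (T : 'M[C]_(m, n)) (U : 'M[G]_(n, p)) i j :
  (scalmx G T *m U) i j = \sum_k T i k *: U k j.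
Proof. by rewrite mxE; apply: eq_bigr => k _; rewrite mxE -scalerAl mul1r. Qed.

Lemma scalmx_sumr m n p (U : 'M[G]_(m, n)) (T : 'M[C]_(n, p)) i j :
  (U *m scalmx G T) i j = \sum_k T k j *: U i k.
Proof. by rewrite mxE; apply: eq_bigr => k _; rewrite mxE -scalerAr mulr1. Qed.

Lemma scalmx_inj m n : injective (@scalmx R G m n).
Proof.
move=> S T /matrixP h; apply/matrixP => i j; have := h i j; rewrite !mxE.
move=> /eqP; rewrite -subr_eq0 -scalerBl scaler_eq0 => /orP[|/eqP /(@cstar_oner_neq0 R G) //].
by rewrite subr_eq0 => /eqP.
Qed.

Lemma MorM n m p (U : 'M[G]_n) (V : 'M[G]_m) (W : 'M[G]_p) S T :
  Mor U V S -> Mor V W T -> Mor U W (T *m S).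
Proof.
by rewrite /Mor /= => h1 h2; rewrite scalmxM -mulmxA h1 mulmxA h2 mulmxA.
Qed.

Lemma Mor_adj n m (U : 'M[G]_n) (V : 'M[G]_m) T :
  is_inverse U (starmx U) -> is_inverse V (starmx V) ->
  Mor U V T -> Mor V U (adjmx T).
Proof.
move=> [uu u'u] [vv v'v] h; rewrite /Mor /=.
have : starmx U *m scalmx G (adjmx T) = scalmx G (adjmx T) *m starmx V.
  by rewrite -!starmx_scal -!starmxM h.
move=> /(congr1 (fun M => U *m M *m V)).
by rewrite !mulmxA uu mul1mx -!mulmxA v'v mulmx1.
Qed.

Lemma cpos_sum (I : Type) (r : seq I) (P : pred I) (F : I -> G) :
  (forall i, P i -> cpos (F i)) -> cpos (\sum_(i <- r | P i) F i).
Proof.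
by move=> h; elim/big_rec: _ => [|i x Pi]; [exact: cpos0 | apply: cposD; exact: h].
Qed.

Lemma cpos_sum_eq0 (I : finType) (F : I -> G) :
  (forall i, cpos (F i)) -> \sum_i F i = 0 -> forall i, F i = 0.
Proof.
move=> h s0 i; apply: cpos_antisym (h i) _.
have := s0; rewrite (bigD1 i) //= => /eqP; rewrite addr_eq0 => /eqP ->.
by rewrite opprK; apply: cpos_sum.
Qed.

Lemma posdef_sum_cpos n (F : 'M[C]_n) (b : 'I_n -> G) : posdefmx F ->
  let s := \sum_l \sum_m F m l *: (b l * star (b m)) in
  cpos s /\ (s = 0 -> forall l, b l = 0).
Proof.
move=> hF s; have [FE d0] := posdef_spectralE hF.
pose O := spmx F; pose d := eigval F.
pose y r := \sum_l O r l *: b l.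
have sE : s = \sum_r (d r)%:C%C *: (y r * star (y r)).
  have Fml m l : F m l = \sum_r Num.conj (O r m) * (d r)%:C%C * O r l.
    rewrite {1}FE mxE; apply: eq_bigr => r _; rewrite mul_mx_diag !mxE //.
  rewrite /s; under eq_bigr do under eq_bigr do rewrite Fml scaler_suml.
  under eq_bigr do rewrite exchange_big /=; rewrite exchange_big /=.
  apply: eq_bigr => r _; rewrite /y star_sum mulr_suml scaler_sumr.
  apply: eq_bigr => l _; rewrite mulr_sumr scaler_sumr; apply: eq_bigr => m _.
  rewrite starZ; set c1 := O r l; set c2 := Num.conj _.
  have -> : c1 *: b l * (c2 *: star (b m)) = (c1 * c2) *: (b l * star (b m)).
    by rewrite -scalerAl -scalerAr scalerA.
  by rewrite scalerA; congr (_ *: _); ring.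
have py r : cpos ((d r)%:C%C *: (y r * star (y r))).
  by apply: cposZ; [exact/ltW/d0 | rewrite -{1}(starK (y r)); exact: cpos_starM].
split; first by rewrite sE; apply: cpos_sum.
rewrite sE => /(cpos_sum_eq0 py) h l.
have y0 r : y r = 0.
  have /eqP := h r; rewrite scaler_eq0 => /orP[/eqP /(congr1 (@complex.Re R)) /= dr0|/eqP yy].
    by have := d0 r; rewrite -/(d r) dr0 ltxx.
  by apply/eqP; rewrite -[y r]starK -(star0 G) (inj_eq (can_inj (@starK R G))) ; apply/eqP/star_mul_eq0; rewrite starK.
have : \sum_r Num.conj (O r l) *: y r = 0 by rewrite big1 // => r _; rewrite y0 scaler0.
have -> // : \sum_r Num.conj (O r l) *: y r = b l.
rewrite /y; under eq_bigr do rewrite scaler_sumr; rewrite exchange_big /=.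
rewrite (bigD1 l) //= -[RHS]addr0; congr (_ + _).
  under eq_bigr do rewrite scalerA; rewrite -scaler_suml.
  have := congr1 (fun M : 'M[C]_n => M l l) (spectral_adjl F); rewrite !mxE eqxx /=.
  by under eq_bigr do rewrite !mxE; move=> ->; rewrite scale1r.
rewrite big1 // => k kl; under eq_bigr do rewrite scalerA; rewrite -scaler_suml.
have := congr1 (fun M : 'M[C]_n => M l k) (spectral_adjl F); rewrite !mxE eq_sym (negbTE kl) /=.
by under eq_bigr do rewrite !mxE; move=> ->; rewrite scale0r.
Qed.

(* In the notation of the proof, [p - U p U* = b b*] with [b = p U (1 - p)], and
   the assumption on [F] says that both sides have zero [F]-weighted trace. *)
Lemma invariant_projection n (U : 'M[G]_n) (F p : 'M[C]_n) :
  is_inverse U (starmx U) ->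
  (forall b : 'I_n -> G, let s := \sum_l \sum_m F m l *: (b l * star (b m)) in
     cpos s /\ (s = 0 -> forall l, b l = 0)) ->
  (forall i j, \sum_l \sum_m F m l *: (U l i * star (U m j)) = F j i *: (1 : G)) ->
  adjmx p = p -> p *m p = p ->
  scalmx G p *m U *m scalmx G p = U *m scalmx G p ->
  scalmx G p *m U = U *m scalmx G p.
Proof.
move=> [UU U'U] Fpos FU ph pp pU; set P := scalmx G p in pU *.
have PP : P *m P = P by rewrite /P -scalmxM pp.
have sP : starmx P = P by rewrite /P starmx_scal ph.
pose b := P *m U *m (1%:M - P).
have bb : b *m starmx b = P - U *m P *m starmx U.
  have sb : starmx b = (1%:M - P) *m starmx U *m P.
    by rewrite /b !starmxM starmxD starmx1 starmxN sP mulmxA.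
  have qq : (1%:M - P) *m (1%:M - P) = 1%:M - P.
    by rewrite mulmxBl mul1mx mulmxBr mulmx1 PP subrr subr0.
  have -> : b *m starmx b = P *m U *m (1%:M - P) *m starmx U *m P.
    by rewrite sb /b !mulmxA -(mulmxA (P *m U)) qq.
  rewrite mulmxBr mulmx1 mulmxBl mulmxBl -(mulmxA P U) UU mulmx1 PP pU.
  congr (_ - _).
  have := congr1 (@starmx n n) pU; rewrite !starmxM sP mulmxA => h.
  by rewrite -(mulmxA U P) -(mulmxA U) h.
have tr0 : \sum_l \sum_m F m l *: (b *m starmx b) l m = 0.
  have subE (X Y : 'M[G]_n) l m : (X - Y) l m = X l m - Y l m by rewrite mxE [(- Y) l m]mxE.
  rewrite bb; under eq_bigr do under eq_bigr do rewrite subE scalerBr.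
  under eq_bigr do rewrite sumrB; rewrite sumrB; apply/eqP; rewrite subr_eq0; apply/eqP.
  have E l m : (U *m P *m starmx U) l m = \sum_j \sum_i p i j *: (U l i * star (U m j)).
    rewrite mxE; apply: eq_bigr => j _; rewrite scalmx_sumr mulr_suml.
    by apply: eq_bigr => i _; rewrite !mxE -scalerAl.
  under [RHS]eq_bigr do under eq_bigr do rewrite E scaler_sumr.
  under [RHS]eq_bigr do under eq_bigr do under eq_bigr do rewrite scaler_sumr.
  under [RHS]eq_bigr do rewrite exchange_big /=.
  under [RHS]eq_bigr do under eq_bigr do rewrite exchange_big /=.
  rewrite [RHS]exchange_big /= [LHS]exchange_big /=; apply: eq_bigr => j _.
  rewrite [RHS]exchange_big /=; apply: eq_bigr => i _.
  have -> : \sum_l \sum_m F m l *: (p i j *: (U l i * star (U m j))) =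
     p i j *: (\sum_l \sum_m F m l *: (U l i * star (U m j))).
    rewrite scaler_sumr; apply: eq_bigr => l _.
    rewrite scaler_sumr; apply: eq_bigr => m _.
    by rewrite !scalerA mulrC.
  by rewrite FU /P mxE !scalerA mulrC.
have b0 : b = 0.
  apply/matrixP => l k; rewrite [RHS]mxE.
  have [_ +] := Fpos (fun l => b l k); apply.
  apply: (@cpos_sum_eq0 _ (fun k => \sum_l0 \sum_m F m l0 *: (b l0 k * star (b m k)))).
    by move=> k'; case: (Fpos (fun l => b l k')).
  rewrite -[RHS]tr0 exchange_big /=; apply: eq_bigr => l' _.
  rewrite exchange_big /=; apply: eq_bigr => m _.
  by rewrite mxE scaler_sumr; apply: eq_bigr => k' _; rewrite !mxE.
by apply/eqP; rewrite -subr_eq0 -pU -{1}[P *m U]mulmx1 -mulmxBr -/b b0.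
Qed.

End ScalarMatrices.

Section SubspaceProjector.
Variable R : realType.
Local Notation C := (R[i]).

Lemma subspace_rowspace n (S : set 'rV[C]_n) : S 0 ->
  (forall (c : C) u v, S u -> S v -> S (c *: u + v)) ->
  exists M : 'M[C]_n, forall v, S v <-> (v <= M)%MS.
Proof.
move=> S0 Slin.
have SZ (c : C) u : S u -> S (c *: u) by move=> Su; rewrite -[_ *: _]addr0; exact: Slin.
have SD u v : S u -> S v -> S (u + v) by move=> Su Sv; rewrite -[u]scale1r; exact: Slin.
pose Q k := `[< exists2 M : 'M[C]_n, \rank M = k & forall v : 'rV_n, (v <= M)%MS -> S v >].
have [||k /asboolP[M Mk MS] kmax] := @ex_maxnP Q n.
- exists 0%N; apply/asboolP; exists 0; first exact: mxrank0.
  by move=> v; rewrite submx0 => /eqP ->.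
- by move=> k /asboolP[M <- _]; exact: rank_leq_row.
exists M => v; split; last exact: MS.
move=> Sv; have MvS : \rank (M + v)%MS = k.
  apply/eqP; rewrite eqn_leq -{2}Mk mxrankS ?addsmxSl // andbT.
  apply: kmax; apply/asboolP; exists (M + v)%MS => // w /sub_addsmxP[[a b] /= ->].
  apply: SD; first by apply: MS; exact: submxMl.
  by rewrite (mx11_scalar b) mul_scalar_mx; exact: SZ.
apply: submx_trans (addsmxSr M v) _.
by rewrite -(geq_leqif (mxrank_leqif_sup (addsmxSl M v))) MvS Mk.
Qed.

Lemma subspace_projector n (S : set 'rV[C]_n) : S 0 ->
  (forall (c : C) u v, S u -> S v -> S (c *: u + v)) ->
  exists p : 'M[C]_n, [/\ adjmx p = p, p *m p = p & forall v, S v <-> v *m p = 0].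
Proof.
move=> S0 Slin; have [M MS] := subspace_rowspace S0 Slin.
have rn : (\rank M <= n)%N by exact: rank_leq_row.
pose Q : 'M[C]_(\rank M, n) := schmidt (row_base M).
have QQ : Q *m adjmx Q = 1%:M by exact/unitarymxP/(schmidt_unitarymx (row_base M) rn).
have QM : (Q :=: M)%MS.
  apply: eqmx_trans (eq_row_base M); apply: eqmx_schmidt_free; exact: row_base_free.
pose q := adjmx Q *m Q.
have qq : q *m q = q by rewrite /q mulmxA -(mulmxA (adjmx Q)) QQ mulmx1.
have qh : adjmx q = q by rewrite /q adjmxM adjmxK.
exists (1%:M - q); split.
- by rewrite adjmxD adjmxN adjmx1 qh.
- by rewrite mulmxBl mul1mx mulmxBr mulmx1 qq subrr subr0.
- move=> v; rewrite MS -QM; split.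
    by move=> /submxP[w ->]; rewrite mulmxBr mulmx1 /q mulmxA -(mulmxA w) QQ mulmx1 subrr.
  rewrite mulmxBr mulmx1 => /eqP; rewrite subr_eq0 => /eqP ->.
  by rewrite /q mulmxA submxMl.
Qed.

End SubspaceProjector.

Lemma vec_functional_lin (R : realType) (A : cstarAlgType R) (f : A -> R[i]) :
  vec_functional f -> forall (I : Type) (r : seq I) (c : I -> R[i]) (F : I -> A),
  f (\sum_(i <- r) c i *: F i) = \sum_(i <- r) c i * f (F i).
Proof.
move=> [H [pi [u [u' [hpi ->]]]]] I r c F.
rewrite (starrep_sum hpi) (psd_suml (hinnerP H)); apply: eq_bigr => i _.
by rewrite (starrepZ hpi) innerZl.
Qed.

Section CoefficientIndependence.
Variables (R : realType) (G : cqg R).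
Local Notation C := (R[i]).

Let ten_lin_l : forall b : G, is_linear (fun a : G => ten a b) := ten_linear_l (ten_min G).
Let ten_lin_r : forall a : G, is_linear (@ten R G a) := ten_linear_r (ten_min G).

Lemma ten0l (b : G) : ten 0 b = 0.
Proof.
by have := ten_lin_l b 1 0 0; rewrite !scale1r !addr0 => /esym/(canRL (addrK _)); rewrite subrr.
Qed.

Lemma ten0r (a : G) : ten a 0 = 0.
Proof.
by have := ten_lin_r a 1 0 0; rewrite !scale1r !addr0 => /esym/(canRL (addrK _)); rewrite subrr.
Qed.

Lemma tenZl (c : C) (a b : G) : ten (c *: a) b = c *: ten a b.
Proof. by have := ten_lin_l b c a 0; rewrite addr0 ten0l addr0. Qed.

Lemma comul0 : comul (0 : G) = 0.
Proof.
have := starhom_linear (comul_hom G) 1 0 0.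
by rewrite !scale1r !addr0 => /esym/(canRL (addrK _)); rewrite subrr.
Qed.

Lemma comul_lin (I : Type) (r : seq I) (c : I -> C) (F : I -> G) :
  comul (\sum_(i <- r) c i *: F i) = \sum_(i <- r) c i *: comul (F i).
Proof.
have h := starhom_linear (comul_hom G).
by elim/big_rec2: _ => [|i x y _ <-]; rewrite ?comul0 ?h.
Qed.

(* [p] is the projector onto the orthogonal complement of the relations between
   the entries of [u]; their invariance makes it commute with [U]. *)
Lemma coef_independent n (U : 'M[G]_n) (F : 'M[C]_n) (u : 'cV[G]_n) :
  is_inverse U (starmx U) ->
  (forall b : 'I_n -> G, let s := \sum_l \sum_m F m l *: (b l * star (b m)) in
     cpos s /\ (s = 0 -> forall l, b l = 0)) ->
  (forall i j, \sum_l \sum_m F m l *: (U l i * star (U m j)) = F j i *: (1 : G)) ->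
  (forall a, comul (u a 0) = \sum_b ten (U a b) (u b 0)) ->
  (forall p : 'M[C]_n, scalmx G p *m U = U *m scalmx G p -> scalmx G p *m u = u -> p = 1%:M) ->
  forall c : 'rV[C]_n, scalmx G c *m u = 0 -> c = 0.
Proof.
move=> Uinv Fpos FU du Hend c cu.
pose S : set 'rV[C]_n := [set c | scalmx G c *m u = 0].
have S0 : S 0 by rewrite /S /= scalmx0 mul0mx.
have SE (v : 'rV_n) : S v <-> \sum_a v 0 a *: u a 0 = 0.
  rewrite /S /=; split.
    by move=> /matrixP/(_ 0 0); rewrite scalmx_suml mxE.
  by move=> h; apply/matrixP => i j; rewrite !ord1 scalmx_suml h mxE.
have Slin (k : C) v w : S v -> S w -> S (k *: v + w).
  move=> /SE hv /SE hw; apply/SE.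
  have -> : \sum_a (k *: v + w) 0 a *: u a 0 = k *: (\sum_a v 0 a *: u a 0) + \sum_a w 0 a *: u a 0.
    rewrite scaler_sumr -big_split /=; apply: eq_bigr => a _.
    by rewrite !mxE scalerDl scalerA.
  by rewrite hv hw scaler0 addr0.
have [p [ph pp Sp]] := subspace_projector S0 Slin.
have Sf (v : 'rV_n) (f : G -> C) : vec_functional f -> S v -> S (v *m map_mx f U).
  move=> hf /SE hv; apply/SE.
  have := @ten_slice_eq0 R G G (cqg_ten2 G) (@ten R G)
    [seq (v 0 a *: U a b, u b 0) | a <- enum 'I_n, b <- enum 'I_n] f (ten_min G) hf.
  rewrite !big_allpairs_dep /= !big_enum /=.
  have -> : \sum_a \sum_(j <- enum 'I_n) ten (v 0 a *: U a j) (u j 0) = 0.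
    transitivity (comul (\sum_a v 0 a *: u a 0)).
      rewrite comul_lin; apply: eq_bigr => a _.
      rewrite du scaler_sumr big_enum /=; apply: eq_bigr => b _.
      by rewrite tenZl.
    by rewrite hv comul0.
  move=> /(_ erefl) h; rewrite -[RHS]h exchange_big /=.
  rewrite big_enum /=; apply: eq_bigr => b _.
  rewrite mxE scaler_suml; apply: eq_bigr => a _.
  rewrite mxE; congr (_ *: _).
  have := vec_functional_lin hf [:: a] (fun a => v 0 a) (fun a => U a b).
  by rewrite !big_seq1 => ->.
have inv : scalmx G p *m U *m scalmx G p = U *m scalmx G p.
  apply/eqP; rewrite -subr_eq0; apply/eqP.
  rewrite -[X in _ - X *m _]mul1mx -mulmxBl -mulmxBl -scalmx1 -scalmxN -scalmxD.
  apply/matrixP => a b; rewrite [RHS]mxE; apply: vec_functional_separates => f hf.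
  have -> : f ((scalmx G (p - 1%:M) *m U *m scalmx G p) a b) =
     (row a (p - 1%:M) *m map_mx f U *m p) 0 b.
    rewrite scalmx_sumr (vec_functional_lin hf) mxE; apply: eq_bigr => k _.
    rewrite scalmx_suml (vec_functional_lin hf) mxE mulrC; congr (_ * _).
    by apply: eq_bigr => l _; rewrite !mxE.
  have : S (row a (p - 1%:M)).
    by apply/Sp; rewrite -row_mul mulmxBl mul1mx pp subrr row0.
  by move=> /(Sf _ _ hf)/Sp ->; rewrite mxE.
have pU := invariant_projection Uinv Fpos FU ph pp inv.
have pu : scalmx G p *m u = u.
  apply/eqP; rewrite -subr_eq0; apply/eqP.
  rewrite -[X in _ - X]mul1mx -mulmxBl -scalmx1 -scalmxN -scalmxD.
  apply/matrixP => a b; rewrite ord1 [RHS]mxE.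
  have : S (row a (p - 1%:M)).
    by apply/Sp; rewrite -row_mul mulmxBl mul1mx pp subrr row0.
  move=> /SE h; rewrite scalmx_suml -[RHS]h; apply: eq_bigr => k _.
  by rewrite !mxE.
have p1 := Hend p pU pu.
by have /Sp := cu; rewrite p1 mulmx1.
Qed.

Lemma Fmatrix_unitary n (U : 'M[G]_n) (F : 'M[C]_n) :
  is_inverse U (starmx U) -> is_Fmatrix U F ->
  forall i j, \sum_l \sum_m F m l *: (U l i * star (U m j)) = F j i *: (1 : G).
Proof.
move=> [UU U'U] [_ [Uc [Ucc [[V [UV VU] ->] [W [VW WV] ->] FU]]] _] i j.
have VE : V = starmx U by rewrite -[V]mulmx1 -UU mulmxA VU mul1mx.
rewrite VE in WV FU.
have FE m : \sum_l F m l *: U l i = \sum_k F k i *: W k m.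
  have /matrixP/(_ m i) := FU; rewrite scalmx_suml scalmx_sumr => ->.
  by apply: eq_bigr => k _; rewrite mxE.
have WE k : \sum_m W k m * star (U m j) = (k == j)%:R.
  have /matrixP/(_ k j) := WV; rewrite !mxE => <-.
  by apply: eq_bigr => m _; rewrite !mxE.
rewrite exchange_big /=.
transitivity (\sum_m (\sum_l F m l *: U l i) * star (U m j)).
  apply: eq_bigr => m _; rewrite mulr_suml; apply: eq_bigr => l _.
  by rewrite scalerAl.
transitivity (\sum_k F k i *: (\sum_m W k m * star (U m j))).
  under eq_bigr do rewrite FE mulr_suml; rewrite exchange_big /=.
  apply: eq_bigr => k _; rewrite scaler_sumr; apply: eq_bigr => m _.
  by rewrite scalerAl.
rewrite (bigD1 j) //= WE eqxx big1 ?addr0 // => k kj.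
by rewrite WE (negbTE kj) scaler0.
Qed.

Lemma MorZ n m (U : 'M[G]_n) (V : 'M[G]_m) k T : Mor U V T -> Mor U V (k *: T).
Proof.
move=> h; apply/matrixP => i j; have /matrixP/(_ i j) := h.
rewrite !scalmx_suml !scalmx_sumr => e.
transitivity (k *: \sum_l T i l *: U l j).
  by rewrite scaler_sumr; apply: eq_bigr => l _; rewrite mxE scalerA.
by rewrite e scaler_sumr; apply: eq_bigr => l _; rewrite mxE scalerA.
Qed.

Lemma Schur_inequivalent n m (U : 'M[G]_n) (V : 'M[G]_m) T :
  is_unitary_rep U -> is_unitary_rep V -> irreducible_rep U -> irreducible_rep V ->
  Mor U V T -> T != 0 -> unitarily_equivalent U V.
Proof.
move=> [_ Uinv] [_ Vinv] [n0 irrU] [m0 irrV] UVT T0.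
have VUT := Mor_adj Uinv Vinv UVT.
have [c cE] := irrU _ (MorM UVT VUT); have [c' c'E] := irrV _ (MorM VUT UVT).
have cc : c *: T = c' *: T.
  by rewrite -mul_mx_scalar -cE -mul_scalar_mx -c'E mulmxA.
have c_ge0 : 0 <= c.
  have := adjmxM_ge0 (col (Ordinal n0) T).
  have -> : (adjmx (col (Ordinal n0) T) *m col (Ordinal n0) T) 0 0 =
     (adjmx T *m T) (Ordinal n0) (Ordinal n0).
    by rewrite !mxE; apply: eq_bigr => k _; rewrite !mxE.
  by rewrite cE mxE eqxx.
have c0 : c != 0.
  apply: contraNneq T0 => c0; apply/eqP/adjmxM_eq0; rewrite cE c0.
  by apply/matrixP => i j; rewrite !mxE mul0rn.
have cE' : c' = c.
  by apply/esym/eqP; rewrite -subr_eq0; have := cc => /eqP; rewrite -subr_eq0 -scalerBl scaler_eq0 (negbTE T0) orbF.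
have cr := ge0_rcRe c_ge0; set r := complex.Re c in cr.
have r0 : 0 < r.
  have := Re_ge0 c_ge0; rewrite le_eqVlt => /orP[/eqP h|//].
  by move: c0; rewrite cr /r -h eqxx.
pose k : C := ((Num.sqrt r)^-1)%:C%C.
have kk : Num.conj k * k * c = 1.
  rewrite conj_rc cr -!rcM -invrM ?unitfE ?sqrtr_eq0 -?ltNge // -expr2 sqr_sqrtr ?ltW //.
  by rewrite mulVf // gt_eqF.
exists (k *: T); split.
- exact: MorZ.
- by rewrite adjmxZ -scalemxAl -scalemxAr scalerA cE scale_scalar_mx kk.
- by rewrite adjmxZ -scalemxAl -scalemxAr scalerA c'E scale_scalar_mx (mulrC k) cE' kk.
Qed.

End CoefficientIndependence.

Section BlockIndependence.
Variables (R : realType) (G : cqg R) (m : nat) (d : 'I_m -> nat).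
Local Notation C := (R[i]).
Variables (U : forall r, 'M[G]_(d r)) (F : forall r, 'M[C]_(d r)).
Hypothesis Uunit : forall r, is_unitary_rep (U r).
Hypothesis Uirr : forall r, irreducible_rep (U r).
Hypothesis Uinj : forall r s, unitarily_equivalent (U r) (U s) -> r = s.
Hypothesis UF : forall r, is_Fmatrix (U r) (F r).

Definition blk : Type := {r : 'I_m & ('I_(d r) * 'I_(d r))%type}.
HB.instance Definition _ := Finite.on blk.

Definition bel r (i k : 'I_(d r)) : blk := Tagged (fun r => ('I_(d r) * 'I_(d r))%type) (i, k).

Lemma belP (x : blk) : exists r i k, x = @bel r i k.
Proof. by case: x => r [i k]; exists r, i, k. Qed.

Definition bmat (T : zmodType) (M : forall r, 'M[T]_(d r)) (x y : blk) : T :=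
  if tag x == tag y then
    if (tagged_as x y).2 == (tagged x).2 then M (tag x) (tagged x).1 (tagged_as x y).1
    else 0
  else 0.

Lemma bmatE (T : zmodType) (M : forall r, 'M[T]_(d r)) r (i k j l : 'I_(d r)) :
  bmat M (bel i k) (bel j l) = if l == k then M r i j else 0.
Proof. by rewrite /bmat /bel /= eqxx tagged_asE. Qed.

Lemma bmat_neq (T : zmodType) (M : forall r, 'M[T]_(d r)) r s (i k : 'I_(d r)) (j l : 'I_(d s)) :
  r != s -> bmat M (bel i k) (bel j l) = 0.
Proof. by rewrite /bmat /= => /negbTE ->. Qed.

Lemma bel_sum (V : nmodType) (h : blk -> V) :
  \sum_x h x = \sum_r \sum_i \sum_k h (@bel r i k).
Proof.
transitivity (\sum_r \sum_(t : 'I_(d r) * 'I_(d r)) h (Tagged (fun r => ('I_(d r) * 'I_(d r))%type) t)).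
  by rewrite sig_big_dep /=; apply: eq_bigr => -[r t] _.
by apply: eq_bigr => r _; rewrite pair_big /=; apply: eq_bigr => -[i k] _.
Qed.

Lemma bel_sum_row (V : nmodType) (h : blk -> V) r k :
  (forall s j l, s != r -> h (@bel s j l) = 0) ->
  (forall j l, l != k -> h (@bel r j l) = 0) ->
  \sum_x h x = \sum_j h (@bel r j k).
Proof.
move=> h1 h2; rewrite bel_sum (bigD1 r) //= [X in _ + X]big1 ?addr0 => [|s sr]; last first.
  by rewrite big1 // => j _; rewrite big1 // => l _; exact: h1.
apply: eq_bigr => j _; rewrite (bigD1 k) //= big1 ?addr0 // => l lk; exact: h2.
Qed.

Lemma bel_eq r (i k j l : 'I_(d r)) : (bel i k == bel j l) = (i == j) && (k == l).
Proof.
apply/eqP/andP => [|[/eqP -> /eqP ->] //].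
by move=> /eqP; rewrite /bel eq_Tagged /= => /eqP[-> ->].
Qed.

Lemma bel_neq r s (i k : 'I_(d r)) (j l : 'I_(d s)) : r != s ->
  (bel i k == bel j l) = false.
Proof. by move=> rs; apply/eqP => /(congr1 tag) /= e; rewrite e eqxx in rs. Qed.

Let n := #|{: blk}|.
Let mk (T : Type) (f : blk -> blk -> T) : 'M[T]_n :=
  \matrix_(a, b) f (enum_val a) (enum_val b).

Lemma blk_sum (V : nmodType) (h : blk -> V) :
  \sum_(a < n) h (enum_val a) = \sum_x h x.
Proof. by rewrite -big_enum_val. Qed.

Let BU := mk (bmat U).
Let BF := mk (bmat F).
Let bu : 'cV[G]_n := \col_a U (tag (enum_val a)) (tagged (enum_val a)).1 (tagged (enum_val a)).2.

Lemma block_unitary : is_inverse BU (starmx BU).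
Proof.
split; apply/matrixP => a b; rewrite !mxE;
  under eq_bigr do rewrite !mxE; rewrite -(inj_eq enum_val_inj).
- rewrite (blk_sum (fun x => bmat U (enum_val a) x * star (bmat U (enum_val b) x))).
  have [r [i [k ->]]] := belP (enum_val a); have [s [j [l ->]]] := belP (enum_val b).
  rewrite (@bel_sum_row _ _ r k) => [|s' j' l' h|j' l' h].
  + have [rs|rs] := eqVneq r s; last first.
      rewrite bel_neq // big1 // => j' _.
      by rewrite [X in star X]bmat_neq ?star0 ?mulr0 // eq_sym.
    case: _ / rs in j l *; rewrite bel_eq.
    have [kl|kl] := eqVneq k l; last first.
      rewrite andbF big1 // => j' _; rewrite !bmatE (negbTE kl) star0 mulr0 //.
    rewrite kl andbT.
    have [_ [/matrixP/(_ i j) + _]] := Uunit r; rewrite !mxE => <-.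
    by apply: eq_bigr => j' _; rewrite !bmatE !eqxx !mxE.
  + by rewrite bmat_neq ?mul0r // eq_sym.
  + by rewrite bmatE (negbTE h) mul0r.
- rewrite (blk_sum (fun x => star (bmat U x (enum_val a)) * bmat U x (enum_val b))).
  have [r [i [k ->]]] := belP (enum_val a); have [s [j [l ->]]] := belP (enum_val b).
  rewrite (@bel_sum_row _ _ r k) => [|s' j' l' h|j' l' h].
  + have [rs|rs] := eqVneq r s; last first.
      rewrite bel_neq // big1 // => j' _.
      by rewrite [bmat U _ (bel j l)]bmat_neq ?mulr0.
    case: _ / rs in j l *; rewrite bel_eq.
    have [kl|kl] := eqVneq k l; last first.
      by rewrite andbF big1 // => j' _; rewrite !bmatE [l == k]eq_sym (negbTE kl) mulr0.
    rewrite kl andbT.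
    have [_ [_ /matrixP/(_ i j)]] := Uunit r; rewrite !mxE => <-.
    by apply: eq_bigr => j' _; rewrite !bmatE !eqxx !mxE.
  + by rewrite bmat_neq ?star0 ?mul0r.
  + by rewrite bmatE eq_sym (negbTE h) star0 mul0r.
Qed.

Lemma block_cpos (b : 'I_n -> G) :
  let s := \sum_l \sum_k BF k l *: (b l * star (b k)) in
  cpos s /\ (s = 0 -> forall l, b l = 0).
Proof.
move=> s; pose B x := b (enum_rank x).
pose t r k := \sum_i \sum_j F r j i *: (B (@bel r i k) * star (B (@bel r j k))).
have tP r k := posdef_sum_cpos (fun i => B (@bel r i k)) (let: And3 h _ _ := UF r in h).
have tpos r k : cpos (t r k) by case: (tP r k).
have sE : s = \sum_r \sum_k t r k.
  transitivity (\sum_x \sum_y bmat F y x *: (B x * star (B y))).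
    rewrite -blk_sum; apply: eq_bigr => l _; rewrite -blk_sum; apply: eq_bigr => k _.
    by rewrite mxE /B !enum_valK.
  rewrite bel_sum; apply: eq_bigr => r _.
  rewrite exchange_big /=; apply: eq_bigr => k _; apply: eq_bigr => i _.
  rewrite (@bel_sum_row _ _ r k) => [|s' j l h|j l h].
  - by apply: eq_bigr => j _; rewrite bmatE eqxx.
  - by rewrite bmat_neq // scale0r.
  - by rewrite bmatE eq_sym (negbTE h) scale0r.
split; first by rewrite sE; apply: cpos_sum => r _; apply: cpos_sum => k _.
have trpos r : cpos (\sum_k t r k) by apply: cpos_sum => k _; exact: tpos.
rewrite sE => /(cpos_sum_eq0 trpos) h l.
rewrite -(enum_valK l) -/(B _); have [r [i [k ->]]] := belP (enum_val l).
have := h r => /(cpos_sum_eq0 (tpos r))/(_ k).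
by case: (tP r k) => _ /[apply].
Qed.

Lemma block_F i j : \sum_l \sum_k BF k l *: (BU l i * star (BU k j)) = BF j i *: (1 : G).
Proof.
transitivity (\sum_x \sum_y bmat F y x *:
    (bmat U x (enum_val i) * star (bmat U y (enum_val j)))).
  rewrite -blk_sum; apply: eq_bigr => l _; rewrite -blk_sum; apply: eq_bigr => k _.
  by rewrite !mxE.
rewrite [BF j i]mxE.
have [r [a [k ->]]] := belP (enum_val i); have [s [b [l ->]]] := belP (enum_val j).
rewrite (@bel_sum_row _ _ r k) => [|s' j' l' h|j' l' h]; last 2 first.
- by rewrite big1 // => y _; rewrite bmat_neq // mul0r scaler0.
- by rewrite big1 // => y _; rewrite bmatE eq_sym (negbTE h) mul0r scaler0.
have row i' : \sum_y bmat F y (bel i' k) *: (bmat U (bel i' k) (bel a k) *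
      star (bmat U y (bel b l))) =
    \sum_j' F r j' i' *: (U r i' a * star (bmat U (bel j' k) (bel b l))).
  rewrite (@bel_sum_row _ _ r k) => [|s' j' l' h|j' l' h].
  - by apply: eq_bigr => j' _; rewrite !bmatE !eqxx.
  - by rewrite bmat_neq // scale0r.
  - by rewrite bmatE eq_sym (negbTE h) scale0r.
under eq_bigr do rewrite row.
clear row; have [rs|rs] := eqVneq r s; last first.
  rewrite bmat_neq 1?eq_sym // scale0r big1 // => i' _; rewrite big1 // => j' _.
  by rewrite bmat_neq // star0 mulr0 scaler0.
case: _ / rs in b l *; rewrite bmatE.
have [->|kl] := eqVneq k l; last first.
  rewrite scale0r big1 // => i' _; rewrite big1 // => j' _.
  by rewrite bmatE eq_sym (negbTE kl) star0 mulr0 scaler0.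
rewrite -(Fmatrix_unitary (Uunit r).2 (UF r)).
by apply: eq_bigr => i' _; apply: eq_bigr => j' _; rewrite bmatE eqxx.
Qed.

Lemma block_comul a : comul (bu a 0) = \sum_b ten (BU a b) (bu b 0).
Proof.
under eq_bigr do rewrite !mxE; rewrite mxE.
rewrite (blk_sum (fun x => ten (bmat U (enum_val a) x) (U (tag x) (tagged x).1 (tagged x).2))).
have [r [i [k ->]]] := belP (enum_val a).
rewrite (@bel_sum_row _ _ r k) => [|s' j l h|j l h].
- rewrite /=; have [[_ ->] _] := Uunit r; apply: eq_bigr => j _.
  by rewrite bmatE eqxx.
- by rewrite bmat_neq 1?eq_sym // ten0l.
- by rewrite bmatE (negbTE h) ten0l.
Qed.

Lemma block_end (p : 'M[C]_n) :
  scalmx G p *m BU = BU *m scalmx G p -> scalmx G p *m bu = bu -> p = 1%:M.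
Proof.
move=> pU pu; pose pf x y := p (enum_rank x) (enum_rank y).
pose T r k s l : 'M[C]_(d r, d s) := \matrix_(i, j) pf (@bel r i k) (@bel s j l).
have TMor r k s l : Mor (U s) (U r) (T r k s l).
  apply/matrixP => i j; have /matrixP/(_ (enum_rank (bel i k)) (enum_rank (bel j l))) := pU.
  rewrite !scalmx_suml !scalmx_sumr => pUe.
  transitivity (\sum_y pf (bel i k) y *: bmat U y (bel j l)).
    rewrite (@bel_sum_row _ _ s l) => [|s' j' l' h|j' l' h].
    - by apply: eq_bigr => j' _; rewrite mxE bmatE eqxx.
    - by rewrite bmat_neq // scaler0.
    - by rewrite bmatE eq_sym (negbTE h) scaler0.
  transitivity (\sum_k0 p (enum_rank (bel i k)) k0 *: BU k0 (enum_rank (bel j l))).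
    rewrite -blk_sum; apply: eq_bigr => b _.
    by rewrite [BU _ _]mxE /pf enum_valK enum_rankK.
  rewrite pUe.
  transitivity (\sum_x pf x (bel j l) *: bmat U (bel i k) x).
    rewrite -blk_sum; apply: eq_bigr => b _.
    by rewrite [BU _ _]mxE /pf enum_valK enum_rankK.
  rewrite (@bel_sum_row _ _ r k) => [|s' j' l' h|j' l' h].
  - by apply: eq_bigr => j' _; rewrite mxE bmatE eqxx.
  - by rewrite bmat_neq 1?eq_sym // scaler0.
  - by rewrite bmatE (negbTE h) scaler0.
have T0 r k s l : r != s -> T r k s l = 0.
  move=> rs; apply/eqP; apply: contraNT rs => T0.
  by rewrite eq_sym (Uinj (Schur_inequivalent (Uunit s) (Uunit r) (Uirr s) (Uirr r) (TMor r k s l) T0)).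
have Tdiag r k l : exists t : C, T r k r l = t%:M := (Uirr r).2 _ (TMor r k r l).
have T1 r k l : T r k r l = (k == l)%:R%:M.
  pose t k l : C := sval (cid (Tdiag r k l)).
  have tE k' l' : T r k' r l' = (t k' l')%:M := svalP (cid (Tdiag r k' l')).
  have row i : \sum_l' t k l' *: U r i l' = U r i k.
    have /matrixP/(_ (enum_rank (bel i k)) 0) := pu.
    rewrite scalmx_suml [bu _ _]mxE enum_rankK /= => <-.
    transitivity (\sum_(y : blk) pf (bel i k) y *: U (tag y) (tagged y).1 (tagged y).2); last first.
      by rewrite -blk_sum; apply: eq_bigr => b _; rewrite [bu _ _]mxE /pf enum_valK.
    rewrite bel_sum (bigD1 r) //= [X in _ + X]big1 ?addr0 => [|s sr]; last first.
      rewrite big1 // => j _; rewrite big1 // => l' _.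
      have := T0 r k s l'; rewrite eq_sym sr => /(_ isT)/matrixP/(_ i j).
      by rewrite !mxE => ->; rewrite scale0r.
    rewrite exchange_big /=; apply: eq_bigr => l' _.
    rewrite (bigD1 i) //= big1 ?addr0 => [|j ji].
      by have /matrixP/(_ i i) := tE k l'; rewrite !mxE eqxx mulr1n => ->.
    have /matrixP/(_ i j) := tE k l'; rewrite !mxE eq_sym (negbTE ji) => ->.
    by rewrite scale0r.
  have : scalmx G (\col_l' t k l') = scalmx G (\col_l' (k == l')%:R).
    have [_ [_ UU]] := Uunit r.
    rewrite -[LHS]mul1mx -[RHS]mul1mx -UU -!mulmxA; congr (_ *m _).
    apply/matrixP => i j; rewrite !scalmx_sumr.
    under eq_bigr do rewrite mxE; rewrite row (bigD1 k) //= mxE eqxx scale1r big1 ?addr0 //.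
    by move=> l' kl; rewrite mxE eq_sym (negbTE kl) scale0r.
  by move=> /scalmx_inj/matrixP/(_ l 0); rewrite !mxE tE => ->.
apply/matrixP => a b; rewrite mxE -(inj_eq enum_val_inj).
have -> : p a b = pf (enum_val a) (enum_val b) by rewrite /pf !enum_valK.
have [r [i [k ->]]] := belP (enum_val a); have [s [j [l ->]]] := belP (enum_val b).
have [rs|rs] := eqVneq r s; last first.
  by rewrite bel_neq //; have /matrixP/(_ i j) := T0 r k s l rs; rewrite !mxE.
case: _ / rs in j l *; rewrite bel_eq.
have /matrixP/(_ i j) := T1 r k l; rewrite !mxE => ->.
by case: (i == j); case: (k == l).
Qed.

Lemma block_independent (c : forall r, 'M[C]_(d r)) :
  \sum_r \sum_i \sum_k c r i k *: U r i k = 0 -> forall r, c r = 0.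
Proof.
move=> c0; pose cf : 'rV[C]_n := \row_a c (tag (enum_val a)) (tagged (enum_val a)).1 (tagged (enum_val a)).2.
have h : cf = 0.
  apply: (coef_independent block_unitary block_cpos block_F block_comul block_end).
  apply/matrixP => i j; rewrite !ord1 scalmx_suml mxE -[RHS]c0.
  transitivity (\sum_(x : blk) c (tag x) (tagged x).1 (tagged x).2 *: U (tag x) (tagged x).1 (tagged x).2).
    by rewrite -blk_sum; apply: eq_bigr => a _; rewrite !mxE.
  by rewrite bel_sum.
move=> r; apply/matrixP => i k; rewrite mxE.
by have /matrixP/(_ 0 (enum_rank (bel i k))) := h; rewrite !mxE enum_rankK.
Qed.

End BlockIndependence.

(** * Restriction of representations and the maps Theta *)

Section LinearExtension.
Variables (R : realType) (V : lmodType R[i]) (K : Type) (u : K -> V) (x : K -> R[i]).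
Local Notation C := (R[i]).
Implicit Types (s : seq (C * (V * C))) (Gr : set (V * C)).

Let U0 : set (V * C) := [set p | exists k, p = (u k, x k)].
Let lc1 s : V := \sum_(p <- s) p.1 *: p.2.1.
Let lc2 s : C := \sum_(p <- s) p.1 * p.2.2.
Let over Gr s : Prop := forall p, p \in s -> Gr p.2 \/ U0 p.2.
Let consistent Gr : Prop := forall s, over Gr s -> lc1 s = 0 -> lc2 s = 0.

Let lc1_cat s t : lc1 (s ++ t) = lc1 s + lc1 t. Proof. by rewrite /lc1 big_cat. Qed.
Let lc2_cat s t : lc2 (s ++ t) = lc2 s + lc2 t. Proof. by rewrite /lc2 big_cat. Qed.

Let sc (c : C) s := [seq (c * p.1, p.2) | p <- s].

Let lc1_sc c s : lc1 (sc c s) = c *: lc1 s.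
Proof. by rewrite /lc1 /sc big_map scaler_sumr; apply: eq_bigr => p _; rewrite scalerA. Qed.
Let lc2_sc c s : lc2 (sc c s) = c * lc2 s.
Proof. by rewrite /lc2 /sc big_map mulr_sumr; apply: eq_bigr => p _; rewrite mulrA. Qed.

Let over_cat Gr s t : over Gr s -> over Gr t -> over Gr (s ++ t).
Proof. by move=> hs ht p; rewrite mem_cat => /orP[/hs|/ht]. Qed.
Let over_sc Gr c s : over Gr s -> over Gr (sc c s).
Proof. by move=> hs _ /mapP[p /hs h ->]. Qed.

Let over_split Gr w s : over (Gr `|` [set w]) s -> exists s' c,
  [/\ over Gr s', lc1 s = lc1 s' + c *: w.1 & lc2 s = lc2 s' + c * w.2].
Proof.
elim: s => [_|[c p] s IH h]; first by exists [::], 0; rewrite scale0r mul0r !addr0.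
have [|s' [c' [h' e1 e2]]] := IH; first by move=> q qs; apply: h; rewrite inE qs orbT.
have E1 : lc1 ((c, p) :: s) = c *: p.1 + lc1 s by rewrite /lc1 big_cons.
have E2 : lc2 ((c, p) :: s) = c * p.2 + lc2 s by rewrite /lc2 big_cons.
have hp : (Gr p \/ U0 p) \/ p = w.
  by case: (h (c, p) (mem_head _ _)) => /= [[]|]; tauto.
case: hp => [hp|pw].
  exists ((c, p) :: s'), c'; split.
  - by move=> q; rewrite inE => /orP[/eqP -> //|/h'].
  - by rewrite E1 e1 /lc1 big_cons addrA.
  - by rewrite E2 e2 /lc2 big_cons addrA.
exists s', (c' + c); split=> //; first by rewrite E1 e1 pw scalerDl; abel.
by rewrite E2 e2 pw mulrDl; ring.
Qed.

Let consistent_add Gr (v : V) : consistent Gr ->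
  exists z, consistent (Gr `|` [set (v, z)]).
Proof.
move=> hG; have [[t [ht tv]]|nv] := pselect (exists t, over Gr t /\ lc1 t = v).
  exists (lc2 t) => s /over_split[s' [c [h' e1 e2]]] s0.
  rewrite e2 /= -lc2_sc -lc2_cat; apply: (hG (s' ++ sc c t)).
    by move=> p; rewrite mem_cat => /orP[/h'|/mapP[q /ht h ->]].
  by rewrite lc1_cat lc1_sc tv -s0 e1.
exists 0 => s /over_split[s' [c [h' e1 e2]]] s0.
have c0 : c = 0.
  apply/eqP/negPn/negP => c0; apply: nv; exists (sc (- c^-1) s'); split; first exact: over_sc.
  have : lc1 s' = - (c *: v) by apply/eqP; rewrite -addr_eq0 -e1 s0.
  by rewrite lc1_sc => ->; rewrite scalerN scaleNr opprK scalerA mulVf // scale1r.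
rewrite e2 c0 mul0r addr0; apply: hG => //.
by rewrite -s0 e1 c0 scale0r addr0.
Qed.

Lemma linear_extension :
  (forall s : seq (C * K), \sum_(p <- s) p.1 *: u p.2 = 0 ->
     \sum_(p <- s) p.1 * x p.2 = 0) ->
  exists f : V -> C, (forall (c : C) a b, f (c *: a + b) = c * f a + f b) /\
    forall k, f (u k) = x k.
Proof.
move=> hu.
have hU0 : consistent set0.
  move=> s hs; have [t [tE1 tE2]] : exists t : seq (C * K),
      lc1 s = \sum_(p <- t) p.1 *: u p.2 /\ lc2 s = \sum_(p <- t) p.1 * x p.2.
    elim: s hs => [_|[c p] s IH h].
      by exists [::]; rewrite /lc1 /lc2 !big_nil.
    have [|t [e1 e2]] := IH; first by move=> q qs; apply: h; rewrite inE qs orbT.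
    have [//|[k pk]] := h (c, p) (mem_head _ _); rewrite /= in pk.
    exists ((c, k) :: t).
    by rewrite /lc1 /lc2 !big_cons /= -/(lc1 s) -/(lc2 s) e1 e2 pk.
  by rewrite tE1 tE2; exact: hu.
have [|Gr [cGr Grmax]] := @Zorn_bigcup _ consistent.
  move=> F FP Ftot s hs.
  have [X [FX hX]] : exists X, (F X \/ X = set0) /\ over X s.
    elim: s hs => [_|p s IH h]; first by exists set0; split=> //; right.
    have [|X [FX hX]] := IH; first by move=> q qs; apply: h; rewrite inE qs orbT.
    case: (h p (mem_head _ _)) => [[Y FY Yp]|Up]; last first.
      by exists X; split=> // q; rewrite inE => /orP[/eqP ->|/hX //]; right.
    case: FX => [FX|X0].
      case: (Ftot _ _ FX FY) => XY.
        exists Y; split; first by left.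
        move=> q; rewrite inE => /orP[/eqP ->|/hX[/XY|]]; by [left|right].
      exists X; split; first by left.
      by move=> q; rewrite inE => /orP[/eqP ->|/hX //]; left; exact: XY.
    exists Y; split; first by left.
    move=> q; rewrite inE => /orP[/eqP ->|/hX[|]]; [by left | by rewrite X0 | by right].
  by case: FX => [/FP|X0]; [exact | rewrite X0 in hX; exact: hU0].
have tot v : exists z, Gr (v, z).
  have [z hz] := consistent_add v cGr; exists z; apply: contrapT => nz.
  apply: (Grmax _ _ hz); split; first by move=> p Gp; left.
  by move=> /(_ (v, z)) h; apply: nz; apply: h; right.
have /choice[f fG] := tot.
exists f; split.
  move=> c a b; have := cGr [:: (c, (a, f a)); (1, (b, f b)); (-1, (c *: a + b, f (c *: a + b)))].
  have h : over Gr [:: (c, (a, f a)); (1, (b, f b)); (-1, (c *: a + b, f (c *: a + b)))].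
    move=> p; rewrite !inE => /or3P[] /eqP -> /=; left; exact: fG.
  rewrite /lc1 /lc2 !big_cons !big_nil /= scale1r scaleN1r mul1r mulN1r !addr0.
  move=> /(_ h); rewrite addrA subrr => /(_ erefl) /eqP.
  by rewrite addrA subr_eq0 => /eqP ->.
move=> k; have := cGr [:: (1, (u k, f (u k))); (-1, (u k, x k))].
rewrite /lc1 /lc2 !big_cons !big_nil /= !scale1r scaleN1r !mul1r mulN1r !addr0 subrr.
have h : over Gr [:: (1, (u k, f (u k))); (-1, (u k, x k))].
  move=> p; rewrite !inE => /orP[] /eqP -> /=; [left; exact: fG | by right; exists k].
by move=> /(_ h erefl) /eqP; rewrite subr_eq0 => /eqP.
Qed.

End LinearExtension.

Section Representability.
Variables (R : realType) (G : cqg R) (I : dual G).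
Local Notation C := (R[i]).
Variable F : forall p : I, 'M[C]_(irr_dim p).
Hypothesis hF : forall p, is_Fmatrix (irr_rep p) (F p).

Lemma represents_exists (x : matfamily I) : exists f : G -> C,
  (forall (c : C) a b, f (c *: a + b) = c * f a + f b) /\
  forall p i j, x p i j = f (irr_rep p i j).
Proof.
pose K := {p : I & ('I_(irr_dim p) * 'I_(irr_dim p))%type}.
pose u (k : K) : G := irr_rep (tag k) (tagged k).1 (tagged k).2.
pose y (k : K) : C := x (tag k) (tagged k).1 (tagged k).2.
have [|f [flin fu]] := @linear_extension R G K u y; last first.
  exists f; split=> // p i j.
  have := fu (Tagged (fun p : I => ('I_(irr_dim p) * 'I_(irr_dim p))%type) (i, j)).
  by rewrite /u /y /= => ->.
move=> s s0; pose ps := undup [seq tag p.2 | p <- s].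
pose P (r : 'I_(size ps)) : I := tnth (in_tuple ps) r.
have Pinj : injective P by exact/tuple_uniqP/undup_uniq.
pose e r (i j : 'I_(irr_dim (P r))) : K := 
  Tagged (fun p : I => ('I_(irr_dim p) * 'I_(irr_dim p))%type) (i, j).
pose c r : 'M[C]_(irr_dim (P r)) := \matrix_(i, j)
   \sum_(p <- s) (if p.2 == e r i j then p.1 else 0).
have sumE (W : lmodType C) (g : K -> W) :
  \sum_(p <- s) p.1 *: g p.2 = \sum_r \sum_i \sum_j c r i j *: g (e r i j).
  transitivity (\sum_(p <- s) \sum_r \sum_i \sum_j
      (if p.2 == e r i j then p.1 else 0) *: g (e r i j)).
    apply: eq_big_seq => -[a [q [i0 j0]]] ps_; rewrite /=.
    have /tnthP[r qr] : q \in in_tuple ps.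
      by rewrite mem_undup; apply/mapP; exists (a, existT _ q (i0, j0)).
    rewrite -/(P r) in qr; have qr' : P r = q by []; clear qr; case: q / qr' i0 j0 ps_ => i0 j0 ps_.
    rewrite (bigD1 r) //= [X in _ + X]big1 ?addr0; last first.
      move=> r' rr'; rewrite big1 // => i _; rewrite big1 // => j _.
      rewrite ifF ?scale0r //; apply/negP => /eqP/(congr1 tag) /= /Pinj E.
      by rewrite E eqxx in rr'.
    rewrite (bigD1 i0) //= [X in _ + X]big1 ?addr0; last first.
      move=> i ii; rewrite big1 // => j _.
      rewrite ifF ?scale0r //; apply/negP => /eqP E.
      have := EqdepFacts.eq_sigT_fst E => _; move/eqP: E; rewrite eq_Tagged /= => /eqP[E _].
      by rewrite E eqxx in ii.
    rewrite (bigD1 j0) //= [X in _ + X]big1 ?addr0; last first.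
      move=> j jj; rewrite ifF ?scale0r //; apply/negP => /eqP/eqP.
      by rewrite eq_Tagged /= => /eqP[E]; rewrite E eqxx in jj.
    by rewrite /e eqxx.
  rewrite exchange_big; apply: eq_bigr => r _ /=.
  rewrite exchange_big; apply: eq_bigr => i _ /=.
  rewrite exchange_big; apply: eq_bigr => j _ /=.
  by rewrite mxE scaler_suml.
have c0 : forall r, c r = 0.
  apply: (@block_independent R G _ (fun r => irr_dim (P r)) (fun r => irr_rep (P r))
    (fun r => F (P r))).
  - by move=> r; exact: irr_unitary.
  - by move=> r; exact: irr_irreducible.
  - by move=> r r' /irr_inj/Pinj.
  - by move=> r; exact: hF.
  by have := sumE _ u; rewrite s0 => <-.
have := sumE (C^o) y; rewrite /GRing.scale /= => ->.
by rewrite big1 // => r _; rewrite big1 // => i _; rewrite big1 // => j _; rewrite c0 mxE mul0r.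
Qed.

End Representability.

Section RestrictionDecomposition.
Variables (R : realType) (GG : indsys R) (D : branching GG).
Local Notation C := (R[i]).

Lemma irr_dim_gt0 (G : cqg R) (I : dual G) (p : I) : (0 < irr_dim p)%N.
Proof. by have [] := irr_irreducible p. Qed.

Lemma posn_scalar_neq0 n (K : nzRingType) : (0 < n)%N -> (1%:M : 'M[K]_n) != 0.
Proof.
case: n => // n _; apply/eqP => /matrixP/(_ ord0 ord0).
by rewrite !mxE eqxx => /eqP; rewrite oner_eq0.
Qed.

Lemma br_mult_finite N (p : isys_dual GG N.+1) :
  finite_set [set q : isys_dual GG N | (0 < br_mult D q p)%N].
Proof.
have [h0|] := pselect (infinite_set ([set: isys_dual GG N] `&`
  (fun q => \sum_(l < br_mult D q p) br_S l *m adjmx (br_S l)) @^-1` [set~ 0])).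
  have := posn_scalar_neq0 C (irr_dim_gt0 p).
  by rewrite -(br_sum D p) (fsbig_dflt _ h0) eqxx.
move=> /contrapT h; apply: sub_finite_set h => q /= m0; split=> // E0.
have := posn_scalar_neq0 C (irr_dim_gt0 q); case/eqP.
pose l0 := Ordinal m0.
have : adjmx (br_S l0) *m (\sum_(l < br_mult D q p) br_S l *m adjmx (br_S l)) *m br_S l0 = 1%:M.
  rewrite (bigD1 l0) //= mulmxDr mulmxDl mulmx_sumr mulmx_suml big1 ?addr0.
    by rewrite mulmxA br_orth eqxx mul1mx br_orth eqxx.
  move=> l ll; rewrite mulmxA br_orth eq_sym (negbTE ll) /=.
  by rewrite raddf0 !mul0mx.
by rewrite E0 mulmx0 mul0mx => <-.
Qed.

Definition br_supp N (p : isys_dual GG N.+1) : seq (isys_dual GG N) :=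
  fset_set [set q : isys_dual GG N | (0 < br_mult D q p)%N].

Lemma br_suppP N (p : isys_dual GG N.+1) q : (q \in br_supp p) = (0 < br_mult D q p)%N.
Proof. rewrite in_fset_set; last exact: br_mult_finite.
by apply/idP/idP; rewrite inE. Qed.

Lemma br_supp_uniq N (p : isys_dual GG N.+1) : uniq (br_supp p).
Proof. exact: fset_uniq. Qed.

Lemma br_bigE N (p : isys_dual GG N.+1) (V : nmodType)
    (f : forall q, 'I_(br_mult D q p) -> V) :
  \sum_(q \in [set: isys_dual GG N]) \sum_(l < br_mult D q p) f q l =
  \sum_(q <- br_supp p) \sum_(l < br_mult D q p) f q l.
Proof.
apply: fsbigTE => q; rewrite -[_ \notin _]/(q \notin br_supp p) br_suppP => h.
by apply: big1 => -[l hl]; rewrite (leq_trans _ hl) in h.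
Qed.

Lemma br_sumE N (p : isys_dual GG N.+1) :
  \sum_(q <- br_supp p) \sum_(l < br_mult D q p) br_S l *m adjmx (br_S l) = 1%:M.
Proof. by rewrite -(br_bigE (fun q l => br_S l *m adjmx (br_S l))) br_sum. Qed.

Lemma scalmx_big (G : cqg R) (I : Type) (r : seq I) m n (F : I -> 'M[C]_(m, n)) :
  scalmx G (\sum_(i <- r) F i) = \sum_(i <- r) scalmx G (F i).
Proof. by apply: big_morph; [exact: scalmxD | exact: scalmx0]. Qed.

Lemma res_repE N (p : isys_dual GG N.+1) : res_rep p =
  \sum_(q <- br_supp p) \sum_(l < br_mult D q p)
     scalmx (GG N) (br_S l) *m irr_rep q *m scalmx (GG N) (adjmx (br_S l)).
Proof.
rewrite -[LHS]mulmx1 -(scalmx1 (GG N)) -br_sumE scalmx_big mulmx_sumr.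
apply: eq_bigr => q _; rewrite scalmx_big mulmx_sumr; apply: eq_bigr => l _.
by rewrite scalmxM mulmxA -(br_mor l).
Qed.

Lemma map_functional (G : cqg R) (f : G -> C) m n k l (A : 'M[C]_(m, n))
  (U : 'M[G]_(n, k)) (B : 'M[C]_(k, l)) :
  (forall (c : C) a b, f (c *: a + b) = c * f a + f b) ->
  map_mx f (scalmx G A *m U *m scalmx G B) = A *m map_mx f U *m B.
Proof.
move=> hf.
have f0 : f 0 = 0 by have := hf (-1) 0 0; rewrite scaleN1r addrC subrr => ->; rewrite mulN1r addrC subrr.
have fZ c a : f (c *: a) = c * f a by rewrite -[c *: a]addr0 hf f0 addr0.
have fD a b : f (a + b) = f a + f b by rewrite -[a]scale1r hf mul1r scale1r.
have fs (I : Type) (r : seq I) (h : I -> G) : f (\sum_(i <- r) h i) = \sum_(i <- r) f (h i).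
  by apply: (big_morph f fD f0).
apply/matrixP => i j; rewrite !mxE fs; apply: eq_bigr => x _.
rewrite !mxE -scalerAr mulr1 fZ fs mulrC; congr (_ * _).
by apply: eq_bigr => y _; rewrite !mxE -scalerAl mul1r fZ.
Qed.

Definition Thmap N (x : matfamily (isys_dual GG N)) : matfamily (isys_dual GG N.+1) :=
  fun p => \sum_(q <- br_supp p) \sum_(l < br_mult D q p)
    br_S l *m x q *m adjmx (br_S l).

Lemma Thmap_is_Theta N (x : matfamily (isys_dual GG N)) : is_Theta x (Thmap x).
Proof.
have [f [flin fx]] := represents_exists (fun p => br_FP D p) x.
exists f; split; first by split=> // *; exact: flin.
split.
  move=> c a b _ _; rewrite -flin; congr f.
  by have [h _ _ _] := theta_hom GG N; rewrite h.
move=> p i j; have -> : theta (irr_rep p i j) = res_rep p i j by rewrite mxE.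
have f0 : f 0 = 0 by have := flin (-1) 0 0; rewrite scaleN1r addrC subrr => ->; rewrite mulN1r addrC subrr.
have fD a b : f (a + b) = f a + f b by rewrite -[a]scale1r flin mul1r scale1r.
rewrite res_repE /Thmap !summxE (big_morph f fD f0); apply: eq_bigr => q _.
rewrite !summxE (big_morph f fD f0); apply: eq_bigr => l _.
have -> : x q = map_mx f (irr_rep q) by apply/matrixP => a b; rewrite mxE fx.
by rewrite -map_functional // mxE.
Qed.
End RestrictionDecomposition.

Section PosdefFacts.
Variable R : realType.
Local Notation C := (R[i]).

Lemma mulmx_rowcol n m (A : 'M[C]_(m, n)) (B : 'M[C]_(n, m)) j :
  (row j A *m col j B) 0 0 = (A *m B) j j.
Proof. by rewrite !mxE; apply: eq_bigr => k _; rewrite !mxE. Qed.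

Lemma posdef_ge0 n (F : 'M[C]_n) m (X : 'M[C]_(n, m)) j : posdefmx F ->
  0 <= (adjmx X *m F *m X) j j.
Proof.
move=> [_ hF]; have -> : (adjmx X *m F *m X) j j = (adjmx (col j X) *m F *m col j X) 0 0.
  have -> : adjmx (col j X) = row j (adjmx X) by apply/matrixP => a b; rewrite !mxE.
  by rewrite -row_mul mulmx_rowcol.
have [->|/hF/ltW //] := eqVneq (col j X) 0.
by rewrite mulmx0 mxE.
Qed.

Lemma posdef_mul_eq0 n (F : 'M[C]_n) m (X : 'M[C]_(n, m)) : posdefmx F ->
  (forall j, (adjmx X *m F *m X) j j = 0) -> X = 0.
Proof.
move=> [_ hF] h; apply/matrixP => i j; rewrite [RHS]mxE.
have [/matrixP/(_ i 0)|/hF] := eqVneq (col j X) 0; first by rewrite !mxE.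
rewrite [X in 0 < X](_ : _ = (adjmx X *m F *m X) j j) ?h ?ltxx //.
have -> : adjmx (col j X) = row j (adjmx X) by apply/matrixP => a b; rewrite !mxE.
by rewrite -row_mul mulmx_rowcol.
Qed.

Lemma posdef_unit n (F : 'M[C]_n) : posdefmx F -> F \in unitmx.
Proof.
move=> hF; rewrite -row_free_unit -kermx_eq0.
apply/eqP; have [aF _] := hF.
have k : kermx F *m F = 0 := mulmx_ker F.
apply: (can_inj (@adjmxK R n n)); rewrite [RHS](_ : _ = 0); last first.
  by apply/matrixP => i j; rewrite !mxE rmorph0.
apply: (posdef_mul_eq0 hF) => j.
by rewrite adjmxK k mul0mx mxE.
Qed.

Lemma posdef_inv n (F : 'M[C]_n) : posdefmx F -> posdefmx (invmx F).
Proof.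
move=> hF; have [aF pF] := hF; have uF := posdef_unit hF.
have aV : adjmx (invmx F) = invmx F.
  rewrite -[LHS]mulmx1 -(mulmxV uF) mulmxA -{2}aF -adjmxM mulmxV // adjmx1 mul1mx //.
split=> // v v0.
have := pF (invmx F *m v); rewrite adjmxM aV -!mulmxA (mulmxA F) mulmxV // mul1mx.
apply; apply: contra_neq v0 => h.
by rewrite -[v]mul1mx -(mulmxV uF) -mulmxA h mulmx0.
Qed.

Lemma mxtrace_posdef_eq0 n (F X : 'M[C]_n) : posdefmx F ->
  \tr (F *m (X *m adjmx X)) = 0 -> X = 0.
Proof.
move=> hF h; apply: (posdef_mul_eq0 hF) => j.
have h2 : \sum_j (adjmx X *m F *m X) j j = 0.
  by rewrite -[LHS]/(\tr (adjmx X *m F *m X)) -mulmxA mxtrace_mulC -mulmxA.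
move: h2 => /eqP; rewrite psumr_eq0; last by move=> k _; exact: posdef_ge0.
by move=> /allP/(_ j (mem_index_enum _))/eqP.
Qed.

Lemma posdef_trace_gt0 n (F : 'M[C]_n) : (0 < n)%N -> posdefmx F -> 0 < \tr F.
Proof.
move=> n0 hF.
have d j : 0 <= F j j.
  by have := posdef_ge0 1%:M j hF; rewrite adjmx1 mul1mx mulmx1.
rewrite lt_neqAle sumr_ge0 // andbT eq_sym; apply/eqP => t0.
have := posn_scalar_neq0 C n0; case/eqP; apply: (mxtrace_posdef_eq0 hF).
by rewrite adjmx1 !mulmx1.
Qed.

End PosdefFacts.

Section Intertwiners.
Variables (R : realType) (G : cqg R).
Local Notation C := (R[i]).

Lemma trmx_scal_mull m n p (T : 'M[C]_(m, n)) (U : 'M[G]_(n, p)) :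
  (scalmx G T *m U)^T = U^T *m scalmx G T^T.
Proof.
by apply/matrixP => i j; rewrite [LHS]mxE scalmx_suml scalmx_sumr; apply: eq_bigr => k _; rewrite !mxE.
Qed.

Lemma trmx_scal_mulr m n p (U : 'M[G]_(m, n)) (T : 'M[C]_(n, p)) :
  (U *m scalmx G T)^T = scalmx G T^T *m U^T.
Proof.
by apply/matrixP => i j; rewrite [LHS]mxE scalmx_suml scalmx_sumr; apply: eq_bigr => k _; rewrite !mxE.
Qed.

(* [F] intertwines [U] with its double contragredient iff [U^T F^T conj U = F^T]. *)
Definition conj_inv n (U : 'M[G]_n) m (V : 'M[G]_m) (X : 'M[C]_(m, n)) : Prop :=
  U^T *m scalmx G X^T *m map_mx star V = scalmx G X^T.

Lemma Fmatrix_conj_inv n (U : 'M[G]_n) (F : 'M[C]_n) :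
  is_inverse U (starmx U) -> is_Fmatrix U F -> conj_inv U U F.
Proof.
move=> uU hF; apply/matrixP => i j; rewrite mxE [RHS]mxE mxE.
rewrite -(Fmatrix_unitary uU hF) exchange_big; apply: eq_bigr => m _.
rewrite scalmx_sumr mulr_suml; apply: eq_bigr => l _.
by rewrite !mxE scalerAl.
Qed.

Lemma conj_inv_Mor n (U : 'M[G]_n) m (V : 'M[G]_m) (F : 'M[C]_m) (X : 'M[C]_(m, n)) :
  is_inverse V (starmx V) -> is_Fmatrix V F -> conj_inv U V X ->
  Mor U V (invmx F *m X).
Proof.
move=> uV hF hX; have hV := Fmatrix_conj_inv uV hF.
have [pF [Uc [Ucc [[W [UW WU] ->] [Z [VZ ZV] _] _]]] _] := hF.
have uF := posdef_unit pF.
have WE : W = starmx V by case: uV => v1 v2; rewrite -[W]mulmx1 -v1 mulmxA WU mul1mx.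
have cV : map_mx star V = W^T by rewrite WE /starmx map_trmx trmxK.
rewrite /conj_inv cV in hX hV.
have ZE : Z = scalmx G (invmx F)^T *m V^T *m scalmx G F^T.
  rewrite -[RHS]mulmx1 -VZ mulmxA -!mulmxA (mulmxA V^T) (mulmxA (V^T *m _)) hV.
  by rewrite mulmxA -scalmxM -trmx_mul mulmxV // trmx1 scalmx1 mul1mx.
have e : U^T *m scalmx G X^T = scalmx G X^T *m scalmx G (invmx F)^T *m V^T *m scalmx G F^T.
  by rewrite -[LHS]mulmx1 -VZ mulmxA hX ZE !mulmxA.
rewrite /Mor /=; apply: trmx_inj; rewrite trmx_scal_mull trmx_scal_mulr.
rewrite trmx_mul scalmxM !mulmxA e.
by rewrite -(mulmxA _ (scalmx G F^T)) -(scalmxM _ F^T) -trmx_mul mulVmx // trmx1 scalmx1 mulmx1.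
Qed.

Lemma conj_inv_pull n (U : 'M[G]_n) m (V : 'M[G]_m) k (U' : 'M[G]_k)
   (S : 'M[C]_(m, n)) (S' : 'M[C]_(m, k)) (X : 'M[C]_m) :
  Mor U V S -> Mor U' V S' -> conj_inv V V X -> conj_inv U U' (adjmx S' *m X *m S).
Proof.
move=> hS hS' hX; rewrite /conj_inv !trmx_mul !scalmxM !mulmxA.
rewrite -trmx_scal_mull hS trmx_scal_mulr.
have E : scalmx G (adjmx S')^T *m map_mx star U' = map_mx star V *m scalmx G (adjmx S')^T.
  have := congr1 (fun M => (starmx M)^T) hS'.
  rewrite !starmxM !starmx_scal trmx_scal_mulr trmx_scal_mull.
  by rewrite /starmx !map_trmx !trmxK.
rewrite -[LHS]mulmxA E mulmxA -[in LHS](mulmxA (scalmx G S^T) V^T).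
by rewrite -[in LHS](mulmxA (scalmx G S^T) _ (map_mx star V)) hX.
Qed.

Lemma Mor_inv n (V : 'M[G]_n) T Ti : Mor V V T -> T *m Ti = 1%:M -> Ti *m T = 1%:M ->
  Mor V V Ti.
Proof.
move=> TE TTi TiT.
rewrite /Mor /= -[LHS]mulmx1 -(scalmx1 G) -TTi scalmxM [LHS]mulmxA -[X in X *m _]mulmxA -(TE : _ = _).
by rewrite mulmxA -scalmxM TiT scalmx1 mul1mx.
Qed.

Lemma Schur_scalar n (U : 'M[G]_n) T : irreducible_rep U -> Mor U U T -> exists c, T = c%:M.
Proof. by move=> [_]; exact. Qed.

End Intertwiners.

Section RestrictedF.
Variables (R : realType) (GG : indsys R) (D : branching GG).
Local Notation C := (R[i]).
Variables (N : nat) (p : isys_dual GG N.+1).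
Local Notation V := (res_rep p).
Local Notation K := (br_Fres D p).
Let Q := br_supp D p.

Lemma res_rep_unitary : is_inverse V (starmx V).
Proof.
have [_ [UU' U'U]] := irr_unitary p.
have [tl t1 tM ts] := theta_hom GG N.
have t0 : theta (0 : GG N.+1) = 0 :> GG N.
  by have := tl (-1) 0 0; rewrite scaleN1r addrC subrr scaleN1r addrC subrr.
have tD a b : theta (a + b) = theta a + theta b :> GG N by have := tl 1 a b; rewrite !scale1r.
have tmul n m k (A : 'M[isys GG N.+1]_(n, m)) (B : 'M[isys GG N.+1]_(m, k)) :
   map_mx (@theta R GG N) (A *m B) = map_mx (@theta R GG N) A *m map_mx (@theta R GG N) B.
  apply/matrixP => i j; rewrite !mxE (big_morph _ tD t0); apply: eq_bigr => k' _.
  by rewrite tM !mxE.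
have tstar : starmx V = map_mx (@theta R GG N) (starmx (irr_rep p)).
  by apply/matrixP => i j; rewrite !mxE ts.
have t1m n : map_mx (@theta R GG N) 1%:M = 1%:M :> 'M[isys GG N]_n.
  by apply/matrixP => i j; rewrite !mxE; case: (i == j); rewrite ?t1 ?t0.
by rewrite /is_inverse tstar /res_rep -!tmul -t1m; split; congr map_mx.
Qed.

Definition sumQ (X : forall q : isys_dual GG N, 'M[C]_(irr_dim q)) : 'M[C]_(irr_dim p) :=
  \sum_(q <- Q) \sum_(l < br_mult D q p) br_S l *m X q *m adjmx (br_S l).

Lemma sumQ_S X q (l : 'I_(br_mult D q p)) : sumQ X *m br_S l = br_S l *m X q.
Proof.
have qQ : q \in Q by rewrite br_suppP; case: l => ? ; exact: leq_ltn_trans.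
rewrite /sumQ mulmx_suml (bigD1_seq q) ?br_supp_uniq //= mulmx_suml (bigD1 l) //=.
rewrite -!mulmxA br_orth eqxx mulmx1 [X in _ + X + _]big1 ?addr0; last first.
  by move=> l' ll'; rewrite -!mulmxA br_orth (negbTE ll') raddf0 !mulmx0.
rewrite big1 ?addr0 // => q' qq'; rewrite mulmx_suml big1 // => l' _.
by rewrite -!mulmxA br_neq ?mulmx0 //; apply/eqP.
Qed.

Lemma S_sumQ X q (l : 'I_(br_mult D q p)) : adjmx (br_S l) *m sumQ X = X q *m adjmx (br_S l).
Proof.
have qQ : q \in Q by rewrite br_suppP; case: l => ? ; exact: leq_ltn_trans.
rewrite /sumQ mulmx_sumr (bigD1_seq q) ?br_supp_uniq //= mulmx_sumr (bigD1 l) //=.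
rewrite !mulmxA br_orth eqxx mul1mx [X in _ + X + _]big1 ?addr0; last first.
  by move=> l' ll'; rewrite !mulmxA br_orth eq_sym (negbTE ll') raddf0 !mul0mx.
rewrite big1 ?addr0 // => q' qq'; rewrite mulmx_sumr big1 // => l' _.
by rewrite !mulmxA br_neq ?mul0mx // => qq; rewrite qq eqxx in qq'.
Qed.

Lemma eq_mulS m (A B : 'M[C]_(m, irr_dim p)) :
  (forall q (l : 'I_(br_mult D q p)), A *m br_S l = B *m br_S l) -> A = B.
Proof.
move=> h; rewrite -[A]mulmx1 -[B]mulmx1 -(br_sumE D p) !mulmx_sumr.
apply: eq_bigr => q _; rewrite !mulmx_sumr; apply: eq_bigr => l _.
by rewrite !mulmxA h.
Qed.

Lemma eq_Smul m (A B : 'M[C]_(irr_dim p, m)) :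
  (forall q (l : 'I_(br_mult D q p)), adjmx (br_S l) *m A = adjmx (br_S l) *m B) -> A = B.
Proof.
move=> h; rewrite -[A]mul1mx -[B]mul1mx -(br_sumE D p) !mulmx_suml.
apply: eq_bigr => q _; rewrite !mulmx_suml; apply: eq_bigr => l _.
by rewrite -!mulmxA h.
Qed.

Lemma sumQ_mul X Y : sumQ X *m sumQ Y = sumQ (fun q => X q *m Y q).
Proof. by apply: eq_mulS => q l; rewrite -mulmxA sumQ_S mulmxA !sumQ_S mulmxA. Qed.

Lemma sumQ1 : sumQ (fun q => 1%:M) = 1%:M.
Proof. by apply: eq_mulS => q l; rewrite sumQ_S mulmx1 mul1mx. Qed.

Lemma tr_sumQ X (E : 'M[C]_(irr_dim p)) : \tr (sumQ X *m E) =
  \sum_(q <- Q) \sum_(l < br_mult D q p) \tr (X q *m (adjmx (br_S l) *m E *m br_S l)).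
Proof.
rewrite /sumQ mulmx_suml raddf_sum; apply: eq_bigr => q _.
rewrite mulmx_suml raddf_sum; apply: eq_bigr => l _ /=.
by rewrite -!mulmxA mxtrace_mulC !mulmxA.
Qed.

Let hF (q : isys_dual GG N) := br_FP D q.

Lemma S_Mor q (l : 'I_(br_mult D q p)) : Mor (irr_rep q) V (br_S l).
Proof. exact: br_mor. Qed.

Lemma adjS_Mor q (l : 'I_(br_mult D q p)) : Mor V (irr_rep q) (adjmx (br_S l)).
Proof.
apply: Mor_adj (br_mor l); last exact: res_rep_unitary.
by have [_] := irr_unitary q.
Qed.

Lemma end_scalar E q (l l' : 'I_(br_mult D q p)) : Mor V V E ->
  exists c, adjmx (br_S l') *m E *m br_S l = c%:M.
Proof.
move=> hE; apply: (Schur_scalar (irr_irreducible q)).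
rewrite -mulmxA; apply: (MorM _ (adjS_Mor l')); exact: MorM (S_Mor l) hE.
Qed.

Lemma end_scalar0 E q q' (l : 'I_(br_mult D q p)) (l' : 'I_(br_mult D q' p)) :
  Mor V V E -> q <> q' -> adjmx (br_S l') *m E *m br_S l = 0.
Proof.
move=> hE qq; apply/eqP/negPn/negP => n0; apply: qq; apply: irr_inj.
apply: Schur_inequivalent n0; try exact: irr_unitary; try exact: irr_irreducible.
rewrite -mulmxA; apply: (MorM _ (adjS_Mor l')); exact: MorM (S_Mor l) hE.
Qed.

Lemma conj_inv_sum n (U : 'M[isys GG N]_n) m (W : 'M[isys GG N]_m) (I : Type) (r : seq I)
   (X : I -> 'M[C]_(m, n)) : (forall i, conj_inv U W (X i)) -> conj_inv U W (\sum_(i <- r) X i).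
Proof.
move=> h; elim/big_rec: _ => [|i Y _ hY].
  by rewrite /conj_inv trmx0 scalmx0 mulmx0 mul0mx.
by rewrite /conj_inv raddfD scalmxD mulmxDr mulmxDl h hY.
Qed.

Lemma br_FresE : K = sumQ (fun q => br_F D q).
Proof.
set K' := sumQ _.
have hK := br_FresP D p; have [pK _ trK] := hK; have [aK _] := pK; have uK := posdef_unit pK.
pose Kinv := sumQ (fun q => invmx (br_F D q)).
have pF (q : isys_dual GG N) : posdefmx (br_F D q) by have [] := hF q.
have K'i : K' *m Kinv = 1%:M.
  by rewrite /K' sumQ_mul -sumQ1; congr sumQ; apply: functional_extensionality_dep => q; rewrite mulmxV ?posdef_unit.
have iK' : Kinv *m K' = 1%:M.
  by rewrite /K' sumQ_mul -sumQ1; congr sumQ; apply: functional_extensionality_dep => q; rewrite mulVmx ?posdef_unit.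
have cK' : conj_inv V V K'.
  apply: conj_inv_sum => q; apply: conj_inv_sum => l.
  rewrite -{1}[br_S l]adjmxK; apply: conj_inv_pull (adjS_Mor l) (adjS_Mor l) _.
  by apply: Fmatrix_conj_inv; [have [_] := irr_unitary q | exact: hF].
pose T := invmx K *m K'; pose Ti := Kinv *m K.
have TE : Mor V V T := conj_inv_Mor res_rep_unitary hK cK'.
have K'E : K' = K *m T by rewrite mulmxA mulmxV // mul1mx.
have TTi : T *m Ti = 1%:M by rewrite /T /Ti -mulmxA (mulmxA K') K'i mul1mx mulVmx.
have TiT : Ti *m T = 1%:M by rewrite /T /Ti -mulmxA (mulmxA K) mulmxV // mul1mx.
have TiE : Mor V V Ti.
  exact: Mor_inv TE TTi TiT.
have TiD : Ti = Kinv *m K by [].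
clearbody T Ti.
have K'T : K' *m T = T *m K'.
  apply: eq_mulS => q l; apply: eq_Smul => q' l'.
  rewrite !mulmxA S_sumQ -!mulmxA sumQ_S !mulmxA.
  have [E|/eqP n] := eqVneq q q'.
    case: q' / E in l' *; have [c cE] := end_scalar l l' TE.
    by rewrite cE -!mulmxA (mulmxA _ T) cE mul_mx_scalar mul_scalar_mx.
  by rewrite end_scalar0 // -!mulmxA (mulmxA _ T) end_scalar0 // mulmx0 mul0mx.
have KT : K *m T = T *m K.
  by rewrite -[LHS]mulmx1 -[RHS]mulmx1 -TTi !mulmxA -K'E K'T -(mulmxA T K) -K'E.
have KTi : K *m Ti = Ti *m K.
  by rewrite -[LHS]mul1mx -TiT -mulmxA (mulmxA T) -KT -!mulmxA TTi mulmx1.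
have iKTi : invmx K *m Ti = Kinv.
  have -> : invmx K *m Ti = Ti *m invmx K.
    by rewrite -[LHS]mulmx1 -(mulmxV uK) mulmxA -(mulmxA _ Ti) -KTi mulmxA mulVmx // mul1mx.
  by rewrite TiD -mulmxA mulmxV // mulmx1.
have tr' E : Mor V V E -> \tr (K' *m E) = \tr (Kinv *m E).
  move=> hE; rewrite !tr_sumQ; apply: eq_bigr => q _; apply: eq_bigr => l _.
  have [c ->] := end_scalar l l hE; rewrite !mul_mx_scalar !linearZ /=; congr (_ * _).
  have [_ _ h] := hF q; have := h 1%:M; rewrite !mulmx1; apply.
  by rewrite /Mor /= scalmx1 mul1mx mulmx1.
have T0 : T - Ti = 0.
  apply: (mxtrace_posdef_eq0 (posdef_inv pK)).
  have hA : Mor V V (adjmx (T - Ti)).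
    apply: Mor_adj; try exact: res_rep_unitary.
    rewrite /Mor /= scalmxD scalmxN mulmxDl mulmxDr mulNmx mulmxN.
    by rewrite (TE : _ = _) (TiE : _ = _).
  rewrite mulmxA mulmxBr iKTi mulmxBl raddfB /= -mulmxA -trK; last exact: MorM hA TE.
  by rewrite mulmxA -K'E tr' // subrr.
have TT : T *m T = 1%:M by move/eqP: T0; rewrite subr_eq0 => /eqP {2}->.
have aK' : adjmx K' = K'.
  rewrite /K' /sumQ adjmx_sum; apply: eq_bigr => q _; rewrite adjmx_sum; apply: eq_bigr => l _.
  by rewrite !adjmxM adjmxK (pF q).1 mulmxA.
have aT : adjmx T = T.
  have := aK'; rewrite K'E adjmxM aK KT => h.
  by rewrite -[LHS]mulmx1 -(mulmxV uK) mulmxA h -mulmxA mulmxV // mulmx1.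
have q0 : 1%:M - T = 0.
  apply: (posdef_mul_eq0 pK) => j; set q := 1%:M - T.
  have K'q : K' *m q = - (K *m q).
    by rewrite K'E -mulmxA -mulmxN /q mulmxBr mulmx1 TT opprB.
  have ge1 := posdef_ge0 q j pK.
  have ge2 : 0 <= (adjmx q *m K' *m q) j j.
    rewrite /K' /sumQ mulmx_sumr mulmx_suml summxE sumr_ge0 // => x _.
    rewrite mulmx_sumr mulmx_suml summxE sumr_ge0 // => l _.
    have -> : adjmx q *m (br_S l *m br_F D x *m adjmx (br_S l)) *m q =
      adjmx (adjmx (br_S l) *m q) *m br_F D x *m (adjmx (br_S l) *m q).
      by rewrite adjmxM adjmxK !mulmxA.
    exact: posdef_ge0.
  rewrite -mulmxA K'q mulmxN mulmxA mxE oppr_ge0 in ge2.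
  by apply/le_anti; rewrite ge1 ge2.
by rewrite K'E; move/eqP: q0; rewrite subr_eq0 => /eqP <-; rewrite mulmx1.
Qed.

Lemma br_FS q (l : 'I_(br_mult D q p)) :
  br_F D p *m br_S l = (br_weight l)%:C%C *: (br_S l *m br_F D q).
Proof.
have [FE _] := br_W_F D p; rewrite FE -mulmxA br_FresE sumQ_S mulmxA.
rewrite br_W_sum (br_bigE (fun q l => (br_weight l)%:C%C *: (br_S l *m adjmx (br_S l)))).
have qQ : q \in Q by rewrite br_suppP; case: l => ? ; exact: leq_ltn_trans.
rewrite mulmx_suml (bigD1_seq q) ?br_supp_uniq //= mulmx_suml (bigD1 l) //=.
rewrite -scalemxAl -mulmxA br_orth eqxx mulmx1 [X in _ + X + _]big1 ?addr0; last first.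
  by move=> l' ll'; rewrite -scalemxAl -mulmxA br_orth (negbTE ll') raddf0 mulmx0 scaler0.
rewrite big1 ?addr0 ?scalemxAl // => q' qq'; rewrite mulmx_suml big1 // => l' _.
by rewrite -scalemxAl -mulmxA br_neq ?mulmx0 ?scaler0 //; apply/eqP.
Qed.

Definition kap (q : isys_dual GG N) : R := \sum_(l < br_mult D q p) br_weight l.

Lemma tr_F_Thmap (x : matfamily (isys_dual GG N)) :
  \tr (br_F D p *m Thmap D x p) = \sum_(q <- Q) (kap q)%:C%C * \tr (br_F D q *m x q).
Proof.
rewrite /Thmap mulmx_sumr raddf_sum; apply: eq_bigr => q _.
rewrite mulmx_sumr raddf_sum /kap rc_sum mulr_suml; apply: eq_bigr => l _ /=.
rewrite !mulmxA br_FS -!scalemxAl linearZ /= -mulmxA mxtrace_mulC -!mulmxA; congr (_ * _).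
by rewrite (mulmxA (adjmx _)) br_orth eqxx mul1mx mxtrace_mulC.
Qed.

End RestrictedF.

(** * Central measures on a weighted branching graph *)

Section RealProbability.
Variables (R : realType) (d : measure_display) (T : measurableType d) (P : probability T R).
Implicit Types A B : set T.

Definition pr A : R := fine (P A).

Lemma prE A : measurable A -> P A = (pr A)%:E.
Proof. by move=> mA; rewrite /pr fineK // fin_num_measure. Qed.

Lemma pr_ge0 A : 0 <= pr A.
Proof. exact: fine_ge0. Qed.

Lemma pr_setT : pr setT = 1.
Proof. by rewrite /pr probability_setT. Qed.

Lemma pr_set0 : pr set0 = 0.
Proof. by rewrite /pr measure0. Qed.

Lemma pr_le A B : measurable A -> measurable B -> A `<=` B -> pr A <= pr B.
Proof.
move=> mA mB AB; rewrite -lee_fin -!prE //.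
by apply: le_measure => //; rewrite inE.
Qed.

Lemma pr_le1 A : measurable A -> pr A <= 1.
Proof. by move=> mA; rewrite -pr_setT; exact: pr_le. Qed.

Lemma prU A B : measurable A -> measurable B -> A `&` B = set0 ->
  pr (A `|` B) = pr A + pr B.
Proof.
move=> mA mB AB; apply: EFin_inj; rewrite EFinD -!prE ?measureU //.
exact: measurableU.
Qed.

Lemma pr_split A B : measurable A -> measurable B ->
  pr A = pr (A `&` B) + pr (A `\` B).
Proof.
move=> mA mB; rewrite -prU; [|exact: measurableI|exact: measurableD|].
- by congr pr; apply/seteqP; split => x; [move=> Ax; case: (pselect (B x)); [left|right] | case=> -[]].
- by apply/seteqP; split => // x [[_ Bx] [_]].
Qed.

Lemma pr_setC A : measurable A -> pr (~` A) = 1 - pr A.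
Proof.
by move=> mA; rewrite -pr_setT (pr_split measurableT mA) setTI -setTD addrC addKr.
Qed.

Lemma measurable_exists_in (I : choiceType) (s : seq I) (F : I -> set T) :
  (forall i, measurable (F i)) -> measurable [set x | exists2 i, i \in s & F i x].
Proof.
move=> mF; have -> : [set x | exists2 i, i \in s & F i x] = \bigcup_(i in [set` s]) F i.
  by apply/seteqP; split => x [j]; exists j.
by apply: fin_bigcup_measurable.
Qed.

Lemma pr_sum (I : choiceType) (s : seq I) (F : I -> set T) A :
  measurable A -> (forall i, measurable (F i)) -> uniq s ->
  {in s &, forall i j, forall x, F i x -> F j x -> i = j} ->
  pr (A `&` [set x | exists2 i, i \in s & F i x]) = \sum_(i <- s) pr (A `&` F i).
Proof.
move=> mA mF; elim: s => [_ _|i s IH /= /andP[ns us] dj].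
  rewrite big_nil -pr_set0; congr pr.
  by apply/seteqP; split => // x [_ []].
rewrite big_cons -IH //; last by move=> a b sa sb; apply: dj; rewrite inE ?sa ?sb orbT.
rewrite -prU.
- congr pr; apply/seteqP; split=> x.
    case=> Ax [j]; rewrite inE => /orP[/eqP ->|js] Fj; [by left | by right; split=> //; exists j].
  case=> [[Ax Fx]|[Ax [j js Fj]]]; split=> //; first by exists i; rewrite // inE eqxx.
  by exists j => //; rewrite inE js orbT.
- exact: measurableI.
- by apply: measurableI => //; exact: measurable_exists_in.
- apply/seteqP; split=> // x [[_ Fi] [_ [j js Fj]]].
  by rewrite (dj _ _ _ _ _ Fi Fj) ?js ?inE ?eqxx ?js ?orbT in ns.
Qed.

Lemma pr_cover (J : choiceType) (F : J -> set T) B (e : R) :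
  countable [set: J] -> (forall i, measurable (F i)) -> measurable B ->
  (forall x, B x -> exists i, F i x) -> 0 < e ->
  exists s : seq J, uniq s /\ forall s' : seq J, {subset s <= s'} ->
    pr (B `\` [set x | exists2 i, i \in s' & F i x]) < e.
Proof.
move=> /countable_injP[f finj] mF mB BF e0.
pose G n := B `\` \bigcup_(i in [set i | (f i < n)%N]) F i.
have fin n : finite_set [set i | (f i < n)%N].
  have -> : [set i | (f i < n)%N] = [set: J] `&` f @^-1` `I_n by apply/seteqP; split => i //= [].
  by rewrite setTI; apply: finite_preimage => // ? ? _ _; apply: finj; rewrite inE.
have mG n : measurable (G n) by apply: measurableD => //; apply: fin_bigcup_measurable.
have capG : \bigcap_n G n = set0.
  apply/seteqP; split=> // x Gx; have [Bx _] := Gx 0%N I.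
  have [i Fi] := BF _ Bx; have [_ []] := Gx (f i).+1 I; exists i => //=.
have : P \o G @ \oo --> P (\bigcap_n G n).
  apply: nonincreasing_cvg_mu => //.
  - by rewrite ltey_eq fin_num_measure.
  - by rewrite capG.
  - move=> m n mn; apply/subsetPset => x [Bx nx]; split=> // -[i /= im Fi].
    by apply: nx; exists i => //=; exact: leq_trans im mn.
rewrite capG measure0 => cv.
have /fine_cvgP[_ /cvgrPdist_lt/(_ e e0)[n _ hn]] := cv.
exists (fset_set [set i | (f i < n)%N]); split; first exact: fset_uniq.
move=> s' ss'.
apply: le_lt_trans (_ : pr (G n) < e); last first.
  by have := hn n (leqnn n); rewrite sub0r normrN ger0_norm //; exact: pr_ge0.
apply: pr_le => //.
  by apply: measurableD => //; exact: measurable_exists_in.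
move=> x [Bx nx]; split=> // -[i /= im Fi]; apply: nx; exists i => //; apply: ss'.
by rewrite in_fset_set // inE.
Qed.

End RealProbability.

Section Graph.
Variables (R : realType) (B : wgraph R).

Definition wgraph_regular : Prop :=
  [/\ forall e : edge B, level (tgt e) = (level (src e)).+1,
      forall e : edge B, 0 < weight e,
      forall v : vertex B, finite_set [set e : edge B | tgt e = v],
      forall x y : vertex B, level x = 0%N -> level y = 0%N -> x = y &
      [/\ countable [set: edge B], countable [set: vertex B] &
      forall v : vertex B, exists t, fin_paths v t]].

Hypothesis hB : wgraph_regular.

Lemma level_tgt (e : edge B) : level (tgt e) = (level (src e)).+1.
Proof. by case: hB. Qed.
Lemma weight_gt0 (e : edge B) : 0 < weight e.
Proof. by case: hB. Qed.
Lemma root_uniq (x y : vertex B) : level x = 0%N -> level y = 0%N -> x = y.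
Proof. by case: hB => _ _ _ h _; exact: h. Qed.

Lemma path_weight_gt0 (t : seq (edge B)) : 0 < path_weight t.
Proof. by rewrite /path_weight; apply: prodr_gt0 => e _; exact: weight_gt0. Qed.

Lemma path_weight_rcons (t : seq (edge B)) e : path_weight (rcons t e) = path_weight t * weight e.
Proof. by rewrite /path_weight -cats1 big_cat big_seq1. Qed.

Lemma walk_rcons (x : vertex B) t e v : walk x (rcons t e) v <-> walk x t (src e) /\ tgt e = v.
Proof.
elim: t x => [|a t IH] x /=; first by split=> -[-> ->].
by rewrite IH; split => [[-> [h ->]]|[[-> h] ->]].
Qed.

Lemma fin_paths_rcons t e (v : vertex B) :
  fin_paths v (rcons t e) <-> fin_paths (src e) t /\ tgt e = v.
Proof.
split=> [[x x0 /walk_rcons[h ev]]|[[x x0 h] ev]]; first by split=> //; exists x.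
by exists x => //; apply/walk_rcons.
Qed.

Lemma fin_paths_size (v : vertex B) t : fin_paths v t -> size t = level v.
Proof.
elim/last_ind: t v => [|t e IH] v; first by move=> [x x0 <-].
by move=> /fin_paths_rcons[/IH h <-]; rewrite size_rcons h level_tgt.
Qed.

Lemma fin_paths_nil (v : vertex B) : level v = 0%N -> fin_paths v [::].
Proof. by exists v. Qed.

Lemma fin_paths_finite (v : vertex B) : finite_set (fin_paths v).
Proof.
move: {2}(level v) (erefl (level v)) => n; elim: n v => [|n IH] v lv.
  apply: sub_finite_set (finite_set1 [::]) => t /fin_paths_size; rewrite lv.
  by case: t.
have [_ _ /(_ v) fv _ _] := hB.
have -> : fin_paths v = \bigcup_(e in [set e | tgt e = v]) ((fun t => rcons t e) @` fin_paths (src e)).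
  apply/seteqP; split=> t.
    elim/last_ind: t => [/fin_paths_size|t e _ /fin_paths_rcons[h ev]]; first by rewrite lv.
    by exists e => //; exists t.
  by move=> [e /= ev [t' h <-]]; apply/fin_paths_rcons.
apply: bigcup_finite => // e /= ev; apply: finite_image; apply: IH.
by have := level_tgt e; rewrite ev lv => -[].
Qed.

Definition fps (v : vertex B) : seq (seq (edge B)) := fset_set (fin_paths v).
Definition preds (v : vertex B) : seq (edge B) := fset_set [set e : edge B | tgt e = v].

Lemma mem_fps v t : t \in fps v <-> fin_paths v t.
Proof.
rewrite /fps in_fset_set; last exact: fin_paths_finite.
by split=> [/set_mem|/mem_set].
Qed.

Lemma mem_preds v e : e \in preds v <-> tgt e = v.
Proof.
rewrite /preds in_fset_set; last by case: hB.
by split=> [/set_mem|/mem_set].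
Qed.

Lemma fps_uniq v : uniq (fps v). Proof. exact: fset_uniq. Qed.
Lemma preds_uniq v : uniq (preds v). Proof. exact: fset_uniq. Qed.

Lemma fps_sum0 (V : nmodType) (f : seq (edge B) -> V) v : level v = 0%N ->
  \sum_(t <- fps v) f t = f [::].
Proof.
move=> lv; have -> : \sum_(t <- fps v) f t = \sum_(t <- [:: [::]]) f t.
  apply: perm_big; apply: uniq_perm => //; first exact: fps_uniq.
  move=> t; rewrite inE; apply/idP/eqP => [/mem_fps/fin_paths_size|->].
    by rewrite lv; case: t.
  by apply/mem_fps; exact: fin_paths_nil.
by rewrite big_seq1.
Qed.

Lemma fps_sumS (V : nmodType) (f : seq (edge B) -> V) v : (0 < level v)%N ->
  \sum_(t <- fps v) f t = \sum_(e <- preds v) \sum_(t <- fps (src e)) f (rcons t e).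
Proof.
move=> lv; pose l := [seq rcons t e | e <- preds v, t <- fps (src e)].
have -> : \sum_(t <- fps v) f t = \sum_(t <- l) f t.
  apply: perm_big; apply: uniq_perm; first exact: fps_uniq.
    apply: allpairs_uniq_dep; first exact: preds_uniq.
      by move=> *; exact: fps_uniq.
    by move=> [e t] [e' t'] _ _ /= /rcons_inj[-> ->].
  move=> t; apply/idP/allpairsPdep => [/mem_fps|[e [t' [/mem_preds he /mem_fps ht ->]]]].
    elim/last_ind: t => [/fin_paths_size /= h|t e _ /fin_paths_rcons[h ev]].
      by rewrite -h in lv.
    by exists e, t; split=> //; [apply/mem_preds | apply/mem_fps].
  by apply/mem_fps/fin_paths_rcons.
by rewrite big_allpairs_dep.
Qed.

Lemma wdimE v : wdim v = \sum_(t <- fps v) path_weight t.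
Proof. by rewrite /wdim fsbig_finite //; exact: fin_paths_finite. Qed.

Lemma fin_paths_exists (v : vertex B) : exists t, fin_paths v t.
Proof. by case: hB => _ _ _ _ []. Qed.

Lemma wdim_gt0 (v : vertex B) : 0 < wdim v.
Proof.
rewrite wdimE; have [t /mem_fps ht] := fin_paths_exists v.
rewrite (bigD1_seq t) ?fps_uniq //= ltr_wpDr ?path_weight_gt0 //.
by apply: sumr_ge0 => s _; rewrite ltW // path_weight_gt0.
Qed.

Lemma wdim_root (v : vertex B) : level v = 0%N -> wdim v = 1.
Proof. by move=> lv; rewrite wdimE fps_sum0 // /path_weight big_nil. Qed.

Lemma inf_level (w : inf_path B) n : level (src (sval w n)) = n.
Proof.
case: w => w [w0 wS] /=; elim: n => // n IH.
by rewrite -wS level_tgt IH.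
Qed.

Lemma inf_tgt (w : inf_path B) n : tgt (sval w n) = src (sval w n.+1).
Proof. by case: w => w []. Qed.

Lemma initialS n (w : nat -> edge B) : initial n.+1 w = rcons (initial n w) (w n).
Proof. by rewrite /initial mkseqS. Qed.

Lemma size_initial n (w : nat -> edge B) : size (initial n w) = n.
Proof. exact: size_mkseq. Qed.

Lemma initial_path n (w : inf_path B) : fin_paths (src (sval w n)) (initial n (sval w)).
Proof.
elim: n => [|n IH]; first by apply: fin_paths_nil; exact: inf_level.
by rewrite initialS; apply/fin_paths_rcons; split=> //; exact: inf_tgt.
Qed.

Lemma fin_paths_fun v v' (t : seq (edge B)) : fin_paths v t -> fin_paths v' t -> v = v'.
Proof.
elim/last_ind: t => [[x x0 /= <-] [y y0 /= <-]|t e _ /fin_paths_rcons[_ <-] /fin_paths_rcons[_ <-] //].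
exact: root_uniq.
Qed.

Lemma cylinder_src v t (w : inf_path B) : fin_paths v t -> cylinder t w ->
  src (sval w (size t)) = v.
Proof.
move=> ht wt; apply: (@fin_paths_fun _ _ t) => //.
by have := initial_path (size t) w; rewrite wt.
Qed.

Lemma cylinder_rcons t e (w : inf_path B) :
  cylinder (rcons t e) w <-> cylinder t w /\ sval w (size t) = e.
Proof.
rewrite /cylinder /= size_rcons initialS; split=> [/rcons_inj[-> ->] //|[-> ->]//].
Qed.

Variable o : inf_path B.
Local Notation Om := (Omega o).

Lemma measurable_cylinder (t : seq (edge B)) : measurable (cylinder t : set Om).
Proof.
have [[w wt]|n] := pselect (exists w : Om, cylinder t w); last first.
  have -> : cylinder t = set0 :> set Om by apply/seteqP; split=> // w wt; apply: n; exists w.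
  exact: measurable0.
apply: sub_sigma_algebra; exists (src (sval w (size t))), t; split=> //.
by rewrite -{2}wt; exact: initial_path.
Qed.

(* Unlike [X_eq], this also makes sense at level 0, where it is everything. *)
Definition XE (v : vertex B) : set Om := [set w | src (sval w (level v)) = v].

Lemma X_eqE N v : (1 <= N)%N -> level v = N -> @X_eq R B N v = XE v :> set Om.
Proof.
case: N => // N _ lv; apply/seteqP; split => w; rewrite /X_eq /XE /passes /= lv inf_tgt //.
Qed.

Lemma XE_cyl v (w : Om) : XE v w <-> exists2 t, t \in fps v & cylinder t w.
Proof.
split=> [Xw|[t /mem_fps ht wt]].
  exists (initial (level v) (sval w)); last by rewrite /cylinder /= size_initial.
  by apply/mem_fps; rewrite -{1}Xw; exact: initial_path.
by rewrite /XE /= -(fin_paths_size ht) (cylinder_src ht wt).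
Qed.

Lemma XE_eq v : XE v = [set w | exists2 t, t \in fps v & cylinder t w].
Proof. by apply/seteqP; split=> w /XE_cyl. Qed.

Lemma measurable_XE v : measurable (XE v).
Proof. by rewrite XE_eq; apply: measurable_exists_in => t; exact: measurable_cylinder. Qed.

Lemma countable_vertex : countable [set: vertex B].
Proof. by case: hB => _ _ _ _ []. Qed.
Lemma countable_edge : countable [set: edge B].
Proof. by case: hB => _ _ _ _ []. Qed.

Lemma measurable_srcn n (S : set (vertex B)) : measurable [set w : Om | S (src (sval w n))].
Proof.
have -> : [set w : Om | S (src (sval w n))] =
    \bigcup_v (if `[< S v /\ level v = n >] then XE v else set0).
  apply/seteqP; split=> w /=.
    move=> Sw; exists (src (sval w n)) => //; rewrite inf_level asboolT //.
    by rewrite /XE /= inf_level.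
  by move=> [v _]; case: asboolP => // -[Sv lv]; rewrite /XE /= lv => ->.
apply: countable_bigcupT_measurable; first exact: countable_vertex.
by move=> v; case: ifP => _; [exact: measurable_XE | exact: measurable0].
Qed.

Lemma frakS_tail g : frakS g -> exists N, forall (w : inf_path B) n, (N <= n)%N ->
  sval (g w) n = sval w n.
Proof.
move=> [N _ hg]; exists N; elim: g / hg => //.
- move=> v gam g lv _ hg w n Nn; rewrite hg /act_perm; case: asboolP => // _.
  by rewrite ltnNge Nn.
- by move=> g h _ IHg _ IHh w n Nn /=; rewrite IHg // IHh.
- by move=> g h _ IHg gh hg w n Nn; rewrite -{2}(hg w) IHg.
Qed.

Definition shuffle_invariant (A : set Om) : Prop := forall g, frakS g -> g @^-1` A = A.

Lemma walk_nth (x : vertex B) t v e0 n : walk x t v -> (n < size t)%N ->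
  src (nth e0 t n) = if n is n'.+1 then tgt (nth e0 t n') else x.
Proof.
elim: t x n => // a t IH x [|n] /= [ax h] nt //.
by rewrite (IH _ _ h nt); case: n nt.
Qed.

Lemma walk_last (x : vertex B) t v e0 : walk x t v ->
  v = if size t is n.+1 then tgt (nth e0 t n) else x.
Proof. by elim: t x => //= a t IH x [_ /IH ->]; case: t {IH}. Qed.

Definition paste (t : seq (edge B)) (w : nat -> edge B) n : edge B :=
  if (n < size t)%N then nth (w n) t n else w n.

Lemma paste_path v t (w : inf_path B) : fin_paths v t -> src (sval w (level v)) = v ->
  is_inf_path (paste t (sval w)).
Proof.
move=> ht wv; have st := fin_paths_size ht; have [x x0 wt] := ht.
split.
  rewrite /paste; case: ltnP => h; last exact: inf_level.
  by rewrite (walk_nth _ wt h).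
move=> n; rewrite /paste; case: (ltnP n.+1 (size t)) => h.
  rewrite ltnW // (walk_nth _ wt h); congr tgt; exact/set_nth_default/ltnW.
case: ltnP => h'; last exact: inf_tgt.
have E : size t = n.+1 by apply/anti_leq; rewrite h h'.
have -> : src (sval w n.+1) = v by rewrite -E st.
by have := walk_last (sval w n) wt; rewrite E => <-.
Qed.

Lemma initial_paste t (w : nat -> edge B) : initial (size t) (paste t w) = t.
Proof.
case: t => [|a t]; first by rewrite /initial.
apply: (@eq_from_nth _ a); first by rewrite size_initial.
move=> i; rewrite size_initial => it; rewrite nth_mkseq // /paste it.
exact: set_nth_default.
Qed.

Lemma measurable_initial n (S : set (seq (edge B))) :
  measurable [set w : Om | S (initial n (sval w))].
Proof.
have -> : [set w : Om | S (initial n (sval w))] =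
   \bigcup_v [set w | exists2 t, t \in [seq t <- fps v | `[< S t /\ level v = n >]] & cylinder t w].
  apply/seteqP; split=> w /=.
    move=> Sw; exists (src (sval w n)) => //; exists (initial n (sval w)).
      rewrite mem_filter asboolT ?inf_level //=; apply/mem_fps; exact: initial_path.
    by rewrite /cylinder /= size_initial.
  move=> [v _ [t]]; rewrite mem_filter => /andP[/asboolP[St lv] /mem_fps ht].
  by rewrite /cylinder /= (fin_paths_size ht) lv => ->.
apply: countable_bigcupT_measurable; first exact: countable_vertex.
by move=> v; apply: measurable_exists_in => t; exact: measurable_cylinder.
Qed.

Lemma cylinder_ext m s (w w' : inf_path B) : (size s <= m)%N ->
  initial m (sval w) = initial m (sval w') -> cylinder s w -> cylinder s w'.
Proof.
move=> sm E <-; rewrite /cylinder /= size_initial.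
have tk (u : inf_path B) : initial (size s) (sval u) = take (size s) (initial m (sval u)).
  by rewrite /initial /mkseq -map_take take_iota (minn_idPl sm).
by rewrite !tk E.
Qed.

Lemma cyl_measure_unique (m1 m2 : {measure set Om -> \bar R}) : (m1 setT < +oo)%E ->
  (forall v t, fin_paths v t -> m1 (cylinder t : set Om) = m2 (cylinder t : set Om)) ->
  forall A, measurable A -> m1 A = m2 A.
Proof.
move=> fin h A mA; pose G := @cylinders R B `|` [set set0].
have [v0 lv0] : exists v : vertex B, level v = 0%N by exists (src (sval o 0%N)); exact: inf_level.
have GT : G setT.
  left; exists v0, [::]; split; first exact: fin_paths_nil.
  by apply/seteqP; split=> w.
have GA : <<s G >> A by apply: sub_sigma_algebra2 mA => C CC; left.
move: A GA {mA}; apply: (@g_sigma_algebra_measure_unique _ R Om G _ (fun=> setT) _ _ m1 m2) => //.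
- move=> C [[v [t [_ ->]]]|->]; [exact: measurable_cylinder | exact: measurable0].
- by rewrite bigcup_const //; exists 0%N.
- move=> C C' [[v [t [ht ->]]]|->]; last by rewrite set0I; right.
  case=> [[v' [t' [ht' ->]]]|->]; last by rewrite setI0; right.
  wlog tt' : t t' v v' ht ht' / (size t <= size t')%N.
    case: (leqP (size t) (size t')) => [h'|/ltnW h']; first by apply; eassumption.
    by move=> H; rewrite setIC; apply: H; eassumption.
  have [E|n] := pselect (exists w : inf_path B, cylinder t w /\ cylinder t' w); last first.
    by right; apply/seteqP; split=> // w [? ?]; apply: n; exists w.
  have [w [wt wt']] := E.
  left; exists v', t'; split=> //; apply/seteqP; split=> [u []//|u ut'].
  split=> //; apply: cylinder_ext tt' _ wt.
  by rewrite wt' ut'.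
- by move=> C [[v [t [ht ->]]]|->]; [exact: h ht | rewrite !measure0].
Qed.

Definition swap_paths (t t' : seq (edge B)) (s : seq (edge B)) : seq (edge B) :=
  if s == t then t' else if s == t' then t else s.

Section Swap.
Variables (v : vertex B) (t t' : seq (edge B)).
Hypotheses (ht : fin_paths v t) (ht' : fin_paths v t') (lv : (0 < level v)%N).
Let N := level v.
Let act (w : nat -> edge B) := act_perm N v (swap_paths t t') w.

Let passesE (w : inf_path B) : passes N v (sval w) <-> src (sval w N) = v.
Proof. by rewrite /passes /N; case: (level v) lv => // n _; rewrite inf_tgt. Qed.

Let swap_path s : fin_paths v s -> fin_paths v (swap_paths t t' s).
Proof. by rewrite /swap_paths; case: ifP => // _; case: ifP. Qed.

Let actE (w : inf_path B) : act (sval w) =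
  if `[< src (sval w N) = v >] then paste (swap_paths t t' (initial N (sval w))) (sval w)
  else sval w.
Proof.
rewrite /act /act_perm; case: asboolP => [/passesE h|h]; last first.
  by rewrite asboolF // => /passesE.
rewrite asboolT //; apply: functional_extensionality_dep => n.
rewrite /paste (fin_paths_size (v := v)) //; apply: swap_path.
by rewrite -{1}h; exact: initial_path.
Qed.

Let act_path (w : inf_path B) : is_inf_path (act (sval w)).
Proof.
rewrite actE; case: asboolP => h; last by case: w h.
apply: (@paste_path v) => //; apply: swap_path; rewrite -{1}h; exact: initial_path.
Qed.

Definition swap (w : Om) : Om := exist _ _ (act_path w).

Lemma swap_frakS : frakS swap.
Proof.
exists N => //; apply: (@FrakS_gen _ _ _ v (swap_paths t t')) => //.
split; first by move=> s; exact: swap_path.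
  have sK : involutive (swap_paths t t').
    move=> s; rewrite /swap_paths; case: (eqVneq s t) => [->|n1].
      by case: (eqVneq t' t) => [->|_] //; rewrite eqxx.
    by case: (eqVneq s t') => [->|n2]; rewrite ?eqxx // (negbTE n1) (negbTE n2).
  by move=> s s' _ _; exact: (inv_inj sK).
move=> s hs; exists (swap_paths t t' s); first exact: swap_path.
rewrite /swap_paths; case: (eqVneq s t) => [->|n1]; first by case: eqVneq => [->|_] //; rewrite eqxx.
by case: (eqVneq s t') => [->|n2]; rewrite ?eqxx // (negbTE n1) (negbTE n2).
Qed.

Lemma swap_cylinder (w : Om) : cylinder t w -> sval (swap w) = paste t' (sval w).
Proof.
move=> wt; rewrite /= actE asboolT; last first.
  by rewrite /N -(fin_paths_size ht) (cylinder_src ht wt).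
congr paste; have := wt; rewrite /cylinder /= (fin_paths_size ht) -/N => ->.
by rewrite /swap_paths eqxx.
Qed.

Lemma measurable_swap : measurable_fun setT swap.
Proof.
apply: (@measurability _ _ Om Om setT swap (@cylinders R B)) => // _ [_ [u [s [_ ->]]] <-].
rewrite setTI; pose M := maxn (size s) N.
have -> : swap @^-1` (cylinder s) =
   [set w : Om | (fun r => exists2 w' : Om, cylinder s (swap w') & initial M (sval w') = r) (initial M (sval w))].
  apply/seteqP; split=> w /=; first by exists w.
  move=> [w' h E]; apply: cylinder_ext (leq_maxl _ N) _ h.
  have EN : initial N (sval w') = initial N (sval w).
    have tk (z : inf_path B) : initial N (sval z) = take N (initial M (sval z)).
      by rewrite /initial /mkseq -map_take take_iota (minn_idPl (leq_maxr _ _)).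
    by rewrite !tk E.
  have Ei i : (i < M)%N -> sval w' i = sval w i.
    by move=> iM; have := congr1 (fun l => nth (sval w 0%N) l i) E; rewrite !nth_mkseq.
  rewrite -/M; apply/eq_in_map => i; rewrite mem_iota add0n => /andP[_ iM] /=.
  rewrite !actE EN; have -> : src (sval w' N) = src (sval w N).
    by apply: (fin_paths_fun (initial_path N w')); rewrite EN; exact: initial_path.
  case: asboolP => _; last exact: Ei.
  by rewrite /paste Ei.
exact: (@measurable_initial M (fun r => exists2 w' : Om, cylinder s (swap w') & initial M (sval w') = r)).
Qed.

End Swap.

Lemma initial_cat n m (w : nat -> edge B) :
  initial (n + m) w = initial n w ++ initial m (fun i => w (n + i)%N).
Proof.
elim: m => [|m IH]; first by rewrite addn0 cats0.
by rewrite addnS !initialS IH rcons_cat.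
Qed.

Lemma walk_cat (x : vertex B) t s u : walk x (t ++ s) u <-> exists2 v, walk x t v & walk v s u.
Proof.
elim: t x => [|a t IH] x /=; first by split=> [h|[v -> h]//]; exists x.
split=> [[-> /IH[v h h']]|[v [-> h] h']]; first by exists v.
by split=> //; apply/IH; exists v.
Qed.

Lemma fin_paths_cat (v u : vertex B) t t' s : fin_paths v t -> fin_paths v t' ->
  fin_paths u (t ++ s) -> fin_paths u (t' ++ s).
Proof.
move=> [x x0 xt] [y y0 yt] [z z0 /walk_cat[v' zt h]].
have E : v' = v by apply: (@fin_paths_fun _ _ t); [exists z|exists x].
by exists y => //; apply/walk_cat; exists v => //; rewrite -E.
Qed.

Lemma cylinder_cat t s (w : inf_path B) : cylinder (t ++ s) w <->
  cylinder t w /\ initial (size s) (fun i => sval w (size t + i)%N) = s.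
Proof.
rewrite /cylinder /= size_cat initial_cat; split.
  by move/eqP; rewrite eqseq_cat ?size_initial // => /andP[/eqP -> /eqP ->].
by move=> [-> ->].
Qed.

Section Central.
Variable P : probability Om R.
Hypothesis cP : central P.
Local Notation pr := (pr P).

Lemma centralE v t : fin_paths v t ->
  pr (cylinder t) = path_weight t * (pr (XE v) / wdim v).
Proof.
move=> ht; have [l0|l0] := posnP (level v).
  have XT : XE v = setT.
    by apply/seteqP; split=> // w _; rewrite /XE /= l0; apply: root_uniq => //; exact: inf_level.
  have t0 : t = [::] by apply/eqP; rewrite -size_eq0 (fin_paths_size ht) l0.
  have -> : cylinder t = setT :> set Om by rewrite t0; apply/seteqP; split.
  by rewrite XT pr_setT wdim_root // t0 /path_weight big_nil mul1r divr1.
have := cP l0 erefl ht; rewrite (X_eqE l0 erefl) -!/(pr _) => <-.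
by rewrite mulrC divfK // gt_eqF // path_weight_gt0.
Qed.

Lemma invariant_swap (A : set Om) v t t' : measurable A -> shuffle_invariant A ->
  fin_paths v t -> fin_paths v t' ->
  pr (A `&` cylinder t) / path_weight t = pr (A `&` cylinder t') / path_weight t'.
Proof.
move=> mA iA ht ht'; have [l0|l0] := posnP (level v).
  have z s : fin_paths v s -> s = [::].
    by move=> hs; apply/eqP; rewrite -size_eq0 (fin_paths_size hs) l0.
  by rewrite (z _ ht) (z _ ht').
have [g [mg gE gS]] : exists g : Om -> Om, [/\ measurable_fun setT g,
    forall w : Om, cylinder t w -> sval (g w) = paste t' (sval w) & frakS g].
  exists (swap ht ht' l0); split; [exact: measurable_swap|exact: swap_cylinder|exact: swap_frakS].
have c_ge0 : 0 <= path_weight t / path_weight t' by rewrite divr_ge0 ?ltW ?path_weight_gt0.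
pose m1 : {measure set Om -> \bar R} := measure_function_pushforward__canonical__measure_function_Measure
  [the {measure set Om -> \bar R} of mrestr P (measurable_cylinder t)] mg.
pose m2 : {measure set Om -> \bar R} := [the {measure set Om -> \bar R} of mscale (NngNum c_ge0)
  [the {measure set Om -> \bar R} of mrestr P (measurable_cylinder t')]].
have m1E C : m1 C = P (g @^-1` C `&` cylinder t) by [].
have m2E C : m2 C = ((path_weight t / path_weight t')%:E * P (C `&` cylinder t'))%E by [].
have st : size t' = size t by rewrite (fin_paths_size ht) (fin_paths_size ht').
have gt' (w : Om) : cylinder t w -> cylinder t' (g w).
  by move=> wt; rewrite /cylinder /= (gE w wt) initial_paste.
have w0 (s : seq (edge B)) : path_weight s != 0 :> R by rewrite gt_eqF // path_weight_gt0.
have catE r (w : Om) : cylinder t w -> cylinder (t' ++ r) (g w) <-> cylinder (t ++ r) w.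
  move=> wt; rewrite !cylinder_cat.
  have -> : (fun i => sval (g w) (size t' + i)%N) = (fun i => sval w (size t + i)%N).
    apply: functional_extensionality_dep => i.
    by rewrite (gE w wt) /paste st ltnNge leq_addr.
  by split=> -[_ ?]; split=> //; exact: gt'.
have h : forall C, measurable C -> m1 C = m2 C.
  apply: cyl_measure_unique.
    rewrite m1E preimage_setT setTI ltey_eq fin_num_measure //; exact: measurable_cylinder.
  move=> u s hs; rewrite m1E m2E.
  have [ss|ss] := leqP (size t') (size s).
    have [E|n] := pselect (take (size t') s = t').
      pose r := drop (size t') s; have sE : s = t' ++ r by rewrite -{1}(cat_take_drop (size t') s) E.
      have -> : g @^-1` cylinder s `&` cylinder t = cylinder (t ++ r) :> set Om.
        apply/seteqP; split=> w.
          by move=> [ws wt]; apply/catE => //; rewrite -sE.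
        by move=> wr; have /cylinder_cat[wt _] := wr; split=> //; rewrite /preimage /= sE; apply/catE.
      have -> : cylinder s `&` cylinder t' = cylinder (t' ++ r) :> set Om.
        rewrite sE; apply/seteqP; split=> w; first by case.
        by move=> wr; split=> //; have /cylinder_cat[] := wr.
      rewrite !prE; try exact: measurable_cylinder.
      rewrite sE in hs; have hs' := fin_paths_cat ht' ht hs.
      rewrite -EFinM (centralE hs) (centralE hs'); congr EFin; rewrite [RHS]mulrA; congr (_ * _).
      by rewrite /path_weight !big_cat /= -/(path_weight t) -/(path_weight t') mulrA divfK.
    have -> : g @^-1` cylinder s `&` cylinder t = set0 :> set Om.
      apply/seteqP; split=> // w [ws wt]; apply: n; have := gt' w wt.
      have := ws; rewrite /preimage /cylinder /= => <-; rewrite /initial /mkseq -map_take take_iota.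
      by rewrite (minn_idPl ss).
    have -> : cylinder s `&` cylinder t' = set0 :> set Om.
      apply/seteqP; split=> // w [ws wt]; apply: n; have := wt.
      have := ws; rewrite /cylinder /= => <-; rewrite /initial /mkseq -map_take take_iota.
      by rewrite (minn_idPl ss).
    by rewrite !measure0 mule0.
  have sub (w : Om) : cylinder t' w -> (cylinder s w <-> take (size s) t' = s).
    move=> <-; rewrite /cylinder /= /initial /mkseq -map_take take_iota (minn_idPl _) //.
    exact: ltnW.
  have [E|n] := pselect (take (size s) t' = s).
    have -> : g @^-1` cylinder s `&` cylinder t = cylinder t :> set Om.
      apply/seteqP; split=> w; first by case.
      by move=> wt; split=> //; apply/sub => //; exact: gt'.
    have -> : cylinder s `&` cylinder t' = cylinder t' :> set Om.
      apply/seteqP; split=> w; first by case.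
      by move=> wt; split=> //; apply/sub.
    rewrite !prE; try exact: measurable_cylinder.
    by rewrite -EFinM (centralE ht) (centralE ht'); congr EFin; rewrite [RHS]mulrA divfK.
  have -> : g @^-1` cylinder s `&` cylinder t = set0 :> set Om.
    by apply/seteqP; split=> // w [ws wt]; apply: n; apply/(sub (g w)) => //; exact: gt'.
  have -> : cylinder s `&` cylinder t' = set0 :> set Om.
    by apply/seteqP; split=> // w [ws wt]; apply: n; apply/(sub w).
  by rewrite !measure0 mule0.
have := h A mA; rewrite m1E m2E.
have -> : g @^-1` A = A by apply: iA.
rewrite !prE; try by apply: measurableI => //; exact: measurable_cylinder.
rewrite -EFinM => -[->]; by rewrite mulrAC (mulrAC (path_weight t)) divff // mul1r mulrC.
Qed.

Lemma invariant_central (A : set Om) v t : measurable A -> shuffle_invariant A -> fin_paths v t ->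
  pr (A `&` cylinder t) = path_weight t * (pr (A `&` XE v) / wdim v).
Proof.
move=> mA iA ht.
have w0 (s : seq (edge B)) : path_weight s != 0 :> R by rewrite gt_eqF // path_weight_gt0.
have -> : pr (A `&` XE v) = \sum_(s <- fps v) pr (A `&` cylinder s).
  rewrite XE_eq pr_sum // => [s||s s' ws ws']; [exact: measurable_cylinder|exact: fps_uniq|].
  by move: ws ws' => /mem_fps hs /mem_fps hs' w; rewrite /cylinder /= (fin_paths_size hs) (fin_paths_size hs') => -> .
rewrite wdimE.
have E s : s \in fps v -> pr (A `&` cylinder s) = path_weight s * (pr (A `&` cylinder t) / path_weight t).
  by move=> /mem_fps hs; rewrite (invariant_swap mA iA ht hs) mulrC divfK.
rewrite big_seq (eq_bigr (fun s => path_weight s * (pr (A `&` cylinder t) / path_weight t))) //.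
rewrite -big_seq -mulr_suml -wdimE mulrAC divff ?gt_eqF ?wdim_gt0 // mul1r.
by rewrite mulrC divfK.
Qed.
End Central.

End Graph.

Section ErgodicMeasures.
Variables (R : realType) (B : wgraph R) (hB : wgraph_regular B) (o : inf_path B).
Local Notation Om := (Omega o).
Local Notation cyl := (fun t => cylinder t : set Om).

Let mcyl t : measurable (cyl t).
Proof. exact: measurable_cylinder. Qed.

Let mXE (v : vertex B) : measurable (XE v : set Om).
Proof. exact: measurable_XE. Qed.

Section OneMeasure.
Variable P : probability Om R.
Hypothesis cP : central P.
Local Notation pr := (pr P).
Local Notation XE := (@XE R B o).

Lemma children_disjoint t (w : Om) (e e' : edge B) :
  cylinder (rcons t e) w -> cylinder (rcons t e') w -> e = e'.
Proof. by move=> /cylinder_rcons[_ <-] /cylinder_rcons[_ <-]. Qed.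

Lemma children_le (A : set Om) t (es : seq (edge B)) : measurable A -> uniq es ->
  \sum_(e <- es) pr (A `&` cyl (rcons t e)) <= pr (A `&` cyl t).
Proof.
move=> mA ues; rewrite -pr_sum //; first last.
- by move=> e e' _ _ w; exact: children_disjoint.
apply: pr_le.
- apply: measurableI => //; apply: measurable_exists_in => e; exact: mcyl.
- by apply: measurableI => //; exact: mcyl.
by move=> w [Aw [e _ /cylinder_rcons[]]].
Qed.

Lemma children_ge (A : set Om) v t (e : R) : measurable A -> fin_paths v t -> 0 < e ->
  exists es : seq (edge B), [/\ uniq es, forall x, x \in es -> src x = v &
    pr (A `&` cyl t) <= \sum_(x <- es) pr (A `&` cyl (rcons t x)) + e].
Proof.
move=> mA ht e0; have mAt : measurable (A `&` cyl t) by apply: measurableI => //; exact: mcyl.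
have mF x : measurable (cyl (rcons t x)) by exact: mcyl.
have [w|s [us hs]] := @pr_cover _ _ _ P _ (fun x => cyl (rcons t x)) _ _ (countable_edge hB) mF mAt _ e0.
  by move=> [_ wt]; exists (sval w (size t)); apply/cylinder_rcons.
pose es := [seq x <- s | src x == v].
have ues : uniq es by rewrite filter_uniq.
exists es; split=> //; first by move=> x; rewrite mem_filter => /andP[/eqP].
rewrite -pr_sum //; last by move=> x x' _ _ w; exact: children_disjoint.
have mU : measurable [set w : Om | exists2 x, x \in es & cylinder (rcons t x) w].
  exact: measurable_exists_in.
rewrite (pr_split P mAt mU); apply: lerD.
  by apply: pr_le; [exact: measurableI | exact: measurableI | move=> w [[? _] ?]].
apply/ltW; apply: le_lt_trans (hs s (fun x h => h)).
apply: pr_le; [exact: measurableD | apply: measurableD => //; exact: measurable_exists_in |].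
move=> w [[Aw wt] nw]; split=> // -[x xs wx]; apply: nw; exists x => //.
rewrite mem_filter xs andbT; apply/eqP; have [_ <-] := (cylinder_rcons t x w).1 wx.
exact: cylinder_src ht wt.
Qed.

Lemma XE_inj v v' (w : Om) : level v = level v' -> XE v w -> XE v' w -> v = v'.
Proof. by move=> l; rewrite /XE /= l => <- ->. Qed.

Lemma level_cover n (A : set Om) (e : R) : measurable A -> 0 < e ->
  exists J : seq (vertex B), [/\ uniq J, forall v, v \in J -> level v = n &
    forall J' : seq (vertex B), {subset J <= J'} -> pr (A `\` [set w | exists2 v, v \in J' & XE v w]) < e].
Proof.
move=> mA e0.
pose F v := if level v == n then XE v else set0.
have mF v : measurable (F v) by rewrite /F; case: ifP => _; [exact: mXE | exact: measurable0].
have [w _|s [us hs]] := pr_cover P (countable_vertex hB) mF mA _ e0.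
  by exists (src (sval w n)); rewrite /F inf_level // eqxx /XE /= inf_level.
pose J := [seq v <- s | level v == n]; exists J; split.
- by rewrite filter_uniq.
- by move=> v; rewrite mem_filter => /andP[/eqP].
move=> J' JJ'; apply: le_lt_trans (hs s (fun x h => h)); apply: pr_le.
- by apply: measurableD => //; apply: measurable_exists_in => v; exact: mXE.
- by apply: measurableD => //; exact: measurable_exists_in.
move=> w [Aw nw]; split=> // -[v vs]; rewrite /F; case: eqP => // lv Xw.
by apply: nw; exists v => //; apply: JJ'; rewrite mem_filter lv eqxx.
Qed.

Lemma XE_root v : level v = 0%N -> XE v = setT.
Proof.
move=> l0; apply/seteqP; split=> // w _.
by rewrite /XE /= l0; apply: (root_uniq hB) => //; exact: inf_level.
Qed.

Definition wharmonic (h : vertex B -> R) : Prop :=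
  (forall v (es : seq (edge B)), uniq es -> (forall e, e \in es -> src e = v) ->
     \sum_(e <- es) weight e * h (tgt e) <= h v) /\
  (forall v (d : R), 0 < d -> exists es : seq (edge B),
     [/\ uniq es, forall e, e \in es -> src e = v &
      h v <= \sum_(e <- es) weight e * h (tgt e) + d]).

Lemma invariant_harmonic (A : set Om) : measurable A -> shuffle_invariant A ->
  wharmonic (fun v => pr (A `&` XE v) / wdim v).
Proof.
move=> mA iA; set h := fun v => _.
have hE v t : fin_paths v t -> pr (A `&` cyl t) = path_weight t * h v.
  exact: invariant_central.
have hE' v t e : fin_paths v t -> src e = v ->
    pr (A `&` cyl (rcons t e)) = path_weight t * (weight e * h (tgt e)).
  move=> ht ev; rewrite (hE (tgt e)) ?path_weight_rcons ?mulrA //.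
  by apply/fin_paths_rcons; rewrite ev.
split=> [v es ues hes|v d d0]; have [t ht] := fin_paths_exists hB v; have wt0 := path_weight_gt0 hB t.
  rewrite -(ler_pM2l wt0) -hE // mulr_sumr.
  rewrite big_seq (eq_bigr (fun e => pr (A `&` cyl (rcons t e)))) -?big_seq; first exact: children_le.
  by move=> e /hes ev; rewrite (hE' v).
have [es [ues hes le]] := children_ge mA ht (mulr_gt0 wt0 d0).
exists es; split=> //; rewrite -(ler_pM2l wt0) -hE // mulrDr mulr_sumr.
rewrite big_seq (eq_bigr (fun e => pr (A `&` cyl (rcons t e)))) -?big_seq //.
by move=> e /hes ev; rewrite (hE' v).
Qed.

Section Comparison.
Variables (q : vertex B -> R) (K : R).
Hypothesis q_ge0 : forall v, 0 <= q v.
Hypothesis q_le : forall v, q v <= K * pr (XE v).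
Let h v := q v / wdim v.
Hypothesis hh : wharmonic h.
Variable a : R.
Hypothesis a0 : 0 < a.
Let S : set (vertex B) := [set v | a * pr (XE v) <= q v].
Let hit k : set Om := [set w | S (src (sval w k))].
Let hits n m : set Om := [set w | exists2 k, (n <= k <= n + m)%N & hit k w].

Let K0 : 0 <= K.
Proof.
have := le_trans (q_ge0 (src (sval o 0%N))) (q_le _).
by rewrite XE_root ?pr_setT ?mulr1 //; exact: inf_level.
Qed.

Let mhit k : measurable (hit k). Proof. exact: measurable_srcn. Qed.

Let mhits n m : measurable (hits n m).
Proof.
have -> : hits n m = [set w | exists2 k, k \in [seq k <- iota 0 (n + m).+1 | (n <= k)%N] & hit k w].
  apply/seteqP; split=> w [k hk wk]; exists k => //.
    by case/andP: hk => h1 h2; rewrite mem_filter h1 mem_iota add0n ltnS h2.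
  by move: hk; rewrite mem_filter mem_iota add0n ltnS.
exact: measurable_exists_in.
Qed.

Let cyl_hit v t n (w : Om) : fin_paths v t -> size t = n -> cylinder t w -> hit n w <-> S v.
Proof. by move=> ht st wt; rewrite /hit /= -st (cylinder_src hB ht wt). Qed.

Let scaleh t (es : seq (edge B)) :
  path_weight t * (\sum_(e <- es) weight e * h (tgt e)) =
  \sum_(e <- es) path_weight (rcons t e) * h (tgt e).
Proof. by rewrite mulr_sumr; apply: eq_bigr => e _; rewrite path_weight_rcons mulrA. Qed.

(* Doob's maximal inequality. *)
Lemma hits_le v t m : fin_paths v t ->
  a * pr (hits (size t) m `&` cyl t) <= path_weight t * h v.
Proof.
have hitcase u s k : fin_paths u s -> S u -> a * pr (hits (size s) k `&` cyl s) <= path_weight s * h u.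
  move=> hs Su; apply: le_trans (_ : a * pr (cyl s) <= _).
    rewrite ler_pM2l //; apply: pr_le; [by apply: measurableI => //; exact: mcyl | exact: mcyl | by move=> w []].
  rewrite (centralE hB cP hs) mulrCA ler_pM2l ?path_weight_gt0 // mulrA ler_pM2r //.
  by rewrite invr_gt0 wdim_gt0.
elim: m v t => [|m IH] v t ht; have [Sv|nS] := pselect (S v); try exact: hitcase.
  have -> : hits (size t) 0 `&` cyl t = set0.
    apply/seteqP; split=> // w [[k]]; rewrite addn0 => kn wk wt; apply: nS.
    have E : k = size t by apply/anti_leq; rewrite andbC.
    by apply/(cyl_hit ht erefl wt); rewrite -E.
  by rewrite pr_set0 mulr0 mulr_ge0 ?divr_ge0 // ltW ?path_weight_gt0 ?wdim_gt0.
apply/ler_addgt0Pr => d d0.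
have [es [ues hes le]] := children_ge (mhits (size t) m.+1) ht (divr_gt0 d0 a0).
apply: le_trans (_ : a * (\sum_(x <- es) pr (hits (size t) m.+1 `&` cyl (rcons t x)) + d / a) <= _).
  by rewrite ler_pM2l.
rewrite mulrDr mulrCA divff ?gt_eqF // mulr1 lerD2r mulr_sumr.
apply: le_trans (_ : \sum_(e <- es) path_weight (rcons t e) * h (tgt e) <= _).
  rewrite big_seq [leRHS]big_seq; apply: ler_sum => x /hes xv.
  have hx : fin_paths (tgt x) (rcons t x) by apply/fin_paths_rcons; rewrite xv.
  apply: le_trans (IH _ _ hx); rewrite ler_pM2l //; apply: pr_le.
  - by apply: measurableI => //; exact: mcyl.
  - by apply: measurableI => //; exact: mcyl.
  move=> w [[k /andP[k1 k2] wk] wx]; split=> //.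
  have [wt _] := (cylinder_rcons t x w).1 wx.
  exists k => //; rewrite size_rcons addSnnS k2 andbT ltn_neqAle k1 andbT.
  by apply/eqP => E; apply: nS; apply/(cyl_hit ht erefl wt); rewrite E.
rewrite -scaleh ler_pM2l ?path_weight_gt0 //; exact: hh.1.
Qed.

Lemma not_hit_ge v t m : fin_paths v t ->
  path_weight t * h v <= a * pr (cyl t) + K * pr (hit (size t + m) `&` cyl t).
Proof.
elim: m v t => [|m IH] v t ht.
  rewrite addn0; have wt0 := path_weight_gt0 hB t.
  have iw : 0 < (wdim v)^-1 by rewrite invr_gt0 wdim_gt0.
  have [Sv|nS] := pselect (S v).
    have -> : hit (size t) `&` cyl t = cyl t.
      by apply/seteqP; split=> w; [case | move=> wt; split=> //; apply/(cyl_hit ht erefl wt)].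
    apply: le_trans (_ : K * pr (cyl t) <= _); last by rewrite lerDr mulr_ge0 ?pr_ge0 // ltW.
    rewrite (centralE hB cP ht) [leRHS]mulrCA ler_pM2l // [leRHS]mulrA ler_pM2r //; exact: q_le.
  apply: le_trans (_ : a * pr (cyl t) <= _); last by rewrite lerDl mulr_ge0 ?pr_ge0.
  rewrite (centralE hB cP ht) [leRHS]mulrCA ler_pM2l // [leRHS]mulrA ler_pM2r //.
  by rewrite leNgt; apply/negP => /ltW.
apply/ler_addgt0Pr => d d0; have wt0 := path_weight_gt0 hB t.
have [es [ues hes le]] := hh.2 v _ (divr_gt0 d0 wt0).
apply: le_trans (_ : path_weight t * (\sum_(e <- es) weight e * h (tgt e) + d / path_weight t) <= _).
  by rewrite ler_pM2l.
rewrite mulrDr mulrCA divff ?gt_eqF // mulr1 lerD2r scaleh.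
apply: le_trans (_ : \sum_(e <- es) (a * pr (setT `&` cyl (rcons t e)) +
   K * pr (hit (size t + m.+1) `&` cyl (rcons t e))) <= _).
  rewrite big_seq [leRHS]big_seq; apply: ler_sum => x /hes xv.
  have hx : fin_paths (tgt x) (rcons t x) by apply/fin_paths_rcons; rewrite xv.
  by have := IH _ _ hx; rewrite size_rcons addSnnS setTI.
rewrite big_split /= -!mulr_sumr lerD // ler_wpM2l ?(ltW a0) ?K0 //.
  by apply: le_trans (children_le _ _ _) _; rewrite ?setTI.
exact: children_le.
Qed.

Lemma ergodic_dichotomy : ergodic P ->
  (forall v, q v <= a * pr (XE v)) \/ (forall v, a * pr (XE v) <= q v).
Proof.
move=> eP; pose U n : set Om := \bigcup_(k in [set k | (n <= k)%N]) hit k.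
have mU n : measurable (U n) by apply: bigcup_measurable.
pose G : set Om := \bigcap_n U n.
have mG : measurable G by apply: bigcapT_measurable.
have iG : shuffle_invariant G.
  move=> g /frakS_tail[N hg]; apply/seteqP; split=> w Gw n _.
    have [k /= nk wk] := Gw (maxn n N) I; exists k => /=; first exact: leq_trans (leq_maxl _ _) nk.
    by rewrite /hit /= -hg //; exact: leq_trans (leq_maxr _ _) nk.
  have [k /= nk wk] := Gw (maxn n N) I; exists k => /=; first exact: leq_trans (leq_maxl _ _) nk.
  by rewrite /hit /= hg //; exact: leq_trans (leq_maxr _ _) nk.
have wd (v : vertex B) : 0 < (wdim v)^-1 by rewrite invr_gt0 wdim_gt0.
have cE := centralE hB cP.
case: (eP G mG iG) => [G0|G1]; [left|right] => v.
  have [t ht] := fin_paths_exists hB v.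
  suff : path_weight t * h v <= a * pr (cyl t).
    by rewrite (cE _ _ ht) [leRHS]mulrCA ler_pM2l ?path_weight_gt0 // [leRHS]mulrA ler_pM2r.
  apply/ler_addgt0Pr => d d0; have d1 : 0 < d / (K + 1) by rewrite divr_gt0 // ltr_wpDl.
  have mC n : measurable (~` U n) by exact: measurableC.
  have [w nG|s [us hs]] := pr_cover P (countableP _) mC (measurableC mG) _ d1.
    by apply: contrapT => h'; apply: nG => n _; apply: contrapT => nU; apply: h'; exists n.
  pose m := \max_(n <- s) n.
  apply: le_trans (not_hit_ge m ht) _; rewrite lerD2l.
  apply: le_trans (_ : (K + 1) * (d / (K + 1)) <= _); last by rewrite mulrCA divff ?mulr1 // gt_eqF // ltr_wpDl.
  apply: ler_pM => //; [exact: pr_ge0 | by rewrite lerDl |].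
  apply/ltW; apply: le_lt_trans (hs s (fun x hx => hx)).
  have -> : pr (hit (size t + m) `&` cyl t) = pr ((hit (size t + m) `&` cyl t) `\` G).
    have m1 : measurable (hit (size t + m) `&` cyl t) by apply: measurableI => //; exact: mcyl.
    rewrite (pr_split P m1 mG) [X in X + _](_ : _ = 0) ?add0r //.
    apply/le_anti; rewrite pr_ge0 andbT; apply: le_trans (_ : pr G <= _).
      by apply: pr_le; [exact: measurableI | exact: mG | move=> w []].
    by rewrite -[pr G]/(fine (P G)) G0.
  apply: pr_le.
  - by apply: measurableD => //; apply: measurableI => //; exact: mcyl.
  - by apply: measurableD; [exact: measurableC | exact: measurable_exists_in].
  move=> w [[hw wt] nG]; split=> // -[n ns nU]; apply: nU; exists (size t + m)%N => //=.
  by apply: leq_trans (leq_addl _ _); rewrite /m; exact: leq_bigmax_seq.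
have [t ht] := fin_paths_exists hB v.
suff : a * pr (cyl t) <= path_weight t * h v.
  by rewrite (cE _ _ ht) mulrCA ler_pM2l ?path_weight_gt0 // mulrA ler_pM2r.
apply/ler_addgt0Pr => d d0.
have mGt : measurable (G `&` cyl t) by apply: measurableI => //; exact: mcyl.
pose F m := hits (size t) m.
have mF m : measurable (F m) by exact: mhits.
have [w [Gw wt]|s [us hs]] := pr_cover P (countableP _) mF mGt _ (divr_gt0 d0 a0).
  have [k /= nk wk] := Gw (size t) I; exists (k - size t)%N; exists k => //.
  by rewrite nk subnKC /=.
pose m := \max_(n <- s) n.
have e1 : pr (cyl t) = pr (G `&` cyl t).
  have mct := mcyl t.
  rewrite (pr_split P mct mG) setIC [X in _ + X](_ : _ = 0) ?addr0 //.
  apply/le_anti; rewrite pr_ge0 andbT; apply: le_trans (_ : pr (~` G) <= _).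
    by apply: pr_le; [exact: measurableD | exact: measurableC | move=> w []].
  by rewrite pr_setC // -[pr G]/(fine (P G)) G1 subrr.
have mFm : measurable (F m `&` cyl t) by apply: measurableI => //; exact: mcyl.
have e2 : pr (cyl t) <= pr (F m `&` cyl t) + d / a.
  rewrite e1 (pr_split P mGt mFm) lerD //.
    by apply: pr_le; [exact: measurableI | exact: mFm | move=> w []].
  apply/ltW; apply: le_lt_trans (hs s (fun x hx => hx)); apply: pr_le.
  - exact: measurableD.
  - by apply: measurableD => //; exact: measurable_exists_in.
  move=> w [[Gw wt] nF]; split=> // -[n ns [k /andP[k1 k2] wk]]; apply: nF; split=> //.
  exists k => //; rewrite k1 /=; apply: leq_trans k2 _; rewrite leq_add2l /m.
  exact: leq_bigmax_seq.
apply: le_trans (_ : a * (pr (F m `&` cyl t) + d / a) <= _); first by rewrite ler_pM2l.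
rewrite mulrDr mulrCA divff ?gt_eqF // mulr1 lerD2r.
exact: hits_le.
Qed.

End Comparison.

Lemma ergodic_harmonic (q : vertex B -> R) (K : R) : ergodic P ->
  (forall v, 0 <= q v) -> (forall v, q v <= K * pr (XE v)) ->
  wharmonic (fun v => q v / wdim v) -> exists c, forall v, q v = c * pr (XE v).
Proof.
move=> eP q0 qK hq; pose r := src (sval o 0%N); have lr : level r = 0%N by exact: inf_level.
have pr1 : pr (XE r) = 1 by rewrite XE_root // pr_setT.
exists (q r) => v; apply/le_anti/andP; split.
  apply/ler_addgt0Pr => d d0.
  have c0 : 0 < q r + d by rewrite ltr_wpDl.
  case: (ergodic_dichotomy q0 qK hq c0 eP) => [/(_ v) le|/(_ r)].
    apply: le_trans le _; rewrite mulrDl lerD2l -[leRHS]mulr1 ler_pM2l //.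
    by apply: pr_le1; exact: mXE.
  by rewrite pr1 mulr1 gerDl leNgt d0.
apply/ler_addgt0Pr => d d0.
have [c0|c0] := ltP 0 (q r - d); last first.
  apply: le_trans (_ : d <= _); last by rewrite lerDr.
  apply: le_trans (_ : d * pr (XE v) <= _).
    by rewrite ler_wpM2r ?pr_ge0 //; rewrite subr_le0 in c0.
  by rewrite -[leRHS]mulr1 ler_pM2l //; apply: pr_le1; exact: mXE.
case: (ergodic_dichotomy q0 qK hq c0 eP) => [/(_ r)|/(_ v) le].
  by rewrite pr1 mulr1 lerBrDr gerDl leNgt d0.
apply: le_trans (_ : (q r - d) * pr (XE v) + d <= _); last by rewrite lerD2r.
rewrite mulrBl addrAC -addrA lerDl subr_ge0 -[leRHS]mulr1 ler_pM2l //.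
by apply: pr_le1; exact: mXE.
Qed.

Lemma pr_XE_and (A : set Om) (u v : vertex B) : measurable A -> shuffle_invariant A ->
  (level u <= level v)%N ->
  pr (A `&` XE u `&` XE v) = pr (A `&` XE v) / wdim v *
    \sum_(t <- fps v | take (level u) t \in fps u) path_weight t.
Proof.
move=> mA iA uv.
have -> : A `&` XE u `&` XE v = A `&` [set w | exists2 t, t \in [seq t <- fps v | take (level u) t \in fps u] & cyl t w].
  have tk (w : Om) t : fin_paths v t -> cylinder t w -> take (level u) t = initial (level u) (sval w).
    move=> ht <-; rewrite /initial /mkseq -map_take take_iota (fin_paths_size hB ht).
    by rewrite (minn_idPl uv).
  apply/seteqP; split=> w.
    move=> [[Aw Xu] /(XE_cyl hB)[t ht wt]]; split=> //; exists t => //; rewrite mem_filter ht andbT.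
    have /(mem_fps hB) hp := ht; rewrite (tk w) //; apply/(mem_fps hB).
    by rewrite -{1}Xu; exact: initial_path.
  move=> [Aw [t]]; rewrite mem_filter => /andP[/(mem_fps hB) h1 ht] wt.
  have /(mem_fps hB) hp := ht.
  split; last by apply/(XE_cyl hB); exists t.
  split=> //; apply/(XE_cyl hB); exists (take (level u) t); first exact/(mem_fps hB).
  by rewrite (tk w) // /cylinder /= size_initial.
rewrite pr_sum //; last 2 first.
- by rewrite filter_uniq // fps_uniq.
- move=> t t'; rewrite !mem_filter => /andP[_ /(mem_fps hB) h1] /andP[_ /(mem_fps hB) h2] w.
  by rewrite /cylinder /= (fin_paths_size hB h1) (fin_paths_size hB h2) => ->.
rewrite big_filter mulr_sumr big_seq_cond [RHS]big_seq_cond; apply: eq_bigr => t /andP[/(mem_fps hB) ht _].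
by rewrite (invariant_central hB cP mA iA ht) mulrC.
Qed.

End OneMeasure.

(* The total weight of the paths to [v] passing through [u]. *)
Definition through (u v : vertex B) : R :=
  \sum_(t <- fps v | take (level u) t \in fps u) path_weight t.

Lemma through_level (u v : vertex B) : level u = level v -> through u v = (u == v)%:R * wdim v.
Proof.
move=> uv; rewrite /through (wdimE hB) mulr_sumr big_mkcond; apply: eq_big_seq => t /(mem_fps hB) ht.
rewrite take_oversize ?uv ?(fin_paths_size hB ht) //.
case: eqVneq => [->|n]; first by rewrite (introT idP ((mem_fps hB v t).2 ht)) mul1r.
rewrite mul0r; case: ifP => // /(mem_fps hB) h.
by rewrite (fin_paths_fun hB h ht) eqxx in n.
Qed.

Lemma throughS (u v : vertex B) : (level u < level v)%N ->
  through u v = \sum_(e <- preds v) weight e * through u (src e).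
Proof.
move=> uv; rewrite /through big_mkcond (fps_sumS hB); last exact: leq_ltn_trans uv.
apply: eq_big_seq => e /(mem_preds hB) ev; rewrite mulr_sumr [RHS]big_mkcond.
have lv : level v = (level (src e)).+1 by rewrite -ev (level_tgt hB).
apply: eq_big_seq => t /(mem_fps hB) ht.
rewrite -cats1 takel_cat ?cats1; last by rewrite (fin_paths_size hB ht) -ltnS -lv.
by case: ifP => // _; rewrite path_weight_rcons // mulrC.
Qed.

Lemma wdimS (v : vertex B) : (0 < level v)%N ->
  wdim v = \sum_(e <- preds v) weight e * wdim (src e).
Proof.
move=> lv; rewrite (wdimE hB) (fps_sumS hB) //; apply: eq_bigr => e _.
rewrite (wdimE hB) mulr_sumr; apply: eq_bigr => t _.
by rewrite path_weight_rcons mulrC.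
Qed.

Lemma shuffle_invariantT : shuffle_invariant (setT : set Om).
Proof. by []. Qed.

Lemma shuffle_invariantC (A : set Om) : shuffle_invariant A -> shuffle_invariant (~` A).
Proof. by move=> iA g gS; have := iA g gS => h; rewrite -preimage_setC h. Qed.

Lemma ergodic_dominated (P P1 : probability Om R) (s : R) : central P -> central P1 -> ergodic P ->
  0 < s -> (forall A, measurable A -> s * pr P1 A <= pr P A) ->
  forall A, measurable A -> P1 A = P A.
Proof.
move=> cP cP1 eP s0 le.
have /= [c hc] : exists c, forall v : vertex B, pr P1 (@XE R B o v) = c * pr P (@XE R B o v).
  apply: (@ergodic_harmonic P cP (fun v => pr P1 (XE v)) s^-1 eP) => [v|v|].
  - exact: pr_ge0.
  - by rewrite mulrC ler_pdivlMr // mulrC; apply: le.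
  - have := invariant_harmonic cP1 measurableT shuffle_invariantT.
    by congr wharmonic; apply: functional_extensionality_dep => v; rewrite setTI.
have c1 : c = 1.
  have lr : level (src (sval o 0%N)) = 0%N by exact: inf_level.
  by have := hc (src (sval o 0%N)); rewrite (XE_root lr) !pr_setT mulr1.
apply: (cyl_measure_unique hB); first by rewrite ltey_eq fin_num_measure.
move=> v t ht; rewrite [LHS](prE P1 (mcyl t)) [RHS](prE P (mcyl t)) (centralE hB cP ht) (centralE hB cP1 ht).
by rewrite hc c1 mul1r.
Qed.

Definition restricted (P : probability Om R) (A : set Om) (mA : measurable A) : probability Om R :=
  [the probability Om R of mnormalize [the {measure set Om -> \bar R} of mrestr P mA] P].

Lemma restrictedE (P : probability Om R) A (mA : measurable A) C : 0 < pr P A -> measurable C ->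
  pr (restricted P mA) C = pr P (C `&` A) / pr P A.
Proof.
move=> a0 mC; rewrite /restricted /pr /= /mnormalize /= {1 2 3}/mrestr setTI.
have -> : ((P A == 0) || (P A == +oo))%E = false.
  by rewrite prE // eqe gt_eqF.
rewrite /mrestr; rewrite prE; last exact: measurableI.
by rewrite /= setTI.
Qed.

Lemma restricted_central P A (mA : measurable A) : central P -> shuffle_invariant A ->
  0 < pr P A -> central (restricted P mA).
Proof.
move=> cP iA a0 N v t N1 lv ht; rewrite -!/(pr _ _) (X_eqE o N1 lv) !restrictedE //.
rewrite setIC [XE v `&` A]setIC (invariant_central hB cP mA iA ht).
rewrite [LHS]mulrAC [RHS]mulrAC; congr (_ / _).
by rewrite mulrC mulKf // gt_eqF // path_weight_gt0.
Qed.

Lemma ergodic_extremal (P : probability Om R) : central P -> ergodic P <-> extremal_central P.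
Proof.
move=> cP; split=> [eP|[_ ex] A mA iA].
  split=> // P1 P2 s c1 c2 /andP[s0 s1] E A mA.
  have E' C : measurable C -> pr P C = s * pr P1 C + (1 - s) * pr P2 C.
    by move=> mC; apply: EFin_inj; rewrite EFinD !EFinM -!prE // E.
  have t0 : 0 < 1 - s by rewrite subr_gt0.
  split; [apply: (ergodic_dominated cP c1 eP s0)|apply: (ergodic_dominated cP c2 eP t0)] => // C mC.
    by rewrite E' // lerDl mulr_ge0 ?pr_ge0 // ltW.
  by rewrite E' // lerDr mulr_ge0 ?pr_ge0 // ltW.
rewrite (prE P mA); have := pr_ge0 P A; rewrite le_eqVlt => /orP[/eqP <-|a0]; first by left.
have := pr_le1 P mA; rewrite le_eqVlt => /orP[/eqP ->|a1]; first by right.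
have mC := measurableC mA; have c0 : 0 < pr P (~` A) by rewrite pr_setC // subr_gt0.
have h01 : 0 < pr P A < 1 by rewrite a0.
have E C : measurable C -> P C =
  ((pr P A)%:E * restricted P mA C + (1 - pr P A)%:E * restricted P mC C)%E.
  move=> mCC; rewrite !prE // -!EFinM -EFinD !restrictedE // -pr_setC //; congr EFin.
  rewrite mulrC divfK ?gt_eqF // [_ * (_ / _)]mulrC divfK ?gt_eqF //.
  by rewrite (pr_split P mCC mA) setDE.
have [h _] := ex _ _ _ (restricted_central mA cP iA a0)
  (restricted_central mC cP (shuffle_invariantC iA) c0) h01 E A mA.
have := restrictedE mA a0 mA; rewrite setIid divff ?gt_eqF // /pr h => h1.
by right; rewrite h1.
Qed.

End ErgodicMeasures.

(** * The branching graph of an inductive system *)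

Section BranchingGraph.
Variables (R : realType) (GG : indsys R) (D : branching GG).
Local Notation C := (R[i]).
Local Notation B := (branching_graph D).

Definition vtx N (p : isys_dual GG N) : vertex B := Tagged (fun N => isys_dual GG N : Type) p.

Definition edg N (q : isys_dual GG N) (p : isys_dual GG N.+1) (l : 'I_(br_mult D q p)) : edge B :=
  existT _ N (existT (fun qp : isys_dual GG N * isys_dual GG N.+1 => 'I_(br_mult D qp.1 qp.2)) (q, p) l).

Lemma vtxE (v : vertex B) : v = vtx (tagged v).
Proof. by case: v. Qed.

Lemma vtx_inj N : injective (@vtx N).
Proof. by move=> p q h; have /eqP := h; rewrite eq_Tagged => /eqP. Qed.

Lemma edgE (e : edge B) : exists N (q : isys_dual GG N) p (l : 'I_(br_mult D q p)), e = edg l.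
Proof. by case: e => N [[q p] l]; exists N, q, p, l. Qed.

Definition pred_list N (p : isys_dual GG N.+1) : seq (edge B) :=
  [seq edg l | q <- br_supp D p, l <- enum 'I_(br_mult D q p)].

Lemma mem_pred_list N (p : isys_dual GG N.+1) e : e \in pred_list p <-> tgt e = vtx p.
Proof.
split=> [/allpairsPdep[q [l [_ _ ->]]] //|].
have [N' [q [p' [l ->]]]] := edgE e; move=> h.
have EN : N' = N by have := congr1 (@tag _ _) h; rewrite /= => -[].
case: N / EN p h => p h; have /vtx_inj hp : vtx p' = vtx p := h.
case: p / hp h => _; apply/allpairsPdep; exists q, l; split=> //; last by rewrite mem_enum.
by rewrite br_suppP; case: l => ?; exact: leq_ltn_trans.
Qed.

Lemma pred_list_uniq N (p : isys_dual GG N.+1) : uniq (pred_list p).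
Proof.
apply: allpairs_uniq_dep; [exact: br_supp_uniq | by move=> q _; exact: enum_uniq |].
move=> [q l] [q' l'] _ _ /= h; have /eqP := h; rewrite eq_Tagged => /eqP /= h2.
have E : q = q' by have := congr1 (@tag _ _) h2; rewrite /= => -[].
case: q' / E l' h h2 => l' _ h2.
by have /eqP := h2; rewrite eq_Tagged => /eqP /= ->.
Qed.

Lemma irr0_one (p : isys_dual GG 0) : irr_rep p = 1%:M.
Proof.
have [[_ hc] [UU _]] := irr_unitary p.
have /choice[u hu] : forall ij : 'I_(irr_dim p) * 'I_(irr_dim p), exists c : C, irr_rep p ij.1 ij.2 = c%:A.
  by move=> ij; exact: isys0.
pose M : 'M[C]_(irr_dim p) := \matrix_(i, j) u (i, j).
have ME : irr_rep p = scalmx (GG 0%N) M by apply/matrixP => i j; rewrite !mxE (hu (i, j)).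
have [h1 _ _ _] := comul_hom (GG 0%N).
have [tl tr t11 _ _ _ _] := ten_min (GG 0%N).
have hcomul (c : C) : comul (c%:A : GG 0%N) = c%:A.
  have := h1 c 1 0; rewrite addr0 => ->; rewrite comul0 addr0; congr (_ *: _).
  by have [_ ->] := comul_hom (GG 0%N).
have hten (c d : C) : ten (c%:A : GG 0%N) d%:A = (c * d)%:A.
  rewrite tenZl; have := tr 1 d 1 0; rewrite addr0 => ->.
  by rewrite ten0r addr0 t11 scalerA.
have MM : M = M *m M.
  apply/matrixP => i j; have := hc i j; rewrite ME !mxE hcomul => E.
  have {}E : (M i j)%:A = (\sum_k M i k * M k j)%:A :> cqg_ten2 (GG 0%N).
    rewrite !mxE E scaler_suml; apply: eq_bigr => k _; by rewrite !mxE hten.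
  move/eqP: E; rewrite -subr_eq0 -scalerBl scaler_eq0 => /orP[|/eqP]; last by move/cstar_oner_neq0.
  by rewrite subr_eq0 !mxE => /eqP.
have M1 : M = 1%:M.
  have u1 : scalmx (GG 0%N) M *m scalmx (GG 0%N) (adjmx M) = 1%:M.
    by rewrite -starmx_scal -ME.
  have mm : M *m adjmx M = 1%:M by apply: (@scalmx_inj _ (GG 0%N)); rewrite scalmxM u1 scalmx1.
  by rewrite -[LHS]mulmx1 -mm mulmxA -MM.
by rewrite ME M1 scalmx1.
Qed.

Lemma irr0_dim (p : isys_dual GG 0) : irr_dim p = 1%N.
Proof.
have [n0 irr] := irr_irreducible p.
have [n1|n1] := leqP (irr_dim p) 1; first by apply/anti_leq; rewrite n1.
have [|c hc] := irr (delta_mx (Ordinal n0) (Ordinal n1)).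
  by rewrite /Mor /= irr0_one mulmx1 mul1mx.
have := congr1 (fun M : 'M[C]_(irr_dim p) => M (Ordinal n0) (Ordinal n1)) hc.
by rewrite !mxE !eqxx /= => /eqP; rewrite oner_eq0.
Qed.

Lemma irr0_uniq (p q : isys_dual GG 0) : p = q.
Proof.
apply: irr_inj; exists (const_mx 1).
have d m n k (A : 'M[C]_(m, n)) (A' : 'M[C]_(n, k)) : n = 1%N -> A = const_mx 1 -> A' = const_mx 1 ->
    A *m A' = const_mx 1.
  move=> n1 -> ->; apply/matrixP => i j; rewrite !mxE.
  under eq_bigr => x _ do rewrite !mxE mulr1; by rewrite sumr_const card_ord n1.
have one n : n = 1%N -> 1%:M = const_mx 1 :> 'M[C]_n.
  by move=> ->; apply/matrixP => i j; rewrite !ord1 !mxE.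
have adj1 m n : adjmx (const_mx 1 : 'M[C]_(m, n)) = const_mx 1.
  by apply/matrixP => i j; rewrite !mxE rmorph1.
split; first by rewrite /Mor /= !irr0_one mulmx1 mul1mx.
- by rewrite adj1 (one _ (irr0_dim p)); apply: d => //; exact: irr0_dim.
- by rewrite adj1 (one _ (irr0_dim q)); apply: d => //; exact: irr0_dim.
Qed.

Lemma irr0_F (p : isys_dual GG 0) : br_F D p = 1%:M.
Proof.
have [pF _ hF] := br_FP D p.
have h := hF 1%:M; rewrite !mulmx1 in h.
have {}h : \tr (br_F D p) = \tr (invmx (br_F D p)).
  by apply: h; rewrite /Mor /= scalmx1 mulmx1 mul1mx.
have uF := posdef_unit pF; have := posdef_trace_gt0 (irr_dim_gt0 p) pF.
have := irr0_dim p; move: (br_F D p) uF h; move: (irr_dim p) => n F uF h n1 t0.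
subst n.
have tE (M : 'M[C]_1) : M = (\tr M)%:M.
  by apply/matrixP => i j; rewrite !ord1 !mxE /mxtrace big_ord1.
rewrite [F]tE; congr _%:M; set t := \tr F in h t0 *.
have tt : t * t = 1.
  have := mulmxV uF; rewrite [F in F *m _]tE [invmx F]tE -h -/t -scalar_mxM => /matrixP/(_ 0 0).
  by rewrite !mxE eqxx.
have : (t - 1) * (t + 1) = 0 by rewrite mulrDr mulr1 mulrBl tt mul1r; ring.
move/eqP; rewrite mulf_eq0 => /orP[|]; first by rewrite subr_eq0 => /eqP.
by rewrite gt_eqF // ltr_wpDr // ler01.
Qed.

Lemma branching_fin_paths N (p : isys_dual GG N) : exists t, fin_paths (vtx p) t.
Proof.
elim: N p => [|N IH] p; first by exists [::], (vtx p).
have [q] : exists q, q \in br_supp D p.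
  apply: contrapT => h; have := posn_scalar_neq0 C (irr_dim_gt0 p).
  rewrite -(br_sumE D p) big_seq big1 ?eqxx // => q qs; case: h; by exists q.
rewrite br_suppP => m0; have [t [x x0 ht]] := IH q.
exists (rcons t (edg (Ordinal m0))), x => //; apply/walk_rcons; by split.
Qed.

Lemma branching_regular : wgraph_regular B.
Proof.
split.
- by [].
- by move=> e; have [N [q [p [l ->]]]] := edgE e; exact: br_weight_gt0.
- move=> v; have [l0|] := eqVneq (level v) 0%N.
    have -> : [set e : edge B | tgt e = v] = set0 by apply/seteqP; split=> // e /= h; rewrite -h in l0.
    exact: finite_set0.
  case: v => [[|N] p] // _; apply: sub_finite_set (finite_seq (pred_list p)) => e /= h.
  by apply/mem_pred_list.
- move=> [N p] [M q] /= h h'; move: p q; rewrite h h' => p q.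
  by rewrite (irr0_uniq p q).
split.
- exact: (@countableP {N : nat & {qp : isys_dual GG N * isys_dual GG N.+1 & 'I_(br_mult D qp.1 qp.2)}}).
- exact: (@countableP {N : nat & isys_dual GG N}).
by move=> v; rewrite (vtxE v); exact: branching_fin_paths.
Qed.
Local Notation hB := branching_regular.

Lemma sum_preds (V : nmodType) (f : edge B -> V) N (p : isys_dual GG N.+1) :
  \sum_(e <- preds (vtx p)) f e = \sum_(q <- br_supp D p) \sum_(l < br_mult D q p) f (edg l).
Proof.
have -> : \sum_(e <- preds (vtx p)) f e = \sum_(e <- pred_list p) f e.
  apply: perm_big; apply: uniq_perm; [exact: preds_uniq | exact: pred_list_uniq |].
  move=> e; apply/idP/idP => [/(mem_preds hB) h|h]; first exact/mem_pred_list.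
  by apply/(mem_preds hB)/mem_pred_list.
rewrite big_allpairs_dep; apply: eq_bigr => q _; by rewrite big_enum.
Qed.

Definition dimq N (p : isys_dual GG N) : R := wdim (vtx p).

Lemma dimq_gt0 N (p : isys_dual GG N) : 0 < dimq p.
Proof. exact: wdim_gt0 hB _. Qed.

Lemma dimqE N (p : isys_dual GG N) : \tr (br_F D p) = (dimq p)%:C%C.
Proof.
elim: N p => [|N IH] p.
  rewrite irr0_F mxtrace1 /dimq (wdim_root hB) // irr0_dim; by rewrite mulr1n.
have := tr_F_Thmap D p (fun q => 1%:M).
have -> : Thmap D (fun q : isys_dual GG N => 1%:M) p = 1%:M.
  rewrite /Thmap -[RHS](br_sumE D p); apply: eq_bigr => q _; apply: eq_bigr => l _.
  by rewrite mulmx1.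
rewrite mulmx1 => ->; rewrite /dimq (wdimS hB) // sum_preds rc_sum; apply: eq_bigr => q _.
by rewrite mulmx1 IH -rcM /kap mulr_suml.
Qed.

End BranchingGraph.

(** * Elements of the limit algebra supported at one vertex *)

Section OperatorNorm.
Variable R : realType.
Local Notation C := (R[i]).

Definition cform n (u v : 'cV[C]_n) : C := (adjmx v *m u) 0 0.

Lemma cform_psd n : psd_form (@cform n).
Proof.
split=> [x y z|c x z|x y|x]; rewrite /cform.
- by rewrite mulmxDr mxE.
- by rewrite -scalemxAr mxE.
- rewrite !mxE rmorph_sum; apply: eq_bigr => i _; rewrite !mxE rmorphM /= conjCK mulrC //.
- exact: adjmxM_ge0.
Qed.

Lemma cvnormE n (v : 'cV[C]_n) : cvnorm v = snorm (@cform n) v.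
Proof.
rewrite /cvnorm /snorm /sqn /cform; congr Num.sqrt; apply: complexI.
rewrite -ge0_rcRe ?adjmxM_ge0 // rc_sum mxE; apply: eq_bigr => i _.
by rewrite !mxE mulrC -cabs_sqr.
Qed.

Lemma cvnorm_ge0 n (v : 'cV[C]_n) : 0 <= cvnorm v.
Proof. exact: sqrtr_ge0. Qed.

Lemma cvnorm_sqr n (v : 'cV[C]_n) : (cvnorm v ^+ 2)%:C%C = (adjmx v *m v) 0 0.
Proof. by rewrite cvnormE (snorm_sqr (cform_psd n)) /sqn -ge0_rcRe // adjmxM_ge0. Qed.

Lemma cvnormZ n (c : C) (v : 'cV[C]_n) : cvnorm (c *: v) = cabs c * cvnorm v.
Proof. by rewrite !cvnormE (snormZ (cform_psd n)). Qed.

Lemma cvnormD n (u v : 'cV[C]_n) : cvnorm (u + v) <= cvnorm u + cvnorm v.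
Proof. by rewrite !cvnormE (snormD (cform_psd n)). Qed.

Lemma cvnorm0 n : cvnorm (0 : 'cV[C]_n) = 0.
Proof. by rewrite -(scale0r 0) cvnormZ cabs0 mul0r. Qed.

Lemma cvnorm_eq0 n (v : 'cV[C]_n) : cvnorm v = 0 -> v = 0.
Proof. by move=> h; apply: adjmxM_eq0; apply/matrixP => i j; rewrite !ord1 -cvnorm_sqr h expr0n mxE. Qed.

Definition opbound n (T : 'M[C]_n) (K : R) : Prop := forall v, cvnorm (T *m v) <= K * cvnorm v.

Lemma opbound_exists n (T : 'M[C]_n) : exists2 K, 0 <= K & opbound T K.
Proof.
exists (\sum_j cvnorm (col j T)); first by apply: sumr_ge0 => j _; exact: cvnorm_ge0.
move=> v; have -> : T *m v = \sum_j v j 0 *: col j T.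
  apply/matrixP => i k; rewrite ord1 summxE mxE; apply: eq_bigr => j _; by rewrite !mxE mulrC.
rewrite cvnormE; apply: le_trans (snorm_sum (cform_psd n) _ _ _) _.
rewrite mulr_suml; apply: ler_sum => j _; rewrite (snormZ (cform_psd n)) -cvnormE mulrC.
rewrite ler_wpM2l ?cvnorm_ge0 //.
rewrite -(ler_pXn2r (ltn0Sn 1)) ?nnegrE ?cabs_ge0 ?cvnorm_ge0 //.
rewrite /cvnorm sqr_sqrtr; last by apply: sumr_ge0 => i _; exact: sqr_ge0.
by rewrite (bigD1 j) //= lerDl; apply: sumr_ge0 => i _; exact: sqr_ge0.
Qed.

Lemma opnorm_le n (T : 'M[C]_n) K : 0 <= K -> opbound T K -> opnorm T <= K.
Proof.
move=> K0 h; apply: ge_sup.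
  by exists (cvnorm (T *m 0)); exists 0 => //; rewrite cvnorm0 ler01.
move=> r [v v1 ->]; apply: le_trans (h v) _.
by rewrite -[leRHS]mulr1 ler_wpM2l.
Qed.

Lemma opbound_opnorm n (T : 'M[C]_n) : opbound T (opnorm T).
Proof.
move=> v; have [K K0 hK] := opbound_exists T.
have [v0|v0] := eqVneq (cvnorm v) 0.
  by rewrite (cvnorm_eq0 v0) mulmx0 cvnorm0 mulr0.
have vp : 0 < cvnorm v by rewrite lt_neqAle eq_sym v0 cvnorm_ge0.
pose w := (cvnorm v)^-1%:C%C *: v.
have w1 : cvnorm w = 1 by rewrite cvnormZ cabs_rc ger0_norm ?invr_ge0 ?ltW // mulVf.
have : cvnorm (T *m w) <= opnorm T.
  apply: ub_le_sup; last by exists w; rewrite ?w1.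
  exists K => r [u u1 ->]; apply: le_trans (hK u) _.
  by rewrite -[leRHS]mulr1 ler_wpM2l.
have iv : 0 <= (cvnorm v)^-1 by rewrite invr_ge0 cvnorm_ge0.
rewrite -scalemxAr cvnormZ cabs_rc (ger0_norm iv).
by rewrite mulrC ler_pdivrMr.
Qed.

Lemma opnorm_ge0 n (T : 'M[C]_n) : 0 <= opnorm T.
Proof.
have [K K0 hK] := opbound_exists T.
apply: ub_le_sup.
  exists K => r [u u1 ->]; apply: le_trans (hK u) _; by rewrite -[leRHS]mulr1 ler_wpM2l.
by exists 0; rewrite ?mulmx0 ?cvnorm0 ?ler01.
Qed.

Lemma opnorm0 n : opnorm (0 : 'M[C]_n) = 0.
Proof.
apply/le_anti; rewrite opnorm_ge0 andbT; apply: opnorm_le => // v.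
by rewrite mul0mx cvnorm0 mul0r.
Qed.

Lemma opnormD n (S T : 'M[C]_n) : opnorm (S + T) <= opnorm S + opnorm T.
Proof.
apply: opnorm_le => [|v]; first by rewrite addr_ge0 ?opnorm_ge0.
rewrite mulmxDl mulrDl; apply: le_trans (cvnormD _ _) _.
by rewrite lerD ?opbound_opnorm.
Qed.

Lemma opboundP n (T : 'M[C]_n) K : 0 <= K ->
  opbound T K <-> forall v : 'cV[C]_n, (adjmx (T *m v) *m (T *m v)) 0 0 <= (K ^+ 2)%:C%C * (adjmx v *m v) 0 0.
Proof.
move=> K0; have e (v : 'cV[C]_n) : (cvnorm (T *m v) <= K * cvnorm v) =
    ((adjmx (T *m v) *m (T *m v)) 0 0 <= (K ^+ 2)%:C%C * (adjmx v *m v) 0 0).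
  rewrite -!cvnorm_sqr -rcM -exprMn lecR ler_pXn2r ?nnegrE ?cvnorm_ge0 //.
  by rewrite mulr_ge0 ?cvnorm_ge0.
by split=> h v; [rewrite -e | rewrite e].
Qed.

End OperatorNorm.

Section Families.
Variables (R : realType) (G : cqg R) (I : dual G).
Local Notation C := (R[i]).
Implicit Types x y : matfamily I.

Definition fsupp x : Prop := finite_set [set p | x p != 0].

Lemma fsupp_Cstar x : fsupp x -> in_Cstar x.
Proof. by move=> hx e e0; exists x; split=> // p; rewrite subrr opnorm0 ltW. Qed.

Lemma fsupp_Wstar x : fsupp x -> in_Wstar x.
Proof.
move=> hx; exists (\sum_(p <- fset_set [set p | x p != 0]) opnorm (x p)) => p.
have h0 : 0 <= \sum_(p <- fset_set [set p | x p != 0]) opnorm (x p).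
  by apply: sumr_ge0 => q _; exact: opnorm_ge0.
have [->|n] := eqVneq (x p) 0; first by rewrite opnorm0.
rewrite (bigD1_seq p) /= ?fset_uniq ?in_fset_set ?inE //.
by rewrite lerDl; apply: sumr_ge0 => q _; exact: opnorm_ge0.
Qed.

Lemma Cstar_Wstar x : in_Cstar x -> in_Wstar x.
Proof.
move=> /(_ 1 ltr01)[y [/fsupp_Wstar[K hK] h]]; exists (1 + K) => p.
have -> : x p = (x p - y p) + y p by rewrite subrK.
by apply: le_trans (opnormD _ _) _; rewrite lerD.
Qed.

Lemma fam_norm_le x K : 0 <= K -> (forall p, opnorm (x p) <= K) -> fam_norm x <= K.
Proof.
move=> K0 h; rewrite /fam_norm.
have [[p0 _]|n] := pselect (exists p : I, True).
  apply: ge_sup; first by exists (opnorm (x p0)), p0.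
  by move=> r [p ->].
have -> : [set r | exists p : I, r = opnorm (x p)] = set0.
  by apply/seteqP; split=> // r [p _]; apply: n; exists p.
by rewrite sup0.
Qed.

(* The family with value [M] at [p] and [0] elsewhere. *)
Definition sv (p : I) (M : 'M[C]_(irr_dim p)) : matfamily I := fun q =>
  match pselect (p = q) with
  | left e => eq_rect p (fun q => 'M[C]_(irr_dim q)) M q e
  | right _ => 0
  end.

Lemma sv_id p M : @sv p M p = M.
Proof. by rewrite /sv; case: pselect => // e; rewrite (Prop_irrelevance e erefl). Qed.

Lemma sv_neq p M q : p <> q -> @sv p M q = 0.
Proof. by rewrite /sv; case: pselect. Qed.

Lemma sv_fun p (f : forall q : I, 'M[C]_(irr_dim q) -> 'M[C]_(irr_dim q)) M q :
  (forall q, f q 0 = 0) -> f q (@sv p M q) = @sv p (f p M) q.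
Proof.
move=> f0; have [e|n] := pselect (p = q); last by rewrite !sv_neq.
by case: q / e; rewrite !sv_id.
Qed.

Lemma sv_fsupp p M : fsupp (@sv p M).
Proof.
apply: sub_finite_set (finite_set1 p) => q /= h; apply: contrapT => n.
by rewrite sv_neq ?eqxx in h * => // E; apply: n.
Qed.

End Families.

Section Closure.
Variables (R : realType) (A : cstarAlgType R).
Local Notation C := (R[i]).
Implicit Types S E : set A.

Lemma cclosure_seq S x : cclosure S x <-> exists u : nat -> A, (forall n, S (u n)) /\ ccvg u x.
Proof.
split=> [h|[u [uS ux]] e e0]; last first.
  by have [N hN] := ux _ e0; exists (u N); rewrite cnormB; split=> //; exact: hN.
have /choice[u hu] : forall n, exists y, S y /\ cnorm (x - y) < n.+1%:R^-1.
  by move=> n; apply: h; rewrite invr_gt0 ltr0n.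
exists u; split; first by move=> n; have [] := hu n.
move=> e e0; exists (Num.bound e^-1) => n Nn; rewrite cnormB.
have [_ h1] := hu n; apply: lt_trans h1 _.
rewrite invf_plt ?posrE ?ltr0n //; apply: lt_le_trans (archi_boundP _) _.
  by rewrite invr_ge0 ltW.
by rewrite ler_nat; apply: leq_trans Nn _.
Qed.

Lemma cclosure_subalgebra E : star_subalgebra E -> star_subalgebra (cclosure E).
Proof.
move=> [E0 ED EM Es]; split.
- by apply/cclosure_seq; exists (fun=> 0); split=> //; exact: ccvg_cst.
- move=> c x y /cclosure_seq[u [uE ux]] /cclosure_seq[v [vE vy]]; apply/cclosure_seq.
  by exists (fun n => c *: u n + v n); split=> [n|]; [exact: ED | apply: ccvgD => //; exact: ccvgZ].
- move=> x y /cclosure_seq[u [uE ux]] /cclosure_seq[v [vE vy]]; apply/cclosure_seq.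
  by exists (fun n => u n * v n); split=> [n|]; [exact: EM | exact: ccvgM].
- move=> x /cclosure_seq[u [uE ux]]; apply/cclosure_seq.
  by exists (fun n => star (u n)); split=> [n|]; [exact: Es | exact: ccvg_star].
Qed.

Lemma cclosureK E : cclosure (cclosure E) `<=` cclosure E.
Proof.
move=> x h e e0; have e2 : 0 < e / 2 by rewrite divr_gt0.
have [y [/(_ _ e2)[z [Ez yz]] xy]] := h _ e2; exists z; split=> //.
by apply: le_lt_trans (cnorm_trans y _ _) _; rewrite [e]splitr ltrD.
Qed.

Lemma linspan_sub S x : S x -> linspan S x.
Proof. by move=> Sx; exists [:: (1, x)]; rewrite big_seq1 scale1r; split=> // p; rewrite inE => /eqP ->. Qed.

Lemma linspan0 S : linspan S 0.
Proof. by exists [::]; rewrite big_nil. Qed.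

Lemma linspanD S (c : C) x y : linspan S x -> linspan S y -> linspan S (c *: x + y).
Proof.
move=> [s [hs ->]] [t [ht ->]]; exists ([seq (c * p.1, p.2) | p <- s] ++ t); split.
  by move=> p; rewrite mem_cat => /orP[/mapP[q /hs h ->]|/ht].
rewrite big_cat big_map scaler_sumr; congr (_ + _).
by apply: eq_bigr => p _; rewrite scalerA.
Qed.

Lemma linspan_sum S (I : eqType) (r : seq I) (F : I -> A) :
  (forall i, i \in r -> linspan S (F i)) -> linspan S (\sum_(i <- r) F i).
Proof.
elim: r => [|i r IH] h; first by rewrite big_nil; exact: linspan0.
rewrite big_cons -[F i]scale1r; apply: linspanD; first by apply: h; rewrite inE eqxx.
by apply: IH => j jr; apply: h; rewrite inE jr orbT.
Qed.

Lemma linspan_ind S (Q : A -> Prop) : Q 0 ->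
  (forall (c : C) x y, S x -> Q y -> Q (c *: x + y)) -> forall x, linspan S x -> Q x.
Proof.
move=> Q0 QD x [s [hs ->]]; elim: s hs => [|p s IH] h; first by rewrite big_nil.
rewrite big_cons; apply: QD; first by apply: h; rewrite inE eqxx.
by apply: IH => q qs; apply: h; rewrite inE qs orbT.
Qed.

Lemma linspan_subalgebra S : (forall x y, S x -> S y -> S (x * y)) ->
  (forall x, S x -> S (star x)) -> star_subalgebra (linspan S).
Proof.
move=> SM Ss; split; [exact: linspan0 | by move=> *; exact: linspanD | |].
- move=> x y hx hy; apply: (linspan_ind (Q := fun z => linspan S (z * y))) hx => [|c a b Sa hb].
    by rewrite mul0r; exact: linspan0.
  rewrite mulrDl -scalerAl; apply: linspanD => //.
  apply: (linspan_ind (Q := fun z => linspan S (a * z))) hy => [|d a' b' Sa' hb']; first by rewrite mulr0; exact: linspan0.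
  by rewrite mulrDr -scalerAr; apply: linspanD => //; apply: linspan_sub; exact: SM.
- move=> x hx; apply: (linspan_ind (Q := fun z => linspan S (star z))) hx => [|c a b Sa hb]; first by rewrite star0; exact: linspan0.
  by rewrite starD starZ; apply: linspanD => //; apply: linspan_sub; exact: Ss.
Qed.

End Closure.

Section LimitElements.
Variables (R : realType) (GG : indsys R) (D : branching GG) (L : limit_algebra D).
Local Notation C := (R[i]).
Local Notation A := (lim_A L).
Local Notation W := (lim_W L).
Local Notation fam N := (matfamily (isys_dual GG N)).

Lemma Thmap_opbound N (x : fam N) K : 0 <= K -> (forall q, opbound (x q) K) ->
  forall p, opbound (Thmap D x p) K.
Proof.
move=> K0 h p; apply/opboundP => // v.
have E (X : fam N) (u : 'cV[C]_(irr_dim p)) : (adjmx u *m sumQ D p X *m u) 0 0 =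
   \sum_(q <- br_supp D p) \sum_(l < br_mult D q p)
     (adjmx (adjmx (br_S l) *m u) *m X q *m (adjmx (br_S l) *m u)) 0 0.
  rewrite /sumQ mulmx_sumr mulmx_suml summxE; apply: eq_bigr => q _.
  rewrite mulmx_sumr mulmx_suml summxE; apply: eq_bigr => l _.
  by rewrite adjmxM adjmxK !mulmxA.
have aT : adjmx (Thmap D x p) = sumQ D p (fun q => adjmx (x q)).
  rewrite /Thmap /sumQ adjmx_sum; apply: eq_bigr => q _; rewrite adjmx_sum; apply: eq_bigr => l _.
  by rewrite !adjmxM adjmxK mulmxA.
have -> : adjmx (Thmap D x p *m v) *m (Thmap D x p *m v) =
    adjmx v *m sumQ D p (fun q => adjmx (x q) *m x q) *m v.
  by rewrite adjmxM aT -sumQ_mul !mulmxA.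
rewrite -[adjmx v in leRHS]mulmx1 -(sumQ1 D p) !E mulr_sumr; apply: ler_sum => q _.
rewrite mulr_sumr; apply: ler_sum => l _.
by have /(opboundP _ K0)/(_ (adjmx (br_S l) *m v)) := h q; rewrite adjmxM !mulmxA mulmx1.
Qed.

Lemma Thmap_Wstar N (x : fam N) : in_Wstar x -> in_Wstar (Thmap D x).
Proof.
move=> [K hK]; pose K' := Num.max K 0; exists K' => p.
have K0 : 0 <= K' by rewrite le_max lexx orbT.
apply: opnorm_le => //; apply: Thmap_opbound => // q v.
apply: le_trans (opbound_opnorm _ _) _; rewrite ler_wpM2r ?cvnorm_ge0 //.
by apply: le_trans (hK q) _; rewrite le_max lexx.
Qed.

(* [Theta_(k + N - 1) o ... o Theta_N]; the index [k + N] makes it well typed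
   without casts. *)
Fixpoint Thn k N (x : fam N) : fam (k + N) :=
  match k return fam (k + N) with k'.+1 => Thmap D (@Thn k' N x) | 0 => x end.
Arguments Thn k {N} x.

Lemma Thn_Wstar k N (x : fam N) : in_Wstar x -> in_Wstar (Thn k x).
Proof. by move=> hx; elim: k => //= k; exact: Thmap_Wstar. Qed.

Lemma Psi_Thn k N (x : fam N) : in_Wstar x -> lim_Psi L (Thn k x) = lim_Psi L x.
Proof.
move=> hx; elim: k => //= k <-; apply: lim_Psi_Theta; first exact: Thn_Wstar.
exact: Thmap_is_Theta.
Qed.

Local Notation inc := (@lim_inc _ _ _ L).

Lemma inc_lin (c : C) a b : inc (c *: a + b) = c *: inc a + inc b.
Proof. exact: (starhom_linear (lim_inc_hom L)). Qed.
Lemma incM a b : inc (a * b) = inc a * inc b.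
Proof. exact: (starhomM (lim_inc_hom L)). Qed.
Lemma inc_star a : inc (star a) = star (inc a).
Proof. exact: (starhom_star (lim_inc_hom L)). Qed.
Lemma inc1 : inc 1 = 1.
Proof. exact: (starhom1 (lim_inc_hom L)). Qed.
Lemma incB a b : inc (a - b) = inc a - inc b.
Proof. by have := inc_lin (-1) b a; rewrite !scaleN1r addrC => ->; rewrite addrC. Qed.
Lemma inc0 : inc 0 = 0.
Proof. by rewrite -(subrr 0) incB subrr. Qed.
Lemma lim_inc_inj : injective inc.
Proof.
move=> a b h; apply/eqP; rewrite -subr_eq0; apply/eqP/cnorm0_eq0.
by rewrite -(lim_inc_norm (l := L)) incB h subrr cnorm0.
Qed.

(* The element of [lim_A] defined by [x], and [0] when [x] is not in [C*(G_N)]. *)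
Definition lel N (x : fam N) : A :=
  if pselect (exists a, inc a = lim_Psi L x) is left h then sval (cid h) else 0.

Lemma lelE N (x : fam N) : in_Cstar x -> inc (lel x) = lim_Psi L x.
Proof.
move=> hx; rewrite /lel; case: pselect => [h|n]; first exact: (svalP (cid h)).
case: n; have : [set z | exists a, z = inc a] (lim_Psi L x).
  by rewrite lim_inc_range => S _ _; apply; exists N, x.
by move=> [a ->]; exists a.
Qed.

Lemma lel_Cstar_elt N (x : fam N) : in_Cstar x -> is_Cstar_elt x (lel x).
Proof. by move=> hx; split=> //; exact: lelE. Qed.

Lemma lel_uniq N (x : fam N) a : in_Cstar x -> inc a = lim_Psi L x -> a = lel x.
Proof. by move=> hx h; apply: lim_inc_inj; rewrite lelE. Qed.

Lemma fsupp_lin N (c : C) (x y : fam N) : fsupp x -> fsupp y -> fsupp (fun p => c *: x p + y p).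
Proof.
move=> hx hy; apply: sub_finite_set (_ : finite_set ([set p | x p != 0] `|` [set p | y p != 0])).
  move=> p /= h; apply: contrapT => n; move: h; apply/negP/negPn/eqP.
  have [->|x0] := eqVneq (x p) 0; last by case: n; left.
  have [->|y0] := eqVneq (y p) 0; last by case: n; right.
  by rewrite scaler0 addr0.
by rewrite finite_setU.
Qed.

Lemma fsupp_mulr N (x y : fam N) : fsupp y -> fsupp (fun p => x p *m y p).
Proof.
apply: sub_finite_set => p /=; apply: contra_neq => ->; exact: mulmx0.
Qed.

Lemma fsupp_adj N (x : fam N) : fsupp x -> fsupp (fun p => adjmx (x p)).
Proof.
apply: sub_finite_set => p /=; apply: contra_neq => ->.
by apply/matrixP => i j; rewrite !mxE rmorph0.
Qed.

Lemma lel_lin N (c : C) (x y : fam N) : fsupp x -> fsupp y ->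
  lel (fun p => c *: x p + y p) = c *: lel x + lel y.
Proof.
move=> hx hy; apply/esym/lel_uniq; first exact/fsupp_Cstar/fsupp_lin.
rewrite inc_lin !lelE; try exact: fsupp_Cstar.
by rewrite lim_Psi_linear //; exact: fsupp_Wstar.
Qed.

Lemma lel_star N (x : fam N) : fsupp x -> star (lel x) = lel (fun p => adjmx (x p)).
Proof.
move=> hx; apply/lel_uniq; first exact/fsupp_Cstar/fsupp_adj.
by rewrite inc_star lelE ?lim_Psi_star //; [exact: fsupp_Wstar | exact: fsupp_Cstar].
Qed.

Lemma lelM_Thn k N (x : fam N) (y : fam (k + N)) : fsupp x -> fsupp y ->
  lel x * lel y = lel (fun p => Thn k x p *m y p).
Proof.
move=> hx hy; apply/lel_uniq; first exact/fsupp_Cstar/fsupp_mulr.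
rewrite incM !lelE; try exact: fsupp_Cstar.
rewrite -(Psi_Thn k) ?lim_PsiM //; try exact: fsupp_Wstar.
exact/Thn_Wstar/fsupp_Wstar.
Qed.

Lemma lel_norm N (x : fam N) K : fsupp x -> 0 <= K -> (forall p, opnorm (x p) <= K) ->
  cnorm (lel x) <= K.
Proof.
move=> hx K0 h; rewrite -(lim_inc_norm (l := L)) lelE; last exact: fsupp_Cstar.
by rewrite lim_Psi_norm; [exact: fam_norm_le | exact: fsupp_Wstar].
Qed.

Definition local_elt N (p : isys_dual GG N) (M : 'M[C]_(irr_dim p)) : A := lel (sv M).

Lemma eq_fam N (x y : fam N) : (forall p, x p = y p) -> x = y.
Proof. exact: functional_extensionality_dep. Qed.

Lemma lv_lin N (p : isys_dual GG N) (c : C) M M' : local_elt (c *: M + M') = c *: local_elt M + @local_elt N p M'.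
Proof.
rewrite /local_elt -lel_lin; try exact: sv_fsupp.
congr lel; apply: eq_fam => q; have [e|n] := pselect (p = q); last by rewrite !sv_neq // scaler0 addr0.
by case: q / e; rewrite !sv_id.
Qed.

Lemma lv0 N (p : isys_dual GG N) : @local_elt N p 0 = 0.
Proof. by have := lv_lin (p := p) (-1) 0 0; rewrite scaleN1r addrC subrr scaleN1r addrC subrr. Qed.
Lemma lvD N (p : isys_dual GG N) M M' : local_elt (M + M') = local_elt M + @local_elt N p M'.
Proof. by have := lv_lin (p := p) 1 M M'; rewrite !scale1r. Qed.
Lemma lvZ N (p : isys_dual GG N) (c : C) M : local_elt (c *: M) = c *: @local_elt N p M.
Proof. by have := lv_lin (p := p) c M 0; rewrite lv0 !addr0. Qed.
Lemma lv_sum N (p : isys_dual GG N) (I : Type) (r : seq I) (F : I -> 'M[C]_(irr_dim p)) :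
  local_elt (\sum_(i <- r) F i) = \sum_(i <- r) local_elt (F i).
Proof. by apply: big_morph; [exact: lvD | exact: lv0]. Qed.

Lemma lv_star N (p : isys_dual GG N) M : star (@local_elt N p M) = local_elt (adjmx M).
Proof.
rewrite /local_elt lel_star; last exact: sv_fsupp.
congr lel; apply: eq_fam => q; rewrite (sv_fun (f := fun q => @adjmx R _ _)) // => q'.
by apply/matrixP => i j; rewrite !mxE rmorph0.
Qed.

Lemma lelMlv k N (x : fam N) (p : isys_dual GG (k + N)) M : fsupp x ->
  lel x * local_elt M = @local_elt _ p (Thn k x p *m M).
Proof.
move=> hx; rewrite /local_elt lelM_Thn //; last exact: sv_fsupp.
by congr lel; apply: eq_fam => q; rewrite (sv_fun (f := fun q M => Thn k x q *m M)) // => q'; exact: mulmx0.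
Qed.

Lemma lvMlv N (p : isys_dual GG N) M M' : local_elt M * local_elt M' = @local_elt N p (M *m M').
Proof. by rewrite (@lelMlv 0) /= ?sv_id //; exact: sv_fsupp. Qed.

Lemma lvM_neq N (p q : isys_dual GG N) M M' : p <> q -> @local_elt N p M * @local_elt N q M' = 0.
Proof. by move=> n; rewrite (@lelMlv 0) /= ?sv_neq ?mul0mx ?lv0 //; exact: sv_fsupp. Qed.

Lemma Thn_adj k N (x : fam N) p : adjmx (Thn k x p) = Thn k (fun q => adjmx (x q)) p.
Proof.
elim: k p => //= k IH p; rewrite /Thmap adjmx_sum; apply: eq_bigr => q _.
rewrite adjmx_sum; apply: eq_bigr => l _.
by rewrite !adjmxM adjmxK IH mulmxA.
Qed.

Lemma lvMlel k N (x : fam N) (p : isys_dual GG (k + N)) M : fsupp x ->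
  local_elt M * lel x = @local_elt _ p (M *m Thn k x p).
Proof.
move=> hx; rewrite -[LHS]starK starM lv_star lel_star // lelMlv; last exact: fsupp_adj.
by rewrite lv_star adjmxM adjmxK Thn_adj; congr (local_elt (_ *m Thn _ _ _)); apply: eq_fam => q; rewrite adjmxK.
Qed.

Lemma lel_decomp N (x : fam N) (s : seq (isys_dual GG N)) : fsupp x -> uniq s ->
  (forall p, x p != 0 -> p \in s) -> lel x = \sum_(p <- s) local_elt (x p).
Proof.
elim: s x => [|q s IH] x hx /=.
  move=> _ h; rewrite big_nil; have -> : x = fun p => 0.
    by apply: eq_fam => p; apply/eqP/negPn/negP => /h.
  have f0 : fsupp (fun p : isys_dual GG N => 0 : 'M[C]_(irr_dim p)).
    by rewrite /fsupp (_ : [set p | _] = set0) //; apply/seteqP; split=> // p /=; rewrite eqxx.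
  apply: lim_inc_inj; rewrite inc0 lelE; last exact: fsupp_Cstar.
  apply: cnorm0_eq0; rewrite lim_Psi_norm; last exact: fsupp_Wstar.
  apply/le_anti; rewrite fam_norm_le //=; last by move=> p; rewrite opnorm0.
  have [[p0 _]|n] := pselect (exists p : isys_dual GG N, True).
    apply: ub_le_sup; first by exists 0 => r [p ->]; rewrite opnorm0.
    by exists p0; rewrite opnorm0.
  rewrite /fam_norm (_ : [set r | _] = set0) ?sup0 //.
  by apply/seteqP; split=> // r [p _]; apply: n; exists p.
move=> /andP[ns us] h; rewrite big_cons.
pose y : fam N := fun p => (-1) *: sv (x q) p + x p.
have yE p : p <> q -> y p = x p by move=> n; rewrite /y sv_neq ?scaler0 ?add0r // => E; apply: n.
have yq : y q = 0 by rewrite /y sv_id scaleN1r addrC subrr.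
have hy : fsupp y by apply: fsupp_lin => //; exact: sv_fsupp.
have <- : lel y = \sum_(p <- s) local_elt (x p).
  rewrite (IH y) //.
    apply: eq_big_seq => p ps; rewrite yE // => E; by rewrite -E ps in ns.
  move=> p; have [->|/eqP n] := eqVneq p q; first by rewrite yq eqxx.
  by rewrite yE // => /h; rewrite inE => /orP[/eqP|].
by rewrite /y lel_lin ?scaleN1r; [rewrite addrA subrr add0r | exact: sv_fsupp |].
Qed.

Definition vset : set A := [set a | exists N (p : isys_dual GG N) (M : 'M[C]_(irr_dim p)), a = local_elt M].

Lemma vsetM a b : vset a -> vset b -> vset (a * b).
Proof.
have key N (p : isys_dual GG N) M k (p' : isys_dual GG (k + N)) M' :
   vset (@local_elt N p M * @local_elt _ p' M') /\ vset (@local_elt _ p' M' * @local_elt N p M).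
  split; first by rewrite lelMlv; [exists (k + N)%N, p'; eexists|exact: sv_fsupp].
  by rewrite lvMlel; [exists (k + N)%N, p'; eexists|exact: sv_fsupp].
move=> [N [p [M ->]]] [N' [p' [M' ->]]].
have [h|/ltnW h] := leqP N N'.
  have [k E] : exists k, N' = (k + N)%N by exists (N' - N)%N; rewrite subnK.
  by subst N'; exact: (key _ _ _ _ _ _).1.
have [k E] : exists k, N = (k + N')%N by exists (N - N')%N; rewrite subnK.
by subst N; exact: (key _ _ _ _ _ _).2.
Qed.

Lemma vset_star a : vset a -> vset (star a).
Proof. by move=> [N [p [M ->]]]; rewrite lv_star; exists N, p; eexists. Qed.

Lemma vspan_subalgebra : star_subalgebra (linspan vset).
Proof. by apply: linspan_subalgebra; [exact: vsetM | exact: vset_star]. Qed.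

Lemma vset_dense : cdense (linspan vset).
Proof.
apply/seteqP; split=> // a _.
have [E0 ED EM Es] := vspan_subalgebra.
have sI : star_subalgebra (inc @` linspan vset).
  split.
  - by exists 0; rewrite ?inc0.
  - by move=> c _ _ [x hx <-] [y hy <-]; exists (c *: x + y); [exact: ED | rewrite inc_lin].
  - by move=> _ _ [x hx <-] [y hy <-]; exists (x * y); [exact: EM | rewrite incM].
  - by move=> _ [x hx <-]; exists (star x); [exact: Es | rewrite inc_star].
have h : cclosure (inc @` linspan vset) (inc a).
  have : [set z | exists a, z = inc a] (inc a) by exists a.
  rewrite lim_inc_range; apply; [exact: cclosure_subalgebra | exact: cclosureK |].
  move=> _ [N [x [hx ->]]] e e0; have e2 : 0 < e / 2 by rewrite divr_gt0.
  have [y [hy xy]] := hx _ e2; exists (lim_Psi L y); split.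
    exists (lel y); last exact: lelE (fsupp_Cstar hy).
    rewrite (lel_decomp hy (fset_uniq (fset_set [set p | y p != 0]))).
      by apply: linspan_sum => p _; apply: linspan_sub; exists N, p; eexists.
    by move=> p yp; rewrite in_fset_set ?inE.
  have -> : lim_Psi L x - lim_Psi L y = lim_Psi L (fun p => (-1) *: y p + x p).
    by rewrite lim_Psi_linear ?scaleN1r 1?addrC //; [exact: fsupp_Wstar | exact: Cstar_Wstar].
  have le p : opnorm ((-1) *: y p + x p) <= e / 2 by rewrite scaleN1r addrC; exact: xy.
  rewrite lim_Psi_norm; last by exists (e / 2).
  apply: le_lt_trans (fam_norm_le (ltW e2) le) _.
  by rewrite gtr_pMr // invf_lt1 // ltr1n.
move=> e e0; have [_ [[b hb <-] h2]] := h _ e0; exists b; split=> //.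
by rewrite -(lim_inc_norm (l := L)) incB.
Qed.

End LimitElements.
Arguments Thn {R GG} D k {N} x.
Arguments vset {R GG D} L _.

Section EigenUnits.
Variables (R : realType) (n : nat) (F : 'M[R[i]]_n).
Hypothesis hF : posdefmx F.
Local Notation C := (R[i]).
Local Notation O := (spmx F).
Local Notation d := (eigval F).

Definition cis (s : R) : C := Complex (cos s) (sin s).

Lemma cisD a b : cis (a + b) = cis a * cis b.
Proof.
apply/eqP; rewrite eq_complex /= cosD sinD; apply/andP; split=> //.
by rewrite [X in _ == X]addrC addrC [X in X + _]mulrC [X in _ + X]mulrC; apply/eqP; ring.
Qed.

(* Matrix units of an eigenbasis of [F]. *)
Definition eig (j k : 'I_n) : 'M[C]_n := adjmx O *m delta_mx j k *m O.

Let OO : O *m adjmx O = 1%:M := spectral_adjr F.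
Let O'O : adjmx O *m O = 1%:M := spectral_adjl F.

Let conjM (X Y : 'M[C]_n) : (adjmx O *m X *m O) *m (adjmx O *m Y *m O) = adjmx O *m (X *m Y) *m O.
Proof. by rewrite !mulmxA -(mulmxA _ O (adjmx O)) OO mulmx1. Qed.

Lemma eigM j k l m : eig j k *m eig l m = (k == l)%:R *: eig j m.
Proof.
rewrite /eig conjM; case: (eqVneq k l) => [->|n0].
  by rewrite mul_delta_mx scale1r.
by rewrite mul_delta_mx_0 // mulmx0 mul0mx scale0r.
Qed.

Lemma adj_eig j k : adjmx (eig j k) = eig k j.
Proof.
rewrite /eig !adjmxM adjmxK mulmxA; congr (_ *m _ *m _).
by apply/matrixP => a b; rewrite !mxE andbC rmorph_nat.
Qed.

Lemma eig_decomp M : M = \sum_j \sum_k (O *m M *m adjmx O) j k *: eig j k.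
Proof.
pose Y := O *m M *m adjmx O.
have ME : M = adjmx O *m Y *m O by rewrite /Y !mulmxA O'O mul1mx -mulmxA O'O mulmx1.
rewrite {1}ME -/Y [Y in _ *m Y *m _]matrix_sum_delta mulmx_sumr mulmx_suml; apply: eq_bigr => j _.
by rewrite mulmx_sumr mulmx_suml; apply: eq_bigr => k _; rewrite -scalemxAr -scalemxAl.
Qed.

Lemma F_eig j k : F *m eig j k = (d j)%:C%C *: eig j k.
Proof.
have [FE _] := posdef_spectralE hF.
rewrite {1}FE /eig conjM scalemxAl scalemxAr; congr (_ *m _ *m _).
apply/matrixP => a b; rewrite mul_diag_mx !mxE.
by case: eqVneq => [->|_] //=; rewrite !mulr0.
Qed.

Lemma eig_F j k : eig j k *m F = (d k)%:C%C *: eig j k.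
Proof.
have aF : adjmx F = F by case: hF.
rewrite -[LHS]adjmxK adjmxM adj_eig aF F_eig adjmxZ adj_eig conj_rc //.
Qed.

Lemma eigval_gt0 j : 0 < d j.
Proof. by have [_] := posdef_spectralE hF. Qed.

Lemma trF_eig j k : \tr (F *m eig j k) = (j == k)%:R * (d j)%:C%C.
Proof.
rewrite F_eig linearZ /= /eig mxtrace_mulC mulmxA OO mul1mx mulrC; congr (_ * _).
rewrite /mxtrace (bigD1 j) //= big1 ?addr0 => [|a aj]; rewrite !mxE ?eqxx //=.
by rewrite (negbTE aj).
Qed.

Lemma imag_pow_eig t j k : imag_pow F t *m eig j k *m imag_pow F (- t) =
  cis (t * (ln (d j) - ln (d k))) *: eig j k.
Proof.
have e s : imag_pow F s = adjmx O *m diag_mx (\row_i cis (s * ln (d i))) *m O.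
  rewrite /imag_pow /adjmx -(invmx_unitary (spectral_unitarymx F)); congr (_ *m diag_mx _ *m _).
  by apply/matrixP => a b; rewrite ord1 !mxE.
rewrite !e /eig !conjM scalemxAl scalemxAr; congr (_ *m _ *m _).
apply/matrixP => a b; rewrite mul_mx_diag mul_diag_mx !mxE.
case: (eqVneq a j) => [->|_] /=; last by rewrite ?mulr0 ?mul0r ?mulr0.
case: (eqVneq b k) => [->|_] /=; last by rewrite ?mulr0 ?mul0r ?mulr0.
by rewrite !mulr1 -cisD; congr cis; ring.
Qed.

End EigenUnits.

Section Corresponding.
Variables (R : realType) (GG : indsys R) (D : branching GG) (L : limit_algebra D).
Local Notation C := (R[i]).
Local Notation A := (lim_A L).
Local Notation F p := (br_F D p).
Local Notation lv := (@local_elt R GG D L _ _).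

Lemma inc_eq (a b : A) : lim_inc a = lim_inc b -> a = b.
Proof. exact: lim_inc_inj. Qed.

Lemma br_F_pos N (p : isys_dual GG N) : posdefmx (F p).
Proof. by have [] := br_FP D p. Qed.

Lemma Thn_eig k N (x : matfamily (isys_dual GG N)) (lam : C) :
  (forall q, F q *m x q = lam *: (x q *m F q)) ->
  forall p, F p *m Thn D k x p = lam *: (Thn D k x p *m F p).
Proof.
elim: k => [|k IH] h //= p; have {}IH := IH h.
rewrite /Thmap mulmx_sumr mulmx_suml scaler_sumr; apply: eq_bigr => q _.
rewrite mulmx_sumr mulmx_suml scaler_sumr; apply: eq_bigr => l _.
have SF : adjmx (br_S l) *m F p = (br_weight l)%:C%C *: (F q *m adjmx (br_S l)).
  have [aFp _] := br_F_pos p; have [aFq _] := br_F_pos q.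
  have := congr1 (@adjmx R _ _) (br_FS l).
  by rewrite !adjmxM adjmxZ adjmxM aFp aFq conj_rc.
rewrite !mulmxA br_FS -!scalemxAl -[X in _ = _ *: X]mulmxA SF -!scalemxAr scalerA.
by rewrite -(mulmxA _ (F q)) IH -scalemxAr -scalemxAl scalerA mulrC !mulmxA.
Qed.

Definition frq N (p : isys_dual GG N) j k : R := ln (eigval (F p) j) - ln (eigval (F p) k).
Definition eigratio N (p : isys_dual GG N) j k : C := (eigval (F p) j / eigval (F p) k)%:C%C.

Lemma F_eig_ratio N (p : isys_dual GG N) j k :
  F p *m eig (F p) j k = eigratio j k *: (eig (F p) j k *m F p).
Proof.
have pF := br_F_pos p; rewrite F_eig // eig_F // scalerA /eigratio -rcM divfK //.
by rewrite gt_eqF // eigval_gt0.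
Qed.

Lemma flow_eig t N (p : isys_dual GG N) j k :
  lim_flow t (lv (eig (F p) j k)) = cis (t * frq j k) *: lv (eig (F p) j k).
Proof.
have hs (M : 'M[C]_(irr_dim p)) := sv_fsupp (G := GG N) M.
apply: inc_eq; rewrite (lim_flowE _ (fsupp_Cstar (hs _)) (lelE L (fsupp_Cstar (hs _)))).
rewrite -lvZ /local_elt lelE; last exact: fsupp_Cstar.
congr lim_Psi; apply: eq_fam => q.
rewrite (sv_fun (f := fun q M => imag_pow (F q) t *m M *m imag_pow (F q) (- t))); last first.
  by move=> q'; rewrite mulmx0 mul0mx.
by rewrite imag_pow_eig //; exact: br_F_pos.
Qed.

Definition trform N (p : isys_dual GG N) (M : 'M[C]_(irr_dim p)) : C :=
  \tr (F p *m M) / (dimq D p)%:C%C.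

Lemma dimqC_neq0 N (p : isys_dual GG N) : (dimq D p)%:C%C != 0 :> C.
Proof. by rewrite (inj_eq (@complexI R)) gt_eqF // dimq_gt0. Qed.

Lemma trform1 N (p : isys_dual GG N) : trform (1%:M : 'M[C]_(irr_dim p)) = 1.
Proof. by rewrite /trform mulmx1 dimqE divff // dimqC_neq0. Qed.

Lemma lv_root (p : isys_dual GG 0) : lv (1%:M : 'M[C]_(irr_dim p)) = 1.
Proof.
apply: inc_eq; rewrite inc1 lelE; last exact/fsupp_Cstar/sv_fsupp.
rewrite -(lim_Psi1 L 0); congr lim_Psi; apply: eq_fam => q.
by rewrite (irr0_uniq q p) sv_id.
Qed.

Lemma local_trace (phi : A -> C) N (p : isys_dual GG N) :
  (forall (c : C) x y, phi (c *: x + y) = c * phi x + phi y) ->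
  (forall j k (M : 'M[C]_(irr_dim p)),
     phi (lv (eig (F p) j k) * lv M) = eigratio j k * phi (lv M * lv (eig (F p) j k))) ->
  forall M : 'M[C]_(irr_dim p), phi (lv M) = phi (lv (1%:M : 'M[C]_(irr_dim p))) * trform M.
Proof.
move=> lin tw; have pF := br_F_pos p.
have p0 : phi 0 = 0 by have := lin (-1) 0 0; rewrite scaleN1r addrC subrr => ->; rewrite mulN1r addrC subrr.
have pD x y : phi (x + y) = phi x + phi y by have := lin 1 x y; rewrite scale1r mul1r.
have pZ c x : phi (c *: x) = c * phi x by have := lin c x 0; rewrite p0 !addr0.
have psum (I : Type) (r : seq I) (f : I -> A) : phi (\sum_(i <- r) f i) = \sum_(i <- r) phi (f i).
  exact: (big_morph phi pD p0).
have n0 := irr_dim_gt0 p; pose k0 := Ordinal n0.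
pose c := phi (lv (eig (F p) k0 k0)) / (eigval (F p) k0)%:C%C.
have d0 j : (eigval (F p) j)%:C%C != 0 :> C.
  by rewrite (inj_eq (@complexI R)) gt_eqF // eigval_gt0.
have key j k : phi (lv (eig (F p) j k)) = c * \tr (F p *m eig (F p) j k).
  rewrite trF_eig //; case: (eqVneq j k) => [<-|jk].
    have := tw j k0 (eig (F p) k0 j); rewrite !lvMlv !eigM eqxx !scale1r => ->.
    by rewrite eqxx scale1r mul1r /c /eigratio rcM fmorphV /=; field; rewrite d0.
  have := tw j j (eig (F p) j k); rewrite !lvMlv !eigM eqxx eq_sym (negbTE jk) scale1r scale0r lv0 p0 => ->.
  by rewrite mulr0 mul0r mulr0.
have lE (M : 'M[C]_(irr_dim p)) : phi (lv M) = c * \tr (F p *m M).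
  rewrite [M in LHS](eig_decomp (F p)) [M in RHS](eig_decomp (F p)).
  rewrite lv_sum psum mulmx_sumr raddf_sum mulr_sumr; apply: eq_bigr => j _ /=.
  rewrite lv_sum psum mulmx_sumr raddf_sum mulr_sumr; apply: eq_bigr => k _ /=.
  by rewrite lvZ pZ key -scalemxAr linearZ /= mulrCA.
move=> M; rewrite !lE mulmx1 dimqE /trform; field; exact: dimqC_neq0.
Qed.

Lemma scalar_fun_lin (phi : A -> C) : (forall (c : C) x y, phi (c *: x + y) = c * phi x + phi y) ->
  [/\ phi 0 = 0, forall x y, phi (x + y) = phi x + phi y, forall c x, phi (c *: x) = c * phi x &
   forall (I : Type) (r : seq I) (f : I -> A), phi (\sum_(i <- r) f i) = \sum_(i <- r) phi (f i)].
Proof.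
move=> lin.
have p0 : phi 0 = 0 by have := lin (-1) 0 0; rewrite scaleN1r addrC subrr => ->; rewrite mulN1r addrC subrr.
have pD x y : phi (x + y) = phi x + phi y by have := lin 1 x y; rewrite scale1r mul1r.
have pZ c x : phi (c *: x) = c * phi x by have := lin c x 0; rewrite p0 !addr0.
by split=> // I r f; exact: (big_morph phi pD p0).
Qed.

Lemma eq_on_vset (phi psi : A -> C) (K K' : R) :
  (forall (c : C) x y, phi (c *: x + y) = c * phi x + phi y) ->
  (forall (c : C) x y, psi (c *: x + y) = c * psi x + psi y) ->
  (forall x, cabs (phi x) <= K * cnorm x) -> (forall x, cabs (psi x) <= K' * cnorm x) ->
  (forall x, vset L x -> phi x = psi x) -> forall x, phi x = psi x.
Proof.
move=> l1 l2 b1 b2 h x.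
have [phi0 phiD _ _] := scalar_fun_lin l1; have [psi0 psiD _ _] := scalar_fun_lin l2.
have hs y : linspan (vset L) y -> phi y = psi y.
  apply: (linspan_ind (Q := fun y => phi y = psi y)); first by rewrite phi0 psi0.
  by move=> c a b va hb; rewrite l1 l2 h // hb.
apply: eq_cabs_eps => e e0; pose M := `|K| + `|K'| + 1.
have M0 : 0 < M by rewrite /M ltr_wpDl // addr_ge0.
have : cclosure (linspan (vset L)) x by rewrite (vset_dense L).
move=> /(_ _ (divr_gt0 e0 M0))[y [hy xy]].
have pB z w : phi (z - w) = phi z - phi w by rewrite -scaleN1r addrC l1 mulN1r addrC.
have sB z w : psi (z - w) = psi z - psi w by rewrite -scaleN1r addrC l2 mulN1r addrC.
have -> : phi x - psi x = phi (x - y) - psi (x - y) by rewrite pB sB (hs y hy); ring.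
apply: le_trans (cabsD _ _) _; rewrite cabsN.
apply: le_trans (lerD (b1 _) (b2 _)) _.
apply: le_trans (_ : M * cnorm (x - y) <= _).
  rewrite -mulrDl ler_wpM2r ?cnorm_ge0 // /M -[leLHS]addr0 lerD // lerD ?ler_norm //.
by rewrite mulrC -ler_pdivlMr // ltW.
Qed.

Section CorrespondingState.
Variables (o : inf_path (branching_graph D)) (P : probability (Omega o) R).
Hypothesis cP : central P.
Variable chi : A -> C.
Hypotheses (sc : is_state chi) (cc : corresponds P chi).
Local Notation hB := (branching_regular D).

Definition vertex_pr N (p : isys_dual GG N) : R := pr P (@XE R (branching_graph D) o (vtx D p)).

Lemma wt_ge0 N (p : isys_dual GG N) : 0 <= vertex_pr p.
Proof. exact: pr_ge0. Qed.

Lemma corr_lv N (p : isys_dual GG N) (M : 'M[C]_(irr_dim p)) :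
  chi (lv M) = (vertex_pr p)%:C%C * trform M.
Proof.
case: N p M => [|N] p M.
  have -> : M = (\tr M) *: 1%:M.
    have := irr0_dim p; move: M; move: (irr_dim p) => n M n1; subst n.
    by apply/matrixP => i j; rewrite !ord1 !mxE /mxtrace big_ord1 eqxx mulr1.
  rewrite lvZ lv_root (stateZ sc) (state1 sc) mulr1 /trform -scalemxAr linearZ /= mulmx1.
  rewrite dimqE mulfK ?dimqC_neq0 // /vertex_pr (XE_root hB) // pr_setT mul1r //.
apply: eq_cabs_eps => e e0.
have hs := sv_fsupp (I := isys_dual GG N.+1) M.
have [J0 hJ] := cc (ltn0Sn N) (lel_Cstar_elt L (fsupp_Cstar hs)) e0.
have := hJ _ (fsubsetUl J0 [fset p]%fset); rewrite -/(local_elt L M) => h.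
apply/ltW; apply: le_lt_trans h; rewrite le_eqVlt; apply/orP; left; apply/eqP; congr (cabs (_ - _)).
rewrite (bigD1_seq p) ?fset_uniq ?inE ?eqxx ?orbT //= big1 ?addr0 => [|q qp]; last first.
  rewrite /irr_character sv_neq ?mulmx0 ?mxtrace0 ?mul0r ?mulr0 // => E.
  by rewrite E eqxx in qp.
by rewrite /irr_character sv_id /vertex_pr (X_eqE (v := vtx D p) o (ltn0Sn N) erefl) dimqE.
Qed.

Lemma trform_twist N (p : isys_dual GG N) (lam : C) (Y M : 'M[C]_(irr_dim p)) :
  F p *m Y = lam *: (Y *m F p) -> trform (Y *m M) = lam * trform (M *m Y).
Proof.
move=> h; rewrite /trform mulmxA h -scalemxAl linearZ /= -mulrA; congr (_ * (_ / _)).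
by rewrite -mulmxA mxtrace_mulC -mulmxA.
Qed.

Lemma chi_twist N (p : isys_dual GG N) j k a :
  chi (lv (eig (F p) j k) * a) = eigratio j k * chi (a * lv (eig (F p) j k)).
Proof.
set Y := lv _; pose K := cabs (eigratio j k) * cnorm Y.
apply: (@eq_on_vset (fun a => chi (Y * a)) (fun a => eigratio j k * chi (a * Y)) (cnorm Y) K).
- by move=> c x y; rewrite mulrDr -scalerAr (state_lin sc).
- by move=> c x y; rewrite mulrDl -scalerAl (state_lin sc); ring.
- by move=> x; apply: le_trans (state_cabs_le sc _) _; exact: ler_cnormM.
- move=> x; rewrite cabsM /K -mulrA ler_wpM2l ?cabs_ge0 // mulrC.
  by apply: le_trans (state_cabs_le sc _) _; exact: ler_cnormM.
have hY q : F q *m sv (eig (F p) j k) q = eigratio j k *: (sv (eig (F p) j k) q *m F q).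
  have [E|n] := pselect (p = q); last by rewrite !sv_neq // mulmx0 mul0mx scaler0.
  by case: q / E; rewrite sv_id; exact: F_eig_ratio.
have sY := sv_fsupp (I := isys_dual GG N) (eig (F p) j k).
move=> _ [N' [p' [M ->]]]; have [h|/ltnW h] := leqP N N'.
  have [m E] : exists m, N' = (m + N)%N by exists (N' - N)%N; rewrite subnK.
  subst N'; rewrite /Y lelMlv // lvMlel // !corr_lv [RHS]mulrCA; congr (_ * _).
  exact/trform_twist/Thn_eig.
have [m E] : exists m, N = (m + N')%N by exists (N - N')%N; rewrite subnK.
subst N; have sM := sv_fsupp (I := isys_dual GG N') M.
rewrite /Y -[local_elt L M]/(lel L (sv M)) lvMlel // lelMlv // !corr_lv [RHS]mulrCA; congr (_ * _).
exact/trform_twist/F_eig_ratio.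
Qed.

End CorrespondingState.

End Corresponding.

(** * Ergodicity implies factoriality *)

Section DominatedTraces.
Variables (R : realType) (GG : indsys R) (D : branching GG) (L : limit_algebra D).
Local Notation C := (R[i]).
Local Notation A := (lim_A L).
Local Notation F p := (br_F D p).
Local Notation lv := (@local_elt R GG D L _ _).
Local Notation hB := (branching_regular D).
Local Notation B := (branching_graph D).
Local Notation one p := (1%:M : 'M[C]_(irr_dim p)).

Lemma tr_F_Thn N (q : isys_dual GG N) k (p : isys_dual GG (k + N)) :
  \tr (F p *m Thn D k (sv (one q)) p) = (through (vtx D q) (vtx D p))%:C%C.
Proof.
elim: k p => [|k IH] p /=.
  rewrite (through_level hB) // rcM; have [->|n] := eqVneq q p.
    by rewrite sv_id mulmx1 dimqE eqxx mul1r.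
  rewrite sv_neq; last exact/eqP.
  rewrite mulmx0 mxtrace0 (_ : (_ == _) = false) ?mul0r //.
  by apply/eqP => /vtx_inj E; rewrite E eqxx in n.
rewrite tr_F_Thmap (throughS hB); last by rewrite /= ltnS leq_addl.
rewrite sum_preds rc_sum; apply: eq_bigr => r _.
by rewrite IH -rcM /kap mulr_suml.
Qed.

Lemma trform_Thn N (q : isys_dual GG N) k (p : isys_dual GG (k + N)) :
  trform D (Thn D k (sv (one q)) p) = (through (vtx D q) (vtx D p) / dimq D p)%:C%C.
Proof. by rewrite /trform tr_F_Thn rcM fmorphV. Qed.

Lemma vertex_level n (J : seq (vertex B)) : (forall v, v \in J -> level v = n) ->
  exists s : seq (isys_dual GG n), J = [seq vtx D p | p <- s].
Proof.
elim: J => [|[m p] J IH] h; first by exists [::].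
have [|s ->] := IH; first by move=> v vJ; apply: h; rewrite inE vJ orbT.
have /= E := h _ (mem_head _ _); subst m.
by exists (p :: s).
Qed.

Section WithState.
Variables (o : inf_path B) (P : probability (Omega o) R).
Hypothesis cP : central P.
Variable chi : A -> C.
Hypotheses (sc : is_state chi) (cc : corresponds P chi).
Local Notation wt := (vertex_pr P).
Local Notation XEv p := (@XE R B o (vtx D p)).

Lemma pr_and_level N (q : isys_dual GG N) k (p : isys_dual GG (k + N)) :
  pr P (XEv q `&` XEv p) = wt p * (through (vtx D q) (vtx D p) / dimq D p).
Proof.
have := pr_XE_and hB cP measurableT (@shuffle_invariantT R B o) (u := vtx D q) (v := vtx D p) (leq_addl k N).
by rewrite !setTI => ->; rewrite -/(through _ _) /vertex_pr /dimq mulrAC -mulrA.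
Qed.

Lemma level_approx N (e : R) : 0 < e -> exists s : seq (isys_dual GG N),
  forall A : set (Omega o), measurable A -> forall s' : seq (isys_dual GG N), uniq s' ->
    {subset s <= s'} -> `|pr P A - \sum_(p <- s') pr P (A `&` XEv p)| < e.
Proof.
move=> e0; have [J [uJ lJ hJ]] := level_cover hB P N measurableT e0.
have [s sE] := vertex_level lJ; subst J; exists s => S mS s' us' ss'.
have mX (v : vertex B) : measurable (@XE R B o v) by exact: (measurable_XE hB).
have mU : measurable [set w : Omega o | exists2 v, v \in [seq vtx D p | p <- s'] & XE v w].
  exact: measurable_exists_in.
have -> : \sum_(p <- s') pr P (S `&` XEv p) =
    pr P (S `&` [set w | exists2 v, v \in [seq vtx D p | p <- s'] & XE v w]).
  rewrite pr_sum ?big_map // => [|v v' /mapP[p _ ->] /mapP[p' _ ->] w].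
    by rewrite map_inj_uniq //; exact: vtx_inj.
  exact: XE_inj.
rewrite (pr_split P mS mU) addrC addKr ger0_norm ?pr_ge0 //.
apply: le_lt_trans (hJ [seq vtx D p | p <- s'] _); last first.
  by move=> v /mapP[p ps ->]; apply/mapP; exists p => //; exact: ss'.
by apply: pr_le; [exact: measurableD | exact: measurableD | move=> w [_ n]; split].
Qed.

Record dominated_trace (phi : A -> C) (K : R) : Prop := DominatedTrace {
  dt_lin : forall (c : C) x y, phi (c *: x + y) = c * phi x + phi y ;
  dt_bd : exists K', forall x, cabs (phi x) <= K' * cnorm x ;
  dt_dom : forall x, cabs (phi (star x * x)) <= K * complex.Re (chi (star x * x)) ;
  dt_twist : forall N (p : isys_dual GG N) j k (M : 'M[C]_(irr_dim p)),
    phi (lv (eig (F p) j k) * lv M) = eigratio D j k * phi (lv M * lv (eig (F p) j k))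
}.

Lemma chi_dominated : dominated_trace chi 1.
Proof.
split.
- exact: state_lin.
- by exists 1 => x; rewrite mul1r; exact: state_cabs_le.
- by move=> x; rewrite mul1r ge0_cabs ?(state_ge0 sc).
- by move=> N p j k M; exact: (chi_twist sc cc).
Qed.

Lemma dominated_trace_comb phi psi K K' (c c' : C) : dominated_trace phi K ->
  dominated_trace psi K' ->
  dominated_trace (fun x => c * phi x + c' * psi x) (cabs c * K + cabs c' * K').
Proof.
move=> [l1 [K1 b1] d1 t1] [l2 [K2 b2] d2 t2]; split.
- by move=> d x y; rewrite l1 l2; ring.
- exists (cabs c * K1 + cabs c' * K2) => x; apply: le_trans (cabsD _ _) _.
  by rewrite !cabsM mulrDl -!mulrA lerD // ler_wpM2l ?cabs_ge0.
- move=> x; apply: le_trans (cabsD _ _) _.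
  by rewrite !cabsM mulrDl -!mulrA lerD // ler_wpM2l ?cabs_ge0.
- by move=> N p j k M; rewrite t1 t2; ring.
Qed.

Lemma dt_lv phi K N (p : isys_dual GG N) (M : 'M[C]_(irr_dim p)) : dominated_trace phi K ->
  phi (lv M) = phi (lv (one p)) * trform D M.
Proof. by move=> h; apply: (local_trace (dt_lin h)) => j k M'; exact: (dt_twist h). Qed.

Lemma dt_unit phi K N (p : isys_dual GG N) : dominated_trace phi K ->
  cabs (phi (lv (one p))) <= K * wt p.
Proof.
move=> h; have := dt_dom h (lv (one p)); rewrite lv_star adjmx1 lvMlv mulmx1 => /le_trans; apply.
by rewrite (corr_lv sc cc) trform1 mulr1.
Qed.

Lemma dt_K_ge0 phi K : dominated_trace phi K -> 0 <= K.
Proof.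
move=> h; have := dt_dom h 1; rewrite star1 mulr1 (state1 sc) /= mulr1.
exact: le_trans (cabs_ge0 _).
Qed.

Lemma dt_coherent phi K N (q : isys_dual GG N) (e : R) : dominated_trace phi K -> 0 < e ->
  exists s : seq (isys_dual GG N.+1), forall s', uniq s' -> {subset s <= s'} ->
   cabs (phi (lv (one q)) - \sum_(p <- s') phi (lv (one p)) *
      (through (vtx D q) (vtx D p) / dimq D p)%:C%C) <= e.
Proof.
move=> h e0; have K0 := dt_K_ge0 h; have K1 : 0 < K + 1 by rewrite ltr_wpDl.
have [s hs] := level_approx N.+1 (divr_gt0 e0 K1); exists s => s' us' ss'.
have mX : measurable (XEv q) by exact: (measurable_XE hB).
have {}hs := hs _ mX s' us' ss'.
pose r := lv (one q); pose ep p := Thn D 1 (sv (one q)) p.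
pose f := \sum_(p <- s') lv (ep p).
have sq := sv_fsupp (I := isys_dual GG N) (one q).
have epep p : ep p *m ep p = ep p.
  rewrite /ep /= -[Thmap _ _ _]/(sumQ D p _) sumQ_mul; congr sumQ.
  apply: eq_fam => q'; have [E|n] := pselect (q = q'); last by rewrite !sv_neq // mulmx0.
  by case: q' / E; rewrite sv_id mulmx1.
have aep p : adjmx (ep p) = ep p.
  rewrite /ep Thn_adj; congr (Thn D 1 _ p); apply: eq_fam => q'.
  rewrite (sv_fun (f := fun q => @adjmx R _ _)) ?adjmx1 // => q''.
  by apply/matrixP => i j; rewrite !mxE rmorph0.
have rr : r * r = r by rewrite /r lvMlv mulmx1.
have rf : r * f = f.
  rewrite /f mulr_sumr; apply: eq_bigr => p _.
  by rewrite /r (@lelMlv _ _ _ L 1) // epep.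
have sr : star r = r by rewrite /r lv_star adjmx1.
have sf : star f = f by rewrite /f star_sum; apply: eq_bigr => p _; rewrite lv_star aep.
have fr : f * r = f by rewrite -[LHS]starK starM sr sf rf sf.
have ff : f * f = f.
  rewrite {1 2}/f big_distrlr /=; apply: eq_big_seq => p ps.
  rewrite (bigD1_seq p) //= lvMlv epep big1 ?addr0 // => p' pp'.
  by rewrite lvM_neq // => E; rewrite E eqxx in pp'.
have zz : star (r - f) * (r - f) = r - f.
  by rewrite starB sr sf mulrBl !mulrBr rr rf fr ff subrr subr0.
have [p0 pD pZ ps] := scalar_fun_lin (dt_lin h).
have pB x y : phi (x - y) = phi x - phi y by rewrite pD -scaleN1r pZ mulN1r.
have fE psi K' : dominated_trace psi K' -> psi f = \sum_(p <- s') psi (lv (one p)) *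
      (through (vtx D q) (vtx D p) / dimq D p)%:C%C.
  move=> hpsi; have [_ _ _ ->] := scalar_fun_lin (dt_lin hpsi); apply: eq_bigr => p _.
  by rewrite (dt_lv _ hpsi) /ep (@trform_Thn N q 1).
rewrite -(fE _ _ h) -pB -zz; apply: le_trans (dt_dom h _) _.
rewrite zz (stateB sc) (fE _ _ chi_dominated) (corr_lv sc cc) trform1 mulr1.
have -> : \sum_(p <- s') chi (lv (one p)) * (through (vtx D q) (vtx D p) / dimq D p)%:C%C =
   (\sum_(p <- s') pr P (XEv q `&` XEv p))%:C%C.
  rewrite rc_sum; apply: eq_bigr => p _; rewrite (corr_lv sc cc) trform1 mulr1 -rcM.
  by rewrite (@pr_and_level N q 1).
rewrite -rcB /=; apply: le_trans (_ : (K + 1) * (e / (K + 1)) <= _).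
  apply: le_trans (_ : (K + 1) * `|pr P (XEv q) - \sum_(p <- s') pr P (XEv q `&` XEv p)| <= _).
    apply: le_trans (ler_wpM2l K0 (ler_norm _)) _; rewrite ler_wpM2r // lerDl //.
  by rewrite ler_pM2l // ltW.
by rewrite mulrCA divff ?mulr1 // gt_eqF.
Qed.

Lemma edge_src N (q : isys_dual GG N) (e : edge B) : src e = vtx D q ->
  exists (p : isys_dual GG N.+1) (l : 'I_(br_mult D q p)), e = edg l.
Proof.
have [N' [q' [p [l ->]]]] := edgE e; move=> h.
have EN : N' = N by have := congr1 (@tag _ _) h; rewrite /= => -[].
subst N'; have /vtx_inj hq : vtx D q' = vtx D q := h.
by subst q'; exists p, l.
Qed.

Lemma dt_harmonic phi K : dominated_trace phi K ->
  (forall N (p : isys_dual GG N), 0 <= complex.Re (phi (lv (one p)))) ->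
  wharmonic (fun v : vertex B => complex.Re (phi (lv (one (tagged v)))) / wdim v).
Proof.
move=> h pos; set g := fun v => _.
have g0 (v : vertex B) : 0 <= g v.
  by rewrite /g divr_ge0 ?pos // ltW // (wdim_gt0 hB).
pose E N (q : isys_dual GG N) (s : seq (isys_dual GG N.+1)) : seq (edge B) :=
  [seq edg l | p <- s, l <- enum 'I_(br_mult D q p)].
have EP N (q : isys_dual GG N) s p (l : 'I_(br_mult D q p)) : p \in s -> edg l \in E N q s.
  by move=> ps; apply/allpairsPdep; exists p, l; split=> //; rewrite mem_enum.
have Eu N (q : isys_dual GG N) s : uniq s -> uniq (E N q s).
  move=> us; apply: allpairs_uniq_dep; [exact: us | by move=> p _; exact: enum_uniq |].
  move=> [p l] [p' l'] _ _ /= hh; have /eqP := hh; rewrite eq_Tagged => /eqP /= h2.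
  have Ep : p = p' by have := congr1 (@tag _ _) h2; rewrite /= => -[].
  subst p'; by have /eqP := h2; rewrite eq_Tagged => /eqP /= ->.
have Es N (q : isys_dual GG N) s e : e \in E N q s -> src e = vtx D q.
  by move=> /allpairsPdep[p [l [_ _ ->]]].
have Esum N (q : isys_dual GG N) s : \sum_(e <- E N q s) weight e * g (tgt e) =
   \sum_(p <- s) complex.Re (phi (lv (one p))) * (through (vtx D q) (vtx D p) / dimq D p) / dimq D q.
  rewrite big_allpairs_dep; apply: eq_bigr => p _; rewrite big_enum /= -mulr_suml.
  have -> : through (vtx D q) (vtx D p) = kap D p q * dimq D q.
    apply: complexI; rewrite -(@tr_F_Thn N q 1) /= tr_F_Thmap rcM -dimqE.
    have [m0|m0] := posnP (br_mult D q p).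
      have -> : kap D p q = 0.
        by rewrite /kap big1 // => l _; have := ltn_ord l; rewrite [X in (_ < X)%N]m0.
      rewrite mul0r big_seq big1 // => r; rewrite br_suppP => r0.
      by rewrite sv_neq ?mulmx0 ?mxtrace0 ?mulr0 // => rq; rewrite -rq m0 in r0.
    rewrite (bigD1_seq q) ?br_supp_uniq ?br_suppP //= sv_id mulmx1 big1 ?addr0 // => r rq.
    by rewrite sv_neq ?mulmx0 ?mxtrace0 ?mulr0 // => E'; rewrite E' eqxx in rq.
  rewrite /g /= -/(dimq D p) /kap.
  have d1 : dimq D p != 0 by rewrite gt_eqF // dimq_gt0.
  have d2 : dimq D q != 0 by rewrite gt_eqF // dimq_gt0.
  by field; rewrite d1 d2.
have coh N (q : isys_dual GG N) (e : R) : 0 < e ->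
    exists s : seq (isys_dual GG N.+1), forall s', uniq s' -> {subset s <= s'} ->
      `|g (vtx D q) - \sum_(e <- E N q s') weight e * g (tgt e)| <= e.
  move=> e0; have dq := dimq_gt0 D q.
  have [s hs] := dt_coherent q h (mulr_gt0 e0 dq); exists s => s' us' ss'.
  rewrite Esum -mulr_suml /g /= -/(dimq D q) -mulrBl normrM [X in _ * X]ger0_norm ?invr_ge0 ?(ltW dq) //.
  rewrite ler_pdivrMr //; apply: le_trans (hs s' us' ss').
  apply: le_trans (ler_Re_cabs _); rewrite ReB Re_sum.
  rewrite le_eqVlt; apply/orP; left; apply/eqP; congr (`|_ - _|); apply: eq_bigr => p _.
  by rewrite [in RHS]mulrC Re_rcM mulrC.
split=> [[M q] es ues hes|[M q] d d0]; rewrite -/(vtx D q) in hes * || rewrite -/(vtx D q).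
  apply/ler_addgt0Pr => d d0; have [s hs] := coh _ q d d0.
  pose tg (e : edge B) : option (isys_dual GG M.+1) :=
    if pselect (exists p (l : 'I_(br_mult D q p)), e = edg l) is left ex then Some (sval (cid ex)) else None.
  have tgP e : src e = vtx D q -> exists2 p, tg e = Some p & exists l : 'I_(br_mult D q p), e = edg l.
    move=> /edge_src ex; rewrite /tg; case: pselect => // ex'.
    by exists (sval (cid ex')) => //; exact: (svalP (cid ex')).
  pose s' := undup (s ++ pmap tg es).
  have us' : uniq s' by exact: undup_uniq.
  have ss' : {subset s <= s'} by move=> p ps; rewrite mem_undup mem_cat ps.
  have esE : {subset es <= E _ q s'}.
    move=> e ees; have [p tp [l el]] := tgP e (hes e ees); rewrite el; apply: EP.
    by rewrite mem_undup mem_cat mem_pmap; apply/orP; right; apply/mapP; exists e.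
  apply: le_trans (_ : \sum_(e <- E _ q s') weight e * g (tgt e) <= _).
    rewrite [leRHS](bigID (mem es)) /= -[leLHS]addr0 lerD //; last first.
      by apply: sumr_ge0 => e _; rewrite mulr_ge0 // ltW // (weight_gt0 hB).
    rewrite -[leRHS]big_filter le_eqVlt; apply/orP; left; apply/eqP; apply: perm_big.
    apply: uniq_perm => //; first by rewrite filter_uniq // Eu.
    by move=> e; rewrite mem_filter; case ees: (e \in es) => //=; rewrite esE.
  have := hs s' us' ss'; rewrite ler_norml => /andP[h1 _].
  by move: h1; rewrite lerBrDr addrC lerBlDr.
have [s hs] := coh _ q d d0; exists (E _ q (undup s)); split.
- exact/Eu/undup_uniq.
- by move=> e /Es.
have := hs (undup s) (undup_uniq s) (fun p ps => etrans (mem_undup s p) ps).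
by rewrite ler_norml => /andP[_]; rewrite lerBlDl addrC.
Qed.

Lemma ergodic_dominated_trace phi K : ergodic P -> dominated_trace phi K ->
  exists c : C, forall a, phi a = c * chi a.
Proof.
move=> eP h; have K0 := dt_K_ge0 h.
have key (u : C) : cabs u = 1 -> exists c : R, forall N (p : isys_dual GG N),
    complex.Re (u * phi (lv (one p))) = c * wt p.
  move=> u1; have hk := dominated_trace_comb K%:C%C u chi_dominated h.
  have hpos N (p : isys_dual GG N) : 0 <= complex.Re (K%:C%C * chi (lv (one p)) + u * phi (lv (one p))).
    rewrite ReD (corr_lv sc cc) trform1 mulr1 -rcM /=.
    have := le_trans (ler_Re_cabs (u * phi (lv (one p)))) _.
    move=> /(_ (K * wt p)); rewrite cabsM u1 mul1r => /(_ (dt_unit p h)).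
    by rewrite ler_norml => /andP[]; rewrite -lerBlDl sub0r.
  have [c hc] : exists c : R, forall v : vertex B,
      complex.Re (K%:C%C * chi (lv (one (tagged v))) + u * phi (lv (one (tagged v)))) = c * pr P (@XE R B o v).
    apply: (ergodic_harmonic hB cP (K := K + K) eP) => [v|v|]; [exact: hpos | | exact: dt_harmonic hk hpos].
    rewrite [v in XE v](vtxE v); apply: le_trans (Re_le_cabs _) _.
    apply: le_trans (dt_unit (tagged v) hk) _.
    by rewrite u1 mul1r mulr1 cabs_rc ger0_norm.
  exists (c - K) => N p; have := hc (vtx D p).
  rewrite /= ReD (corr_lv sc cc) trform1 mulr1 -rcM /= => E.
  by rewrite mulrBl -E addrC addKr.
have [c1 h1] := key 1 (cabs1 R).
have [|c2 h2] := key (- 'i%C); first by rewrite cabsN cabs_i.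
exists (Complex c1 c2) => a.
  have [K' b1] := dt_bd h; pose c := Complex c1 c2; rewrite -/c.
  apply: (@eq_on_vset _ _ _ L phi (fun x => c * chi x) K' (cabs c)) => //.
  - exact: dt_lin h.
  - by move=> d x y; rewrite (state_lin sc); ring.
  - by move=> x; rewrite cabsM ler_wpM2l ?cabs_ge0 //; exact: state_cabs_le.
  move=> _ [N [p [M ->]]]; rewrite (dt_lv M h) (corr_lv sc cc) mulrA; congr (_ * _).
  have Ri (z : C) : complex.Re (- 'i%C * z) = complex.Im z.
    by case: z => x y /=; ring.
  have := h1 N p; have := h2 N p; rewrite mul1r Ri.
  case: (phi (lv (one p))) => x y /= -> ->.
  by apply/eqP; rewrite eq_complex /=; apply/andP; split; apply/eqP; ring.
Qed.

End WithState.

End DominatedTraces.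

Section HilbertDensity.
Variables (R : realType) (H : hilbertType R).
Local Notation C := (R[i]).
Implicit Types (u v w : H) (T : H -> H).
Let hi := hinnerP H.

Lemma hnorm_ge0 v : 0 <= hnorm v. Proof. exact: sqrtr_ge0. Qed.
Lemma hnormD u v : hnorm (u + v) <= hnorm u + hnorm v. Proof. exact: (snormD hi). Qed.
Lemma hnormZ (c : C) v : hnorm (c *: v) = cabs c * hnorm v. Proof. exact: (snormZ hi). Qed.
Lemma hnormN v : hnorm (- v) = hnorm v. Proof. exact: (snormN hi). Qed.
Lemma hnormB u v : hnorm (u - v) = hnorm (v - u). Proof. by rewrite -hnormN opprB. Qed.
Lemma hnorm_dist v u w : hnorm (u - w) <= hnorm (u - v) + hnorm (v - w).
Proof. by apply: le_trans (hnormD _ _); rewrite addrA subrK. Qed.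
Lemma hnorm0 : hnorm (0 : H) = 0.
Proof. by rewrite -(scale0r 0) hnormZ cabs0 mul0r. Qed.
Lemma hnorm_sqr v : (hnorm v ^+ 2)%:C%C = inner v v.
Proof. by rewrite hnormE (snorm_sqr hi) /sqn -ge0_rcRe // inner_ge0. Qed.
Lemma hnorm_eq0 v : hnorm v = 0 -> v = 0.
Proof. by move=> h; apply: inner_eq0; rewrite -hnorm_sqr h expr0n. Qed.
Lemma hCS u v : cabs (inner u v) <= hnorm u * hnorm v.
Proof. exact: (psd_CS hi). Qed.

Lemma hnorm_eq_eps u v K : (forall e : R, 0 < e -> hnorm (u - v) <= K * e) -> u = v.
Proof.
move=> h; apply/eqP; rewrite -subr_eq0; apply/eqP/hnorm_eq0/le_anti; rewrite hnorm_ge0 andbT.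
apply/ler_addgt0Pr => e e0; rewrite add0r.
have K0 : 0 < `|K| + 1 by rewrite ltr_wpDl.
have := h _ (divr_gt0 e0 K0) => /le_trans; apply.
apply: le_trans (_ : (`|K| + 1) * (e / (`|K| + 1)) <= _).
  by apply: ler_wpM2r; [exact: ltW (divr_gt0 e0 K0) | apply: le_trans (ler_norm K) _; rewrite lerDl].
by rewrite mulrCA divff ?mulr1 // gt_eqF.
Qed.

Variables (X : lmodType C) (emb : X -> H).
Hypothesis elin : is_linear emb.
Hypothesis edense : forall v (e : R), 0 < e -> exists a, hnorm (v - emb a) < e.

Let embB a b : emb (a - b) = emb a - emb b.
Proof. by have := elin (-1) b a; rewrite !scaleN1r addrC => ->; rewrite addrC. Qed.

Lemma dense_fun_eq0 (f : H -> C) K : (forall u v, cabs (f u - f v) <= K * hnorm (u - v)) ->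
  (forall a, f (emb a) = 0) -> forall v, f v = 0.
Proof.
move=> fK f0 v; apply: cabs_eq0; apply/le_anti; rewrite cabs_ge0 andbT.
apply/ler_addgt0Pr => e e0; rewrite add0r.
have K0 : 0 < `|K| + 1 by rewrite ltr_wpDl.
have [a ha] := edense v (divr_gt0 e0 K0).
have := fK v (emb a); rewrite f0 subr0 => /le_trans; apply.
apply: le_trans (_ : (`|K| + 1) * (e / (`|K| + 1)) <= _).
  apply: le_trans (_ : (`|K| + 1) * hnorm (v - emb a) <= _).
    by rewrite ler_wpM2r ?hnorm_ge0 // (le_trans (ler_norm K)) // lerDl.
  by rewrite ler_pM2l // ltW.
by rewrite mulrCA divff ?mulr1 // gt_eqF.
Qed.

Lemma bounded_opB T u v : bounded_op T -> T (u - v) = T u - T v.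
Proof. by move=> [l _]; have := l (-1) v u; rewrite !scaleN1r addrC => ->; rewrite addrC. Qed.

Lemma dense_inner_eq T1 T2 w1 w2 (c : C) : bounded_op T1 -> bounded_op T2 ->
  (forall a, inner (T1 (emb a)) w1 = c * inner (T2 (emb a)) w2) ->
  forall v, inner (T1 v) w1 = c * inner (T2 v) w2.
Proof.
move=> b1 b2 h v; apply/eqP; rewrite -subr_eq0; apply/eqP.
have [_ [K1 k1]] := b1; have [_ [K2 k2]] := b2.
apply: (dense_fun_eq0 (f := fun v => inner (T1 v) w1 - c * inner (T2 v) w2)
   (K := K1 * hnorm w1 + cabs c * (K2 * hnorm w2))) => [u v'|a]; last by rewrite h subrr.
have -> : inner (T1 u) w1 - c * inner (T2 u) w2 - (inner (T1 v') w1 - c * inner (T2 v') w2) =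
   inner (T1 (u - v')) w1 - c * inner (T2 (u - v')) w2.
  by rewrite !bounded_opB // !(psdBl hi); ring.
apply: le_trans (cabsD _ _) _; rewrite cabsN cabsM mulrDl; apply: lerD.
  by apply: le_trans (hCS _ _) _; rewrite mulrAC ler_wpM2r ?hnorm_ge0.
rewrite -mulrA ler_wpM2l ?cabs_ge0 //.
by apply: le_trans (hCS _ _) _; rewrite mulrAC ler_wpM2r ?hnorm_ge0.
Qed.

Lemma dense_op_eq T1 T2 : bounded_op T1 -> bounded_op T2 ->
  (forall a, T1 (emb a) = T2 (emb a)) -> forall v, T1 v = T2 v.
Proof.
move=> b1 b2 h v; apply: hilbert_eq => w.
by rewrite (dense_inner_eq (w1 := w) (w2 := w) (c := 1) b1 b2) ?mul1r // => a; rewrite h mul1r.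
Qed.

Lemma dense_extension (f : X -> H) (K : R) : is_linear f ->
  (forall a, hnorm (f a) <= K * hnorm (emb a)) ->
  exists T, bounded_op T /\ forall a, T (emb a) = f a.
Proof.
move=> flin fK.
have fB a b : f (a - b) = f a - f b.
  by have := flin (-1) b a; rewrite !scaleN1r addrC => ->; rewrite addrC.
have {}fK a : hnorm (f a) <= `|K| * hnorm (emb a).
  by apply: le_trans (fK a) _; rewrite ler_wpM2r ?hnorm_ge0 // ler_norm.
set K1 := `|K| in fK; have K10 : 0 <= K1 by exact: normr_ge0.
pose G v x := forall e : R, 0 < e -> exists a, hnorm (v - emb a) < e /\ hnorm (x - f a) < e.
have fdist a b : hnorm (f a - f b) <= K1 * hnorm (emb a - emb b) by rewrite -fB -embB; exact: fK.
have Gu v x y : G v x -> G v y -> x = y.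
  move=> h1 h2; apply: (@hnorm_eq_eps _ _ (2 + K1 * 2)) => e e0.
  have [a [a1 a2]] := h1 _ e0; have [b [b1 b2]] := h2 _ e0.
  apply: le_trans (hnorm_dist (f a) _ _) _; rewrite mulrDl -{1}[2]/(1 + 1) mulrDl mul1r -addrA.
  apply: lerD; first exact: ltW.
  apply: le_trans (hnorm_dist (f b) _ _) _; rewrite [leRHS]addrC; apply: lerD; last first.
    by rewrite hnormB ltW.
  apply: le_trans (fdist _ _) _; rewrite -mulrA ler_wpM2l // mulrDl !mul1r.
  by apply: le_trans (hnorm_dist v _ _) _; rewrite lerD // ltW // hnormB.
have Gex v : exists x, G v x.
  have /choice[a ha] : forall n, exists a, hnorm (v - emb a) < n.+1%:R^-1.
    by move=> n; apply: edense; rewrite invr_gt0 ltr0n.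
  have inv0 (e : R) : 0 < e -> exists N, forall n, (N <= n)%N -> hnorm (v - emb (a n)) < e.
    move=> e0; exists (Num.bound e^-1) => n Nn; apply: lt_trans (ha n) _.
    rewrite invf_plt ?posrE ?ltr0n //; apply: lt_le_trans (archi_boundP _) _.
      by rewrite invr_ge0 ltW.
    by rewrite ler_nat; apply: leq_trans Nn _.
  have [x hx] : exists l, forall e : R, 0 < e -> exists N, forall n, (N <= n)%N -> hnorm (f (a n) - l) < e.
    apply: (@hilbert_complete R H) => e e0.
    have K2 : 0 < 2 * (K1 + 1) by rewrite mulr_gt0 // ltr_wpDl.
    have [N hN] := inv0 _ (divr_gt0 e0 K2); exists N => m n Nm Nn.
    rewrite -/(hnorm _); apply: le_lt_trans (fdist _ _) _.
    apply: le_lt_trans (_ : (K1 + 1) * hnorm (emb (a m) - emb (a n)) < _).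
      by rewrite ler_wpM2r ?hnorm_ge0 // lerDl.
    have K3 : 0 < K1 + 1 by rewrite ltr_wpDl.
    rewrite mulrC -ltr_pdivlMr //.
    apply: le_lt_trans (hnorm_dist v _ _) _; rewrite hnormB.
    apply: lt_le_trans (ltrD (hN _ Nm) (hN _ Nn)) _.
    rewrite le_eqVlt; apply/orP; left; apply/eqP; field; rewrite gt_eqF //.
  exists x => e e0; have [N1 h1] := inv0 _ e0; have [N2 h2] := hx _ e0.
  exists (a (maxn N1 N2)); split; first by apply: h1; exact: leq_maxl.
  by rewrite hnormB; apply: h2; exact: leq_maxr.
have /choice[T hT] := Gex.
have GT a : T (emb a) = f a.
  by apply: Gu (hT _) _ => e e0; exists a; rewrite !subrr hnorm0.
exists T; split=> //; split.
  move=> c u v; apply: (Gu _ _ _ (hT _)) => e e0.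
  have k0 : 0 < cabs c + 1 by rewrite ltr_wpDl ?cabs_ge0.
  have e1 : 0 < e / (2 * (cabs c + 1)) by rewrite divr_gt0 // mulr_gt0.
  have [a [a1 a2]] := hT u _ e1; have [b [b1 b2]] := hT v _ e1.
  have est (p q r s : H) : hnorm (p - q) < e / (2 * (cabs c + 1)) -> hnorm (r - s) < e / (2 * (cabs c + 1)) ->
      hnorm (c *: p + r - (c *: q + s)) < e.
    move=> h1 h2; have -> : c *: p + r - (c *: q + s) = c *: (p - q) + (r - s).
      by rewrite scalerBr; abel.
    apply: le_lt_trans (hnormD _ _) _; rewrite hnormZ.
    apply: lt_le_trans (_ : (cabs c + 1) * (e / (2 * (cabs c + 1))) + (cabs c + 1) * (e / (2 * (cabs c + 1))) <= _); last first.
      rewrite le_eqVlt; apply/orP; left; apply/eqP; field; rewrite gt_eqF //.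
    apply: ler_ltD.
      apply: le_trans (ler_wpM2l (cabs_ge0 c) (ltW h1)) _.
      by rewrite ler_wpM2r ?lerDl // ltW.
    apply: lt_le_trans h2 _; rewrite -[leLHS]mul1r ler_wpM2r ?lerDr ?cabs_ge0 // ltW //.
  by exists (c *: a + b); rewrite elin flin; split; apply: est.
exists K1 => v; apply/ler_addgt0Pr => e e0.
have k0 : 0 < K1 + 1 by rewrite ltr_wpDl.
have [a [a1 a2]] := hT v _ (divr_gt0 e0 k0).
have -> : T v = (T v - f a) + f a by rewrite subrK.
apply: le_trans (hnormD _ _) _.
apply: le_trans (_ : e / (K1 + 1) + K1 * (hnorm v + e / (K1 + 1)) <= _).
  apply: lerD; first exact: ltW.
  apply: le_trans (fK a) _; rewrite ler_wpM2l //.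
  have -> : emb a = v + (emb a - v) by rewrite addrCA subrr addr0.
  by apply: le_trans (hnormD _ _) _; rewrite lerD2l hnormB ltW.
rewrite le_eqVlt; apply/orP; left; apply/eqP; field; rewrite gt_eqF //.
Qed.

End HilbertDensity.

Section GNSFacts.
Variables (R : realType) (A : cstarAlgType R) (chi : A -> R[i]) (sc : is_state chi) (g : gns chi).
Local Notation H := (gns_space g).
Local Notation pi := (@gns_rep _ _ _ g).
Local Notation xi := (gns_vec g).
Local Notation C := (R[i]).
Let hr := gns_repP g.

Lemma gns_inner a b : inner (pi a xi) (pi b xi) = chi (star b * a).
Proof. by rewrite (gns_state g) (starrepM hr) (starrep_star hr). Qed.

Lemma gns_emb_lin : is_linear (fun a => pi a xi).
Proof. by move=> c a b; rewrite (starrep_linear hr). Qed.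

Lemma gns_hnorm a : hnorm (pi a xi) = snorm (sform chi) a.
Proof. by rewrite hnormE /snorm /sqn gns_inner. Qed.

Lemma gns_hnorm_sqr a : hnorm (pi a xi) ^+ 2 = complex.Re (chi (star a * a)).
Proof. by apply: complexI; rewrite hnorm_sqr gns_inner -ge0_rcRe // (state_ge0 sc). Qed.

Lemma gns_hnorm_vec : hnorm xi = 1.
Proof. by rewrite -(starrep1 hr xi) gns_hnorm (state_snorm1 sc). Qed.

Definition gnsS : set (H -> H) := [set T | exists a, T = pi a].

Lemma gnsS_bicommutant a : commutant (commutant gnsS) (pi a).
Proof.
split; first exact: starrep_bounded.
by move=> T [_ hT] v; rewrite hT //; exists a.
Qed.

End GNSFacts.
Arguments gnsS {R A chi} g _.

Section ErgodicFactor.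
Variables (R : realType) (GG : indsys R) (D : branching GG) (L : limit_algebra D).
Local Notation C := (R[i]).
Local Notation A := (lim_A L).
Local Notation F p := (br_F D p).
Local Notation lv := (@local_elt R GG D L _ _).
Variables (o : inf_path (branching_graph D)) (P : probability (Omega o) R).
Hypothesis cP : central P.
Variable chi : A -> C.
Hypotheses (sc : is_state chi) (cc : corresponds P chi).
Variable g : gns chi.
Local Notation H := (gns_space g).
Local Notation pi := (@gns_rep _ _ _ g).
Local Notation xi := (gns_vec g).
Let hr := gns_repP g.
Let hi := hinnerP H.

Lemma right_mul_bound N (p : isys_dual GG N) j k (a : A) :
  complex.Re (chi (star (a * lv (eig (F p) j k)) * (a * lv (eig (F p) j k)))) <=
  complex.Re (eigratio D k j) * complex.Re (chi (star a * a)).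
Proof.
set Y := lv _; pose e := lv (eig (F p) j j).
have YY : Y * star Y = e by rewrite /Y lv_star adj_eig lvMlv eigM eqxx scale1r.
have ee : e * e = e by rewrite /e lvMlv eigM eqxx scale1r.
have se : star e = e by rewrite /e lv_star adj_eig.
have es z : chi (e * z) = chi (z * e).
  rewrite (chi_twist sc cc) /eigratio divff ?mul1r //.
  by rewrite gt_eqF // eigval_gt0 //; exact: br_F_pos.
have -> : chi (star (a * Y) * (a * Y)) = eigratio D k j * chi (star a * a * e).
  have Ys : star Y = lv (eig (F p) k j) by rewrite /Y lv_star adj_eig.
  have -> : star (a * Y) * (a * Y) = lv (eig (F p) k j) * (star a * (a * Y)) by rewrite starM Ys !mulrA.
  by rewrite (chi_twist sc cc) -YY Ys !mulrA.
have r0 : 0 <= complex.Re (eigratio D k j).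
  by rewrite /eigratio /= divr_ge0 // ltW // eigval_gt0 //; exact: br_F_pos.
rewrite {1}/eigratio Re_rcM ler_wpM2l //.
have -> : star a * a = star a * a * e + star a * a * (1 - e) by rewrite -mulrDr addrC subrK mulr1.
rewrite mulrDl -[_ * e * e]mulrA ee -[_ * (1 - e) * e]mulrA mulrBl mul1r ee subrr mulr0 addr0.
rewrite (stateD sc) ReD lerDl.
have f2 : (1 - e) * (1 - e) = 1 - e.
  by rewrite mulrBl mul1r mulrBr mulr1 ee subrr subr0.
have -> : chi (star a * a * (1 - e)) = chi (star (a * (1 - e)) * (a * (1 - e))).
  have fs z : chi ((1 - e) * z) = chi (z * (1 - e)).
    by rewrite mulrBl mulrBr mul1r mulr1 !(stateB sc) es.
  have -> : star (a * (1 - e)) * (a * (1 - e)) = (1 - e) * (star a * a * (1 - e)).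
    by rewrite starM starB star1 se !mulrA.
  by rewrite fs -(mulrA _ (1 - e) (1 - e)) f2.
exact: Re_ge0 (state_ge0 sc _).
Qed.

Lemma right_mul_op N (p : isys_dual GG N) j k : exists T, commutant (gnsS g) T /\
  forall a, T (pi a xi) = pi (a * lv (eig (F p) j k)) xi.
Proof.
set Y := lv _; pose r := complex.Re (eigratio D k j).
have r0 : 0 <= r by rewrite /r /= divr_ge0 // ltW // eigval_gt0 //; exact: br_F_pos.
have [|a|T [bT TE]] := dense_extension (gns_emb_lin g) (gns_cyclic (g := g))
  (f := fun a => pi (a * Y) xi) (K := Num.sqrt r).
- by move=> c a b; rewrite mulrDl -scalerAl (starrep_linear hr).
- rewrite -(ler_pXn2r (ltn0Sn 1)) ?nnegrE ?mulr_ge0 ?hnorm_ge0 ?sqrtr_ge0 // exprMn (sqr_sqrtr r0).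
  by rewrite !(gns_hnorm_sqr sc g); exact: right_mul_bound.
exists T; split=> //; split=> // _ [b ->] v.
have bb : bounded_op (pi b) := starrep_bounded hr b.
have comp T1 T2 : bounded_op T1 -> bounded_op T2 -> bounded_op (fun v : H => T1 (T2 v)).
  move=> [l1 [K1 h1]] [l2 [K2 h2]]; split; first by move=> c x y; rewrite l2 l1.
  exists (`|K1| * K2) => w; apply: le_trans (h1 _) _; rewrite -mulrA.
  apply: le_trans (_ : `|K1| * hnorm (T2 w) <= _); first by rewrite ler_wpM2r ?hnorm_ge0 ?ler_norm.
  by rewrite ler_wpM2l.
apply: (dense_op_eq (gns_cyclic (g := g)) (T1 := fun v => T (pi b v)) (T2 := fun v => pi b (T v))).
- exact: comp.
- exact: comp.
by move=> a; rewrite -(starrepM hr) !TE -(starrepM hr) mulrA.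
Qed.

Lemma ergodic_factor : ergodic P -> is_factor (commutant (commutant (gnsS g))).
Proof.
move=> eP T TM TM'; have [bT TR] := TM; have [_ Tcom] := TM'.
have Tpi a v : T (pi a v) = pi a (T v) by apply: Tcom; exact: gnsS_bicommutant.
have [Tlin [K0 TK0]] := bT; pose K := `|K0|.
have TK v : hnorm (T v) <= K * hnorm v.
  by apply: le_trans (TK0 v) _; rewrite ler_wpM2r ?hnorm_ge0 // ler_norm.
have K_ge0 : 0 <= K by exact: normr_ge0.
pose phi a := inner (T (pi a xi)) xi.
have dphi : dominated_trace chi phi K.
  split.
  - by move=> c x y; rewrite /phi (starrep_linear hr) Tlin (psdDl hi) (psdZl hi).
  - exists K => x; apply: le_trans (hCS _ _) _; rewrite (gns_hnorm_vec sc) mulr1.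
    by apply: le_trans (TK _) _; rewrite ler_wpM2l // gns_hnorm; exact: state_snorm_le.
  - move=> x; have -> : phi (star x * x) = inner (T (pi x xi)) (pi x xi).
      by rewrite /phi (starrepM hr) Tpi (starrep_star hr).
    apply: le_trans (hCS _ _) _; rewrite -(gns_hnorm_sqr sc g) expr2 mulrA ler_wpM2r ?hnorm_ge0 //.
  - move=> N p j k M; set Y := lv (eig _ j k); set x := lv M.
    have [T' [cT' T'E]] := right_mul_op j k.
    have key v : inner (pi Y v) xi = eigratio D j k * inner (T' v) xi.
      apply: (dense_inner_eq (emb := fun a => pi a xi)); [exact: gns_cyclic | exact: starrep_bounded | by case: cT' |].
      by move=> a; rewrite T'E -(starrepM hr) -!(gns_state g); exact: (chi_twist sc cc).
    rewrite /phi (starrepM hr) Tpi key -T'E; congr (_ * inner _ _).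
    by rewrite (TR T' cT').
have [c hc] := ergodic_dominated_trace cP sc cc eP dphi.
exists c; apply: (dense_op_eq (emb := fun a => pi a xi)); [exact: gns_cyclic | exact: bT | |].
  split; first by move=> d u v; rewrite scalerDr !scalerA mulrC.
  by exists (cabs c) => v; rewrite hnormZ.
move=> a; apply: hilbert_eq => w; rewrite [LHS](psdC hi) [RHS](psdC hi); congr (Num.conj _).
suff h w' : inner (T (pi a xi)) w' = c * inner (pi a xi) w'.
  by rewrite [LHS](psdC hi) [RHS](psdC hi) h (psdZl hi).
rewrite [LHS](psdC hi) [X in c * X](psdC hi); apply: (can_inj conjCK); rewrite rmorphM /= !conjCK.
apply: (@dense_inner_eq _ _ _ (fun a => pi a xi) (gns_cyclic (g := g)) id id).
- by split=> //; exists 1 => v; rewrite mul1r.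
- by split=> //; exists 1 => v; rewrite mul1r.
move=> b /=; rewrite [LHS](psdC hi) [X in _ * X](psdC hi) -rmorphM /=; congr (Num.conj _).
have := hc (star b * a); rewrite /phi (starrepM hr) Tpi (starrep_star hr) => ->.
by rewrite gns_inner.
Qed.

End ErgodicFactor.

(** * KMS states and ergodicity implies extremality *)

Section Entire.
Variables (R : realType) (A : cstarAlgType R).
Local Notation C := (R[i]).

Lemma starhom_contractive (B : cstarAlgType R) (f : A -> B) a : is_starhom f -> cnorm (f a) <= cnorm a.
Proof.
move=> [flin f1 fM fs].
have f0 : f 0 = 0 by have := flin (-1) 0 0; rewrite scaleN1r addrC subrr scaleN1r addrC subrr.
have fD x y : f (x + y) = f x + f y by have := flin 1 x y; rewrite !scale1r.
have fZ (c : C) x : f (c *: x) = c *: f x by have := flin c x 0; rewrite f0 !addr0.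
have fpos x : cpos x -> cpos (f x).
  by move=> /cpos_sqrt[r [pr rr _]]; rewrite -rr fM; apply: cpos_sqr; rewrite -fs (cpos_sa pr).
have sb : star (star a * a) = star a * a by rewrite starM starK.
have p1 := fpos _ (cpos_starM a).
have /fpos := cpos_subr sb (lexx (cnorm (star a * a))).
rewrite -scaleN1r addrC flin scaleN1r addrC fZ f1 => p2.
have := cpos_le_norm p1 p2; rewrite ger0_norm ?cnorm_ge0 // cnorm_starM fM fs cnorm_starM.
by rewrite ler_pXn2r // nnegrE cnorm_ge0.
Qed.

Definition centire (k : C -> C) : Prop := forall z, exists d : C, forall e : R, 0 < e ->
  exists2 r : R, 0 < r & forall h : C, h != 0 -> cabs h < r ->
    cabs (h^-1 * (k (z + h) - k z) - d) < e.

Lemma entire_linear (B : cstarAlgType R) (T : A -> B) (K : R) (f : C -> A) : is_linear T ->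
  (forall x, cnorm (T x) <= K * cnorm x) -> is_entire f -> is_entire (fun z => T (f z)).
Proof.
move=> Tl TK hf z; have [d hd] := hf z; exists (T d) => e e0.
have T0 : T 0 = 0 by have := Tl (-1) 0 0; rewrite scaleN1r addrC subrr scaleN1r addrC subrr.
have TB x y : T (x - y) = T x - T y by have := Tl (-1) y x; rewrite !scaleN1r addrC => ->; rewrite addrC.
have TZ (c : C) x : T (c *: x) = c *: T x by have := Tl c x 0; rewrite T0 !addr0.
have K0 : 0 < `|K| + 1 by rewrite ltr_wpDl.
have [r r0 hr] := hd _ (divr_gt0 e0 K0); exists r => // h h0 hh.
rewrite -TB -TZ -TB; apply: le_lt_trans (TK _) _.
apply: le_lt_trans (_ : (`|K| + 1) * cnorm (h^-1 *: (f (z + h) - f z) - d) < _).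
  by rewrite ler_wpM2r ?cnorm_ge0 // (le_trans (ler_norm K)) // lerDl.
by rewrite mulrC -ltr_pdivlMr //; exact: hr.
Qed.

Lemma entire_functional (psi : A -> C) (K : R) (f : C -> A) :
  (forall (c : C) x y, psi (c *: x + y) = c * psi x + psi y) ->
  (forall x, cabs (psi x) <= K * cnorm x) -> is_entire f -> centire (fun z => psi (f z)).
Proof.
move=> Tl TK hf z; have [d hd] := hf z; exists (psi d) => e e0.
have T0 : psi 0 = 0 by have := Tl (-1) 0 0; rewrite scaleN1r addrC subrr => ->; rewrite mulN1r addrC subrr.
have TB x y : psi (x - y) = psi x - psi y by have := Tl (-1) y x; rewrite scaleN1r mulN1r addrC => ->; rewrite addrC.
have TZ (c : C) x : psi (c *: x) = c * psi x by have := Tl c x 0; rewrite T0 !addr0.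
have K0 : 0 < `|K| + 1 by rewrite ltr_wpDl.
have [r r0 hr] := hd _ (divr_gt0 e0 K0); exists r => // h h0 hh.
rewrite -TB -TZ -TB; apply: le_lt_trans (TK _) _.
apply: le_lt_trans (_ : (`|K| + 1) * cnorm (h^-1 *: (f (z + h) - f z) - d) < _).
  by rewrite ler_wpM2r ?cnorm_ge0 // (le_trans (ler_norm K)) // lerDl.
by rewrite mulrC -ltr_pdivlMr //; exact: hr.
Qed.

Lemma centire_comb (k l : C -> C) (c : C) : centire k -> centire l -> centire (fun z => k z - c * l z).
Proof.
move=> hk hl z; have [d hd] := hk z; have [d' hd'] := hl z; exists (d - c * d') => e e0.
have e2 : 0 < e / 2 by rewrite divr_gt0.
have K0 : 0 < cabs c + 1 by rewrite ltr_wpDl ?cabs_ge0.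
have [r r0 hr] := hd _ e2; have [r' r0' hr'] := hd' _ (divr_gt0 e2 K0).
exists (Num.min r r'); first by rewrite lt_min r0.
move=> h h0; rewrite lt_min => /andP[h1 h2].
have -> : h^-1 * (k (z + h) - c * l (z + h) - (k z - c * l z)) - (d - c * d') =
  (h^-1 * (k (z + h) - k z) - d) - c * (h^-1 * (l (z + h) - l z) - d') by ring.
apply: le_lt_trans (cabsD _ _) _; rewrite cabsN cabsM [e]splitr; apply: ltrD; first exact: hr.
apply: le_lt_trans (_ : (cabs c + 1) * cabs (h^-1 * (l (z + h) - l z) - d') < _).
  by rewrite ler_wpM2r ?cabs_ge0 // lerDl.
by rewrite mulrC -ltr_pdivlMr //; exact: hr'.
Qed.

End Entire.

Section ComplexExponential.
Variable R : realType.
Local Notation C := (R[i]).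

(* The entire function [exp(i mu z)]. *)
Definition cexp (mu : R) (z : C) : C := (expR (- (mu * complex.Im z)))%:C%C * cis (mu * complex.Re z).

Lemma cexp_real mu t : cexp mu t%:C%C = cis (t * mu).
Proof. by rewrite /cexp /= mulr0 oppr0 expR0 mul1r mulrC. Qed.

Lemma cexpD mu z h : cexp mu (z + h) = cexp mu z * cexp mu h.
Proof.
case: z h => [a b] [c d]; rewrite /cexp /= !mulrDr opprD expRD cisD rcM; ring.
Qed.

Lemma derive_approx (f : R -> R) (x df e : R) : is_derive x 1 f df -> 0 < e ->
  exists2 r : R, 0 < r & forall h, `|h| < r -> `|f (x + h) - f x - df * h| <= e * `|h|.
Proof.
move=> [dx E] e0; have : (fun h : R => h^-1 *: (f (h *: 1 + x) - f x)) @ 0^' --> df.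
  by rewrite -E; exact: dx.
move/cvgrPdist_le => /(_ _ e0); rewrite near_withinE => /nbhs_ballP[r r0 hr].
exists r => // h hh; have [->|h0] := eqVneq h 0.
  by rewrite addr0 subrr mulr0 subr0 normr0 mulr0.
have := hr h; rewrite /ball /= sub0r normrN => /(_ hh h0).
have -> : df - h^-1 *: (f (h *: 1 + x) - f x) = - (h^-1 * (f (x + h) - f x - df * h)).
  by rewrite /GRing.scale /= mulr1 [h + x]addrC; field.
by rewrite normrN normrM normfV mulrC ler_pdivrMr ?normr_gt0.
Qed.

Lemma cexp_approx (e : R) : 0 < e -> exists2 r : R, 0 < r & forall u v : R, `|u| < r -> `|v| < r ->
  cabs ((expR u)%:C%C * cis v - 1 - Complex u v) <= e * (`|u| + `|v|).
Proof.
move=> e0; pose d := Num.min (e / 8) 1.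
have d0 : 0 < d by rewrite lt_min ltr01 andbT divr_gt0.
have [dE dL] : d <= e / 8 /\ d <= 1 by split; rewrite ge_min lexx ?orbT.
move: d d0 dE dL => d d0 dE dL.
have [r1 r10 h1] := derive_approx (is_derive_expR (0 : R)) d0.
have [r2 r20 h2] := derive_approx (is_derive_sin (0 : R)) d0.
have [r3 r30 h3] := derive_approx (is_derive_cos (0 : R)) d0.
exists (Num.min (Num.min r1 r2) (Num.min r3 d)); first by rewrite !lt_min r10 r20 r30 d0.
move=> u v; rewrite !lt_min => /andP[/andP[u1 _] /andP[_ ud]] /andP[/andP[_ v2] /andP[v3 vd]].
have := h1 u u1; have := h2 v v2; have := h3 v v3.
rewrite !add0r expR0 sin0 cos0 oppr0 mul0r !subr0 ?addr0 !mul1r => hc hs he.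
apply: le_trans (cabs_le_ReIm _) _; rewrite /cis /= !mul0r subr0 addr0 !subr0.
set E := expR u in he *.
have hE : `|E - 1| <= 2 * `|u|.
  have -> : E - 1 = (E - 1 - u) + u by ring.
  apply: le_trans (ler_normD _ _) _; rewrite mulrDl mul1r lerD2r.
  by apply: le_trans he _; rewrite ler_piMl.
have hE2 : `|E| <= 3.
  have -> : E = (E - 1) + 1 by ring.
  apply: le_trans (ler_normD _ _) _; rewrite normr1; move: hE ud; lra.
have hs2 : `|sin v| <= 2 * `|v|.
  have -> : sin v = (sin v - v) + v by ring.
  apply: le_trans (ler_normD _ _) _; rewrite mulrDl mul1r lerD2r.
  by apply: le_trans hs _; rewrite ler_piMl.
have re : `|E * cos v - 1 - u| <= d * `|u| + 3 * (d * `|v|).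
  have -> : E * cos v - 1 - u = (E - 1 - u) + E * (cos v - 1) by ring.
  by apply: le_trans (ler_normD _ _) _; apply: lerD => //; rewrite normrM ler_pM.
have im : `|E * sin v - v| <= 4 * (d * `|v|) + d * `|v|.
  have -> : E * sin v - v = (E - 1) * sin v + (sin v - v) by ring.
  apply: le_trans (ler_normD _ _) _; apply: lerD => //; rewrite normrM.
  apply: le_trans (ler_pM (normr_ge0 _) (normr_ge0 _) hE hs2) _.
  by rewrite mulrACA -natrM ler_pM2l // ler_wpM2r // ltW.
apply: le_trans (lerD re im) _.
have nu := normr_ge0 u; have nv := normr_ge0 v; nra.
Qed.

Lemma cexp_entire mu : centire (cexp mu).
Proof.
move=> z; exists (cexp mu z * Complex 0 mu) => e e0.
have M0 : 0 < `|mu| + 1 by rewrite ltr_wpDl.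
have K0 : 0 < (cabs (cexp mu z) + 1) * (2 * (`|mu| + 1)).
  by rewrite !mulr_gt0 // ltr_wpDl ?cabs_ge0.
have [r r0 hr] := cexp_approx (divr_gt0 e0 K0).
exists (r / (`|mu| + 1)); first by rewrite divr_gt0.
move=> h h0; rewrite ltr_pdivlMr // => hh.
have [ha hb] : `|complex.Re h| <= cabs h /\ `|complex.Im h| <= cabs h.
  by rewrite -![_ <= cabs h](@ler_pXn2r _ 2) ?nnegrE ?cabs_ge0 // cabs_sqrE !real_normK ?num_real // lerDl lerDr !sqr_ge0.
have bd (x : R) : `|x| <= cabs h -> `|mu * x| <= (`|mu| + 1) * cabs h.
  by move=> hx; rewrite normrM ler_pM // lerDl.
have b1 := bd _ ha; have b2 := bd _ hb.
have -> : h^-1 * (cexp mu (z + h) - cexp mu z) - cexp mu z * Complex 0 mu =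
   cexp mu z * (h^-1 * (cexp mu h - 1 - Complex (- (mu * complex.Im h)) (mu * complex.Re h))).
  have -> : Complex (- (mu * complex.Im h)) (mu * complex.Re h) = Complex 0 mu * h.
    by case: h {h0 hh ha hb bd b1 b2} => a b; apply/eqP; rewrite eq_complex /=; apply/andP; split; apply/eqP; ring.
  by rewrite cexpD; field.
rewrite cabsM; have := hr (- (mu * complex.Im h)) (mu * complex.Re h).
rewrite normrN => /(_ (le_lt_trans b2 _) (le_lt_trans b1 _)).
rewrite [_ * cabs h]mulrC => /(_ hh hh) H.
have : cabs (h^-1 * (cexp mu h - 1 - Complex (- (mu * complex.Im h)) (mu * complex.Re h))) <=
  e / (cabs (cexp mu z) + 1).
  rewrite cabsM cabsV mulrC ler_pdivrMr ?cabs_gt0 //; apply: le_trans H _.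
  apply: le_trans (_ : e / ((cabs (cexp mu z) + 1) * (2 * (`|mu| + 1))) * (2 * (`|mu| + 1) * cabs h) <= _).
    by rewrite ler_wpM2l ?divr_ge0 ?(ltW e0) ?(ltW K0) // -mulrA mulrDl mul1r lerD.
  have M2 : 2 * (`|mu| + 1) != 0 by rewrite gt_eqF // mulr_gt0.
  by rewrite invfM [e * _]mulrA [leLHS]mulrA divfK.
move=> {}H; apply: le_lt_trans (ler_wpM2l (cabs_ge0 _) H) _.
rewrite mulrCA gtr_pMr // ltr_pdivrMr ?mul1r ?ltrDl //.
by rewrite ltr_wpDl ?cabs_ge0.
Qed.

End ComplexExponential.

Section KMS.
Variables (R : realType) (A : cstarAlgType R) (tau : R -> A -> A) (beta : R) (chi : A -> R[i]).
Hypotheses (sc : is_state chi) (tau_hom : forall t, is_starhom (tau t)) (kms : is_KMS tau beta chi).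
Local Notation C := (R[i]).
Local Notation zb := (Complex 0 beta).

Lemma kms_near1 (D : set A) : cdense D -> exists2 x, D x & chi x != 0.
Proof.
move=> dD; have : cclosure D 1 by rewrite dD.
move=> /(_ 1 ltr01)[x [Dx hx]]; exists x => //; apply/negP => /eqP c0.
have := state_cabs_le sc (1 - x); rewrite (stateB sc) c0 subr0 (state1 sc) cabs1.
by rewrite leNgt hx.
Qed.

(* [k(z) 1] is another entire extension of the constant orbit of [0], so the
   KMS condition forces [k] to vanish at [i beta]. *)
Lemma kms_identity (k : C -> C) : centire k -> (forall t : R, k t%:C%C = 0) -> k zb = 0.
Proof.
move=> hk k0; have [D [[D0 _ _ _] dD _ _ hK]] := kms.
have [x Dx x0] := kms_near1 dD.
have ext : entire_extension tau 0 (fun z => k z *: 1).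
  split.
    move=> z; have [d hd] := hk z; exists (d *: 1) => e e0.
    have [r r0 hr] := hd e e0; exists r => // h h0 hh.
    by rewrite -scalerBl scalerA -scalerBl cnormZ cnorm1 mulr1; exact: hr.
  move=> t; rewrite k0 scale0r; have := starhom_linear (tau_hom t) (-1) 0 0.
  by rewrite scaleN1r addrC subrr scaleN1r addrC subrr.
have := hK x 0 _ Dx D0 ext; rewrite mul0r (state0 sc) -scalerAr mulr1 (stateZ sc) => /eqP.
by rewrite mulf_eq0 (negbTE x0) orbF => /eqP.
Qed.

Lemma dense_bounded_eq (D : set A) (phi psi : A -> C) (K K' : R) : cdense D ->
  (forall (c : C) x y, phi (c *: x + y) = c * phi x + phi y) ->
  (forall (c : C) x y, psi (c *: x + y) = c * psi x + psi y) ->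
  (forall x, cabs (phi x) <= K * cnorm x) -> (forall x, cabs (psi x) <= K' * cnorm x) ->
  (forall x, D x -> phi x = psi x) -> forall x, phi x = psi x.
Proof.
move=> dD l1 l2 b1 b2 h x.
apply: eq_cabs_eps => e e0; pose M := `|K| + `|K'| + 1.
have M0 : 0 < M by rewrite /M ltr_wpDl // addr_ge0.
have : cclosure D x by rewrite dD.
move=> /(_ _ (divr_gt0 e0 M0))[y [hy xy]].
have pB z w : phi (z - w) = phi z - phi w by rewrite -scaleN1r addrC l1 mulN1r addrC.
have sB z w : psi (z - w) = psi z - psi w by rewrite -scaleN1r addrC l2 mulN1r addrC.
have -> : phi x - psi x = phi (x - y) - psi (x - y) by rewrite pB sB (h y hy); ring.
apply: le_trans (cabsD _ _) _; rewrite cabsN.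
apply: le_trans (lerD (b1 _) (b2 _)) _.
apply: le_trans (_ : M * cnorm (x - y) <= _).
  rewrite -mulrDl ler_wpM2r ?cnorm_ge0 // /M -[leLHS]addr0 lerD // lerD ?ler_norm //.
by rewrite mulrC -ler_pdivlMr // ltW.
Qed.

Lemma state_mulr_bd x a : cabs (chi (x * a)) <= cnorm x * cnorm a.
Proof. by apply: le_trans (state_cabs_le sc _) _; exact: ler_cnormM. Qed.

Lemma state_mull_bd x a : cabs (chi (a * x)) <= cnorm x * cnorm a.
Proof. by rewrite mulrC; apply: le_trans (state_cabs_le sc _) _; exact: ler_cnormM. Qed.

Lemma kms_all : exists D : set A,
    [/\ star_subalgebra D, cdense D,
        forall t y, D y -> D (tau t y),
        forall y, D y -> exists f, entire_extension tau y f
      & forall x y f, D y -> entire_extension tau y f -> chi (x * f zb) = chi (y * x)].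
Proof.
have [D [sD dD tD eD hK]] := kms; exists D; split=> // x y f Dy ef.
apply: (@dense_bounded_eq D (fun x => chi (x * f zb)) (fun x => chi (y * x)) (cnorm (f zb)) (cnorm y)) => //.
- by move=> c a b; rewrite mulrDl -scalerAl (state_lin sc).
- by move=> c a b; rewrite mulrDr -scalerAr (state_lin sc).
- by move=> a; exact: state_mull_bd.
- by move=> a; exact: state_mulr_bd.
by move=> a Da; exact: hK.
Qed.

End KMS.

Section FrequencyProjection.
Variables (R : realType) (GG : indsys R) (D : branching GG) (L : limit_algebra D).
Local Notation C := (R[i]).
Local Notation A := (lim_A L).
Local Notation F p := (br_F D p).
Local Notation lv := (@local_elt R GG D L _ _).
Local Notation tau := (@lim_flow _ _ _ L).

Definition contraction (T : A -> A) : Prop := is_linear T /\ forall a, cnorm (T a) <= cnorm a.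

Lemma contractionB T x y : contraction T -> T (x - y) = T x - T y.
Proof. by move=> [Tl _]; rewrite -scaleN1r addrC Tl scaleN1r addrC. Qed.

Lemma contraction0 T : contraction T -> T 0 = 0.
Proof. by move=> hT; have := contractionB 0 0 hT; rewrite !subrr. Qed.

Lemma contractionZ T c x : contraction T -> T (c *: x) = c *: T x.
Proof. by move=> hT; rewrite -[c *: x]addr0 hT.1 (contraction0 hT) addr0. Qed.

Lemma contraction_comp T S : contraction T -> contraction S -> contraction (T \o S).
Proof.
move=> [Tl Tc] [Sl Sc]; split=> [c x y|a] /=; first by rewrite Sl Tl.
exact: le_trans (Tc _) (Sc _).
Qed.

Lemma cabs_cis (t : R) : cabs (cis t) = 1.
Proof. by apply/eqP; rewrite -(@eqrXn2 _ 2) ?cabs_ge0 // cabs_sqrE /= cos2Dsin2 expr1n. Qed.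

Lemma contractionZc T t : contraction T -> contraction (fun a => cis t *: T a).
Proof.
move=> [Tl Tc]; split=> [c x y|a]; first by rewrite Tl scalerDr !scalerA mulrC.
by rewrite cnormZ cabs_cis mul1r.
Qed.

Lemma tau_contraction t : contraction (tau t).
Proof. by split=> [|a]; [exact: starhom_linear (lim_flow_hom _ t) | exact: starhom_contractive (lim_flow_hom _ t)]. Qed.

Lemma eig_span_ind (Q : A -> Prop) : Q 0 ->
  (forall (c : C) N (p : isys_dual GG N) j k y, Q y -> Q (c *: lv (eig (F p) j k) + y)) ->
  forall x, linspan (vset L) x -> Q x.
Proof.
move=> Q0 QS; apply: linspan_ind => // c x y [N [p [M ->]]] Qy.
have pF := br_F_pos D p; rewrite (eig_decomp (F p) M) lv_sum scaler_sumr.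
elim/big_ind : _ y Qy => [y|a b ha hb y hy|j _ y hy]; first by rewrite add0r.
  by rewrite -addrA; apply: ha; apply: hb.
rewrite lv_sum scaler_sumr.
elim/big_ind : _ y hy => [y|a b ha hb y hy|k _ y hy]; first by rewrite add0r.
  by rewrite -addrA; apply: ha; apply: hb.
by rewrite lvZ scalerA; apply: QS.
Qed.

Lemma contraction_eq T S : contraction T -> contraction S ->
  (forall N (p : isys_dual GG N) j k, T (lv (eig (F p) j k)) = S (lv (eig (F p) j k))) ->
  forall a, T a = S a.
Proof.
move=> hT hS TS a; apply: eq_cnorm_eps => e e0.
have : cclosure (linspan (vset L)) a by rewrite vset_dense.
have e2 : 0 < e / 2 by rewrite divr_gt0.
move=> /(_ _ e2)[b [hb ab]].
have E : T b = S b.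
  move: b hb {ab}; apply: eig_span_ind; first by rewrite (contraction0 hT) (contraction0 hS).
  by move=> c N p j k y Ty; rewrite hT.1 hS.1 TS Ty.
have -> : T a - S a = T (a - b) - S (a - b).
  by rewrite (contractionB _ _ hT) (contractionB _ _ hS) E opprB addrA subrK.
apply: le_trans (ler_cnormD _ _) _; rewrite cnormN [e]splitr.
by apply: lerD; apply: le_trans (ltW ab); [exact: hT.2 | exact: hS.2].
Qed.

Lemma tauC s t a : tau s (tau t a) = tau t (tau s a).
Proof.
apply: (contraction_eq (T := tau s \o tau t) (S := tau t \o tau s)).
- exact: contraction_comp (tau_contraction s) (tau_contraction t).
- exact: contraction_comp (tau_contraction t) (tau_contraction s).
move=> N p j k /=; rewrite !flow_eig !(contractionZ _ _ (tau_contraction _)) !flow_eig.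
by rewrite !scalerA mulrC.
Qed.

Variable mu : R.

Definition findex := {N : nat & {p : isys_dual GG N & ('I_(irr_dim p) * 'I_(irr_dim p))%type}}.

Definition ffreq (i : findex) : R := frq D (tagged (tagged i)).1 (tagged (tagged i)).2.

Definition ftime n : R :=
  if choice.unpickle n is Some i then (if ffreq i == mu then 0 else pi / (ffreq i - mu)) else 0.

(* The [n]-th step annihilates the [n]-th frequency when it differs from [mu],
   and fixes the frequency [mu]. *)
Fixpoint qavg n (a : A) : A :=
  if n is n'.+1 then
    (2^-1 : C) *: (qavg n' a + cis (- (mu * ftime n')) *: tau (ftime n') (qavg n' a))
  else a.

Lemma qavg_contraction n : contraction (qavg n).
Proof.
elim: n => [|n IH]; first by split=> /=.
have [h1 h2] := contractionZc (- (mu * ftime n)) (contraction_comp (tau_contraction (ftime n)) IH).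
split=> [c x y|a] /=.
  have := h1 c x y; rewrite /= => ->; rewrite IH.1 !scalerDr !scalerA !addrA [c * _]mulrC.
  have -> : c * (2^-1 * cis (- (mu * ftime n))) = 2^-1 * c * cis (- (mu * ftime n)) by ring.
  by congr (_ + _); exact: addrAC.
rewrite cnormZ; have -> : cabs (2^-1 : C) = 2^-1.
  have -> : (2^-1 : C) = (2^-1 : R)%:C%C by rewrite fmorphV rmorph_nat.
  by rewrite cabs_rc ger0_norm.
rewrite mulrC ler_pdivrMr // mulr_natr mulr2n.
apply: le_trans (ler_cnormD _ _) _; apply: lerD; first exact: IH.2.
exact: h2.
Qed.

Lemma cis0 : cis (0 : R) = 1.
Proof. by rewrite /cis cos0 sin0. Qed.

Lemma qavg_eig N (p : isys_dual GG N) j k : exists m, forall n, (m <= n)%N ->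
  qavg n (lv (eig (F p) j k)) = (frq D j k == mu)%:R *: lv (eig (F p) j k).
Proof.
pose i : findex := existT _ N (existT _ p (j, k)).
have fi : ffreq i = frq D j k by [].
have step n (c : C) : qavg n (lv (eig (F p) j k)) = c *: lv (eig (F p) j k) ->
  qavg n.+1 (lv (eig (F p) j k)) =
  (2^-1 * (1 + cis ((frq D j k - mu) * ftime n)) * c) *: lv (eig (F p) j k).
  move=> /= ->; rewrite (contractionZ _ _ (tau_contraction _)) flow_eig !scalerA -scalerDl scalerA.
  congr (_ *: _); rewrite mulrBl -[_ * _ - _ * _]addrC cisD [ftime n * _]mulrC; ring.
have [E|NE] := eqVneq (frq D j k) mu.
  exists 0%N => n _; elim: n => [|n IH]; first by rewrite scale1r.
  rewrite (step _ _ IH) E subrr mul0r cis0 mulr1; congr (_ *: _).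
  by rewrite -[1 + 1]/(2%:R) mulVf // pnatr_eq0.
exists (choice.pickle i).+1; elim=> // n IH; rewrite ltnS leq_eqVlt => /predU1P[E|/IH E].
  have [c hc] : exists c : C, qavg n (lv (eig (F p) j k)) = c *: lv (eig (F p) j k).
    elim: n {IH E} => [|n [c IH]]; first by exists 1; rewrite scale1r.
    by exists (2^-1 * (1 + cis ((frq D j k - mu) * ftime n)) * c); exact: step.
  rewrite (step _ _ hc) -E /ftime choice.pickleK fi (negbTE NE) [(_ - _) * _]mulrC divfK ?subr_eq0 //.
  have -> : cis (pi : R) = -1 by rewrite /cis cospi sinpi; apply/eqP; rewrite eq_complex /= oppr0 !eqxx.
  by rewrite subrr mulr0 mul0r.
by rewrite (step _ _ E) mulr0.
Qed.

Lemma qavg_cvg a : exists l, ccvg (fun n => qavg n a) l.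
Proof.
apply: cstar_complete => e e0.
have e3 : 0 < e / 3 by rewrite divr_gt0.
have : cclosure (linspan (vset L)) a by rewrite vset_dense.
move=> /(_ _ e3)[b [hb ab]].
have [m hm] : exists m, forall n n', (m <= n)%N -> (m <= n')%N -> qavg n b = qavg n' b.
  move: b hb {ab}; apply: eig_span_ind.
    by exists 0%N => n n' _ _; rewrite !(contraction0 (qavg_contraction _)).
  move=> c N p j k y [m hm]; have [m' hm'] := qavg_eig j k.
  exists (maxn m m') => n n'; rewrite !geq_max => /andP[h1 h2] /andP[h3 h4].
  by rewrite !(qavg_contraction _).1 !hm' // (hm n n').
exists m => n n' h h'.
have -> : qavg n a - qavg n' a = qavg n (a - b) - qavg n' (a - b).
  by rewrite !(contractionB _ _ (qavg_contraction _)) (hm n n') // opprB addrA subrK.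
apply: le_lt_trans (ler_cnormD _ _) _; rewrite cnormN.
apply: le_lt_trans (lerD ((qavg_contraction _).2 _) ((qavg_contraction _).2 _)) _.
by lra.
Qed.

Definition eproj a : A := sval (cid (qavg_cvg a)).

Lemma eprojP a : ccvg (fun n => qavg n a) (eproj a).
Proof. exact: svalP (cid (qavg_cvg a)). Qed.

Lemma eproj_contraction : contraction eproj.
Proof.
split=> [c x y|a].
  apply: ccvg_unique (eprojP _) _.
  have := ccvgD (ccvgZ c (eprojP x)) (eprojP y).
  by move=> h e e0; have [N hN] := h e e0; exists N => n /hN; rewrite (qavg_contraction n).1.
exact: (ccvg_le (eprojP a) (fun n => (qavg_contraction n).2 a)).
Qed.

Lemma eproj_eig N (p : isys_dual GG N) j k :
  eproj (lv (eig (F p) j k)) = (frq D j k == mu)%:R *: lv (eig (F p) j k).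
Proof.
apply: ccvg_unique (eprojP _) _ => e e0; have [m hm] := qavg_eig j k.
by exists m => n /hm ->; rewrite subrr cnorm0.
Qed.

Lemma eproj_tau t a : eproj (tau t a) = cis (t * mu) *: eproj a.
Proof.
apply: (contraction_eq (T := eproj \o tau t) (S := fun a => cis (t * mu) *: eproj a)).
- exact: contraction_comp eproj_contraction (tau_contraction t).
- exact: contractionZc eproj_contraction.
move=> N p j k /=; rewrite flow_eig (contractionZ _ _ eproj_contraction) eproj_eig !scalerA.
by case: eqP => [->//|_]; rewrite !mulr0.
Qed.

Lemma qavg_tau n t a : qavg n (tau t a) = tau t (qavg n a).
Proof.
elim: n => //= n ->; rewrite (contractionZ _ _ (tau_contraction _)).
congr (_ *: _); have := (tau_contraction t).1 (cis (- (mu * ftime n))) (tau (ftime n) (qavg n a)) (qavg n a).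
by rewrite addrC => ->; rewrite tauC addrC.
Qed.

Lemma qavg_ext n y f : entire_extension tau y f ->
  entire_extension tau (qavg n y) (fun z => qavg n (f z)).
Proof.
move=> [ef hf]; split; last by move=> t; rewrite hf qavg_tau.
have [h1 h2] := qavg_contraction n.
by apply: (entire_linear (K := 1)) h1 _ ef => x; rewrite mul1r.
Qed.

Lemma qavg_closed (S : set A) n y : star_subalgebra S -> (forall t y, S y -> S (tau t y)) ->
  S y -> S (qavg n y).
Proof.
move=> [S0 Sl _ _] St Sy; elim: n => //= n IH.
by rewrite -[_ *: _]addr0; apply: (Sl _ _ _ _ S0); rewrite addrC; apply: (Sl) => //; exact: St.
Qed.

End FrequencyProjection.

Section KMSTwist.
Variables (R : realType) (GG : indsys R) (D : branching GG) (L : limit_algebra D).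
Local Notation C := (R[i]).
Local Notation A := (lim_A L).
Local Notation F p := (br_F D p).
Local Notation lv := (@local_elt R GG D L _ _).
Local Notation tau := (@lim_flow _ _ _ L).
Variable chi : A -> C.
Hypotheses (sc : is_state chi) (kms : is_KMS tau (-1) chi).
Local Notation zi := (Complex 0 (-1) : C).

Lemma kms_eproj mu y f x (S : set A) :
  star_subalgebra S -> (forall t y, S y -> S (tau t y)) ->
  (forall x y f, S y -> entire_extension tau y f -> chi (x * f zi) = chi (y * x)) ->
  S y -> entire_extension tau y f ->
  chi (x * eproj mu (f zi)) = chi (eproj mu y * x).
Proof.
move=> sS St SK Sy ef; apply: eq_cabs_eps => e e0.
have X0 : 0 < cnorm x + 1 by rewrite ltr_wpDl ?cnorm_ge0.
have e2 : 0 < e / 2 / (cnorm x + 1) by rewrite !divr_gt0.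
have [n1 h1] := eprojP mu (f zi) e2; have [n2 h2] := eprojP mu y e2.
set n := maxn n1 n2.
have := SK x _ _ (qavg_closed mu n sS St Sy) (qavg_ext mu n ef) => E.
have -> : chi (x * eproj mu (f zi)) - chi (eproj mu y * x) =
  chi (x * (eproj mu (f zi) - qavg mu n (f zi))) - chi ((eproj mu y - qavg mu n y) * x).
  by rewrite mulrBr mulrBl !(stateB sc) E; ring.
apply: le_trans (cabsD _ _) _; rewrite cabsN [e]splitr.
have bd z : cnorm z < e / 2 / (cnorm x + 1) -> cnorm x * cnorm z <= e / 2.
  move=> /ltW h; rewrite -(divfK (lt0r_neq0 X0) (e / 2)) mulrC.
  by apply: ler_pM; rewrite ?cnorm_ge0 // lerDl.
apply: lerD.
  apply: le_trans (state_mulr_bd sc _ _) _; apply: bd; rewrite cnormB; apply: h1; exact: leq_maxl.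
apply: le_trans (state_mull_bd sc _ _) _; apply: bd; rewrite cnormB; apply: h2; exact: leq_maxr.
Qed.

Lemma kms_twist N (p : isys_dual GG N) j k x :
  chi (lv (eig (F p) j k) * x) = eigratio D j k * chi (x * lv (eig (F p) j k)).
Proof.
set Y := lv _; pose mu := frq D j k; set lam := eigratio _ _ _.
have [S [sS dS St Se SK]] := kms_all sc kms.
have lamE : cexp mu zi = lam.
  rewrite /cexp /= mulr0 cis0 mulr1 mulrN1 opprK /mu /frq expRB !lnK ?posrE ?eigval_gt0 //; exact: br_F_pos.
have EY : eproj mu Y = Y by rewrite /Y eproj_eig eqxx scale1r.
have main y : S y -> chi (eproj mu y * x) = lam * chi (x * eproj mu y).
  move=> Sy; have [f ef] := Se y Sy.
  rewrite -(kms_eproj mu x sS St SK Sy ef) -lamE.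
  have hk : centire (fun z => chi (x * eproj mu (f z)) - chi (x * eproj mu y) * cexp mu z).
    apply: centire_comb (cexp_entire mu).
    apply: (entire_functional (K := cnorm x) (psi := fun a => chi (x * eproj mu a))) ef.1.
    - by move=> c a b; rewrite (eproj_contraction L mu).1 mulrDr -scalerAr (state_lin sc).
    - move=> a; apply: le_trans (state_mulr_bd sc _ _) _.
      by rewrite ler_wpM2l ?cnorm_ge0 // (eproj_contraction L mu).2.
  have := kms_identity sc (@lim_flow_hom _ _ _ L) kms hk.
  move=> /(_ _)/eqP; rewrite subr_eq0 => H; rewrite [RHS]mulrC; apply/eqP; apply: H => t.
  by rewrite ef.2 eproj_tau cexp_real -scalerAr (stateZ sc) mulrC subrr.
rewrite -EY; apply: (dense_bounded_eq (D := S) (phi := fun y => chi (eproj mu y * x))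
  (psi := fun y => lam * chi (x * eproj mu y)) (K := cnorm x) (K' := cabs lam * cnorm x) dS) => //.
- by move=> c a b; rewrite (eproj_contraction L mu).1 mulrDl -scalerAl (state_lin sc).
- by move=> c a b; rewrite (eproj_contraction L mu).1 mulrDr -scalerAr (state_lin sc); ring.
- move=> a; apply: le_trans (state_mull_bd sc _ _) _.
  by rewrite ler_wpM2l ?cnorm_ge0 // (eproj_contraction L mu).2.
- move=> a; rewrite cabsM -mulrA ler_wpM2l ?cabs_ge0 //.
  apply: le_trans (state_mulr_bd sc _ _) _.
  by rewrite ler_wpM2l ?cnorm_ge0 // (eproj_contraction L mu).2.
Qed.

End KMSTwist.

Section ErgodicExtremal.
Variables (R : realType) (GG : indsys R) (D : branching GG) (L : limit_algebra D).
Local Notation C := (R[i]).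
Local Notation A := (lim_A L).
Variables (o : inf_path (branching_graph D)) (P : probability (Omega o) R).
Hypothesis cP : central P.
Variable chi : A -> C.
Hypotheses (qc : quantized_character chi) (cc : corresponds P chi) (eP : ergodic P).

Lemma ergodic_component (chi1 chi2 : A -> C) (s : R) : quantized_character chi1 ->
  is_state chi2 -> 0 < s < 1 ->
  (forall a, chi a = s%:C%C * chi1 a + (1 - s)%:C%C * chi2 a) -> chi1 = chi.
Proof.
case: qc => sc _ _ [sc1 kms1 _] sc2 /andP[s0 s1] E.
have dt : dominated_trace chi chi1 s^-1.
  split; first exact: state_lin sc1.
  - by exists 1 => x; rewrite mul1r; exact: state_cabs_le.
  - move=> x; have h1 := state_ge0 sc1 x; have h2 := state_ge0 sc2 x.
    have hre z : 0 <= z -> 0 <= complex.Re z :> R by rewrite lecE /= => /andP[].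
    rewrite E ReD !Re_rcM {1}(ge0_rcRe h1) cabs_rc ger0_norm ?hre // mulrC ler_pdivlMr //.
    by rewrite mulrC lerDl mulr_ge0 ?subr_ge0 ?(ltW s1) // hre.
  - by move=> N p j k M; exact: kms_twist.
have [c hc] := ergodic_dominated_trace cP sc cc eP dt.
have c1 : c = 1 by have := hc 1; rewrite (state1 sc1) (state1 sc) mulr1.
by apply/funext => a; rewrite hc c1 mul1r.
Qed.

Lemma ergodic_extremal_character : extremal_character chi.
Proof.
split=> // chi1 chi2 s q1 q2 hs E; have [sc1 _ _] := q1; have [sc2 _ _] := q2; split.
  exact: (ergodic_component q1 sc2 hs E).
apply: (ergodic_component (s := 1 - s) q2 sc1).
  by case/andP: hs => h1 h2; rewrite subr_gt0 h2 gtrBl.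
by move=> a; rewrite E addrC; congr (_ + _ * _); rewrite opprB addrC subrK.
Qed.

End ErgodicExtremal.

(** * The central operator of an invariant set *)

Section TwistedStates.
Variables (R : realType) (GG : indsys R) (D : branching GG) (L : limit_algebra D).
Local Notation C := (R[i]).
Local Notation A := (lim_A L).
Local Notation F p := (br_F D p).
Local Notation lv := (@local_elt R GG D L _ _).
Local Notation tau := (@lim_flow _ _ _ L).
Local Notation zi := (Complex 0 (-1) : C).

Lemma cexp_frq N (p : isys_dual GG N) j k : cexp (frq D j k) zi = @eigratio _ _ D N p j k.
Proof.
by rewrite /cexp /= mulr0 cis0 mulr1 mulrN1 opprK /frq expRB !lnK ?posrE ?eigval_gt0 //; exact: br_F_pos.
Qed.

Lemma is_entire_comb (k : C -> C) (a : A) (f : C -> A) : centire k -> is_entire f ->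
  is_entire (fun z => k z *: a + f z).
Proof.
move=> hk hf z; have [d hd] := hk z; have [d' hd'] := hf z; exists (d *: a + d') => e e0.
have e2 : 0 < e / 2 by rewrite divr_gt0.
have K0 : 0 < cnorm a + 1 by rewrite ltr_wpDl ?cnorm_ge0.
have [r r0 hr] := hd _ (divr_gt0 e2 K0); have [r' r'0 hr'] := hd' _ e2.
exists (Num.min r r'); first by rewrite lt_min r0.
move=> h h0; rewrite lt_min => /andP[h1 h2].
have -> : h^-1 *: (k (z + h) *: a + f (z + h) - (k z *: a + f z)) - (d *: a + d') =
  (h^-1 * (k (z + h) - k z) - d) *: a + (h^-1 *: (f (z + h) - f z) - d').
  rewrite opprD addrACA scalerDr -scalerBl scalerA opprD addrACA -scalerBl; congr (_ + _).
apply: le_lt_trans (ler_cnormD _ _) _; rewrite cnormZ [e]splitr; apply: ltrD; last exact: hr'.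
apply: le_lt_trans (_ : cabs (h^-1 * (k (z + h) - k z) - d) * (cnorm a + 1) < _).
  by rewrite ler_wpM2l ?cabs_ge0 // lerDl.
by rewrite -ltr_pdivlMr //; exact: hr.
Qed.

Lemma centireM (c : C) k : centire k -> centire (fun z => c * k z).
Proof.
move=> hk z; have [d hd] := hk z; exists (c * d) => e e0.
have K0 : 0 < cabs c + 1 by rewrite ltr_wpDl ?cabs_ge0.
have [r r0 hr] := hd _ (divr_gt0 e0 K0); exists r => // h h0 hh.
rewrite -mulrBr mulrCA -mulrBr cabsM.
apply: le_lt_trans (_ : (cabs c + 1) * cabs (h^-1 * (k (z + h) - k z) - d) < _).
  by rewrite ler_wpM2r ?cabs_ge0 // lerDl.
by rewrite mulrC -ltr_pdivlMr //; exact: hr.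
Qed.

Variable chi : A -> C.
Hypotheses (sc : is_state chi) (kms : is_KMS tau (-1) chi).
Variable psi : A -> C.
Hypothesis sp : is_state psi.
Hypothesis twist : forall N (p : isys_dual GG N) j k x,
  psi (lv (eig (F p) j k) * x) = eigratio D j k * psi (x * lv (eig (F p) j k)).

Lemma twisted_extension y : linspan (vset L) y -> exists f, entire_extension tau y f /\
  forall x, psi (x * f zi) = psi (y * x).
Proof.
move: y; apply: eig_span_ind.
  exists (fun=> 0); split; last by move=> x; rewrite mulr0 mul0r.
  split=> [z|t]; last by rewrite (contraction0 (tau_contraction L t)).
  by exists 0 => e e0; exists 1 => // h _ _; rewrite !subr0 scaler0 cnorm0.
move=> c N p j k y [f [[ef hf] E]].
exists (fun z => (c * cexp (frq D j k) z) *: lv (eig (F p) j k) + f z); split.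
  split; first exact: is_entire_comb (centireM c (cexp_entire _)) ef.
  by move=> t; rewrite cexp_real hf (tau_contraction L t).1 flow_eig scalerA.
move=> x; rewrite cexp_frq mulrDr mulrDl -scalerAr -scalerAl !(state_lin sp) E twist mulrA //.
Qed.

(* The given KMS state only serves to make the extensions unique at [- i]. *)
Lemma twisted_KMS : is_KMS tau (-1) psi.
Proof.
exists (linspan (vset L)); split.
- exact: vspan_subalgebra.
- exact: vset_dense.
- move=> t y; move: y; apply: eig_span_ind.
    by rewrite (contraction0 (tau_contraction L t)); exact: linspan0.
  move=> c N p j k y Ty; rewrite (tau_contraction L t).1 flow_eig scalerA.
  by apply: linspanD => //; apply: linspan_sub; exists N, p, (eig (F p) j k).
- by move=> y /twisted_extension[f [ef _]]; exists f.
move=> x y f _ /twisted_extension[f0 [[ef0 hf0] E]] [ef hf].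
rewrite -E; have bd : forall a, cabs (psi (x * a)) <= cnorm x * cnorm a := state_mulr_bd sp x.
have lin : forall (c : C) a b, psi (x * (c *: a + b)) = c * psi (x * a) + psi (x * b).
  by move=> c a b; rewrite mulrDr -scalerAr (state_lin sp).
have := kms_identity sc (@lim_flow_hom _ _ _ L) kms (centire_comb 1
  (entire_functional lin bd ef) (entire_functional lin bd ef0)).
move=> /(_ _)/eqP; rewrite mul1r subr_eq0 => H; apply/eqP; apply: H => t.
by rewrite hf hf0 mul1r subrr.
Qed.

End TwistedStates.

Lemma diagonal_elt (R : realType) (GG : indsys R) (D : branching GG) (L : limit_algebra D) N
  (s : seq (isys_dual GG N)) (c : isys_dual GG N -> R) : uniq s ->
  (forall p, 0 <= c p) -> (forall p, c p <= 1) ->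
  exists2 x : matfamily (isys_dual GG N), is_Cstar_elt x (\sum_(p <- s) local_elt L ((c p)%:C%C *: (1%:M : 'M[R[i]]_(irr_dim p)))) &
    cnorm (\sum_(p <- s) local_elt L ((c p)%:C%C *: (1%:M : 'M[R[i]]_(irr_dim p)))) <= 1.
Proof.
move=> us c0 c1.
pose x : matfamily (isys_dual GG N) := fun p => if p \in s then (c p)%:C%C *: 1%:M else 0.
have xs : fsupp x.
  apply: (sub_finite_set (B := [set` s])); last exact: finite_seq.
  by move=> p; rewrite /x /=; case: ifP => //; rewrite eqxx.
have E : \sum_(p <- s) local_elt L ((c p)%:C%C *: (1%:M : 'M[R[i]]_(irr_dim p))) = lel L x.
  rewrite (lel_decomp L xs us) => [|p]; last by rewrite /x; case: ifP => //; rewrite eqxx.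
  by rewrite !big_seq; apply: eq_bigr => p ps; rewrite /x ps.
exists x; rewrite E; first by apply: lel_Cstar_elt; exact: fsupp_Cstar.
apply: lel_norm => // p; apply: opnorm_le => // v.
rewrite /x; case: ifP => _; last by rewrite mul0mx cvnorm0 mul1r cvnorm_ge0.
rewrite -scalemxAl mul1mx cvnormZ cabs_rc ger0_norm //.
by rewrite ler_wpM2r ?cvnorm_ge0.
Qed.

Section TailProjection.
Variables (R : realType) (GG : indsys R) (D : branching GG) (L : limit_algebra D).
Local Notation C := (R[i]).
Local Notation A := (lim_A L).
Local Notation F p := (br_F D p).
Local Notation lv := (@local_elt R GG D L _ _).
Local Notation hB := (branching_regular D).
Local Notation B := (branching_graph D).
Local Notation one p := (1%:M : 'M[C]_(irr_dim p)).
Variables (o : inf_path B) (P : probability (Omega o) R).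
Hypothesis cP : central P.
Variable chi : A -> C.
Hypotheses (sc : is_state chi) (cc : corresponds P chi).
Local Notation wt := (vertex_pr P).
Local Notation XEv p := (@XE R B o (vtx D p)).
Variable S : set (Omega o).
Hypotheses (mS : measurable S) (iS : shuffle_invariant S).

Let mX N (p : isys_dual GG N) : measurable (XEv p).
Proof. exact: (measurable_XE hB). Qed.

Let mI (X Y : set (Omega o)) : measurable X -> measurable Y -> measurable (X `&` Y).
Proof. exact: measurableI. Qed.

Definition err (N : nat) : R := 2^-1 ^+ N.

Lemma err_gt0 N : 0 < err N.
Proof. by rewrite exprn_gt0 // invr_gt0. Qed.

Definition support N : seq (isys_dual GG N) := undup (sval (cid (level_approx P N (err_gt0 N)))).

Lemma support_approx N (X : set (Omega o)) : measurable X ->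
  `|pr P X - \sum_(p <- support N) pr P (X `&` XEv p)| < err N.
Proof.
move=> mX'; apply: (svalP (cid (level_approx P N (err_gt0 N))) _ mX'); first exact: undup_uniq.
by move=> p; rewrite mem_undup.
Qed.

(* [P(S | X_N = p)]. *)
Definition condp N (p : isys_dual GG N) : R := pr P (S `&` XEv p) / wt p.

Lemma condp_wt N (p : isys_dual GG N) : condp p * wt p = pr P (S `&` XEv p).
Proof.
rewrite /condp; have [z|z] := eqVneq (wt p) 0; last by rewrite divfK.
rewrite z mulr0; apply/esym/le_anti; rewrite pr_ge0 andbT -z; by apply: pr_le; [exact: mI | exact: mX | move=> w []].
Qed.

Lemma condp_ge0 N (p : isys_dual GG N) : 0 <= condp p.
Proof. by rewrite divr_ge0 ?pr_ge0. Qed.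

Lemma condp_le1 N (p : isys_dual GG N) : condp p <= 1.
Proof.
rewrite /condp; have [z|z] := eqVneq (wt p) 0; first by rewrite z invr0 mulr0 ler01.
have w0 : 0 < wt p by rewrite lt_neqAle eq_sym z wt_ge0.
by rewrite ler_pdivrMr // mul1r; apply: pr_le; [exact: mI | exact: mX | move=> w []].
Qed.

Lemma pr_inv_and N (q : isys_dual GG N) k (p : isys_dual GG (k + N)) :
  pr P (S `&` XEv q `&` XEv p) = condp p * pr P (XEv q `&` XEv p).
Proof.
rewrite (pr_XE_and hB cP mS iS) ?leq_addl // (pr_and_level cP) mulrA condp_wt.
by rewrite -mulrA; congr (_ * _); rewrite mulrC.
Qed.

Definition average N : A := \sum_(p <- support N) lv ((condp p)%:C%C *: one p).

Lemma average_star N : star (average N) = average N.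
Proof.
rewrite star_sum; apply: eq_bigr => p _; rewrite lv_star; congr lv.
apply/matrixP => i j; rewrite !mxE rmorphM /= conj_rc rmorph_nat eq_sym //.
Qed.

Lemma average_norm N : cnorm (average N) <= 1.
Proof.
have [x _ h] := diagonal_elt L (undup_uniq _ : uniq (support N)) (c := @condp N) (@condp_ge0 N) (@condp_le1 N).
exact: h.
Qed.

Lemma average_comm N (q : isys_dual GG N) (M : 'M[C]_(irr_dim q)) k :
  average (k + N) * lv M = lv M * average (k + N).
Proof.
rewrite mulr_suml mulr_sumr; apply: eq_bigr => p _.
rewrite -[@local_elt _ _ _ _ _ q M]/(lel L (sv M)) lvMlel ?lelMlv; try exact: sv_fsupp.
by rewrite -scalemxAl mul1mx -scalemxAr mulmx1.
Qed.

Lemma chi_lv_average N (q : isys_dual GG N) k :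
  chi (lv (one q) * average (k + N)) =
  (\sum_(p <- support (k + N)) pr P (S `&` XEv q `&` XEv p))%:C%C.
Proof.
rewrite mulr_sumr (state_sum sc) rc_sum; apply: eq_bigr => p _.
rewrite pr_inv_and lvZ -scalerAr (stateZ sc) -[@local_elt _ _ _ _ _ q _]/(lel L (sv _)) lelMlv ?mulmx1; last exact: sv_fsupp.
by rewrite (corr_lv sc cc) trform_Thn pr_and_level // -!rcM.
Qed.

Definition sqmean N : R := \sum_(q <- support N) condp q * pr P (S `&` XEv q).

Lemma chi_average2 N k : chi (average N * average (k + N)) =
  (\sum_(q <- support N) condp q * \sum_(p <- support (k + N)) pr P (S `&` XEv q `&` XEv p))%:C%C.
Proof.
rewrite mulr_suml (state_sum sc) rc_sum; apply: eq_bigr => q _.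
by rewrite lvZ -scalerAl (stateZ sc) chi_lv_average rcM.
Qed.

Definition support_set N : set (Omega o) :=
  [set w | exists2 v, v \in [seq vtx D p | p <- support N] & XE v w].

Lemma measurable_support N : measurable (support_set N).
Proof. by apply: measurable_exists_in => v; exact: (measurable_XE hB). Qed.

Lemma sum_support N (X : set (Omega o)) : measurable X ->
  \sum_(p <- support N) pr P (X `&` XEv p) = pr P (X `&` support_set N).
Proof.
move=> mX'; rewrite pr_sum ?big_map // => [v||v v' /mapP[p _ ->] /mapP[p' _ ->] w].
- exact: (measurable_XE hB).
- by rewrite map_inj_uniq ?undup_uniq //; exact: vtx_inj.
- exact: XE_inj.
Qed.

Lemma sum_le_pr N (X : set (Omega o)) : measurable X ->
  \sum_(p <- support N) pr P (X `&` XEv p) <= pr P X.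
Proof.
move=> mX'; rewrite sum_support //; apply: pr_le; [|exact: mX'|by move=> w []].
by apply: mI => //; exact: measurable_support.
Qed.

(* The martingale identity [E(f_N f_M) = E(f_N ^ 2)] for [f_N = P(S | X_N)], up to
   the mass outside the finite supports. *)
Lemma sqmean_close N k :
  0 <= sqmean N - complex.Re (chi (average N * average (k + N))) <= err (k + N).
Proof.
rewrite chi_average2 /= /sqmean -sumrB; under eq_bigr do rewrite -mulrBr.
have b q : 0 <= pr P (S `&` XEv q) - \sum_(p <- support (k + N)) pr P (S `&` XEv q `&` XEv p) :> R.
  by rewrite subr_ge0; apply: sum_le_pr; exact: mI.
rewrite sumr_ge0 /= => [|q _]; last by rewrite mulr_ge0 ?condp_ge0.
apply: le_trans (_ : \sum_(q <- support N) (pr P (S `&` XEv q) -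
   \sum_(p <- support (k + N)) pr P (S `&` XEv q `&` XEv p)) <= _).
  by apply: ler_sum => q _; rewrite ler_piMl ?b // condp_le1.
rewrite sumrB exchange_big /= sum_support //.
have mSU : measurable (S `&` support_set N) by apply: mI => //; exact: measurable_support.
have := support_approx (k + N) mSU; move=> /ltW /(le_trans (ler_norm _)).
congr (_ - _ <= _); apply: eq_bigr => p _.
have -> : S `&` support_set N `&` XEv p = S `&` XEv p `&` support_set N by exact: setIAC.
by rewrite -sum_support; [apply: eq_bigr => q _; rewrite setIAC | exact: mI].
Qed.

Lemma sqmeanE N : chi (average N * average N) = (sqmean N)%:C%C.
Proof.
have := chi_average2 N 0; rewrite add0n => ->; congr (_%:C%C).
apply: eq_big_seq => q qs; congr (_ * _); rewrite (bigD1_seq q) ?undup_uniq //= big1 => [|p pq].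
  by rewrite addr0 -setIA setIid.
rewrite -(pr_set0 P); congr (pr P); apply/seteqP; split=> // w [[_ h1] h2].
by move/eqP: pq; apply; apply: vtx_inj; exact: XE_inj h2 h1.
Qed.

Lemma average_dist N k : snorm (sform chi) (average N - average (k + N)) ^+ 2 <=
  sqmean (k + N) - sqmean N + 2 * err (k + N).
Proof.
have hs := sformP sc; rewrite (snorm_sqr hs) (sqnB hs) /sqn /sform !average_star !sqmeanE /=.
have := sqmean_close N k; have -> : chi (average (k + N) * average N) = Num.conj (chi (average N * average (k + N))).
  by rewrite -(state_conj sc) starM !average_star.
rewrite cRe_conj => /andP[_]; lra.
Qed.

Lemma errS N : 2 * err N.+1 = err N.
Proof. by rewrite /err exprS mulrA divff ?mul1r // pnatr_eq0. Qed.

Lemma err_small (e : R) : 0 < e -> exists N, forall n, (N <= n)%N -> err n < e.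
Proof.
move=> e0; exists (Num.bound e^-1) => n Nn; rewrite /err exprVn.
rewrite invf_plt ?posrE ?exprn_gt0 //; apply: lt_le_trans (archi_boundP _) _.
  by rewrite invr_ge0 ltW.
by rewrite -natrX ler_nat; apply: leq_trans Nn _; exact: ltnW (ltn_expl _ _).
Qed.

Lemma sqmean_le1 N : sqmean N <= 1.
Proof.
apply: le_trans (_ : pr P S <= 1); last exact: pr_le1.
apply: le_trans (sum_le_pr N mS); apply: ler_sum => q _.
by rewrite ler_piMl ?pr_ge0 // condp_le1.
Qed.

Lemma average_cauchy (e : R) : 0 < e -> exists N, forall m n, (N <= m)%N -> (N <= n)%N ->
  snorm (sform chi) (average m - average n) < e.
Proof.
move=> e0; have hs := sformP sc; have sq0 : 0 < e ^+ 2 / 2 by rewrite divr_gt0 ?exprn_gt0.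
pose v n : R := sqmean n - 2 * err n.
have v_inc n : v n <= v n.+1.
  have := average_dist n 1; rewrite add1n /v -[err n]errS; have := sqr_ge0 (snorm (sform chi) (average n - average n.+1)).
  lra.
have v_le n : v n <= 1.
  by rewrite /v lerBlDr; apply: le_trans (sqmean_le1 n) _; rewrite lerDl mulr_ge0 // ltW // err_gt0.
have [N1 h1] := nondecr_bounded_cauchy v_inc v_le sq0.
have e4 : 0 < e ^+ 2 / 8 by rewrite divr_gt0 ?exprn_gt0.
have [N2 h2] := err_small e4.
exists (maxn N1 N2) => m n; wlog mn : m n / (m <= n)%N.
  move=> W hm hn; have [/W|/ltnW/W] := leqP m n; first exact.
  by rewrite (snormB hs); exact.
rewrite !geq_max => /andP[m1 m2] /andP[n1 n2].
rewrite -(ltr_pXn2r (ltn0Sn 1)) ?nnegrE ?snorm_ge0 ?(ltW e0) //.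
have := average_dist m (n - m); rewrite subnK // => h.
have := h1 _ _ n1 m1; have := h2 _ n2; have := h2 _ m2; move: h; rewrite /v ltr_norml.
have := err_gt0 n; have := err_gt0 m; lra.
Qed.

Variable g : gns chi.
Local Notation H := (gns_space g).
Local Notation pi := (@gns_rep _ _ _ g).
Local Notation xi := (gns_vec g).
Let hr := gns_repP g.
Let hi := hinnerP H.

Definition hcvg (u : nat -> H) (l : H) : Prop :=
  forall e : R, 0 < e -> exists N, forall n, (N <= n)%N -> hnorm (u n - l) < e.

Lemma average_lv_cauchy N (q : isys_dual GG N) (M : 'M[C]_(irr_dim q)) (e : R) : 0 < e ->
  exists K, forall m n, (K <= m)%N -> (K <= n)%N ->
  hnorm (pi (average m) (pi (lv M) xi) - pi (average n) (pi (lv M) xi)) < e.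
Proof.
move=> e0; have K0 : 0 < cnorm (lv M) + 1 by rewrite ltr_wpDl ?cnorm_ge0.
have [K hK] := average_cauchy (divr_gt0 e0 K0); exists (maxn N K) => m n.
rewrite !geq_max => /andP[m1 m2] /andP[n1 n2].
have cm k : (N <= k)%N -> average k * lv M = lv M * average k.
  by move=> /subnK <-; exact: average_comm.
rewrite -!(starrepM hr) !cm // -(starrepB hr) -mulrBr (gns_hnorm g).
apply: le_lt_trans (state_snormM sc _ _) _.
apply: le_lt_trans (_ : (cnorm (lv M) + 1) * snorm (sform chi) (average m - average n) < _).
  by rewrite ler_wpM2r ?snorm_ge0 // lerDl.
by rewrite mulrC -ltr_pdivlMr //; exact: hK.
Qed.

Lemma average_op_cauchy (v : H) (e : R) : 0 < e -> exists K, forall m n, (K <= m)%N -> (K <= n)%N ->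
  hnorm (pi (average m) v - pi (average n) v) < e.
Proof.
have avg n w : hnorm (pi (average n) w) <= hnorm w.
  by apply: le_trans (starrep_norm hr _ _) _; rewrite ler_piMl ?hnorm_ge0 // average_norm.
have loc b : linspan (vset L) b -> forall e : R, 0 < e -> exists K, forall m n, (K <= m)%N -> (K <= n)%N ->
  hnorm (pi (average m) (pi b xi) - pi (average n) (pi b xi)) < e.
  move: b; apply: linspan_ind.
    move=> {}e e0; exists 0%N => m n _ _.
    by rewrite (starrep0 hr) !(starrep_op0 hr) subrr hnorm0.
  move=> c x y [N [q [M ->]]] IH {}e e0.
  have c0 : 0 < cabs c + 1 by rewrite ltr_wpDl ?cabs_ge0.
  have e2 : 0 < e / 2 by rewrite divr_gt0.
  have [K1 h1] := average_lv_cauchy M (divr_gt0 e2 c0).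
  have [K2 h2] := IH _ e2.
  exists (maxn K1 K2) => m n; rewrite !geq_max => /andP[m1 m2] /andP[n1 n2].
  rewrite (starrep_linear hr) !(starrep_op_lin hr) opprD addrACA -scalerBr.
  apply: le_lt_trans (hnormD _ _) _; rewrite hnormZ [e]splitr; apply: ltrD; last exact: h2.
  apply: le_lt_trans (_ : (cabs c + 1) * hnorm (pi (average m) (pi (lv M) xi) - pi (average n) (pi (lv M) xi)) < _).
    by rewrite ler_wpM2r ?hnorm_ge0 // lerDl.
  by rewrite mulrC -ltr_pdivlMr //; exact: h1.
move=> e0; have e5 : 0 < e / 5 by rewrite divr_gt0.
have [a va] := gns_cyclic v e5.
have [b [hb ab]] : exists b, linspan (vset L) b /\ cnorm (a - b) < e / 5.
  have : cclosure (linspan (vset L)) a by rewrite vset_dense.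
  exact.
have vb : hnorm (v - pi b xi) < e / 5 + e / 5.
  apply: le_lt_trans (hnorm_dist (pi a xi) _ _) _; apply: ltrD => //.
  rewrite -(starrepB hr) (gns_hnorm g); apply: le_lt_trans ab; exact: state_snorm_le.
have [K hK] := loc _ hb _ e5; exists K => m n hm hn.
apply: le_lt_trans (hnorm_dist (pi (average m) (pi b xi)) _ _) _.
apply: le_lt_trans (_ : hnorm (v - pi b xi) + (e / 5 + hnorm (v - pi b xi)) < _); last by move: vb; lra.
apply: lerD; first by rewrite -(starrep_opB hr).
apply: le_trans (hnorm_dist (pi (average n) (pi b xi)) _ _) _.
by apply: lerD; [exact/ltW/hK | rewrite -(starrep_opB hr) (hnormB v); exact: (avg n (pi b xi - v))].
Qed.

Lemma average_op_cvg (v : H) : exists l, hcvg (fun n => pi (average n) v) l.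
Proof. by apply: hilbert_complete => e e0; exact: average_op_cauchy. Qed.

Definition tail_op (v : H) : H := sval (cid (average_op_cvg v)).

Lemma tail_opP (v : H) : hcvg (fun n => pi (average n) v) (tail_op v).
Proof. exact: svalP (cid (average_op_cvg v)). Qed.

Lemma hcvg_unique u l l' : hcvg u l -> hcvg u l' -> l = l'.
Proof.
move=> h h'; apply: (hnorm_eq_eps (K := 2)) => e e0.
have [N hN] := h e e0; have [N' hN'] := h' e e0; set n := maxn N N'.
apply: le_trans (hnorm_dist (u n) _ _) _; rewrite mulrDl mul1r; apply: lerD.
  by rewrite hnormB; apply/ltW/hN; exact: leq_maxl.
by apply/ltW/hN'; exact: leq_maxr.
Qed.

Lemma hcvg_op (T : H -> H) u l : bounded_op T -> hcvg u l -> hcvg (fun n => T (u n)) (T l).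
Proof.
move=> bT h e e0; have [Tl [K TK]] := bT; have K0 : 0 < `|K| + 1 by rewrite ltr_wpDl.
have [N hN] := h _ (divr_gt0 e0 K0); exists N => n Nn; rewrite -(bounded_opB _ _ bT).
apply: le_lt_trans (TK _) _.
apply: le_lt_trans (_ : (`|K| + 1) * hnorm (u n - l) < _).
  by rewrite ler_wpM2r ?hnorm_ge0 // (le_trans (ler_norm K)) // lerDl.
by rewrite mulrC -ltr_pdivlMr //; exact: hN.
Qed.

Lemma hcvg_inner u l w : hcvg u l -> clim (fun n => inner (u n) w) (inner l w).
Proof.
move=> h e e0; have K0 : 0 < hnorm w + 1 by rewrite ltr_wpDl ?hnorm_ge0.
have [N hN] := h _ (divr_gt0 e0 K0); exists N => n Nn; rewrite -(psdBl hi).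
apply: le_lt_trans (hCS _ _) _.
apply: le_lt_trans (_ : hnorm (u n - l) * (hnorm w + 1) < _).
  by rewrite ler_wpM2l ?hnorm_ge0 // lerDl.
by rewrite -ltr_pdivlMr //; exact: hN.
Qed.

Lemma tail_op_bounded : bounded_op tail_op.
Proof.
split=> [c x y|].
  apply: hcvg_unique (tail_opP _) _ => e e0.
  have c0 : 0 < cabs c + 1 by rewrite ltr_wpDl ?cabs_ge0.
  have e2 : 0 < e / 2 by rewrite divr_gt0.
  have [N1 h1] := tail_opP x (divr_gt0 e2 c0); have [N2 h2] := tail_opP y e2.
  exists (maxn N1 N2) => n; rewrite geq_max => /andP[n1 n2].
  rewrite (starrep_op_lin hr) opprD addrACA -scalerBr.
  apply: le_lt_trans (hnormD _ _) _; rewrite hnormZ [e]splitr; apply: ltrD; last exact: h2.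
  apply: le_lt_trans (_ : (cabs c + 1) * hnorm (pi (average n) x - tail_op x) < _).
    by rewrite ler_wpM2r ?hnorm_ge0 // lerDl.
  by rewrite mulrC -ltr_pdivlMr //; exact: h1.
exists 1 => v; rewrite mul1r; apply/ler_addgt0Pr => e e0.
have [N hN] := tail_opP v e0; have := hN N (leqnn N) => h.
have -> : tail_op v = (tail_op v - pi (average N) v) + pi (average N) v by rewrite subrK.
apply: le_trans (hnormD _ _) _; rewrite addrC; apply: lerD; last by rewrite hnormB ltW.
by apply: le_trans (starrep_norm hr _ _) _; rewrite ler_piMl ?hnorm_ge0 // average_norm.
Qed.

Lemma tail_op_bicommutant : commutant (commutant (gnsS g)) tail_op.
Proof.
split; first exact: tail_op_bounded.
move=> T [bT Tcom] v; apply: hcvg_unique (tail_opP _) _.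
have := hcvg_op bT (tail_opP v) => h e e0; have [N hN] := h e e0.
by exists N => n /hN; rewrite Tcom //; exists (average n).
Qed.

Lemma tail_op_pi x v : tail_op (pi x v) = pi x (tail_op v).
Proof.
have bT := tail_op_bounded; have loc b : linspan (vset L) b -> tail_op (pi b v) = pi b (tail_op v).
  move: b; apply: linspan_ind.
    by rewrite !(starrep0 hr); apply: hcvg_unique (tail_opP _) _ => e e0; exists 0%N => n _; rewrite (starrep_op0 hr) subrr hnorm0.
  move=> c a b [N [q [M ->]]] IH; rewrite !(starrep_linear hr) bT.1 IH; congr (_ *: _ + _).
  apply: hcvg_unique (tail_opP _) _ => e e0.
  have [K hK] := hcvg_op (starrep_bounded hr (lv M)) (tail_opP v) e0; exists (maxn N K) => n.
  rewrite geq_max => /andP[Nn /hK]; rewrite -!(starrepM hr).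
  suff -> : average n * lv M = lv M * average n by [].
  by rewrite -(subnK Nn); exact: average_comm.
have [_ [K TK]] := bT.
apply: (hnorm_eq_eps (K := (`|K| + 1) * (hnorm v + 1) + (hnorm (tail_op v) + 1))) => e e0.
have [b [hb xb]] : exists b, linspan (vset L) b /\ cnorm (x - b) < e.
  have : cclosure (linspan (vset L)) x by rewrite vset_dense.
  exact.
have -> : tail_op (pi x v) - pi x (tail_op v) = tail_op (pi (x - b) v) - pi (x - b) (tail_op v).
  by rewrite !(starrepB hr) (bounded_opB _ _ bT) (loc b hb) opprB addrA subrK.
apply: le_trans (hnormD _ _) _; rewrite hnormN mulrDl.
have s w : hnorm (pi (x - b) w) <= (hnorm w + 1) * e.
  apply: le_trans (starrep_norm hr _ _) _; rewrite mulrC.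
  by apply: ler_pM; rewrite ?cnorm_ge0 ?hnorm_ge0 ?lerDl // ltW.
apply: lerD => //; apply: le_trans (TK _) _; rewrite -mulrA.
apply: le_trans (_ : (`|K| + 1) * hnorm (pi (x - b) v) <= _).
  by rewrite ler_wpM2r ?hnorm_ge0 // (le_trans (ler_norm K)) // lerDl.
by rewrite ler_wpM2l // addr_ge0.
Qed.

Definition tail_form (a : A) : C := inner (tail_op (pi a xi)) xi.

Lemma tail_form_clim a : clim (fun n => chi (average n * a)) (tail_form a).
Proof.
have h := hcvg_inner xi (tail_opP (pi a xi)) => e e0; have [N hN] := h e e0.
by exists N => n /hN; rewrite (gns_state g) (starrepM hr).
Qed.

Lemma tail_form_lin (c : C) x y : tail_form (c *: x + y) = c * tail_form x + tail_form y.
Proof. by rewrite /tail_form (starrep_linear hr) tail_op_bounded.1 (psdDl hi) (psdZl hi). Qed.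

Lemma tail_form_ge0 x : 0 <= tail_form (star x * x).
Proof.
have E : tail_form (star x * x) = inner (tail_op (pi x xi)) (pi x xi).
  by rewrite /tail_form (starrepM hr) tail_op_pi (starrep_star hr).
have pos n w : 0 <= inner (pi (average n) w) w.
  rewrite (starrep_sum hr) (psd_suml hi) sumr_ge0 // => p _.
  rewrite lvZ (starrepZ hr) (psdZl hi) mulr_ge0 //; first by rewrite lecR condp_ge0.
  have -> : lv (one p) = star (lv (one p)) * lv (one p).
    by rewrite lv_star lvMlv mulmx1; congr lv; apply/matrixP => i j; rewrite !mxE rmorph_nat eq_sym.
  by rewrite (starrepM hr) (starrep_star hr) (psd_ge0 hi).
have cl := hcvg_inner (pi x xi) (tail_opP (pi x xi)).
rewrite E lecE; apply/andP; split.
  by rewrite (clim_real cl) // => n; apply/ger0_Im/pos.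
by apply: clim_Re_ge cl _ => n; apply/Re_ge0/pos.
Qed.

Lemma tail_form_twist N (p : isys_dual GG N) j k x :
  tail_form (lv (eig (F p) j k) * x) = eigratio D j k * tail_form (x * lv (eig (F p) j k)).
Proof.
apply: clim_unique (tail_form_clim _) _ => e e0.
have [K hK] := climZ (eigratio D j k) (tail_form_clim (x * lv (eig (F p) j k))) e0.
exists (maxn N K) => n; rewrite geq_max => /andP[Nn /hK].
have cm := average_comm (eig (F p) j k) (n - N); rewrite subnK // in cm.
by rewrite [average n * (lv _ * x)]mulrA cm -mulrA (chi_twist sc cc) -mulrA.
Qed.

Lemma tail_form_one N (q : isys_dual GG N) : tail_form (lv (one q)) = (pr P (S `&` XEv q))%:C%C.
Proof.
apply: clim_unique (tail_form_clim _) _ => e e0; have [K hK] := err_small e0.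
exists (maxn N K) => n; rewrite geq_max => /andP[Nn /hK he].
rewrite -(subnK Nn) average_comm chi_lv_average -rcB cabs_rc distrC.
apply: lt_trans (support_approx _ _) _; first exact: mI.
by rewrite subnK.
Qed.

Lemma tail_form_lv N (q : isys_dual GG N) M :
  tail_form (lv M) = (pr P (S `&` XEv q))%:C%C * trform D (M : 'M[C]_(irr_dim q)).
Proof.
rewrite (local_trace (phi := tail_form)) ?tail_form_one //; first exact: tail_form_lin.
by move=> j k M'; exact: tail_form_twist.
Qed.

Lemma root_exists : exists p : isys_dual GG 0, XEv p = setT.
Proof.
have l0 : level (src (sval o 0%N)) = 0%N by case: (svalP o).
move: (src (sval o 0%N)) l0 => [N p] /= N0; subst N.
by exists p; exact: (XE_root hB).
Qed.

Lemma tail_form1 : tail_form 1 = (pr P S)%:C%C.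
Proof. by have [p E] := root_exists; rewrite -(lv_root L p) tail_form_one E setIT. Qed.

Lemma tail_form_scalar (c : C) : (forall a, tail_form a = c * chi a) -> P S = 0%E \/ P S = 1%E.
Proof.
move=> hc; have c1 : c = (pr P S)%:C%C by rewrite -tail_form1 hc (state1 sc) mulr1.
have ind N (p : isys_dual GG N) : pr P (S `&` XEv p) = pr P S * wt p.
  apply: complexI; rewrite -tail_form_one hc (corr_lv sc cc) trform1 mulr1 c1 -rcM //.
rewrite (prE P mS); have [z|z] := eqVneq (pr P S) 0; [left | right].
  by rewrite z.
have S0 : 0 < pr P S by rewrite lt_neqAle eq_sym z pr_ge0.
have cylE v t : fin_paths v t -> restricted P mS (cylinder t) = P (cylinder t : set (Omega o)).
  move=> ht; have mC : measurable (cylinder t : set (Omega o)) by exact: (measurable_cylinder hB).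
  rewrite (prE (restricted P mS) mC) (prE P mC) (restrictedE (A := S)) //; congr (_%:E).
  rewrite setIC (invariant_central hB cP mS iS ht) [v]vtxE ind.
  have := invariant_central hB cP measurableT (@shuffle_invariantT R B o) ht.
  rewrite !setTI => ->; rewrite /vertex_pr -vtxE; field.
  by rewrite z gt_eqF // (wdim_gt0 hB).
have fin : (restricted P mS setT < +oo)%E by rewrite probability_setT ltry.
have E := cyl_measure_unique hB fin cylE mS.
by have := restrictedE mS S0 mS; rewrite setIid divff // /pr E => ->.
Qed.

Definition tail_state (a : A) : C := (pr P S)^-1%:C%C * tail_form a.

Hypothesis qc : quantized_character chi.
Hypothesis S0 : 0 < pr P S.

Lemma tail_state_state : is_state tail_state.
Proof.
split=> [c x y|x|]; first by rewrite /tail_state tail_form_lin; ring.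
- by rewrite mulr_ge0 ?tail_form_ge0 // lecR invr_ge0 ltW.
- by rewrite /tail_state tail_form1 -rcM mulVf // gt_eqF.
Qed.

Lemma tail_state_lv N (q : isys_dual GG N) M :
  tail_state (lv M) = (pr P (S `&` XEv q) / pr P S)%:C%C * trform D (M : 'M[C]_(irr_dim q)).
Proof. by rewrite /tail_state tail_form_lv mulrA -rcM mulrC [_^-1 * _]mulrC mulrC. Qed.

Lemma tail_state_quantized : quantized_character tail_state.
Proof.
have ts := tail_state_state; have [_ kms _] := qc; split=> //.
  apply: (twisted_KMS sc kms) => // N p j k x.
  by rewrite /tail_state tail_form_twist mulrCA.
move=> N N1; set E := [set r | _].
have ub : ubound E 1.
  by move=> _ [x [a [_ a1 ->]]]; apply: le_trans (state_cabs_le ts _) a1.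
have near e : 0 < e -> exists2 r, E r & 1 - e < r.
  move=> e0; have [s hs] := level_approx P N (mulr_gt0 e0 S0).
  have us := undup_uniq s.
  have [x hx nx] := diagonal_elt L us (c := fun=> 1) (fun=> ler01 : 0 <= 1 :> R) (fun=> lexx 1).
  set a := \sum_(p <- _) _ in hx nx; exists (cabs (tail_state a)); first by exists x, a.
  have -> : tail_state a = ((\sum_(p <- undup s) pr P (S `&` XEv p)) / pr P S)%:C%C.
    rewrite (state_sum ts) mulr_suml rc_sum; apply: eq_bigr => p _.
    by rewrite scale1r tail_state_lv trform1 mulr1.
  have ss : {subset s <= undup s} by move=> p; rewrite mem_undup.
  rewrite cabs_rc ger0_norm ?divr_ge0 ?sumr_ge0 ?ltW // => [|p _]; last exact: pr_ge0.
  rewrite ltr_pdivlMr // mulrBl mul1r; have := hs S mS _ us ss; rewrite ltr_norml => /andP[_].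
  lra.
have nE : E !=set0 by have [r Er _] := near 1 ltr01; exists r.
apply/le_anti/andP; split; first exact: ge_sup.
apply/ler_addgt0Pr => e e0; have [r Er hr'] := near e e0.
rewrite -lerBlDr; apply: le_trans (ltW hr') _; apply: ub_le_sup => //; by exists 1.
Qed.

End TailProjection.

Section Main.
Variables (R : realType) (GG : indsys R) (D : branching GG) (L : limit_algebra D).
Local Notation C := (R[i]).
Local Notation A := (lim_A L).
Variables (o : inf_path (branching_graph D)) (P : probability (Omega o) R).
Hypothesis cP : central P.
Variable chi : A -> C.
Hypotheses (qc : quantized_character chi) (cc : corresponds P chi).

Let sc : is_state chi. Proof. by case: qc. Qed.

Lemma factor_ergodic : factorial_state chi -> ergodic P.
Proof.
move=> [g fac] S mS iS.
have [|c hc] := fac _ (tail_op_bicommutant cP sc cc mS iS g).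
  split; first exact: tail_op_bounded.
  move=> T [_ Tcom] v; apply/esym; apply: Tcom; split; first exact: tail_op_bounded.
  by move=> _ [a ->] w; exact: tail_op_pi.
apply: (tail_form_scalar (cP := cP) (sc := sc) (cc := cc) (mS := mS) (iS := iS) (g := g) (c := c)).
by move=> a; rewrite /tail_form hc (psdZl (hinnerP _)) -(gns_state g).
Qed.

Lemma conditional_character S (mS : measurable S) (iS : shuffle_invariant S) (g : gns chi) :
  0 < pr P S -> exists2 psi : A -> C, quantized_character psi &
  (forall a, tail_form cP sc cc mS iS g a = (pr P S)%:C%C * psi a) /\
  (forall N (q : isys_dual GG N) M,
    psi (local_elt L M) = (pr P (S `&` @XE R (branching_graph D) o (vtx D q)) / pr P S)%:C%C *
      trform D (M : 'M[C]_(irr_dim q))).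
Proof.
move=> S0; exists (tail_state cP sc cc mS iS g); first exact: tail_state_quantized.
split=> [a|N q M]; last exact: tail_state_lv.
by rewrite /tail_state mulrA -rcM divff ?mul1r // gt_eqF.
Qed.

Lemma extremal_ergodic : extremal_character chi -> ergodic P.
Proof.
move=> [_ ex] S mS iS.
rewrite (prE P mS); have := pr_ge0 P S; rewrite le_eqVlt => /orP[/eqP <-|a0]; first by left.
have := pr_le1 P mS; rewrite le_eqVlt => /orP[/eqP ->|a1]; first by right.
have mC := measurableC mS; have c0 : 0 < pr P (~` S) by rewrite pr_setC // subr_gt0.
have h01 : 0 < pr P S < 1 by rewrite a0.
have [g] := gns_exists sc.
have iC := shuffle_invariantC iS.
have [chi1 q1 [f1 v1]] := conditional_character mS iS g a0.
have [chi2 q2 [_ v2]] := conditional_character mC iC g c0.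
have [s1 _ _] := q1; have [s2 _ _] := q2.
have mX N (p : isys_dual GG N) : measurable (@XE R (branching_graph D) o (vtx D p)).
  exact: (measurable_XE (branching_regular D)).
have [|E _] := ex chi1 chi2 (pr P S) q1 q2 h01.
  apply: (@eq_on_vset _ _ _ _ _ _ 1 (cabs (pr P S)%:C%C + cabs (1 - pr P S)%:C%C)).
  - exact: state_lin.
  - by move=> c x y; rewrite (state_lin s1) (state_lin s2); ring.
  - by move=> x; rewrite mul1r; exact: state_cabs_le.
  - move=> x; apply: le_trans (cabsD _ _) _; rewrite !cabsM mulrDl.
    by apply: lerD; rewrite ler_wpM2l ?cabs_ge0 ?state_cabs_le.
  move=> _ [N [p [M ->]]]; rewrite (corr_lv sc cc) v1 v2.
  move: (trform D M) => t; rewrite !mulrA -mulrDl; congr (_ * _).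
  rewrite -!rcM -rcD; congr (_%:C%C); rewrite -pr_setC // ![_ * (_ / _)]mulrC !divfK ?gt_eqF //.
  by rewrite /vertex_pr (pr_split P (mX N p) mS) setDE ![XE _ `&` _]setIC.
rewrite -(prE P mS).
apply: (tail_form_scalar (cP := cP) (sc := sc) (cc := cc) (mS := mS) (iS := iS) (g := g) (c := (pr P S)%:C%C)).
by move=> a; rewrite f1 E.
Qed.

End Main.

Theorem theorem2p2 (R : realType) (GG : indsys R) (D : branching GG)
    (L : limit_algebra D) (o : inf_path (branching_graph D))
    (P : probability (Omega o) R) (hP : central P) :
  (forall chi : lim_A L -> R[i],
     quantized_character chi -> corresponds P chi ->
     (ergodic P <-> factorial_state chi) /\
     (factorial_state chi <-> extremal_character chi)) /\
  (ergodic P <-> extremal_central P).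
Proof.
split; last exact: (ergodic_extremal (branching_regular D)).
move=> chi qc cc; have [sc _ _] := qc; have [g] := gns_exists sc.
have ef : ergodic P -> factorial_state chi by move=> eP; exists g; exact: (ergodic_factor hP sc cc).
have fe := factor_ergodic hP qc cc.
split; split => //.
  by move/fe; exact: ergodic_extremal_character.
by move/(extremal_ergodic hP qc cc).
Qed.
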